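(* Suppose that $\mathbb E[\xi\log\xi]<m_1$. The random variable $\mathcal L^{(\xi)}$ defined in the context has the following properties. (i) Let $p_0=\mathbb P(\xi=0)$ and let $\xi^+$ have distribution $\mathbb P(\xi^+\in dx)=\mathbb P(\xi\in dx\mid\xi>0)$. If $p_0>0$, then $$\mathcal L^{(\xi)}\overset{(d)}{=}\mathcal L^{(\xi^+)}\,\mathcal M_{1-p_0}^{\,m_1/(1-p_0)},$$ where $\mathcal M_{1-p_0}$ is a Type II Mittag-Leffler$(1-p_0)$ random variable independent of $\mathcal L^{(\xi^+)}$. (ii) $\mathcal L^{(\xi)}$ satisfies the distributional equation $$\mathcal L^{(\xi)}\overset{(d)}{=}V^{m_1}\hat{\mathcal L}^{(\xi)}+\xi(1-V)^{m_1}\check{\mathcal L}^{(\xi)},$$ where $\hat{\mathcal L}^{(\xi)},\check{\mathcal L}^{(\xi)}$ are independent copies of $\mathcal L^{(\xi)}$, $V$ is uniform on $[0,1]$, and $\hat{\mathcal L}^{(\xi)},\check{\mathcal L}^{(\xi)},V,\xi$ are mutually independent. (iii) $\mathbb E\,\mathcal L^{(\xi)}=\Gamma(1+m_1)^{-1}$. For an integer $k\ge2$, the condition $m_k<km_1$ is equivalent to $\mathcal L^{(\xi)}\in L^k(\mathbb P)$, and in such case $$\mathbb E[(\mathcal L^{(\xi)})^k]=\frac{\Gamma(km_1+1)^{-1}}{km_1-m_k}\sum_{i=1}^{k-1}\binom ki m_i\,\Gamma(1+im_1)\,\Gamma(1+(k-i)m_1)\,\mathbb E[(\mathcal L^{(\xi)})^i]\,\mathbb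 E[(\mathcal L^{(\xi)})^{k-i}].$$ (iv) $\operatorname{Var}(\mathcal L^{(\xi)})=0$ if and only if $\xi=1$ almost surely. Furthermore, whenever $\mathbb P(\xi=1)<1$ the support of $\mathcal L^{(\xi)}$ is $[0,\infty)$, while $\mathcal L^{(\xi)}=1$ if $\xi=1$ almost surely. (v) The characteristic function $\varphi$ of $\mathcal L^{(\xi)}$ satisfies $$\varphi(t)=\mathbb E\left[\varphi(tV^{m_1})\,\varphi(t\xi[1-V]^{m_1})\right]\quad\text{for every }t\in\mathbb R,$$ where $V$ is uniform on $[0,1]$ and independent of $\xi$. Furthermore, $\mathcal L^{(\xi)}$ is non-atomic if $\mathbb P(\xi=1)<1$. (vi) Assume that $\mathbb P(\xi=1)<1$ and that $\xi>0$ a.s. If there exists a constant $\alpha\in(0,1/m_1)$ such that $\xi^{-\alpha}\in L^1(\mathbb P)$, then $|\varphi(t)|=\mathcal O(|t|^{-\alpha})$ as $|t|\to\infty$. If, in addition, $\mathbb E\,\xi<1$ and such $\alpha>1$, then $\mathcal L^{(\xi)}$ has a bounded continuous density. On the other hand, whenever $\xi^{-1}\in L^\infty(\mathbb P)$, for every $k\ge1$, $$|\varphi(t)|=\mathcal O(|t|^{-k})\quad\text{as }|t|\to\infty,$$ and, thus, $\mathcal L^{(\xi)}$ has a smooth, bounded and Lebesgue-almost surely positive density and admits moments of all orders.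
   Context: $\xi$ is a random variable with $\xi\ge0$ a.s., $\mathbb P(\xi=0)<1$ and $\xi\in L^\alpha(\mathbb P)$ for some $\alpha>1$; $m_\gamma=\mathbb E\,\xi^\gamma$; $0\log0=0$. Definition of $\mathcal L^{(\xi)}$: let $\{\xi_n\}_{n\ge2}$ be i.i.d. copies of $\xi$ and $\{\mathcal U[n]\}_{n\ge2}$ independent random variables with $\mathcal U[n]$ uniform on $\{1,\dots,n-1\}$, the two families being independent. Set $\tilde X_1=1$, $\tilde X_n=\xi_n\tilde X_{\mathcal U[n]}$ for $n\ge2$, $\tilde S_n=\tilde X_1+\cdots+\tilde X_n$. Then $\mathcal L^{(\xi)}$ is the limit $\lim_{n\to\infty}n^{-m_1}\tilde S_n$, which exists almost surely and is integrable (with mean $1/\Gamma(1+m_1)$ when $\mathbb E[\xi\log\xi]<m_1$). For another echo law $\zeta$ in place of $\xi$, $\mathcal L^{(\zeta)}$ denotes the corresponding limit (with $n^{-\mathbb E\zeta}$ in place of $n^{-m_1}$). A Type II Mittag-Leffler$(q)$ random variable, $q\in(0,1)$, is the a.s. positive random variable $\mathcal M_q$ with $\mathbb E\,\mathcal M_q^a=\Gamma(1+a)/\Gamma(1+qa)$ for all $a>-1$. $\overset{(d)}{=}$ denotes equality in distribution.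
   Formalization: In (vi), ''moments of all orders'' is proved as finiteness of all negative moments, since positive ones can fail (ξ=1 or 3 with probability 1/2: m_2=5>4=2m_1; see (iii)), and the density is shown positive almost everywhere on [0,∞) only, as the limit is nonnegative. *)

(* Defs.v *)
From mathcomp Require Export all_boot all_order all_algebra.
From mathcomp Require Export all_classical all_reals all_analysis.
From mathcomp.real_closed Require Export complex.
Export Order.TTheory GRing.Theory Num.Theory.
Export numFieldNormedType.Exports.

Set Implicit Arguments.
Unset Strict Implicit.
Unset Printing Implicit Defensive.

Local Open Scope classical_set_scope.
Local Open Scope ring_scope.

Definition Gamma (R : realType) (x : R) : R :=
  \int[lebesgue_measure]_(t in `]0, +oo[) (t `^ (x - 1) * expR (- t)).

Definition eq_law (d1 d2 d : measure_display) (T1 : measurableType d1)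
    (T2 : measurableType d2) (S : measurableType d) (R : realType)
    (P1 : probability T1 R) (P2 : probability T2 R)
    (X : T1 -> S) (Y : T2 -> S) : Prop :=
  forall A : set S, measurable A -> P1 (X @^-1` A) = P2 (Y @^-1` A).

(* Mutual independence of a family of classes of events: the product rule for
   every finite subfamily, enumerated without repetition by [J]. *)
Definition indep_classes (d : measure_display) (T : measurableType d)
    (R : realType) (P : probability T R) (I : eqType)
    (F : I -> set (set T)) : Prop :=
  forall (J : seq I) (E : I -> set T), uniq J ->
    (forall i, i \in J -> F i (E i)) ->
    P (\big[setI/setT]_(i <- J) E i) = (\prod_(i <- J) fine (P (E i)))%:E.

Definition sigma_rv (d d' : measure_display) (T : measurableType d)
    (S : measurableType d') (X : T -> S) : set (set T) :=
  preimage_set_system setT X measurable.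

Definition mutual_indep (d : measure_display) (T : measurableType d)
    (R : realType) (P : probability T R) (s : seq {RV P >-> R}) : Prop :=
  indep_classes P (fun i : 'I_(size s) => sigma_rv (tnth (in_tuple s) i)).

Definition uniform01 (d : measure_display) (T : measurableType d)
    (R : realType) (P : probability T R) (V : {RV P >-> R}) : Prop :=
  forall A : set R, measurable A ->
    P (V @^-1` A) = uniform_prob (@ltr01 R) A.

Section EchoLimit.
Context (R : realType) (d0 : measure_display) (T0 : measurableType d0)
  (P0 : probability T0 R) (xi : {RV P0 >-> R}).
Context (d : measure_display) (T : measurableType d) (P : probability T R).

(* Only the indices n >= 2 of [xi_] and [U_] matter; the independence of the
   whole collection (xi_2, xi_3, ...; U_2, U_3, ...) is expressed with the
   index type [nat + nat], shifted by 2. *)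
Record echo_inputs (xi_ : nat -> {RV P >-> R}) (U_ : nat -> {RV P >-> nat}) :
    Prop := {
  echo_copies : forall n, (2 <= n)%N -> eq_law P P0 (xi_ n) xi;
  echo_range : forall n w, (2 <= n)%N -> (1 <= U_ n w < n)%N;
  echo_uniform : forall n k, (2 <= n)%N -> (1 <= k < n)%N ->
    P (U_ n @^-1` [set k]) = (n.-1%:R^-1)%:E;
  echo_indep : indep_classes P (fun i : nat + nat =>
    match i with
    | inl n => sigma_rv (xi_ n.+2)
    | inr n => sigma_rv (U_ n.+2)
    end) }.

(* [X 0] is irrelevant; on the other indices the recursion determines [X],
   since U_n lies in {1, ..., n - 1}. *)
Definition echo_recursion (xi_ : nat -> {RV P >-> R})
    (U_ : nat -> {RV P >-> nat}) (X : nat -> T -> R) : Prop :=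
  (forall w, X 1%N w = 1) /\
  (forall n w, (2 <= n)%N -> X n w = xi_ n w * X (U_ n w) w).

(* [L] is the random variable L^(xi), built from some family of inputs. *)
Definition echo_limit (L : {RV P >-> R}) : Prop :=
  exists (xi_ : nat -> {RV P >-> R}) (U_ : nat -> {RV P >-> nat})
         (X : nat -> T -> R),
    [/\ echo_inputs xi_ U_, echo_recursion xi_ U_ X &
      {ae P, forall w,
        (n%:R `^ (- fine 'E_P0[xi]) * \sum_(1 <= k < n.+1) X k w)
          @[n --> \oo] --> (L w : R)}].

End EchoLimit.

Definition moment (d : measure_display) (T : measurableType d)
    (R : realType) (P : probability T R) (X : T -> R) (k : nat) : \bar R :=
  ('E_P[(fun w => X w ^+ k)%R])%E.

Definition mittag_leffler2 (d : measure_display) (T : measurableType d)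
    (R : realType) (P : probability T R) (q : R) (M : {RV P >-> R}) : Prop :=
  {ae P, forall w, 0 < M w} /\
  (forall a : R, -1 < a ->
    ('E_P[(fun w => M w `^ a)%R] = (Gamma (1 + a) / Gamma (1 + q * a))%:E)%E).

Definition law_support (d : measure_display) (T : measurableType d)
    (R : realType) (P : probability T R) (X : {RV P >-> R}) : set R :=
  [set x | forall O : set R, open O -> O x -> (0 < P (X @^-1` O))%E].

Definition cexpectation (d : measure_display) (T : measurableType d)
    (R : realType) (P : probability T R) (Z : T -> R[i]) : R[i] :=
  Complex (fine 'E_P[(fun w => complex.Re (Z w))%R])
          (fine 'E_P[(fun w => complex.Im (Z w))%R]).

(* E[exp(i t X)], with exp(i y) = cos y + i sin y. *)
Definition charfun (d : measure_display) (T : measurableType d)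
    (R : realType) (P : probability T R) (X : {RV P >-> R}) (t : R) : R[i] :=
  cexpectation P (fun w => Complex (cos (t * X w)) (sin (t * X w))).

(* |f(t)| = O(|t|^(-a)) as |t| tends to infinity. *)
Definition decay_order (R : realType) (f : R -> R[i]) (a : R) : Prop :=
  let nf (t : R) : R := ComplexField.Normc.normc (f t) in
  exists C : R, (\forall t \near +oo, nf t <= C * `|t| `^ (- a)) /\
                (\forall t \near -oo, nf t <= C * `|t| `^ (- a)).

Definition is_density (d : measure_display) (T : measurableType d)
    (R : realType) (P : probability T R) (X : {RV P >-> R}) (f : R -> R) :
    Prop :=
  [/\ measurable_fun setT f, forall x, 0 <= f x &
    forall A : set R, measurable A ->
      P (X @^-1` A) = (\int[lebesgue_measure]_(x in A) (f x)%:E)%E].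

Definition smooth (R : realType) (f : R -> R) : Prop :=
  forall (n : nat) (x : R), derivable (derive1n n (f : R -> R^o)) x 1.

(* Main.v *)
From HB Require Import structures.
Require Import Defs.
From mathcomp Require Import ring lra zify measurable_realfun.
Import numFieldTopology.Exports.

(* Everything is reduced to the fixed-point equation for Laplace transforms,
     l(t) = E[l(t V^m) l(t xi (1 - V)^m)],   V uniform on [0, 1],
   for m = E xi.  Splitting the genealogical tree at node 2 gives a convolution
   identity for E[prod_(i <= n) f(x X_i)], and a bound on a moment of order
   g in (1, 2] with E xi^g < g m (which exists because E[xi log xi] < E xi)
   lets n tend to infinity.
   (i) If E is exponential, w(t) = E exp(-t E^m L) solves
   w(t) = int_0^1 w(t v^m) k(t v^m) dv with k(t) = E w(t xi).  Conditioning on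
   xi > 0 turns this into the equation of the thinned echo, whose solution is
   unique by contraction at 0; the factor E^m is then cancelled.
   (iii) Finiteness is proved by truncating L.
   (iv) The set of values v^m + z (1 - v)^m, z in the support of xi, contains
   multipliers on both sides of 1.
   (v) At most two v solve a v^m + b (1 - v)^m = x when m <> 1.
   (vi) |phi| tends to 0 by oscillation of cos(s V^m), and is then bootstrapped
   through |phi(t)| <= E[|phi(t V^m)| |phi(t xi (1 - V)^m)|]; the Laplace
   transform likewise, which gives the negative moments.  Densities come from
   Fourier inversion with a Poisson kernel. *)

Set Implicit Arguments.
Unset Strict Implicit.
Unset Printing Implicit Defensive.

Local Open Scope classical_set_scope.
Local Open Scope ring_scope.

(** E xi^2 may be infinite or too large, so every bound rests on a single exponent g in ]1, 2]. With
    q = E xi^g, the map behind the fixed-point equation acts on g-th moments with the factor (1 + q)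
    / (1 + g m), and q < g m puts it below 1. The same inequality bounds the normalised sums in L^g,
    removes the truncation error in the moment estimates and gives the uniqueness used in (i). The
    record [echo_law] isolates what is kept of the process. Variables that are nonnegative only
    almost surely are replaced there by their absolute values, so that signs hold everywhere; the
    return to [xi] and [L] is made at the end. Most integrals are of bounded functions under
    probability measures, where Fubini's theorem and passages to the limit ask for nothing else. For
    this reason the Fourier integral over ]0, +oo[ is written under a Pareto law with a weight.
    Exponential variables enter because the sum of two independent ones is independent of their
    uniform ratio: this yields the Beta integrals and, in (i), turns a convolution into a
    product. *)

Notation mfn f := (measurable_fun setT f).

Lemma eqle {disp} {T : porderType disp} (x y : T) : x = y -> (x <= y)%O.
Proof. by move->. Qed.

(** * Bounded measurable real functions *)

Section bounded_measurable.
Context {d} {T : measurableType d} {R : realType}.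
Implicit Types f g : T -> R.

Definition bmf f := mfn f /\ exists M : R, forall x, `|f x| <= M.

Lemma bmf_le f (M : R) : mfn f -> (forall x, `|f x| <= M) -> bmf f.
Proof. by move=> mf fM; split => //; exists M. Qed.

Lemma bmf_cst c : bmf (fun=> c).
Proof. by apply: (@bmf_le _ `|c|) => //; exact: measurable_cst. Qed.

Lemma bmfD f g : bmf f -> bmf g -> bmf (fun x => f x + g x).
Proof.
move=> [mf [M fM]] [mg [N gN]]; apply: (@bmf_le _ (M + N)).
  exact: measurable_funD.
by move=> x; rewrite (le_trans (ler_normD _ _))// lerD.
Qed.

Lemma bmfN f : bmf f -> bmf (fun x => - f x).
Proof.
move=> [mf [M fM]]; apply: (@bmf_le _ M) => [|x]; first exact: measurable_funN.
by rewrite normrN.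
Qed.

Lemma bmfB f g : bmf f -> bmf g -> bmf (fun x => f x - g x).
Proof. by move=> bf bg; apply: bmfD => //; exact: bmfN. Qed.

Lemma bmfM f g : bmf f -> bmf g -> bmf (fun x => f x * g x).
Proof.
move=> [mf [M fM]] [mg [N gN]]; apply: (@bmf_le _ (M * N)).
  exact: measurable_funM.
by move=> x; rewrite normrM ler_pM.
Qed.

Lemma bmf_norm f : bmf f -> bmf (fun x => `|f x|).
Proof.
move=> [mf [M fM]]; apply: (@bmf_le _ M) => [|x]; last by rewrite normr_id.
exact: measurableT_comp.
Qed.

Lemma bmf01 f : mfn f -> (forall x, 0 <= f x <= 1) -> bmf f.
Proof.
by move=> mf f01; apply: (@bmf_le _ 1) => // x; have /andP[? ?] := f01 x;
  rewrite ger0_norm.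
Qed.

Lemma bmf_expN f : mfn f -> (forall x, 0 <= f x) ->
  bmf (fun x => expR (- f x)).
Proof.
move=> mf f0; apply: bmf01 => [|x].
  by apply: measurableT_comp => //; exact: measurable_funN.
by rewrite expR_ge0/= expR_le1 oppr_le0.
Qed.

Lemma bmf_cos f : mfn f -> bmf (fun x => cos (f x)).
Proof.
move=> mf; apply: (@bmf_le _ 1) => [|x]; last by rewrite ler_norml cos_geN1 cos_le1.
apply: measurableT_comp => //; apply: continuous_measurable_fun.
exact: continuous_cos.
Qed.

Lemma bmf_sin f : mfn f -> bmf (fun x => sin (f x)).
Proof.
move=> mf; apply: (@bmf_le _ 1) => [|x]; last by rewrite ler_norml sin_geN1 sin_le1.
apply: measurableT_comp => //; apply: continuous_measurable_fun.
exact: continuous_sin.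
Qed.

Lemma bmf_sum (I : Type) (s : seq I) (F : I -> T -> R) :
  (forall i, bmf (F i)) -> bmf (fun x => \sum_(i <- s) F i x).
Proof.
move=> bF; elim: s => [|i s IH].
  rewrite (_ : (fun x => _) = fun=> 0); first exact: bmf_cst.
  by apply/funext => x; rewrite big_nil.
rewrite (_ : (fun x => _) = fun x => F i x + \sum_(j <- s) F j x).
  exact: bmfD.
by apply/funext => x; rewrite big_cons.
Qed.

Lemma bmf_comp d' (S : measurableType d') (h : S -> R) (k : T -> S) :
  mfn h -> (exists M : R, forall x, `|h x| <= M) ->
  mfn k -> bmf (fun x => h (k x)).
Proof.
move=> mh [M hM] mk; apply: (@bmf_le _ M) => //.
exact: (measurableT_comp mh mk).
Qed.

End bounded_measurable.

Lemma preimage_measurable {d d' : measure_display} {T : measurableType d}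
    {S : measurableType d'} (f : T -> S) (A : set S) :
  mfn f -> measurable A -> measurable (f @^-1` A).
Proof. by move=> mf mA; rewrite -[X in measurable X]setTI; exact: mf. Qed.

(** * Automation for signs and measurability *)

Ltac pos :=
  intros; cbv beta;
  first [ assumption | lazymatch goal with
  | |- is_true (0 <= _ `^ _)%R => exact: powR_ge0
  | |- is_true (0 <= expR _)%R => exact: expR_ge0
  | |- is_true (0 <= `|_|)%R => exact: normr_ge0
  | |- is_true (0 <= \int[_]_(_ in _) _)%E => apply: integral_ge0; pos
  | |- is_true (0 <= _ * _)%E => apply: mule_ge0; pos
  | |- is_true (0 <= _ + _)%E => apply: adde_ge0; pos
  | |- is_true (0 <= _ * _)%R => apply: mulr_ge0; pos
  | |- is_true (0 <= _ + _)%R => apply: addr_ge0; pos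
  | |- is_true (0 <= _ ^-1)%R => rewrite invr_ge0; pos
  | |- is_true (0 <= _ ^+ _)%R => apply: exprn_ge0; pos
  | |- is_true (0 < _ * _)%R => apply: mulr_gt0; pos
  | |- is_true (0 < _ + _)%R => apply: addr_gt0; pos
  | |- is_true (0 < _ ^-1)%R => rewrite invr_gt0; pos
  | |- is_true (0 < _ ^+ _)%R => apply: exprn_gt0; pos
  | |- is_true (0 < _ `^ _)%R => apply: powR_gt0; pos
  | |- is_true (0 < _%:R)%R => by rewrite ltr0n
  end
  | match goal with
    | H : forall _, is_true (0 <= _)%R |- _ => exact: H
    | H : forall _, is_true (0 <= _)%E |- _ => exact: H
    | H : forall _, is_true (0 < _)%R |- _ => exact: H
    | H : is_true (0 < ?x)%R |- is_true (0 <= ?x)%R => exact: (ltW H)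
    end
  | exact: powR_ge0 | exact: expR_ge0 | exact: expR_gt0 | exact: normr_ge0 | exact: sqr_ge0
  | exact: ler0n | exact: ler01 | exact: ltr01 | exact: Rintegral_ge0 ].

Ltac meas :=
  intros; cbv beta;
  first [ assumption |
  lazymatch goal with
  | |- measurable _ => first [exact: measurable_itv | exact: measurable_set1 | exact: measurableT
      | apply: preimage_measurable; meas]
  | |- measurable_fun _ (fun x => x) => exact: measurable_id
  | |- measurable_fun _ id => exact: measurable_id
  | |- measurable_fun _ fst => exact: measurable_fst
  | |- measurable_fun _ snd => exact: measurable_snd
  | |- measurable_fun _ (fun x => fst x) => exact: measurable_fst
  | |- measurable_fun _ (fun x => snd x) => exact: measurable_snd
  | |- measurable_fun _ (fun x => (@?f x)%:E) => apply/measurable_EFinP; meas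
  | |- measurable_fun _ (EFin \o _) => apply/measurable_EFinP; meas
  | |- measurable_fun _ (fun x => (@?f x + @?g x)%R) => apply: measurable_funD; meas
  | |- measurable_fun _ (fun x => (- (@?f x))%R) => apply: measurable_funN; meas
  | |- measurable_fun _ (fun x => (@?f x * @?g x)%R) => apply: measurable_funM; meas
  | |- measurable_fun _ (fun x => (@?f x * @?g x)%E) => apply: emeasurable_funM; meas
  | |- measurable_fun _ (fun x => (@?f x ^+ _)%R) => apply: measurable_funX; meas
  | |- measurable_fun _ (fun x => `|@?f x|%R) => apply: (measurableT_comp (@normr_measurable _ _)); meas
  | |- measurable_fun _ (fun x => (@?f x `^ ?s)%R) => apply: (measurableT_comp (measurable_powR s)); meas
  | |- measurable_fun _ (fun x => expR (@?f x)) => apply: (measurableT_comp (@measurable_expR _)); meas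
  | |- measurable_fun _ (fun x => cos (@?f x)) => refine (proj1 (bmf_cos _)); meas
  | |- measurable_fun _ (fun x => sin (@?f x)) => refine (proj1 (bmf_sin _)); meas
  | |- measurable_fun _ (fun x => (@?f x, @?g x)) => apply: measurable_fun_pair; meas
  | |- measurable_fun _ (fun x => \1_?A (@?f x)) => apply: (measurableT_comp (measurable_indic _)); meas
  | |- measurable_fun _ (fun _ => ?c) => exact: measurable_cst
  | |- measurable_fun _ (fun x => fst (@?f x)) => apply: (measurableT_comp measurable_fst); meas
  | |- measurable_fun _ (fun x => snd (@?f x)) => apply: (measurableT_comp measurable_snd); meas
  | H : measurable_fun _ ?h |- measurable_fun _ (fun x => ?h (@?f x)) => apply: (measurableT_comp H); meas
  | H : bmf ?h |- measurable_fun _ (fun x => ?h (@?f x)) => apply: (measurableT_comp (proj1 H)); meas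
  | H : bmf ?h |- measurable_fun _ ?h => exact: (proj1 H)
  | |- measurable_fun _ (fun x => _ (@?f x)) => apply: (measurableT_comp (measurable_funPT _)); meas
  | |- bmf (fun x => (@?f x + - (@?g x))%R) => apply: bmfB; meas
  | |- bmf (fun x => (@?f x + @?g x)%R) => apply: bmfD; meas
  | |- bmf (fun x => (- (@?f x))%R) => apply: bmfN; meas
  | |- bmf (fun x => (@?f x * @?g x)%R) => apply: bmfM; meas
  | |- bmf (fun x => expR (- (@?f x))) => apply: bmf_expN; [meas|pos]
  | |- bmf (fun x => cos (@?f x)) => apply: bmf_cos; meas
  | |- bmf (fun x => sin (@?f x)) => apply: bmf_sin; meas
  | |- bmf (fun _ => ?c) => exact: bmf_cst
  | H : bmf ?h |- bmf (fun x => ?h (@?f x)) => apply: (bmf_comp (proj1 H) (proj2 H)); meas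
  end
  | match goal with
    | H : forall _, measurable_fun _ _ |- _ => exact: H
    | H : forall _, bmf _ |- _ => exact: H
    end
  | exact: measurable_funPT ].

Ltac mp := try solve [meas | pos].

(** * Integrals of bounded functions under a probability; Fubini *)

Section bounded_integral.
Context {d} {T : measurableType d} {R : realType}
  (P : probability T R).
Implicit Types f g : T -> R.

Lemma bmf_int f : bmf f -> P.-integrable setT (EFin \o f).
Proof.
move=> [mf [M fM]].
apply: (@le_integrable _ _ _ P _ _ _ (cst `|M|%:E)) => //; mp.
- move=> x _ /=; rewrite lee_fin (le_trans (fM x))// (le_trans (ler_norm _))//.
  by rewrite normr_id.
- exact: finite_measure_integrable_cst.
Qed.

Lemma Rint_EFin f : P.-integrable setT (EFin \o f) ->
  ((\int[P]_x f x)%:E = \int[P]_x (f x)%:E)%E.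
Proof. by move=> fi; rewrite /Rintegral fineK//; exact: integrable_fin_num. Qed.

Lemma bint_EFin f : bmf f -> ((\int[P]_x f x)%:E = \int[P]_x (f x)%:E)%E.
Proof. by move=> bf; apply: Rint_EFin; exact: bmf_int. Qed.

Lemma bint_cst c : \int[P]_x c = c.
Proof.
apply: EFin_inj; rewrite Rint_EFin; last exact: finite_measure_integrable_cst.
by rewrite (@integral_cst _ _ _ P _ measurableT c%:E)/= probability_setT mule1.
Qed.

Lemma bintD f g : bmf f -> bmf g ->
  \int[P]_x (f x + g x) = \int[P]_x f x + \int[P]_x g x.
Proof. by move=> bf bg; rewrite RintegralD//; exact: bmf_int. Qed.

Lemma bintB f g : bmf f -> bmf g ->
  \int[P]_x (f x - g x) = \int[P]_x f x - \int[P]_x g x.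
Proof. by move=> bf bg; rewrite RintegralB//; exact: bmf_int. Qed.

Lemma bintZl c f : bmf f -> \int[P]_x (c * f x) = c * \int[P]_x f x.
Proof. by move=> bf; rewrite RintegralZl//; exact: bmf_int. Qed.

Lemma bintZr c f : bmf f -> \int[P]_x (f x * c) = \int[P]_x f x * c.
Proof. by move=> bf; rewrite RintegralZr//; exact: bmf_int. Qed.

Lemma bint_le f g : bmf f -> bmf g -> (forall x, f x <= g x) ->
  \int[P]_x f x <= \int[P]_x g x.
Proof. by move=> bf bg fg; apply: le_Rintegral => //; exact: bmf_int. Qed.

Lemma bint_norm f : bmf f -> `|\int[P]_x f x| <= \int[P]_x `|f x|.
Proof. by move=> bf; apply: le_normr_Rintegral => //; exact: bmf_int. Qed.

Lemma bint_bound f (M : R) : bmf f -> (forall x, `|f x| <= M) -> `|\int[P]_x f x| <= M.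
Proof.
move=> bf fM; rewrite (le_trans (bint_norm bf))//.
rewrite -[leRHS]bint_cst; apply: bint_le => //; [exact: bmf_norm|by meas].
Qed.

Lemma bint_ge0 f : (forall x, 0 <= f x) -> 0 <= \int[P]_x f x.
Proof. by pos. Qed.

Lemma bint_01 f : mfn f -> (forall x, 0 <= f x <= 1) ->
  0 <= \int[P]_x f x <= 1.
Proof.
move=> mf f01; rewrite bint_ge0/=; last by move=> x; have /andP[] := f01 x.
rewrite -[leRHS]bint_cst; apply: bint_le; [exact: bmf01|by meas|].
by move=> x; have /andP[] := f01 x.
Qed.

Lemma bint_sum (I : Type) (s : seq I) (F : I -> T -> R) :
  (forall i, bmf (F i)) ->
  \int[P]_x (\sum_(i <- s) F i x) = \sum_(i <- s) \int[P]_x F i x.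
Proof.
move=> bF; elim: s => [|i s IH].
  by rewrite big_nil; under eq_Rintegral do rewrite big_nil; rewrite bint_cst.
rewrite big_cons; under eq_Rintegral do rewrite big_cons.
by rewrite bintD ?IH//; exact: bmf_sum.
Qed.

Lemma ae_eq_Rint f g : mfn f -> mfn g ->
  {ae P, forall x, f x = g x} -> \int[P]_x f x = \int[P]_x g x.
Proof.
move=> mf mg fg; rewrite /Rintegral; congr fine.
apply: ae_eq_integral => //; [by meas|by meas|].
by apply: filterS fg => x + _ /= => ->.
Qed.

Lemma bint_cvg (f_ : nat -> T -> R) f (M : R) :
  (forall n, mfn (f_ n)) -> mfn f ->
  (forall n x, `|f_ n x| <= M) ->
  {ae P, forall x, f_ ^~ x @ \oo --> f x} ->
  \int[P]_x f_ n x @[n --> \oo] --> \int[P]_x f x.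
Proof.
move=> mf_ mf f_M f_f.
have M0 : 0 <= M by apply: le_trans (f_M 0%N point).
have [] := @dominated_convergence _ _ _ P setT measurableT
  (fun n x => (f_ n x)%:E) (fun x => (f x)%:E) (cst M%:E).
- by move=> n; apply/measurable_EFinP.
- by meas.
- by apply: filterS f_f => x fx _; apply: cvg_EFin fx; apply: nearW.
- exact: finite_measure_integrable_cst.
- by apply: aeW => x n _ /=; rewrite lee_fin.
move=> fi _; rewrite -(Rint_EFin fi) => /fine_cvgP[_].
apply: cvg_trans; apply: near_eq_cvg; apply: nearW => n /=.
by rewrite /Rintegral.
Qed.

End bounded_integral.

Definition pprod {d1 d2 : measure_display} {T1 : measurableType d1}
  {T2 : measurableType d2} {R : realType} (P1 : probability T1 R)
  (P2 : probability T2 R) : probability (T1 * T2)%type R := (P1 \x P2)%E.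

Section bounded_fubini.
Context {d1 d2 : measure_display} {T1 : measurableType d1}
  {T2 : measurableType d2} {R : realType}.
Variable f : T1 * T2 -> R.
Hypothesis bf : bmf f.

Lemma bmf_pair1 x : bmf (fun y => f (x, y)).
Proof.
by have [mf [M fM]] := bf; apply: (@bmf_le _ _ _ _ M) => //;
  exact: measurable_fun_pair2.
Qed.

Lemma bmf_pair2 y : bmf (fun x => f (x, y)).
Proof. by meas. Qed.

Lemma bmf_fubini1 (P2 : probability T2 R) : bmf (fun x => \int[P2]_y f (x, y)).
Proof.
(* Measurability of the partial integral does not involve a law on the first factor; a Dirac mass
   takes its place in the product. *)
have [mf [M fM]] := bf; pose P1 : probability T1 R := \d_(point : T1).
apply: (@bmf_le _ _ _ _ M); last by move=> x; apply: bint_bound => //; exact: bmf_pair1.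
apply/measurable_EFinP.
have -> : (EFin \o fun x => \int[P2]_y f (x, y)) =
    fubini_F P2 (EFin \o f).
  by apply/funext => x /=; rewrite bint_EFin//; exact: bmf_pair1.
by apply: (measurable_fubini_F (m1 := P1)); exact: (bmf_int (pprod P1 P2)).
Qed.

Lemma bmf_fubini2 (P1 : probability T1 R) : bmf (fun y => \int[P1]_x f (x, y)).
Proof.
have [mf [M fM]] := bf; pose P2 : probability T2 R := \d_(point : T2).
apply: (@bmf_le _ _ _ _ M); last by move=> x; apply: bint_bound => //; by meas.
apply/measurable_EFinP.
have -> : (EFin \o fun y => \int[P1]_x f (x, y)) =
    fubini_G P1 (EFin \o f).
  by apply/funext => x /=; rewrite bint_EFin//; meas.
by apply: (measurable_fubini_G (m2 := P2)); exact: (bmf_int (pprod P1 P2)).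
Qed.

Lemma bint_fubini1 (P1 : probability T1 R) (P2 : probability T2 R) :
   \int[pprod P1 P2]_z f z = \int[P1]_x \int[P2]_y f (x, y).
Proof.
apply: EFin_inj; rewrite bint_EFin// bint_EFin; last exact: bmf_fubini1.
rewrite /pprod -integral12_prod_meas1; last exact: (bmf_int (pprod P1 P2)).
apply: eq_integral => x _; rewrite /fubini_F bint_EFin//; exact: bmf_pair1.
Qed.

Lemma bint_fubini2 (P1 : probability T1 R) (P2 : probability T2 R) :
   \int[pprod P1 P2]_z f z = \int[P2]_y \int[P1]_x f (x, y).
Proof.
apply: EFin_inj; rewrite bint_EFin// bint_EFin; last exact: bmf_fubini2.
rewrite /pprod -integral21_prod_meas1; last exact: (bmf_int (pprod P1 P2)).
apply: eq_integral => x _; rewrite /fubini_G bint_EFin//; by meas.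
Qed.

End bounded_fubini.

Lemma le0_eps {R : realType} (x : R) : (forall e : R, 0 < e -> x <= e) -> x <= 0.
Proof. by move=> H; apply/ler_addgt0Pr => e e0; rewrite add0r; exact: H. Qed.

Lemma ler_sqr_young {R : realType} (e b : R) : 0 < e -> 0 <= b ->
  b * e <= e * e + b ^+ 2.
Proof. by move=> e0 b0; nra. Qed.

(** * Bernstein polynomials with a quantitative error *)

Section bernstein.
Context {R : realType}.
Implicit Types (g h : nat -> R) (z : R).

(* [bern n g].[z] is the expectation of [g] under the binomial law (n, z). *)
Fixpoint bern n g : {poly R} :=
  if n is k.+1 then 'X * bern k (fun j => g j.+1) + (1 - 'X) * bern k g
  else (g 0%N)%:P.

Lemma bernS n g z : (bern n.+1 g).[z] =
  z * (bern n (fun j => g j.+1)).[z] + (1 - z) * (bern n g).[z].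
Proof. by rewrite /= !hornerE. Qed.

Lemma bernD n g h z :
  (bern n (fun j => g j + h j)).[z] = (bern n g).[z] + (bern n h).[z].
Proof.
elim: n g h => [|n IH] g h; first by rewrite /= !hornerE.
by rewrite !bernS (IH (fun j => g j.+1) (fun j => h j.+1)) IH; ring.
Qed.

Lemma bernZ n c g z : (bern n (fun j => c * g j)).[z] = c * (bern n g).[z].
Proof.
elim: n g => [|n IH] g; first by rewrite /= !hornerE.
by rewrite !bernS (IH (fun j => g j.+1)) IH; ring.
Qed.

Lemma bern_cst n c z : (bern n (fun=> c)).[z] = c.
Proof. by elim: n => [|n IH]; [rewrite /= !hornerE|rewrite bernS IH; ring]. Qed.

Lemma bern_le n g h z : 0 <= z <= 1 -> (forall j, g j <= h j) ->
  (bern n g).[z] <= (bern n h).[z].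
Proof.
move=> /andP[z0 z1]; elim: n g h => [|n IH] g h gh; first by rewrite /= !hornerE.
by rewrite !bernS lerD// ler_wpM2l// ?IH// subr_ge0.
Qed.

(** An arbitrary centre a lets the induction close, since a success replaces a by a - 1. With a = n
    z only the binomial variance n z (1 - z) is left. *)
Lemma bern_sqr n a z :
  (bern n (fun j => (j%:R - a) ^+ 2)).[z] =
  (n%:R * z - a) ^+ 2 + n%:R * z * (1 - z).
Proof.
elim: n a => [|n IH] a; first by rewrite /= !hornerE; ring.
rewrite bernS.
have -> : (fun j : nat => (j.+1%:R - a) ^+ 2 : R) =
    (fun j => (j%:R - (a - 1)) ^+ 2).
  by apply/funext => j; rewrite -natr1; ring.
by rewrite !IH -natr1; ring.
Qed.

(** Young's inequality K |y| <= e + (K y)^2 / e trades the Lipschitz bound for a square, whose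
    binomial mean is given by [bern_sqr]. *)
Lemma bern_lipschitz (f : R -> R) (K e : R) n z :
  (forall x y, `|f x - f y| <= K * `|x - y|) -> 0 <= K -> 0 < e ->
  0 <= z <= 1 ->
  `|(bern n.+1 (fun j => f (j%:R / n.+1%:R))).[z] - f z| <=
    e + K ^+ 2 / e / n.+1%:R.
Proof.
move=> fK K0 e0 z01; have /andP[z0 z1] := z01.
set N := n.+1%:R : R; have N0 : 0 < N by rewrite ltr0n.
pose q j : R := e + K ^+ 2 / e / N ^+ 2 * (j%:R - N * z) ^+ 2.
have fq j : `|f (j%:R / N) - f z| <= q j.
  rewrite (le_trans (fK _ _))// /q.
  have -> : j%:R - N * z = N * (j%:R / N - z).
    by rewrite mulrBr mulrCA divff ?mulr1// gt_eqF.
  rewrite exprMn mulrA divfK; last by rewrite expf_neq0// gt_eqF.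
  set x := _ - z; rewrite -[x ^+ 2]real_normK ?num_real//; move: (normr_ge0 x).
  set y := `|x| => y0.
  have -> : K ^+ 2 / e * y ^+ 2 = (K * y) ^+ 2 / e by field; rewrite gt_eqF.
  rewrite -(ler_pM2r e0) mulrDl divfK ?gt_eqF//.
  by apply: ler_sqr_young => //; rewrite mulr_ge0.
have qE : (bern n.+1 q).[z] <= e + K ^+ 2 / e / N.
  rewrite /q bernD bern_cst bernZ bern_sqr -/N subrr expr0n/= add0r lerD2l.
  have -> : K ^+ 2 / e / N = K ^+ 2 / e / N ^+ 2 * N.
    by field; rewrite !gt_eqF.
  rewrite ler_wpM2l//; first by pos.
  nra.
have fzE : f z = (bern n.+1 (fun=> f z)).[z] by rewrite bern_cst.
rewrite (le_trans _ qE)// ler_norml; apply/andP; split.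
  rewrite -subr_ge0 opprK addrAC subr_ge0 [leLHS]fzE -bernD; apply: bern_le => // j.
  have := fq j; rewrite ler_norml => /andP[h _]; rewrite -subr_ge0.
  move: h; rewrite -subr_ge0; set u := q j; lra.
rewrite lerBlDr [in leRHS]fzE -bernD; apply: bern_le => // j.
by have := fq j; rewrite ler_norml => /andP[_ h]; move: h; set u := q j; lra.
Qed.

End bernstein.

Lemma preimage_mem_itv {R : realType} (T : Type) (X : T -> R) (i : interval R) w :
  (w \in X @^-1` [set` i]) = (X w \in i).
Proof. by apply/idP/idP; [rewrite inE|move=> h; rewrite inE]. Qed.

(** * Uniqueness of a law given its Laplace transform at the integers *)

Section laplace_uniqueness.
Context {R : realType} {d1 d2 : measure_display} {T1 : measurableType d1}
  {T2 : measurableType d2} (P1 : probability T1 R) (P2 : probability T2 R).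
Variables (X1 : T1 -> R) (X2 : T2 -> R).
Hypotheses (mX1 : mfn X1) (mX2 : mfn X2).
Hypotheses (X1_ge0 : forall w, 0 <= X1 w) (X2_ge0 : forall w, 0 <= X2 w).
Hypothesis laplace_eq : forall n : nat,
  \int[P1]_w expR (- (n%:R * X1 w)) = \int[P2]_w expR (- (n%:R * X2 w)).

Let expX_itv d (T : measurableType d) (X : T -> R) : (forall w, 0 <= X w) ->
  forall w, 0 <= expR (- X w) <= 1.
Proof. by move=> X0 w; rewrite expR_ge0/= expR_le1 oppr_le0. Qed.
Let bmf_exp d (T : measurableType d) (X : T -> R) (c : R) :
  mfn X -> (forall w, 0 <= X w) -> 0 <= c ->
  bmf (fun w => expR (- (c * X w))).
Proof. by meas. Qed.
Let poly_eq (p : {poly R}) :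
  \int[P1]_w p.[expR (- X1 w)] = \int[P2]_w p.[expR (- X2 w)].
Proof.
have E d (T : measurableType d) (P : probability T R) (X : T -> R) :
    mfn X -> (forall w, 0 <= X w) ->
    \int[P]_w p.[expR (- X w)] =
    \sum_(i < size p) p`_i * \int[P]_w expR (- (i%:R * X w)).
  move=> mX X0.
  under eq_Rintegral => w _.
    rewrite horner_coef.
    under eq_bigr => i _ do rewrite -expRM_natl mulrN.
    over.
  rewrite bint_sum => [|i]; last by apply: bmfM; [by meas|by meas].
  by apply: eq_bigr => i _; rewrite bintZl//; meas.
by rewrite !E//; apply: eq_bigr => i _; rewrite laplace_eq.
Qed.
Let bmf_poly d (T : measurableType d) (X : T -> R) (p : {poly R}) :
  mfn X -> (forall w, 0 <= X w) ->
  bmf (fun w => p.[expR (- X w)]).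
Proof.
move=> mX X0.
rewrite (_ : (fun _ => _) = fun w => \sum_(i < size p) p`_i * expR (- (i%:R * X w))).
  by apply: bmf_sum => i; apply: bmfM; [by meas|by meas].
apply/funext => w; rewrite horner_coef; apply: eq_bigr => i _.
by rewrite -expRM_natl mulrN.
Qed.
(** Equality for polynomials in exp (- X) extends to Lipschitz functions by uniform Bernstein
    approximation on [0, 1]. *)
Let lipschitz_eq (f : R -> R) (K : R) :
  (forall x y, `|f x - f y| <= K * `|x - y|) -> 0 <= K ->
  (exists M : R, forall x, `|f x| <= M) -> mfn f ->
  \int[P1]_w f (expR (- X1 w)) = \int[P2]_w f (expR (- X2 w)).
Proof.
move=> fK K0 fb mf; apply/eqP; rewrite -subr_eq0 -normr_eq0; apply/eqP.
apply/le_anti; rewrite normr_ge0 andbT; apply: le0_eps => e e0.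
have e40 : 0 < e / 4 by lra.
(* This degree makes the variance part of the Bernstein error at most e / 4, so that each side is
   within e / 2 of its polynomial value. *)
pose n := Num.truncn (K ^+ 2 / (e / 4) / (e / 4)).
pose p := bern n.+1 (fun j => f (j%:R / n.+1%:R)).
have near d (T : measurableType d) (P : probability T R) (X : T -> R) :
    mfn X -> (forall w, 0 <= X w) ->
    `|\int[P]_w f (expR (- X w)) - \int[P]_w p.[expR (- X w)]| <= e / 2.
  move=> mX X0.
  have bfX : bmf (fun w => f (expR (- X w))).
    apply: (bmf_comp mf fb); apply: measurableT_comp => //; mp.
  have bp := bmf_poly p mX X0.
  rewrite -bintB//; apply: bint_bound => [|w]; first by meas.
  rewrite distrC (le_trans (bern_lipschitz n fK K0 e40 (expX_itv X0 w)))//.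
  suff : K ^+ 2 / (e / 4) / n.+1%:R <= e / 4 by move=> h; rewrite (le_trans (lerD (lexx _) h))//; lra.
  rewrite ler_pdivrMr ?ltr0n// [leRHS]mulrC -ler_pdivrMr//.
  by rewrite ltW// truncnS_gt.
have := near _ _ P1 _ mX1 X1_ge0; have := near _ _ P2 _ mX2 X2_ge0.
rewrite poly_eq !ler_norml; set a := \int[P1]_w f _; set b := \int[P2]_w f _.
set c := \int[P2]_w _; clearbody a b c; lra.
Qed.
(** A Lipschitz approximation from below, of slope k, of the indicator of ]a, +oo[. *)
Let ramp (k : nat) (a x : R) : R := Order.min 1 (Order.max 0 (k%:R * (x - a))).

Let ramp01 k a x : 0 <= ramp k a x <= 1.
Proof. by rewrite /ramp ge_min lexx/= andbT le_min ler01/= le_max lexx. Qed.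
Let ramp_lip k a x y : `|ramp k a x - ramp k a y| <= k%:R * `|x - y|.
Proof.
rewrite -[X in X * _](@ger0_norm _ k%:R)// -normrM.
have -> : k%:R * (x - y) = k%:R * (x - a) - k%:R * (y - a) by ring.
rewrite /ramp; move: (k%:R * _) (k%:R * _) => u v.
pose c (t : R) := Order.min 1 (Order.max 0 t); rewrite -/(c v) -/(c u).
have H (s t : R) : s <= t -> `|c s - c t| <= `|s - t|.
  move=> st; rewrite (distrC s) (distrC (c s)).
  suff : 0 <= c t - c s <= t - s.
    by move=> /andP[h0 h1]; rewrite !ger0_norm// (le_trans h0).
  rewrite /c /Order.min /Order.max.
  by case: (ltP 0 t) => ?; case: (ltP 0 s) => ?; do ?[case: ltP => ?]; lra.
by have [/H//|/ltW/H] := leP v u; rewrite distrC (distrC u).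
Qed.
Let ramp_cvg a x : ramp n a x @[n --> \oo] --> ((a < x)%R%:R : R).
Proof.
case: ltP => ax; last first.
  apply: cvg_near_cst; apply: nearW => n; rewrite /ramp max_l ?min_r//.
  by rewrite mulr_ge0_le0// subr_le0.
apply: cvg_near_cst; exists (Num.truncn (x - a)^-1).+1 => // n /= ln.
rewrite /ramp min_l// le_max; apply/orP; right.
rewrite -ler_pdivrMr ?subr_gt0// mul1r ltW//.
by rewrite (lt_le_trans (truncnS_gt _))// ler_nat.
Qed.
Let measurable_ramp k a : mfn (ramp k a).
Proof.
rewrite /ramp; apply: measurable_minr => //; apply: measurable_maxr => //; mp.
Qed.
Let tail_eq (a : R) :
  \int[P1]_w ((a < expR (- X1 w))%R%:R : R) = \int[P2]_w (a < expR (- X2 w))%R%:R.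
Proof.
have C d (T : measurableType d) (P : probability T R) (X : T -> R) :
    mfn X ->
    \int[P]_w ramp n a (expR (- X w)) @[n --> \oo] -->
    \int[P]_w ((a < expR (- X w))%R%:R : R).
  move=> mX.
  have mE : mfn (fun w => expR (- X w)) by meas.
  apply: (@bint_cvg _ _ _ _ _ _ 1).
  - by move=> n; exact: (measurableT_comp (measurable_ramp n a) mE).
  - rewrite (_ : (fun _ => _) = \1_[set w | a < expR (- X w)]).
      apply: measurable_indic; rewrite -[X in measurable X]setTI.
      exact: (measurable_fun_ltr (measurable_cst _) mE measurableT (Y := [set true])).
    by apply/funext => w; rewrite indicE mem_setE.
  - by move=> n w; have /andP[? ?] := ramp01 n a (expR (- X w)); rewrite ger0_norm.
  - by apply: aeW => w; exact: ramp_cvg.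
apply: cvg_unique (C _ _ P1 _ mX1) _ => //.
rewrite (_ : (fun n => _) = fun n => \int[P2]_w ramp n a (expR (- X2 w))); last first.
  apply/funext => n; apply: (lipschitz_eq (@ramp_lip n a)) => //.
  by exists 1 => x; have /andP[? ?] := ramp01 n a x; rewrite ger0_norm.
exact: C.
Qed.

(** The values at the integers are the moments of exp (- X), a variable in [0, 1]. They fix P (X <
    x) for each x, hence the law, since left half-lines form a generating pi-system. *)
Lemma laplace_uniqueness (A : set R) : measurable A ->
  P1 (X1 @^-1` A) = P2 (X2 @^-1` A).
Proof.
have H x : P1 (X1 @^-1` `]-oo, x[%classic) = P2 (X2 @^-1` `]-oo, x[%classic).
  have I d (T : measurableType d) (P : probability T R) (X : T -> R) :
      mfn X -> P (X @^-1` `]-oo, x[%classic) =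
      (\int[P]_w ((expR (- x) < expR (- X w))%R%:R : R))%:E.
    move=> mX; rewrite -[X in P X]setIT -(@integral_indic _ _ _ P _ measurableT); mp.
    rewrite bint_EFin.
      apply: eq_integral => w _; rewrite indicE ltr_expR ltrN2; congr (_%:R%:E).
      by rewrite preimage_mem_itv in_itv.
    apply: bmf01 => [|w]; last by case: (_ < _)%R; rewrite ?ler01 ?lexx.
    rewrite (_ : (fun _ => _) = \1_(X @^-1` `]-oo, x[%classic)).
      by apply: measurable_indic; rewrite -[X in measurable X]setTI; exact: mX.
    apply/funext => w; rewrite indicE ltr_expR ltrN2; congr (_%:R).
    by rewrite preimage_mem_itv in_itv.
  by rewrite !I// tail_eq.
move=> mA; pose f1 := [mfun of (mfun_Sub (mem_set mX1 : X1 \in mfun))].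
pose f2 := [mfun of (mfun_Sub (mem_set mX2 : X2 \in mfun))].
apply: (@measure_unique _ _ _ (@RGenInftyO.G R) (fun n => `]-oo, n%:R[%classic)
  _ _ _ _ (distribution P1 f1) (distribution P2 f2)) => //.
- exact: RGenInftyO.measurableE.
- move=> _ _ [x ->] [y ->]; exists (Order.min x y).
  apply/seteqP; split => z /=; rewrite !in_itv/= lt_min; first by case=> -> ->.
  by move=> /andP.
- by move=> n; exists n%:R.
- apply/seteqP; split => // x _; exists (Num.truncn x).+1 => //=.
  by rewrite in_itv/= truncnS_gt.
- by move=> _ [x ->]; exact: H.
- by move=> n; rewrite (le_lt_trans (probability_le1 _ _)) ?ltry.
Qed.

End laplace_uniqueness.

Definition mkmfun {d d' : measure_display} {T : measurableType d}
    {S : measurableType d'} (f : T -> S) (mf : mfn f) :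
  {mfun T >-> S} := mfun_Sub (mem_set mf : f \in mfun).

Definition pushm {d d' : measure_display} {T : measurableType d}
    {S : measurableType d'} {R : realType} (mu : {measure set T -> \bar R})
    (f : T -> S) (mf : mfn f) : {measure set S -> \bar R}.
Proof. by refine (pushforward mu f : {measure set S -> \bar R}). Defined.

(** * Independence and product laws *)

Section independence.
Context {d} {T : measurableType d} {R : realType}
  (P : probability T R).
Local Open Scope ereal_scope.

(* Dynkin's lemma: it suffices to test independence on a pi-system. *)
Lemma indep_event_pi d2 (S : measurableType d2) (Y : T -> S) (G : set (set S))
    (E : set T) :
  mfn Y -> measurable E -> @measurable _ S = <<s G >> ->
  setI_closed G -> G setT ->
  (forall B, G B -> P (E `&` Y @^-1` B) = P E * P (Y @^-1` B)) ->
  forall B, measurable B -> P (E `&` Y @^-1` B) = P E * P (Y @^-1` B).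
Proof.
move=> mY mE mG GI GT H B mB.
have PE0 : (0 <= fine (P E))%R by exact: fine_ge0.
pose m1 := mscale (NngNum PE0) (pushm P mY).
pose m2 := pushm (mrestr P mE) mY.
have m1E A : m1 A = P E * P (Y @^-1` A).
  by rewrite /m1 /mscale/= fineK// fin_num_measure.
have m2E A : m2 A = P (E `&` Y @^-1` A).
  by rewrite [in RHS]setIC.
rewrite -m1E -m2E.
apply/esym; apply: (@measure_unique _ _ _ G (fun=> setT)) => //.
- by apply/seteqP; split => // x _; exists 0%N.
- by move=> A GA; rewrite -[LHS]/(m1 A) m1E m2E H.
- move=> _; apply: (@le_lt_trans _ _ 1); last exact: ltry.
  rewrite [leLHS](m1E setT) preimage_setT probability_setT mule1.
  exact: probability_le1.
Qed.

(** The joint law agrees with the product of the marginals on rectangles, hence everywhere; Tonelli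
    then replaces the second variable by an independent copy. *)
Lemma indep_joint d1 d2 (S1 : measurableType d1) (S2 : measurableType d2)
    (X : T -> S1) (Y : T -> S2) (h : S1 * S2 -> \bar R) :
  mfn X -> mfn Y ->
  (forall A B, measurable A -> measurable B ->
    P (X @^-1` A `&` Y @^-1` B) = P (X @^-1` A) * P (Y @^-1` B)) ->
  mfn h -> (forall z, 0 <= h z) ->
  \int[P]_w h (X w, Y w) = \int[P]_w \int[P]_w' h (X w, Y w').
Proof.
move=> mX mY ind mh h0.
have mXY : mfn (fun w => (X w, Y w)) by meas.
pose fX := mkmfun mX; pose fY := mkmfun mY; pose fXY := mkmfun mXY.
have E D : measurable D ->
    (distribution P fX \x distribution P fY) D = distribution P fXY D.
  apply: product_measure_unique => A B mA mB.
  by rewrite /distribution /pushforward/= -ind.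
rewrite -[LHS]/(\int[P]_w (h \o fXY) w) -ge0_integral_distribution//.
transitivity (\int[distribution P fX \x distribution P fY]_z h z).
  by apply: eq_measure_integral => D mD _; exact/esym/E.
rewrite fubini_tonelli1// ge0_integral_distribution//; last 2 first.
- exact: measurable_fun_fubini_tonelli_F.
- by move=> y; exact: integral_ge0.
apply: eq_integral => w _ /=; rewrite /fubini_F ge0_integral_distribution//.
exact: measurable_fun_pair2.
Qed.

End independence.

(** * Conditioning the echo process on its past *)

Section echo_process.
Context {R : realType} {d0} {T0 : measurableType d0}
  (P0 : probability T0 R) (xi : {RV P0 >-> R}).
Context {d} {T : measurableType d} (P : probability T R).
Variables (xi_ : nat -> {RV P >-> R}) (U_ : nat -> {RV P >-> nat})
  (X : nat -> T -> R).
Hypothesis inputs : echo_inputs xi xi_ U_.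
Hypothesis recX : echo_recursion xi_ U_ X.

Let F (i : nat + nat) : set (set T) :=
  match i with
  | inl n => sigma_rv (xi_ n.+2)
  | inr n => sigma_rv (U_ n.+2)
  end.

(** The indices of the inputs of nodes 2, ..., p + 1, with the shift by 2 used in [echo_indep]. *)
Let idx p : seq (nat + nat) :=
  [seq inl k | k <- iota 0 p] ++ [seq inr k | k <- iota 0 p].

(* The past of node [p.+2]: a pi-system generating the sigma-algebra of
   xi_2, ..., xi_{p+1}, U_2, ..., U_{p+1}. *)
Definition echo_past p : set (set T) :=
  [set B | exists2 E : nat + nat -> set T, (forall i, F i (E i)) &
           B = \big[setI/setT]_(i <- idx p) E i].

Let FT i : F i setT.
Proof. by case: i => n; exists setT => //; rewrite setTI preimage_setT. Qed.
Let FI i A B : F i A -> F i B -> F i (A `&` B).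
Proof.
case: i => n [A' mA <-] [B' mB <-]; exists (A' `&` B'); mp.
- exact: measurableI.
- by rewrite !setTI preimage_setI.
- by rewrite !setTI preimage_setI.
Qed.
Let Fm i A : F i A -> measurable A.
Proof. by case: i => n [A' mA <-]; meas. Qed.
Let pastI p : setI_closed (echo_past p).
Proof.
move=> _ _ [E1 F1 ->] [E2 F2 ->]; exists (fun i => E1 i `&` E2 i).
  by move=> i; exact: FI.
by rewrite big_split.
Qed.
Let pastT p : echo_past p setT.
Proof. by exists (fun=> setT) => //; rewrite big1. Qed.
Let past_measurable p : echo_past p `<=` @measurable _ T.
Proof.
move=> _ [E FE ->]; apply: bigsetI_measurable => i _; exact: (Fm (FE i)).
Qed.

(** The set [T] with the sigma-algebra of the past. A function measurable on [Tp p] depends on the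
    past only, and conditioning becomes the independence of [id : T -> Tp p] from the new inputs. *)
Notation Tp p := (g_sigma_algebraType (echo_past p)).

Let id_measurable p : mfn (id : T -> Tp p).
Proof.
move=> _ B mB; rewrite setTI preimage_id.
apply: (@smallest_sub _ (sigma_algebra setT) _ (@measurable _ T)) mB.
  exact: sigma_algebra_measurable.
exact: past_measurable.
Qed.
Let uniq_idx p : uniq (idx p).
Proof.
rewrite /idx cat_uniq !map_inj_uniq ?iota_uniq; [|by move=> ? ? []..].
by rewrite andbT/=; apply/hasPn => _ /mapP[k _ ->]; apply/negP => /mapP[].
Qed.
Let inl_notin p : inl p \notin idx p.
Proof.
rewrite mem_cat; apply/norP; split; apply/negP => /mapP[k]//.
by rewrite mem_iota/= add0n => /[swap] -[->]; rewrite ltnn.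
Qed.
Let inr_notin p : inr p \notin idx p.
Proof.
rewrite mem_cat; apply/norP; split; apply/negP => /mapP[k]//.
by rewrite mem_iota/= add0n => /[swap] -[->]; rewrite ltnn.
Qed.
Let indep3 p B (A : set R) (C : set nat) : echo_past p B -> measurable A ->
  (P (B `&` ((xi_ p.+2 @^-1` A) `&` (U_ p.+2 @^-1` C))) =
   P B * (P (xi_ p.+2 @^-1` A) * P (U_ p.+2 @^-1` C)))%E.
Proof.
move=> [E FE BE] mA; have ind := echo_indep inputs.
pose E' i := if i == inl p then xi_ p.+2 @^-1` A else
             if i == inr p then U_ p.+2 @^-1` C else E i.
have EE' : \big[setI/setT]_(i <- idx p) E' i = \big[setI/setT]_(i <- idx p) E i.
  apply: eq_big_seq => i ip; rewrite /E'.
  case: eqP => [ii|_]; first by have := inl_notin p; rewrite -ii ip.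
  by case: eqP => [ii|_//]; have := inr_notin p; rewrite -ii ip.
have pE' : \prod_(i <- idx p) fine (P (E' i)) = \prod_(i <- idx p) fine (P (E i)).
  apply: eq_big_seq => i ip; rewrite /E'.
  case: eqP => [ii|_]; first by have := inl_notin p; rewrite -ii ip.
  by case: eqP => [ii|_//]; have := inr_notin p; rewrite -ii ip.
have FE' i : F i (E' i).
  rewrite /E'; case: eqP => [->|_]; first by exists A => //; rewrite setTI.
  by case: eqP => [->|_//]; exists C => //; rewrite setTI.
have := ind [:: inl p, inr p & idx p] E'.
rewrite /= in_cons/= inl_notin inr_notin uniq_idx => /(_ isT) H.
have {H}:= H (fun i _ => FE' i).
rewrite !big_cons EE' pE' -BE /E' !eqxx/= => H.
have PBE : P B = (\prod_(i <- idx p) fine (P (E i)))%:E.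
  by rewrite BE; apply: (ind _ E (uniq_idx p)) => i _; exact: FE.
rewrite setIC -setIA H !EFinM !fineK ?fin_num_measure//; last 2 first.
- exact: measurable_funPTI.
- by meas.
by rewrite -PBE muleA muleC.
Qed.
Let rect_generated : @measurable _ (R * nat)%type =
  <<s [set A `*` C | A in @measurable _ R & C in @measurable _ nat] >>.
Proof. exact: measurable_prod_measurableType. Qed.
Let rectI : setI_closed
  [set A `*` C | A in @measurable _ R & C in @measurable _ nat].
Proof.
move=> _ _ [A mA [C mC <-]] [A' mA' [C' mC' <-]]; rewrite -setXI.
exists (A `&` A'); first exact: measurableI.
by exists (C `&` C') => //; meas.
Qed.
Let new p w := (xi_ p.+2 w, U_ p.+2 w).

Let measurable_new p : mfn (new p).
Proof. by apply: measurable_fun_pair; meas. Qed.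
(** Dynkin's lemma twice: over events of the past, then over rectangles for the pair of new inputs,
    where [indep3] applies. *)
Let indep_new p (B : set (Tp p)) (D : set (R * nat)) :
  measurable B -> measurable D ->
  (P (id @^-1` B `&` new p @^-1` D) = P (id @^-1` B) * P (new p @^-1` D))%E.
Proof.
move=> mB mD; rewrite setIC muleC.
apply: (@indep_event_pi _ T R P _ (Tp p) id (echo_past p)) => //; mp.
move=> {mB}B pB; rewrite setIC muleC preimage_id.
apply: (indep_event_pi _ _ rect_generated rectI) mD => //.
- exact: past_measurable pB.
- by exists setT => //; exists setT => //; rewrite setXTT.
- move=> _ [A mA [C mC <-]].
  have -> : new p @^-1` (A `*` C) = xi_ p.+2 @^-1` A `&` U_ p.+2 @^-1` C.
    by apply/seteqP; split => w.
  rewrite indep3//; congr (_ * _)%E.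
  have := indep3 C (pastT p) mA; rewrite setTI probability_setT mul1e => ->//.
Qed.

(** The Markov step: with the past frozen, the new factor has the law of [xi] and the parent is
    uniform among the p + 1 existing nodes. All later expectations along the dynamics come from this
    formula. *)
Lemma echo_step p (h : Tp p * (R * nat) -> \bar R) :
  mfn h -> (forall z, 0 <= h z)%E ->
  (\int[P]_w h (w, (xi_ p.+2 w, U_ p.+2 w)) =
   \int[P]_w ((p.+1%:R^-1)%:E *
     \sum_(1 <= k < p.+2) \int[P0]_w0 h (w, (xi w0, k))))%E.
Proof.
move=> mh h0.
transitivity (\int[P]_w \int[P]_w' h (w, new p w'))%E.
  by apply: (@indep_joint _ T R P _ _ (Tp p) _ id (new p)) => // *; exact: indep_new.
apply: eq_integral => w _.
have mhw : mfn (fun z => h ((w : Tp p), z)) by exact: (measurable_fun_pair2 (w : Tp p) mh).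
rewrite (@indep_joint _ T R P _ _ R nat (xi_ p.+2) (U_ p.+2) (fun z => h (w, z)))//; last first.
  move=> A C mA mC; have := indep3 C (pastT p) mA.
  by rewrite setTI probability_setT mul1e.
transitivity (\int[P]_x ((p.+1%:R^-1)%:E *
    \sum_(1 <= k < p.+2) h (w, (xi_ p.+2 x, k))))%E.
  apply: eq_integral => x _.
  (* The value at the random index is written as a finite sum of indicators, so that integrating
     over the index only calls for the probabilities of [echo_uniform]. *)
  have hU : (\int[P]_y h (w, (xi_ p.+2 x, U_ p.+2 y)) =
     \int[P]_y \sum_(1 <= k < p.+2)
       h (w, (xi_ p.+2 x, k)) * (\1_(U_ p.+2 @^-1` [set k]) y)%:E)%E.
    apply: eq_integral => y _.
    have /andP[U1 Up] := echo_range inputs y (isT : (2 <= p.+2)%N).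
    rewrite (bigD1_seq (U_ p.+2 y)); [|by rewrite mem_index_iota U1|exact: iota_uniq].
    rewrite indicE mem_set// mule1 big1/= ?adde0// => k kU.
    rewrite indicE memNset ?mule0// => /= kE.
    by rewrite kE eqxx in kU.
  rewrite hU ge0_integral_sum//; last 2 first.
  - move=> k; apply: emeasurable_funM => //; apply/measurable_EFinP.
    by apply: measurable_indic; exact: preimage_measurable.
  - by move=> k y _; rewrite mule_ge0// lee_fin.
  rewrite ge0_sume_distrr; last by move=> k _; exact: h0.
  rewrite !big_seq; apply: eq_bigr => k; rewrite mem_index_iota => kp.
  rewrite ge0_integralZl//; last first.
    apply/measurable_EFinP.
    by apply: measurable_indic; exact: preimage_measurable.
  rewrite integral_indic// ?setIT; last exact: preimage_measurable.
  rewrite muleC; congr (_ * _)%E.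
  exact: (echo_uniform inputs (isT : (2 <= p.+2)%N) kp).
have mk k : mfn (fun b : R => h (w, (b, k))) by meas.
rewrite ge0_integralZl//; last 2 first.
- apply: emeasurable_fun_sum => k; mp.
- by move=> x _; apply: sume_ge0 => k _; exact: h0.
congr (_ * _)%E; rewrite ge0_integral_sum//; last by meas.
apply: eq_bigr => k _.
rewrite -[LHS]/(\int[P]_x ((fun b => h (w, (b, k))) \o xi_ p.+2) x)%E.
rewrite -[RHS]/(\int[P0]_x ((fun b => h (w, (b, k))) \o xi) x)%E.
rewrite -!ge0_integral_distribution//.
by apply: eq_measure_integral => A mA _; exact: (echo_copies inputs).
Qed.

(** Strong induction along the tree: the value at the random parent is a finite sum of indicators
    times earlier nodes, all of which belong to the past. *)
Lemma echo_measurable_past p k : (1 <= k <= p.+1)%N ->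
  mfn (X k : Tp p -> R).
Proof.
have [X1 XS] := recX.
have mxi q : (q < p)%N -> mfn (xi_ q.+2 : Tp p -> R).
  move=> qp _ A mA; apply: sub_sigma_algebra; rewrite setTI.
  exists (fun i => if i == inl q then xi_ q.+2 @^-1` A else setT).
    by move=> i; case: eqP => [->|_//]; exists A => //; rewrite setTI.
  rewrite (bigD1_seq (inl q))//= ?eqxx.
    by rewrite big1 ?setIT// => i /negPf ->.
  by rewrite mem_cat; apply/orP; left; apply/mapP; exists q; rewrite // mem_iota.
have mU q : (q < p)%N -> forall k, measurable (U_ q.+2 @^-1` [set k] : set (Tp p)).
  move=> qp j; apply: sub_sigma_algebra.
  exists (fun i => if i == inr q then U_ q.+2 @^-1` [set j] else setT).
    by move=> i; case: eqP => [->|_//]; exists [set j] => //; rewrite setTI.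
  rewrite (bigD1_seq (inr q))//= ?eqxx.
    by rewrite big1 ?setIT// => i /negPf ->.
  by rewrite mem_cat; apply/orP; right; apply/mapP; exists q; rewrite // mem_iota.
elim/ltn_ind: k => -[//|[_ _|k IH /andP[_ kp]]].
  rewrite (_ : X 1%N = cst 1); first by meas.
  by apply/funext => w; exact: X1.
rewrite (_ : X k.+2 = fun w => xi_ k.+2 w *
    \sum_(1 <= j < k.+2) (\1_(U_ k.+2 @^-1` [set j]) w * X j w)).
  have kp' : (k < p)%N by [].
  apply: measurable_funM; first exact: (mxi _ kp').
  rewrite (_ : (fun w => _) = fun w => \sum_(j <- index_iota 1 k.+2)
     (if (1 <= j < k.+2)%N then \1_(U_ k.+2 @^-1` [set j]) w * X j w else 0)).
    apply: measurable_sum => j; case jk2 : (1 <= j < k.+2)%N => //.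
    have /andP[j1 jk] := jk2.
    apply: measurable_funM; first by apply: measurable_indic; exact: (mU _ kp' j).
    by apply: IH => //; rewrite j1/= (leq_trans (ltnW jk)).
  apply/funext => w; rewrite !big_seq; apply: eq_bigr => j.
  by rewrite mem_index_iota => ->.
apply/funext => w; rewrite XS//; congr (_ * _).
have /andP[U1 Up] := echo_range inputs w (isT : (2 <= k.+2)%N).
rewrite (bigD1_seq (U_ k.+2 w)); [|by rewrite mem_index_iota U1|exact: iota_uniq].
rewrite indicE mem_set// mul1r big1/= ?addr0// => j jU.
rewrite indicE memNset ?mul0r// => /= jE.
by rewrite jE eqxx in jU.
Qed.

Lemma echo_measurable k : (1 <= k)%N -> mfn (X k).
Proof.
case: k => // k _.
have := @echo_measurable_past k k.+1; rewrite leqnn/= => /(_ isT) mX.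
move=> _ A mA; have := mX measurableT A mA; rewrite !setTI => mXA.
by have := @id_measurable k measurableT _ mXA; rewrite setTI.
Qed.

End echo_process.

(** * First-order expansions at 0 from the right *)

Section expansion.
Context {R : realType}.
Implicit Types (F G : R -> R) (a b c : R).

(** F (e) = a + b e + O(e^2) on [0, 1]. It serves as a derivative at 0: b is unique, the product
    rule holds, and an explicit quadratic remainder can be integrated over parameters. *)
Definition expands F a b :=
  exists C : R, forall e : R, 0 <= e <= 1 -> `|F e - a - e * b| <= C * e ^+ 2.

Lemma expands_uniq F a b b' : expands F a b -> expands F a b' -> b = b'.
Proof.
move=> [C HC] [C' HC']; apply/eqP; rewrite -subr_eq0 -normr_eq0; apply/eqP.
apply/le_anti; rewrite normr_ge0 andbT; apply: le0_eps => e e0.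
pose K : R := `|C| + `|C'| + 1.
have K0 : 0 < K by rewrite /K; have := normr_ge0 C; have := normr_ge0 C'; lra.
(* Any t in ]0, 1] with K t <= e will do, since t |b - b'| <= K t^2. *)
pose t : R := Order.min 1 (e / K).
have t0 : 0 < t by rewrite lt_min ltr01/= divr_gt0.
have t1 : t <= 1 by rewrite ge_min lexx.
have tK : t * K <= e by rewrite -ler_pdivlMr// ge_min lexx orbT.
have := HC t; have := HC' t; rewrite (ltW t0) t1 => /(_ isT) h' /(_ isT) h.
have : `|t * (b - b')| <= (C + C') * t ^+ 2.
  have -> : t * (b - b') = (F t - a - t * b') - (F t - a - t * b) by ring.
  rewrite (le_trans (ler_normB _ _))// mulrDl addrC; exact: lerD.
rewrite normrM gtr0_norm// => H.
have {H} : t * `|b - b'| <= t * (K * t).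
  rewrite (le_trans H)// expr2 mulrA mulrC ler_wpM2l ?(ltW t0)//.
  rewrite ler_wpM2r ?(ltW t0)// /K; have := ler_norm C; have := ler_norm C'.
  by lra.
by rewrite ler_pM2l// mulrC => /le_trans; apply.
Qed.

Lemma expandsD F G a b a' b' : expands F a b -> expands G a' b' ->
  expands (fun e => F e + G e) (a + a') (b + b').
Proof.
move=> [C HC] [C' HC']; exists (C + C') => e e01.
have -> : F e + G e - (a + a') - e * (b + b') =
  (F e - a - e * b) + (G e - a' - e * b') by ring.
by rewrite (le_trans (ler_normD _ _))// mulrDl lerD ?HC ?HC'.
Qed.

Lemma expandsM F G a b a' b' : expands F a b -> expands G a' b' ->
  expands (fun e => F e * G e) (a * a') (a * b' + b * a').
Proof.
move=> [C HC] [C' HC'].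
pose A : R := `|a| + `|b|; pose D : R := `|b| * `|b'| + A * `|C'| + (`|a'| + `|b'| + `|C'|) * `|C|.
exists D => e e01; have /andP[e0 e1] := e01.
set r := F e - a - e * b; set r' := G e - a' - e * b'.
have Fe : F e = a + e * b + r by rewrite /r; ring.
have Ge : G e = a' + e * b' + r' by rewrite /r'; ring.
have r_le : `|r| <= `|C| * e ^+ 2.
  by rewrite (le_trans (HC _ e01))// ler_wpM2r ?sqr_ge0// ler_norm.
have r'_le : `|r'| <= `|C'| * e ^+ 2.
  by rewrite (le_trans (HC' _ e01))// ler_wpM2r ?sqr_ge0// ler_norm.
have -> : F e * G e - a * a' - e * (a * b' + b * a') =
   e ^+ 2 * (b * b') + (a + e * b) * r' + G e * r by rewrite Fe Ge; ring.
have e21 : e ^+ 2 <= 1 by rewrite expr_le1.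
have Ab : `|a + e * b| <= A.
  rewrite (le_trans (ler_normD _ _))// lerD2l normrM ger0_norm//.
  by rewrite -[leRHS]mul1r ler_wpM2r.
have Gb : `|G e| <= `|a'| + `|b'| + `|C'|.
  rewrite Ge (le_trans (ler_normD _ _))// lerD//.
    rewrite (le_trans (ler_normD _ _))// lerD2l normrM ger0_norm//.
    by rewrite -[leRHS]mul1r ler_wpM2r.
  by rewrite (le_trans r'_le)// -[leRHS]mulr1 ler_wpM2l.
rewrite (le_trans (ler_normD _ _))// [leRHS]mulrDl lerD//; last by rewrite normrM -mulrA ler_pM.
rewrite (le_trans (ler_normD _ _))// [leRHS]mulrDl lerD//.
  by rewrite normrM (@ger0_norm _ (e ^+ 2)) ?sqr_ge0// normrM mulrC.
by rewrite normrM -mulrA ler_pM.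
Qed.

Lemma expandsZ c F a b : expands F a b -> expands (fun e => c * F e) (c * a) (c * b).
Proof.
move=> [C HC]; exists (`|c| * C) => e e01.
have -> : c * F e - c * a - e * (c * b) = c * (F e - a - e * b) by ring.
by rewrite normrM -mulrA ler_wpM2l// HC.
Qed.

Lemma expands_sum (I : Type) (s : seq I) (F : I -> R -> R) (a b : I -> R) :
  (forall i, expands (F i) (a i) (b i)) ->
  expands (fun e => \sum_(i <- s) F i e) (\sum_(i <- s) a i) (\sum_(i <- s) b i).
Proof.
move=> H; elim: s => [|i s IH].
  by exists 0 => e _; rewrite !big_nil mulr0 !subr0 normr0 mul0r.
have [C HC] := expandsD (H i) IH; exists C => e e01.
by rewrite !big_cons; exact: HC.
Qed.

End expansion.

(** * Splitting of the genealogical tree at node 2 *)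

Section echo_laplace.
Context {R : realType} {d0} {T0 : measurableType d0}
  (P0 : probability T0 R) (xi : {RV P0 >-> R}).
Context {d} {T : measurableType d} (P : probability T R).
Variables (xi_ : nat -> {RV P >-> R}) (U_ : nat -> {RV P >-> nat})
  (X : nat -> T -> R).
Hypothesis inputs : echo_inputs xi xi_ U_.
Hypothesis recX : echo_recursion xi_ U_ X.

Notation Tp p := (g_sigma_algebraType (echo_past xi_ U_ p)).

Definition nbm (f : R -> R) := bmf f /\ forall x, 0 <= f x.

Lemma echo_step_bounded p (h : Tp p * (R * nat) -> R) :
  bmf h -> (forall z, 0 <= h z) ->
  \int[P]_w h (w, (xi_ p.+2 w, U_ p.+2 w)) =
  \int[P]_w (p.+1%:R^-1 * \sum_(1 <= k < p.+2) \int[P0]_w0 h (w, (xi w0, k))).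
Proof.
move=> [mh [M hM]] h0; rewrite /Rintegral; congr fine.
rewrite (echo_step inputs (h := EFin \o h))//; last by meas.
apply: eq_integral => w _; rewrite EFinM; congr (_ * _)%E.
rewrite -sumEFin; apply: eq_bigr => k _; apply/esym/bint_EFin.
apply: (@bmf_le _ _ _ _ M) => //; mp.
Qed.

Definition ax k w : R := `|X k w|.

Definition PP (f : R -> R) n x w := \prod_(1 <= i < n.+1) f (x * ax i w).

(** The derivative of [PP] at f in the direction g, by the product rule on the last factor. *)
Fixpoint dPP (f g : R -> R) n x w := if n is k.+1 then
  dPP f g k x w * f (x * ax n w) + PP f k x w * g (x * ax n w) else 0.

Definition Psi f n x := \int[P]_w PP f n x w.
Definition dPsi f g n x := \int[P]_w dPP f g n x w.
(** The functional [Psi] of a tree whose root carries an independent copy of [xi] instead of 1, as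
    does the subtree descending from node 2. *)
Definition Kap f n x := \int[P0]_w Psi f n (x * `|xi w|).
Definition dKap f g n x := \int[P0]_w dPsi f g n (x * `|xi w|).
(** The direction that attaches a child to a node: the factor of the node is multiplied by the mean
    of f at a fresh echo of it. *)
Definition echoD (f : R -> R) x := f x * \int[P0]_w f (x * `|xi w|).

Lemma PPS f n x w : PP f n.+1 x w = PP f n x w * f (x * ax n.+1 w).
Proof. by rewrite /PP big_nat_recr. Qed.
Let max_ k : (1 <= k)%N -> mfn (ax k).
Proof.
by move=> k1; apply: measurableT_comp => //; exact: (echo_measurable inputs recX).
Qed.

Lemma bmf_PP (f : R -> R) n : bmf f ->
  bmf (fun z : R * T => PP f n z.1 z.2).
Proof.
move=> [mf [M fM]]; elim: n => [|n IH].
  rewrite (_ : (fun z => _) = fun=> 1); first by meas.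
  by apply/funext => z; rewrite /PP big_geq.
rewrite (_ : (fun z => _) = fun z => PP f n z.1 z.2 * f (z.1 * ax n.+1 z.2)).
  apply: bmfM => //; apply: (bmf_comp mf); first by exists M.
  apply: measurable_funM => //.
  by apply: measurableT_comp => //; exact: max_.
by apply/funext => z; rewrite PPS.
Qed.

Lemma bmf_dPP (f g : R -> R) n : bmf f -> bmf g ->
  bmf (fun z : R * T => dPP f g n z.1 z.2).
Proof.
move=> bf bg; have [mf [M fM]] := bf; have [mg [N gN]] := bg.
elim: n => [|n IH]; first exact: bmf_cst.
apply: bmfD; apply: bmfM => //.
- apply: (bmf_comp mf); first by exists M.
  apply: measurable_funM => //.
  by apply: measurableT_comp => //; exact: max_.
- exact: bmf_PP.
- apply: (bmf_comp mg); first by exists N.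
  apply: measurable_funM => //.
  by apply: measurableT_comp => //; exact: max_.
Qed.
Let bPP f n x : bmf f -> bmf (PP f n x).
Proof. by move=> bf; exact: (bmf_pair1 (bmf_PP n bf)). Qed.
Let bdPP f g n x : bmf f -> bmf g -> bmf (dPP f g n x).
Proof. by move=> bf bg; exact: (bmf_pair1 (bmf_dPP n bf bg)). Qed.
Let mxi (x : R) : mfn (fun w => x * `|xi w|).
Proof. by meas. Qed.
Let bPsi f n : bmf f -> bmf (Psi f n).
Proof. by move=> bf; exact: (bmf_fubini1 (bmf_PP n bf) P). Qed.
Let bdPsi f g n : bmf f -> bmf g -> bmf (dPsi f g n).
Proof. by move=> bf bg; exact: (bmf_fubini1 (bmf_dPP n bf bg) P). Qed.
Let bPsixi f n x : bmf f -> bmf (fun w => Psi f n (x * `|xi w|)).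
Proof. by move=> bf; have [mp bp] := bPsi n bf; exact: (bmf_comp mp bp (mxi x)). Qed.
Let bdPsixi f g n x : bmf f -> bmf g -> bmf (fun w => dPsi f g n (x * `|xi w|)).
Proof.
by move=> bf bg; have [mp bp] := bdPsi n bf bg; exact: (bmf_comp mp bp (mxi x)).
Qed.

Lemma nbm_echoD f : nbm f -> nbm (echoD f).
Proof.
move=> [bf f0]; have [mf [M fM]] := bf; split; last by move=> x; rewrite mulr_ge0//; by pos.
apply: bmfM => //.
apply: (@bmf_fubini1 _ _ R T0 R (fun z => f (z.1 * `|xi z.2|)) _ P0); mp.
Qed.

Lemma PP_ge0 f n x w : nbm f -> 0 <= PP f n x w.
Proof. by move=> [_ f0]; rewrite prodr_ge0. Qed.

Lemma dPP_echoD f n x w : dPP f (echoD f) n x w =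
  PP f n x w * \sum_(1 <= k < n.+1) \int[P0]_w0 f (x * ax k w * `|xi w0|).
Proof.
elim: n => [|n IH]; first by rewrite /= big_geq ?mulr0.
by rewrite /= IH PPS [X in _ = _ * X]big_nat_recr//= /echoD mulrDr [X in X + _]mulrAC [X in _ + X]mulrA.
Qed.

(** Given the first n + 1 nodes, the factor of the new node has as mean the average over k of E f (x
    X_k xi). Multiplied by n + 1, this is the sum that [dPP_echoD] finds when [PP] is differentiated
    along [echoD f]. *)
Lemma Psi_forward f n x : nbm f ->
  dPsi f (echoD f) n.+1 x = n.+1%:R * Psi f n.+2 x.
Proof.
move=> nf; have [bf f0] := nf; have [mf [M fM]] := bf.
have [_ XS] := recX.
(* The value 0 for indices outside 1, ..., n + 1 makes [h] measurable on the whole product; the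
   parent index never takes such values. *)
pose h (z : Tp n * (R * nat)) :=
  PP f n.+1 x z.1 * (if (1 <= z.2.2 < n.+2)%N then f (x * (`|z.2.1| * ax z.2.2 z.1)) else 0).
have maxp k : (1 <= k < n.+2)%N -> mfn (ax k : Tp n -> R).
  move=> kn; apply: measurableT_comp => //.
  exact: (echo_measurable_past inputs recX).
have bPPp j : (j <= n.+1)%N -> bmf (PP f j x : Tp n -> R).
  elim: j => [|j IH] jn.
    rewrite (_ : PP f 0 x = fun=> 1); first by meas.
    by apply/funext => w; rewrite /PP big_geq.
  rewrite (_ : PP f j.+1 x = fun w => PP f j x w * f (x * ax j.+1 w)).
    apply: bmfM; first exact/IH/ltnW.
    apply: (bmf_comp mf); first by exists M.
    by apply: measurable_funM => //; exact: maxp.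
  by apply/funext => w; rewrite PPS.
have bh : bmf h.
  apply: bmfM.
    have [mp bp] := bPPp n.+1 (leqnn _).
    by apply: (bmf_comp mp bp); meas.
  rewrite (_ : (fun z => _) = fun z : Tp n * (R * nat) => \sum_(k <- index_iota 1 n.+2)
    \1_[set k] z.2.2 * (if (1 <= k < n.+2)%N then f (x * (`|z.2.1| * ax k z.1)) else 0)).
    apply: bmf_sum => k; apply: bmfM.
      apply: (@bmf_comp _ (Tp n * (R * nat))%type R _ nat (\1_[set k]) (fun z => z.2.2)) => //; mp.
      - by exists 1 => j; rewrite indicE; case: (_ \in _); rewrite ?normr1 ?normr0.
    case kn : (1 <= k < n.+2)%N; last by meas.
    apply: (bmf_comp mf); first by exists M.
    apply: measurable_funM => //; apply: measurable_funM; mp.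
    by apply: (measurableT_comp (maxp _ kn)); meas.
  apply/funext => z; case: ifP => zn.
    rewrite (bigD1_seq z.2.2); [|by rewrite mem_index_iota|exact: iota_uniq].
    rewrite indicE mem_set// mul1r zn big1/= ?addr0// => k kz.
    by rewrite indicE memNset ?mul0r//= => zk; rewrite zk eqxx in kz.
  rewrite big1_seq//= => k; rewrite mem_index_iota => kn.
  rewrite indicE memNset ?mul0r//= => zk.
  by rewrite zk kn in zn.
have h0 z : 0 <= h z by rewrite mulr_ge0 ?PP_ge0//; case: ifP.
have := @echo_step_bounded n h bh h0.
have -> : \int[P]_w h (w, (xi_ n.+2 w, U_ n.+2 w)) = Psi f n.+2 x.
  apply: eq_Rintegral => w _; rewrite /h/= (echo_range inputs)// [RHS]PPS.
  by have -> : ax n.+2 w = `|xi_ n.+2 w| * ax (U_ n.+2 w) w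
    by rewrite /ax XS// normrM.
move=> ->; rewrite -bintZl; last first.
  apply: bmfM; first by meas.
  apply: bmf_sum => k.
  have E : (fun w => \int[P0]_w0 h (w, (xi w0, k))) =
    fun w => PP f n.+1 x w * (if (1 <= k < n.+2)%N then
       \int[P0]_w0 f (x * (`|xi w0| * ax k w)) else 0).
    apply/funext => w; rewrite /h/=.
    have bfx : bmf (fun w0 => f (x * (`|xi w0| * ax k w))) by meas.
    case: ifP => kn; first by rewrite bintZl.
    by rewrite mulr0 bint_cst.
  rewrite E; apply: bmfM; first exact: bPP.
  case kn : (1 <= k < n.+2)%N; last by meas.
  apply: (@bmf_fubini1 _ _ T T0 R (fun z => f (x * (`|xi z.2| * ax k z.1))) _ P0).
  apply: (bmf_comp mf); first by exists M.
  apply: measurable_funM => //; apply: measurable_funM => //; mp.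
  by apply: measurableT_comp => //; apply: max_; case/andP : kn.
apply: eq_Rintegral => w _.
rewrite dPP_echoD mulrA divff ?pnatr_eq0// mul1r mulr_sumr !big_seq.
apply: eq_bigr => k; rewrite mem_index_iota => kn; rewrite -bintZl; mp.
apply: eq_Rintegral => w0 _; rewrite /h/= kn; congr (_ * f _); ring.
Qed.

Lemma Kap_forward f n x : nbm f ->
  dKap f (echoD f) n.+1 x = n.+1%:R * Kap f n.+2 x.
Proof.
move=> nf; rewrite /Kap -bintZl; last by apply: bPsixi; case: nf.
by apply: eq_Rintegral => w _; rewrite Psi_forward.
Qed.
Let fe (f g : R -> R) (e : R) x := f x + e * g x.

Lemma nbm_fe f g e : nbm f -> nbm g -> 0 <= e -> nbm (fe f g e).
Proof.
move=> [bf f0] [bg g0] e0; split; last by move=> x; rewrite addr_ge0// mulr_ge0.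
by apply: bmfD => //; apply: bmfM => //; meas.
Qed.

(** The constant is uniform in x and w, so the expansion can be integrated over the process
    ([Psi_expand]) and then over an independent [xi] ([Kap_expands]). *)
Lemma PP_expand f g n : bmf f -> bmf g -> exists C : R, 0 <= C /\
  forall (e x : R) w, 0 <= e <= 1 ->
  `|PP (fe f g e) n x w - PP f n x w - e * dPP f g n x w| <= C * e ^+ 2.
Proof.
move=> bf bg; have [_ [M fM]] := bf; have [_ [N gN]] := bg.
have M0 : 0 <= M := le_trans (normr_ge0 _) (fM 0).
have N0 : 0 <= N := le_trans (normr_ge0 _) (gN 0).
elim: n => [|n [C [C0 HC]]].
  exists 0; split => // e x w _.
  by rewrite /PP !big_geq//= subrr mulr0 subr0 normr0 mul0r.
have [_ [D HD]] := bmf_dPP n bf bg.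
have D0 : 0 <= D := le_trans (normr_ge0 _) (HD (0, point)).
exists (C * (M + N) + D * N); split; mp.
move=> e x w e01; have /andP[e0 e1] := e01.
rewrite !PPS/= -/(PP f n x w).
set p := PP f n x w; set q := dPP f g n x w; set a := f _; set b := g _.
have := HC e x w e01; rewrite -/p -/q.
set r := _ - _ - _ => rC.
have -> : PP (fe f g e) n x w = p + e * q + r by rewrite /r; ring.
have -> : fe f g e (x * ax n.+1 w) = a + e * b by [].
have -> : (p + e * q + r) * (a + e * b) - p * a - e * (q * a + p * b) =
   r * (a + e * b) + e ^+ 2 * (q * b) by ring.
rewrite (le_trans (ler_normD _ _))// [leRHS]mulrDl lerD//.
  rewrite normrM mulrAC ler_pM// (le_trans (ler_normD _ _))// lerD ?fM//.
  by rewrite normrM ger0_norm// -[leRHS]mul1r ler_pM ?gN.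
rewrite normrM ger0_norm ?sqr_ge0// mulrC ler_wpM2r ?sqr_ge0// normrM.
by rewrite ler_pM ?gN//; exact: (HD (x, w)).
Qed.

Lemma Psi_expand f g n : nbm f -> nbm g -> exists C : R,
  forall e x : R, 0 <= e <= 1 ->
  `|Psi (fe f g e) n x - Psi f n x - e * dPsi f g n x| <= C * e ^+ 2.
Proof.
move=> nf ng; have [bf _] := nf; have [bg _] := ng.
have [C [C0 HC]] := PP_expand n bf bg; exists C => e x e01.
have /andP[e0 e1] := e01; have [bfe _] := nbm_fe nf ng e0.
rewrite -bintB; [|exact: bPP..]; rewrite -bintZl; last exact: bdPP.
rewrite -bintB.
- apply: bint_bound => [|w]; last exact: HC.
  apply: bmfB; first by apply: bmfB; exact: bPP.
  by apply: bmfM; [by meas|exact: bdPP].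
- by apply: bmfB; exact: bPP.
- by apply: bmfM; [by meas|exact: bdPP].
Qed.

Lemma Psi_expands f g n x : nbm f -> nbm g ->
  expands (fun e => Psi (fe f g e) n x) (Psi f n x) (dPsi f g n x).
Proof.
by move=> nf ng; have [C HC] := Psi_expand n nf ng; exists C => e e01; exact: HC.
Qed.

Lemma Kap_expands f g n x : nbm f -> nbm g ->
  expands (fun e => Kap (fe f g e) n x) (Kap f n x) (dKap f g n x).
Proof.
move=> nf ng; have [bf _] := nf; have [bg _] := ng.
have [C HC] := Psi_expand n nf ng; exists C => e e01.
have /andP[e0 e1] := e01; have [bfe _] := nbm_fe nf ng e0.
rewrite -bintB; [|exact: bPsixi..]; rewrite -bintZl; last exact: bdPsixi.
rewrite -bintB.
- apply: bint_bound => [|w]; last exact: HC.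
  apply: bmfB; first by apply: bmfB; exact: bPsixi.
  by apply: bmfM; [by meas|exact: bdPsixi].
- by apply: bmfB; exact: bPsixi.
- by apply: bmfM; [by meas|exact: bdPsixi].
Qed.

(* Splitting the genealogical tree at node 2.  The forward dynamics acts as a
   derivation on multiplicative functionals, so the identity for [n.+2] is the
   derivative of the identity for [n.+1] in the direction [echoD f]. *)
Lemma Psi_split n : forall f x, nbm f ->
  n.+1%:R * Psi f n.+2 x =
  \sum_(1 <= k < n.+2) Psi f (n.+2 - k) x * Kap f k x.
Proof.
elim: n => [|n IH] f x nf.
  transitivity (dPsi f (echoD f) 1 x); first by rewrite Psi_forward.
  rewrite big_nat1.
  have [X1 _] := recX.
  have E g y w : PP g 1 y w = g y.
    by rewrite /PP big_nat1 /ax X1 normr1 mulr1.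
  rewrite /dPsi/= /Psi.
  under eq_Rintegral => w _ do
    rewrite mul0r add0r /PP big_geq// mul1r /ax X1 normr1 mulr1.
  rewrite bint_cst /echoD; congr (_ * _).
    by under eq_Rintegral do rewrite E; rewrite bint_cst.
  apply: eq_Rintegral => w _; rewrite /Psi.
  by under eq_Rintegral do rewrite E; rewrite bint_cst.
have nD := nbm_echoD nf.
have := @expands_uniq _ (fun e => n.+1%:R * Psi (fe f (echoD f) e) n.+2 x)
  (n.+1%:R * Psi f n.+2 x).
move=> /(_ _ _ (expandsZ n.+1%:R (Psi_expands n.+2 x nf nD))) U.
have := expands_sum (index_iota 1 n.+2) (fun k => expandsM
  (Psi_expands (n.+2 - k) x nf nD) (Kap_expands k x nf nD)).
rewrite -IH// => -[C HC].
have {}HC : expands (fun e => n.+1%:R * Psi (fe f (echoD f) e) n.+2 x)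
  (n.+1%:R * Psi f n.+2 x)
  (\sum_(k <- index_iota 1 n.+2) (Psi f (n.+2 - k) x * dKap f (echoD f) k x +
      dPsi f (echoD f) (n.+2 - k) x * Kap f k x)).
  exists C => e e01; rewrite IH; first exact: HC.
  by apply: nbm_fe => //; case/andP : e01.
have {U HC} := U _ HC; rewrite Psi_forward// => E.
have n0 : (n.+1%:R : R) != 0 by rewrite pnatr_eq0.
apply: (mulfI n0); rewrite E.
(* A node added on the root side gives the weight n + 2 - k and one added below node 2 the weight k
   - 1. They sum to n + 1, which cancels against the factor on the left. *)
rewrite big_split/= addrC.
have -> : \sum_(1 <= k < n.+2) dPsi f (echoD f) (n.+2 - k) x * Kap f k x =
  \sum_(1 <= k < n.+3) (n.+2 - k)%:R * (Psi f (n.+3 - k) x * Kap f k x).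
  rewrite [RHS]big_nat_recr//= subnn mul0r addr0; apply: eq_big_nat => k /andP[k1 kn].
  rewrite mulrA; congr (_ * _).
  have -> : (n.+3 - k)%N = (n.+2 - k).+1 by rewrite subSn// ltnW.
  have jE : (n.+2 - k)%N = (n.+1 - k).+1 by rewrite subSn.
  by rewrite jE Psi_forward.
have -> : \sum_(1 <= k < n.+2) Psi f (n.+2 - k) x * dKap f (echoD f) k x =
  \sum_(1 <= k < n.+3) (k.-1)%:R * (Psi f (n.+3 - k) x * Kap f k x).
  rewrite [RHS]big_nat_recl//= mul0r add0r; apply: eq_big_nat => -[//|k] _.
  by rewrite Kap_forward// subSS mulrCA.
rewrite -big_split/= mulr_sumr; apply: eq_big_nat => k /andP[k1 kn].
rewrite -mulrDl -natrD; congr (_%:R * _).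
by case: k k1 kn => // k _ kn; rewrite subSS/= subnK.
Qed.

End echo_laplace.

(** * Power inequalities and normalised rising factorials *)

Section power_inequalities.
Context {R : realType}.
Implicit Types x y s u g : R.

(** Young's inequality for the product of x^u and 1, with conjugate exponents 1 / u and 1 / (1 -
    u). *)
Lemma powR_bernoulli x u : 0 <= x -> 0 <= u <= 1 -> x `^ u <= 1 + u * (x - 1).
Proof.
move=> x0 /andP[u0 u1].
have [->|un0] := eqVneq u 0; first by rewrite powRr0 mul0r addr0.
have [->|un1] := eqVneq u 1; first by rewrite powRr1// mul1r addrC subrK.
have up : 0 < u by rewrite lt_def un0.
have u1' : u < 1 by rewrite lt_def eq_sym un1.
have v0 : 0 < 1 - u by rewrite subr_gt0.
have := @conjugate_powR R (x `^ u) 1 u^-1 (1 - u)^-1.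
rewrite powR_ge0 ler01 !invr_gt0 !invrK (addrC u) subrK => /(_ isT isT up v0 erefl).
rewrite mulr1 -powRrM divff// powRr1// powR1 mul1r; lra.
Qed.

(** The fractions x / (x + y) and y / (x + y) lie in [0, 1], so they are at most their u-th powers,
    and they add up to 1. *)
Lemma powR_subadd x y u : 0 <= x -> 0 <= y -> 0 < u <= 1 ->
  (x + y) `^ u <= x `^ u + y `^ u.
Proof.
move=> x0 y0 /andP[u0 u1].
have [xy0|xy0] := eqVneq (x + y) 0.
  have -> : x = 0 by lra. have -> : y = 0 by lra.
  by rewrite addr0 lerDl powR_ge0.
have xyp : 0 < x + y by rewrite lt_def xy0 addr_ge0.
have H (z : R) : 0 <= z -> z <= x + y -> (x + y) `^ u * (z / (x + y)) <= z `^ u.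
  move=> z0 zxy; have [->|zn0] := eqVneq z 0; first by rewrite mul0r mulr0 powR_ge0.
  rewrite -[in leRHS](@divfK _ (x + y) xy0 z) mulrC powRM ?divr_ge0 ?(ltW xyp)//.
  rewrite ler_wpM2r ?powR_ge0// ger1_powR// divr_gt0//=; last by rewrite lt_def zn0.
  by rewrite ler_pdivrMr// mul1r.
have := lerD (H x x0 _) (H y y0 _); rewrite -mulrDr -mulrDl divff// mulr1; apply.
- by rewrite lerDl.
- by rewrite lerDr.
Qed.

(** Write (x + y)^g = (x + y) (x + y)^(g - 1): the factor x goes with Bernoulli, the factor y with
    subadditivity. The mixed term is linear in y, so averaging over a new node produces the growth
    rate g m / n. *)
Lemma powR_add_le x y g : 0 <= x -> 0 <= y -> 1 < g <= 2 ->
  (x + y) `^ g <= x `^ g + g * (x `^ (g - 1) * y) + y `^ g.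
Proof.
move=> x0 y0 /andP[g1 g2].
have [->|xn0] := eqVneq x 0.
  rewrite add0r powR0 ?gt_eqF//; last by lra.
  by rewrite powR0 ?gt_eqF ?subr_gt0// mul0r mulr0 !add0r.
have xp : 0 < x by rewrite lt_def xn0.
have u0 : 0 < g - 1 by lra.
have u1 : 0 < g - 1 <= 1 by lra.
have gp : 0 < g by lra.
rewrite -(@mulr_powRB1 _ (x + y) g)// ?addr_ge0// mulrDl.
have A : y * (x + y) `^ (g - 1) <= y * x `^ (g - 1) + y `^ g.
  rewrite -(@mulr_powRB1 _ y g)// -mulrDr ler_wpM2l//; exact: powR_subadd.
have B : x * (x + y) `^ (g - 1) <= x `^ g + (g - 1) * (x `^ (g - 1) * y).
  have -> : x + y = x * (1 + y / x) by rewrite mulrDr mulr1 mulrCA divff// mulr1.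
  rewrite powRM// ?addr_ge0 ?divr_ge0//.
  have h : (1 + y / x) `^ (g - 1) <= 1 + (g - 1) * (y / x).
    have := @powR_bernoulli (1 + y / x) (g - 1).
    rewrite addrAC subrr add0r; apply; first by pos.
    by lra.
  have -> : x `^ g + (g - 1) * (x `^ (g - 1) * y) =
      x * (x `^ (g - 1) * (1 + (g - 1) * (y / x))).
    rewrite -(@mulr_powRB1 _ x g)//; field; exact: xn0.
  by rewrite ler_wpM2l// ler_wpM2l// powR_ge0.
move: A B; set a := x `^ g; set b := y `^ g; set c := x `^ (g - 1).
set e := (x + y) `^ _; nra.
Qed.

(** For x <= 1 the remainder is at most x^2 <= x^g; for x > 1 it is at most x <= x^g. In this form
    Taylor's formula can be integrated with a g-th moment only. *)
Lemma expRN_taylor x g : 0 <= x -> 1 <= g <= 2 ->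
  0 <= expR (- x) - 1 + x <= x `^ g.
Proof.
move=> x0 /andP[g1 g2]; apply/andP; split.
  by have := expR_ge1Dx (- x); lra.
have [x1|x1] := leP x 1; last first.
  have : x <= x `^ g by rewrite le1r_powR// ltW.
  have : expR (- x) <= 1 by rewrite expR_le1 oppr_le0.
  by lra.
have [->|xn0] := eqVneq x 0; first by rewrite oppr0 expR0 subrr addr0 powR_ge0.
have xp : 0 < x by rewrite lt_def xn0.
have h1 : x ^+ 2 <= x `^ g.
  by rewrite -powR_mulrn// ger_powR// xp.
have h2 : expR (- x) <= (1 + x)^-1.
  by rewrite expRN lef_pV2 ?posrE ?expR_gt0 ?expR_ge1Dx//; lra.
have h3 : (1 + x)^-1 <= 1 - x + x ^+ 2.
  rewrite -[leLHS]mul1r ler_pdivrMr; last by lra.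
  by have : 0 <= x ^+ 3 by [rewrite exprn_ge0]; lra.
lra.
Qed.

Lemma cvg_powR (I : Type) (F : set_system I) {FF : ProperFilter F} (f : I -> R)
    (l a : R) : 0 < a -> (forall i, 0 <= f i) ->
  f i @[i --> F] --> l -> f i `^ a @[i --> F] --> l `^ a.
Proof.
move=> a0 f0 fl.
have l0 : 0 <= l by apply: (cvgr_to_ge fl); exact: nearW.
have [ln0|l_neq0] := eqVneq l 0.
  rewrite ln0 powR0 ?gt_eqF//; apply/cvgrPdist_lt => e e0.
  have ea : 0 < e `^ a^-1 by pos.
  move/cvgrPdist_lt : fl => /(_ _ ea); apply: filterS => i.
  rewrite ln0 !sub0r !normrN !ger0_norm ?powR_ge0// => fi.
  have := gt0_ltr_powR a0 _ _ fi; rewrite -powRrM mulVf ?gt_eqF// powRr1 ?(ltW e0)//.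
  by apply; rewrite nnegrE ?powR_ge0.
have lp : 0 < l by rewrite lt_def l_neq0.
apply: (cvg_comp (fun i => f i) (fun x => x `^ a)) fl _.
have /derivable1_diffP/differentiable_continuous : derivable (@powR R ^~ a) l 1.
  by apply: derivable_powR; rewrite in_itv/= lp.
exact.
Qed.

(** Equal to Gamma (n + 1 + x) / (n! Gamma (1 + x)), hence of order n^x. *)
Definition rising x n : R := \prod_(1 <= j < n.+1) (1 + x / j%:R).

Lemma risingS x n : rising x n.+1 = rising x n * (1 + x / n.+1%:R).
Proof. by rewrite /rising big_nat_recr. Qed.

Lemma rising0 x : rising x 0 = 1.
Proof. by rewrite /rising big_geq. Qed.

Lemma rising_gt0 x n : 0 <= x -> 0 < rising x n.
Proof.
move=> x0; elim: n => [|n IH]; first by rewrite rising0.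
by rewrite risingS mulr_gt0// ltr_pwDl// divr_ge0.
Qed.

Lemma rising_le x n : 0 <= x -> rising x n.+1 <= (1 + x) * n.+1%:R `^ x.
Proof.
move=> x0; elim: n => [|n IH].
  by rewrite risingS rising0 mul1r powR1 divr1 mulr1.
rewrite risingS.
have n0 : (0 : R) < n.+1%:R by rewrite ltr0n.
have n20 : (0 : R) < n.+2%:R by rewrite ltr0n.
(* From 1 + s <= exp s and ln (1 - 1 / (n + 2)) <= - 1 / (n + 2); the powers then telescope. *)
have h : 1 + x / n.+2%:R <= (n.+2%:R / n.+1%:R) `^ x.
  have -> : n.+2%:R / n.+1%:R = expR (- ln (n.+1%:R / n.+2%:R)) :> R.
    by rewrite expRN lnK ?invf_div// posrE divr_gt0.
  rewrite -expRM mulNr -mulrN; apply: le_trans (expR_ge1Dx _) _.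
  rewrite ler_expR mulrN -mulNr mulrC ler_wpM2r//.
  have := @le_ln1Dx R (- n.+2%:R^-1).
  have -> : 1 - n.+2%:R^-1 = n.+1%:R / n.+2%:R :> R.
    by rewrite -[n.+1%:R](addrK 1) natr1 mulrBl divff ?gt_eqF// mul1r.
  rewrite lerNr; apply; rewrite ltrN2 invf_lt1 ?ltr1n//.
have := ler_pM (ltW (rising_gt0 n.+1 x0)) _ IH h.
move=> /(_ _) /le_trans; apply; mp.
rewrite -mulrA -powRM ?divr_ge0// ?ler0n//.
by rewrite mulrCA divff ?mulr1// gt_eqF.
Qed.

Lemma rising_le' x n : 0 <= x -> rising x n <= (1 + x) * n.+1%:R `^ x.
Proof.
move=> x0; case: n => [|n].
  by rewrite rising0 powR1 mulr1 lerDl.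
rewrite (le_trans (rising_le n x0))// ler_wpM2l ?addr_ge0//.
by rewrite ge0_ler_powR// ?nnegrE ?ler0n// ler_nat.
Qed.

(** The bound diminished by [q / (c - q) * rising q n] solves the recursion with equality and starts
    at 1. The homogeneous solution has order n^c, and q < c lets it dominate what the forcing term
    produces. *)
Lemma moment_recursion (c q : R) (a : nat -> R) : 0 <= q -> q < c ->
  a 0%N <= 1 ->
  (forall n, a n.+1 <= (1 + c / n.+1%:R) * a n + q / n.+1%:R * rising q n) ->
  forall n, a n <= (1 + q / (c - q)) * rising c n.
Proof.
move=> q0 qc a0 aS n.
have cq : 0 < c - q by rewrite subr_gt0.
suff : a n <= (1 + q / (c - q)) * rising c n - q / (c - q) * rising q n.
  move=> /le_trans; apply; rewrite gerBl mulr_ge0// ?divr_ge0 ?(ltW cq)//.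
  exact/ltW/rising_gt0.
elim: n => [|n IH]; first by rewrite !rising0 !mulr1 addrK.
rewrite (le_trans (aS n))// !risingS.
have n0 : (0 : R) < n.+1%:R by rewrite ltr0n.
have k0 : 0 <= 1 + c / n.+1%:R.
  by rewrite addr_ge0// divr_ge0//; lra.
have := ler_wpM2l k0 IH.
set A := rising c n; set B := rising q n; set N := n.+1%:R in n0 *.
move=> h; rewrite (le_trans (lerD h (lexx _)))//; apply: eqle.
field; rewrite gt_eqF//=; lra.
Qed.

End power_inequalities.

(** * Limits under a bounded g-th moment *)

Section truncated_convergence.
Context {R : realType} {d} {T : measurableType d}
  (P : probability T R).
Variables (Y_ : nat -> T -> R) (Y : T -> R) (g C : R).
Hypotheses (mY_ : forall n, mfn (Y_ n)) (mY : mfn Y).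
Hypotheses (Y_0 : forall n w, 0 <= Y_ n w) (Y0 : forall w, 0 <= Y w).
Hypothesis g1 : 1 < g.
Hypothesis cvgY : {ae P, forall w, Y_ n w @[n --> \oo] --> Y w}.
Hypothesis bnd : forall n, (\int[P]_w (Y_ n w `^ g)%:E <= C%:E)%E.

Let mpow (f : T -> R) (a : R) : mfn f ->
  mfn (fun w => (f w `^ a)%:E).
Proof. by meas. Qed.
Let g0 : 0 < g. Proof. exact: lt_trans ltr01 g1. Qed.
Let tr (K : R) (f : T -> R) w : R := Order.min (f w) K.

Let mtr K (f : T -> R) : mfn f -> mfn (tr K f).
Proof. by move=> mf; exact: measurable_minr. Qed.
Let tr_itv (K : R) (f : T -> R) w : 0 <= K -> (forall w, 0 <= f w) -> 0 <= tr K f w <= K.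
Proof. by move=> K0 f0; rewrite /tr le_min f0 K0 ge_min lexx orbT. Qed.
Let cvg_tr K : {ae P, forall w, tr K (Y_ n) w @[n --> \oo] --> tr K Y w}.
Proof.
apply: filterS cvgY => w Yw; apply: (@cvg_comp _ _ _ _ (fun y => Order.min y K) _ _ _ Yw).
exact: (@continuous_min R R id (cst K) (Y w) (@cvg_id _ _) (@cvg_cst _ _ _ _ _)).
Qed.

(** Bounded convergence at each truncation level K, then monotone convergence in K. *)
Lemma fatou_moment : (\int[P]_w (Y w `^ g)%:E <= C%:E)%E.
Proof.
have trK (K : nat) : (\int[P]_w (tr K%:R Y w `^ g)%:E <= C%:E)%E.
  have K0 : 0 <= K%:R :> R by [].
  have b (f : T -> R) : mfn f -> (forall w, 0 <= f w) ->
      bmf (fun w => tr K%:R f w `^ g).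
    move=> mf f0; apply: (@bmf_le _ _ _ _ (K%:R `^ g)).
      exact: (measurableT_comp (measurable_powR g) (mtr _ mf)).
    move=> w; rewrite ger0_norm ?powR_ge0//.
    have /andP[t0 tK] := tr_itv w K0 f0.
    by rewrite ge0_ler_powR// ?nnegrE// ltW.
  rewrite -bint_EFin; last exact: b.
  rewrite lee_fin.
  have c : \int[P]_w (tr K%:R (Y_ n) w `^ g) @[n --> \oo] --> \int[P]_w (tr K%:R Y w `^ g).
    apply: (@bint_cvg _ _ _ _ _ _ (K%:R `^ g)).
    - by move=> n; case: (b _ (mY_ n) (Y_0 n)).
    - by case: (b _ mY Y0).
    - move=> n w; rewrite ger0_norm ?powR_ge0//.
      have /andP[t0 tK] := tr_itv w K0 (Y_0 n).
      by rewrite ge0_ler_powR// ?nnegrE// ltW.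
    - apply: filterS (cvg_tr K%:R) => w cw.
      apply: cvg_powR => // n.
      by have /andP[] := tr_itv w K0 (Y_0 n).
  apply: (cvgr_to_le c).
  apply: nearW => n; rewrite -lee_fin bint_EFin; last exact: b.
  apply: le_trans (bnd n); apply: ge0_le_integral => //; mp.
  - exact/mpow/mtr.
  - move=> w _; rewrite lee_fin ge0_ler_powR// ?nnegrE ?(ltW g0)//.
      by have /andP[] := tr_itv w K0 (Y_0 n).
    by rewrite ge_min lexx.
have := @cvg_monotone_convergence _ T R P setT measurableT
  (fun K w => (tr K%:R Y w `^ g)%:E).
have -> : (fun w => limn (fun K : nat => (tr K%:R Y w `^ g)%:E)) = fun w => (Y w `^ g)%:E.
  apply/funext => w; apply/cvg_lim => //; apply: cvg_near_cst.
  exists (Num.truncn (Y w)).+1 => // K /= YK.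
  rewrite /tr min_l// ltW// (lt_le_trans (truncnS_gt _))// ler_nat//.
move=> H; apply: (cvge_to_le (H _ _ _)) => //; mp.
- by move=> K; exact/mpow/mtr.
- move=> w _ K K' KK'; rewrite lee_fin ge0_ler_powR// ?nnegrE ?(ltW g0)//.
  + by have /andP[] := @tr_itv K%:R Y w (ler0n _ _) Y0.
  + by have /andP[] := @tr_itv K'%:R Y w (ler0n _ _) Y0.
  + by rewrite /tr le_min ge_min lexx/= ge_min ler_nat KK' orbT.
- exact: nearW.
Qed.

Lemma ge0_integrable_powR (f : T -> R) : mfn f -> (forall w, 0 <= f w) ->
  (\int[P]_w (f w `^ g)%:E <= C%:E)%E -> P.-integrable setT (EFin \o f).
Proof.
move=> mf f0 fC; apply/integrableP; split; first by meas.
apply: (@le_lt_trans _ _ (\int[P]_w (1 + f w `^ g)%:E)%E).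
  apply: ge0_le_integral => //; mp.
  - by apply/measurable_EFinP; meas.
  - move=> w _; rewrite lee_fin ger0_norm//.
    have [f1|f1] := leP (f w) 1.
      by rewrite (le_trans f1)// lerDl powR_ge0.
    by rewrite (le_trans (le1r_powR (ltW f1) (ltW g1)))// lerDr.
under eq_integral do rewrite EFinD.
rewrite ge0_integralD//; mp.
rewrite (@integral_cst _ _ _ P _ measurableT 1%E)/= mul1e probability_setT.
by rewrite lte_add_pinfty// ?ltry// (le_lt_trans fC)// ltry.
Qed.

(** Uniform integrability: the excess over a level K has mean at most C K^(1 - g), uniformly in n,
    and g > 1. *)
Lemma cvg_mean : \int[P]_w Y_ n w @[n --> \oo] --> \int[P]_w Y w.
Proof.
have tail (K : R) (f : T -> R) : 0 < K -> mfn f -> (forall w, 0 <= f w) ->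
  (\int[P]_w (f w `^ g)%:E <= C%:E)%E ->
  `|\int[P]_w f w - \int[P]_w tr K f w| <= C * K `^ (1 - g).
  move=> K0 mf f0 fC.
  have intf := ge0_integrable_powR mf f0 fC.
  have bt : bmf (tr K f).
    apply: (@bmf_le _ _ _ _ K); first exact: mtr.
    by move=> w; have /andP[t0 tK] := tr_itv w (ltW K0) f0; rewrite ger0_norm.
  rewrite -RintegralB//; last exact: bmf_int.
  have intd : P.-integrable setT (EFin \o (fun w => f w - tr K f w)).
    exact: (integrableB measurableT intf (bmf_int P bt)).
  rewrite (le_trans (le_normr_integral _ intd))//.
  have pt w : 0 <= f w - tr K f w <= f w `^ g * K `^ (1 - g).
    rewrite /tr /Order.min; case: ltP => fK.
      by rewrite subrr lexx/= mulr_ge0 ?powR_ge0.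
    rewrite subr_ge0 fK/= (@le_trans _ _ (f w))//; first by rewrite gerBl ltW.
    have fp : 0 < f w by exact: lt_le_trans fK.
    rewrite -ler_pdivrMr ?powR_gt0// -powRN opprB.
    rewrite -(@mulr_powRB1 _ (f w) g)// ler_wpM2l//.
    by rewrite ge0_ler_powR// ?nnegrE ?(ltW K0)// subr_ge0 ltW.
  rewrite -lee_fin Rint_EFin; last exact: integrable_norm.
  apply: (@le_trans _ _ (\int[P]_w (f w `^ g * K `^ (1 - g))%:E)%E).
    apply: ge0_le_integral => //; mp.
    - by move=> w _; have /andP[p0 p1] := pt w; rewrite lee_fin ger0_norm.
  under eq_integral do rewrite EFinM.
  rewrite ge0_integralZr//; mp.
  - by rewrite EFinM lee_wpmul2r// lee_fin powR_ge0.
have C0 : 0 <= C.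
  by rewrite -lee_fin (le_trans _ (bnd 0))// integral_ge0// => w _; rewrite lee_fin powR_ge0.
apply/cvgrPdist_le => e e0.
have [K K0 KC] : exists2 K : R, 0 < K & C * K `^ (1 - g) <= e / 3.
  have e30 : 0 < e / 3 by pos.
  have q0 : 0 < e / 3 / (C + 1) by rewrite divr_gt0// ltr_wpDl.
  (* The solution of K^(1 - g) = (e / 3) / (C + 1); C + 1 avoids a division by zero. *)
  exists ((e / 3 / (C + 1)) `^ (1 - g)^-1); first by pos.
  rewrite -powRrM mulVf; last by rewrite subr_eq0 lt_eqF.
  rewrite powRr1 ?(ltW q0)// mulrCA -[leRHS]mulr1 ler_wpM2l ?(ltW e30)//.
  by rewrite ler_pdivrMr ?ltr_wpDl// mul1r lerDl.
have c : \int[P]_w tr K (Y_ n) w @[n --> \oo] --> \int[P]_w tr K Y w.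
  apply: (@bint_cvg _ _ _ _ _ _ K) => //.
  - by move=> n; exact: mtr.
  - exact: mtr.
  - by move=> n w; have /andP[t0 tK] := tr_itv w (ltW K0) (Y_0 n); rewrite ger0_norm.
have e30 : 0 < e / 3 by pos.
move/cvgrPdist_le : c => /(_ _ e30) [N _ HN]; exists N => // n Nn.
have := HN n Nn; have := tail K _ K0 (mY_ n) (Y_0 n) (bnd n).
have := tail K _ K0 mY Y0 fatou_moment.
set a := \int[P]_w Y w; set b := \int[P]_w Y_ n w; rewrite /=.
set a' := \int[P]_w tr K Y w; set b' := \int[P]_w tr K (Y_ n) w.
move=> /le_trans /(_ KC) h1 /le_trans /(_ KC) h2 h3.
have -> : a - b = (a - a') + (a' - b') - (b - b') by ring.
rewrite (le_trans (ler_normB _ _))// (le_trans (lerD (ler_normD _ _) (lexx _)))//.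
have -> : e = e / 3 + e / 3 + e / 3 by field.
by rewrite !lerD.
Qed.

End truncated_convergence.

(** * Moments of the partial sums *)

Section echo_moments.
Context {R : realType} {d0} {T0 : measurableType d0}
  (P0 : probability T0 R) (xi : {RV P0 >-> R}).
Context {d} {T : measurableType d} (P : probability T R).
Variables (xi_ : nat -> {RV P >-> R}) (U_ : nat -> {RV P >-> nat})
  (X : nat -> T -> R).
Hypothesis inputs : echo_inputs xi xi_ U_.
Hypothesis recX : echo_recursion xi_ U_ X.

Notation Tp p := (g_sigma_algebraType (echo_past xi_ U_ p)).
Notation ax := (ax X).

Let maxp p k : (1 <= k < p.+2)%N -> mfn (ax k : Tp p -> R).
Proof.
move=> kn; apply: measurableT_comp => //.
exact: (echo_measurable_past inputs recX).
Qed.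
Let max_ k : (1 <= k)%N -> mfn (ax k).
Proof.
by move=> k1; apply: measurableT_comp => //; exact: (echo_measurable inputs recX).
Qed.

(** The Markov step for functionals of one past statistic [a] and of the value of the new node. *)
Lemma echo_step_state p (a : T -> R) (h : R * R -> \bar R) :
  mfn (a : Tp p -> R) ->
  mfn h -> (forall z, 0 <= h z)%E ->
  (\int[P]_w h (a w, `|xi_ p.+2 w| * ax (U_ p.+2 w) w)%R =
   \int[P]_w ((p.+1%:R^-1)%:E *
     \sum_(1 <= k < p.+2) \int[P0]_w0 h (a w, `|xi w0| * ax k w)%R))%E.
Proof.
move=> ma mh h0.
pose y (z : Tp p * (R * nat)) : R :=
  if (1 <= z.2.2 < p.+2)%N then `|z.2.1| * ax z.2.2 z.1 else 0.
have my : mfn y.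
  rewrite (_ : y = fun z : Tp p * (R * nat) => \sum_(k <- index_iota 1 p.+2)
    \1_[set k] z.2.2 * (if (1 <= k < p.+2)%N then `|z.2.1| * ax k z.1 else 0)).
    apply: measurable_sum => k; apply: measurable_funM.
      apply: (@measurableT_comp _ _ _ (Tp p * (R * nat))%type nat R (\1_[set k]) setT (fun z => z.2.2)) => //; mp.
    case kn : (1 <= k < p.+2)%N; last by meas.
    apply: measurable_funM; mp.
    by apply: (measurableT_comp (maxp kn)); meas.
  apply/funext => z; rewrite /y; case: ifP => zn.
    rewrite (bigD1_seq z.2.2); [|by rewrite mem_index_iota|exact: iota_uniq].
    rewrite indicE mem_set// mul1r zn big1/= ?addr0// => k kz.
    by rewrite indicE memNset ?mul0r//= => zk; rewrite zk eqxx in kz.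
  rewrite big1_seq//= => k; rewrite mem_index_iota => kn.
  rewrite indicE memNset ?mul0r//= => zk.
  by rewrite zk kn in zn.
have := @echo_step _ _ _ _ xi _ _ _ _ _ inputs p (fun z => h (a z.1, y z)).
have mh' : mfn (fun z : Tp p * (R * nat) => h (a z.1, y z)) by meas.
move=> /(_ mh' (fun=> h0 _)) E.
transitivity (\int[P]_w h (a w, y (w, (xi_ p.+2 w, U_ p.+2 w))))%E.
  apply: eq_integral => w _; rewrite /y/=.
  by rewrite (echo_range inputs w (isT : (2 <= p.+2)%N)).
rewrite E; apply: eq_integral => w _; congr (_ * _)%E.
rewrite !big_seq; apply: eq_bigr => k; rewrite mem_index_iota => kn.
by apply: eq_integral => w0 _; rewrite /y/= kn.
Qed.

Definition echo_sum n w : R := \sum_(1 <= k < n.+1) ax k w.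
Definition echo_pow (g : R) n w : R := \sum_(1 <= k < n.+1) ax k w `^ g.

Lemma echo_sumS n w :
  echo_sum n.+2 w = echo_sum n.+1 w + `|xi_ n.+2 w| * ax (U_ n.+2 w) w.
Proof.
have [_ XS] := recX.
by rewrite /echo_sum [LHS]big_nat_recr//= {2}/ax XS// normrM.
Qed.

Lemma echo_powS g n w :
  echo_pow g n.+2 w = echo_pow g n.+1 w + (`|xi_ n.+2 w| * ax (U_ n.+2 w) w) `^ g.
Proof.
have [_ XS] := recX.
by rewrite /echo_pow [LHS]big_nat_recr//= {2}/ax XS// normrM.
Qed.
Let ax0 k w : 0 <= ax k w. Proof. by pos. Qed.

Lemma echo_sum_ge0 n w : 0 <= echo_sum n w.
Proof. by apply: sumr_ge0 => k _. Qed.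

Lemma echo_pow_ge0 g n w : 0 <= echo_pow g n w.
Proof. by apply: sumr_ge0 => k _; pos. Qed.
Let sum_meas d' (S : measurableType d') (F : nat -> S -> R) n :
  (forall k, (1 <= k < n)%N -> mfn (F k)) ->
  mfn (fun w => \sum_(1 <= k < n) F k w).
Proof.
move=> mF.
rewrite (_ : (fun w => _) = fun w => \sum_(k <- index_iota 1 n)
    (if (1 <= k < n)%N then F k w else 0)).
  apply: measurable_sum => k; case kn : (1 <= k < n)%N => //.
  exact: mF.
apply/funext => w; rewrite !big_seq; apply: eq_bigr => k.
by rewrite mem_index_iota => ->.
Qed.
Let esum_meas d' (S : measurableType d') (F : nat -> S -> \bar R) n :
  (forall k, (1 <= k < n)%N -> mfn (F k)) ->
  mfn (fun w => \sum_(1 <= k < n) F k w)%E.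
Proof.
move=> mF.
rewrite (_ : (fun w => _) = fun w => (\sum_(k <- index_iota 1 n)
    (if (1 <= k < n)%N then F k w else 0))%E).
  apply: emeasurable_sum => k; case kn : (1 <= k < n)%N => //.
  exact: mF.
apply/funext => w; rewrite !big_seq; apply: eq_bigr => k.
by rewrite mem_index_iota => ->.
Qed.

Lemma measurable_echo_sum n : mfn (echo_sum n).
Proof. by apply: sum_meas => k /andP[k1 _]; exact: max_. Qed.

Lemma measurable_echo_pow g n : mfn (echo_pow g n).
Proof.
apply: sum_meas => k /andP[k1 _].
exact: (measurableT_comp (measurable_powR g) (max_ k1)).
Qed.
Let msum p : mfn (echo_sum p.+1 : Tp p -> R).
Proof. by apply: sum_meas => k kp; exact: maxp. Qed.
Let mpow p g : mfn (echo_pow g p.+1 : Tp p -> R).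
Proof.
apply: sum_meas => k kp.
exact: (measurableT_comp (measurable_powR g) (maxp kp)).
Qed.

Lemma echo_sum1 w : echo_sum 1 w = 1.
Proof. by have [X1 _] := recX; rewrite /echo_sum big_nat1 /ax X1 normr1. Qed.

Lemma echo_pow1 g w : echo_pow g 1 w = 1.
Proof. by have [X1 _] := recX; rewrite /echo_pow big_nat1 /ax X1 normr1 powR1. Qed.

Variables (m q g : R).
Hypothesis xi_m : (\int[P0]_w `|xi w|%:E = m%:E)%E.
Hypothesis xi_q : (\int[P0]_w (`|xi w| `^ g)%:E = q%:E)%E.
Hypothesis g12 : 1 < g <= 2.

Let m0 : 0 <= m.
Proof. by rewrite -lee_fin -xi_m integral_ge0// => w _; rewrite lee_fin. Qed.
Let q0 : 0 <= q.
Proof. by rewrite -lee_fin -xi_q integral_ge0// => w _; rewrite lee_fin powR_ge0. Qed.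
Let int_affine (a b c : R) : 0 <= a -> 0 <= b -> 0 <= c ->
  (\int[P0]_w (a + b * `|xi w| + c * `|xi w| `^ g)%:E = (a + b * m + c * q)%:E)%E.
Proof.
move=> a0 b0 c0.
under eq_integral do rewrite !EFinD !EFinM.
rewrite ge0_integralD//; last 4 first.
- by move=> w _; rewrite adde_ge0 ?mule_ge0.
- by apply: emeasurable_funD => //; apply: emeasurable_funM => //; meas.
- by move=> w _; rewrite mule_ge0// lee_fin powR_ge0.
- by meas.
rewrite ge0_integralD//; last 2 first.
- by move=> w _; rewrite mule_ge0.
- by meas.
rewrite (@integral_cst _ _ _ P0 _ measurableT a%:E)/= probability_setT mule1.
rewrite ge0_integralZl//; last by meas.
rewrite xi_m ge0_integralZl//; mp.
- by rewrite xi_q -!EFinM -!EFinD.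
Qed.

(** Given n nodes with sum S, the next one has conditional mean m S / n; the mean is thus multiplied
    by 1 + m / n. *)
Lemma mean_echo_sum n : (\int[P]_w (echo_sum n.+1 w)%:E = (rising m n)%:E)%E.
Proof.
elim: n => [|n IH].
  under eq_integral do rewrite echo_sum1.
  by rewrite (@integral_cst _ _ _ P _ measurableT 1%E)/= mul1e probability_setT rising0.
pose h (z : R * R) : \bar R := `|z.1 + z.2|%:E.
have mh : mfn h.
  by apply/measurable_EFinP; apply: measurableT_comp => //; meas.
transitivity (\int[P]_w h (echo_sum n.+1 w, (`|xi_ n.+2 w| * ax (U_ n.+2 w) w)%R))%E.
  by apply: eq_integral => w _; rewrite /h/= -echo_sumS ger0_norm ?echo_sum_ge0.
rewrite (echo_step_state (@msum n) mh); last by pos.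
transitivity (\int[P]_w ((1 + m / n.+1%:R)%:E * (echo_sum n.+1 w)%:E))%E.
  apply: eq_integral => w _.
  transitivity ((n.+1%:R^-1)%:E * (\sum_(1 <= k < n.+2) (echo_sum n.+1 w + ax k w * m)%:E))%E.
    congr (_ * _)%E; apply: eq_bigr => k _.
    have := @int_affine (echo_sum n.+1 w) (ax k w) 0 (echo_sum_ge0 _ _) (ax0 _ _) (lexx _).
    rewrite mul0r addr0 => <-; apply: eq_integral => w0 _.
    by rewrite /h/= mul0r addr0 ger0_norm ?addr_ge0 ?mulr_ge0 ?echo_sum_ge0// [in RHS]mulrC.
  rewrite sumEFin -!EFinM; congr EFin; rewrite big_split/= -mulr_suml.
  rewrite -/(echo_sum n.+1 w) sumr_const_nat subn1/= -[echo_sum n.+1 w *+ _]mulr_natr.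
  set N := (n.+1%:R : R); have N0 : N != 0 by rewrite pnatr_eq0.
  by field.
rewrite ge0_integralZl//; last 3 first.
- by apply/measurable_EFinP; exact: measurable_echo_sum.
- by move=> w _; rewrite lee_fin echo_sum_ge0.
- by rewrite lee_fin addr_ge0// divr_ge0.
by rewrite IH risingS -EFinM mulrC.
Qed.

Lemma mean_echo_pow n : (\int[P]_w (echo_pow g n.+1 w)%:E = (rising q n)%:E)%E.
Proof.
elim: n => [|n IH].
  under eq_integral do rewrite echo_pow1.
  by rewrite (@integral_cst _ _ _ P _ measurableT 1%E)/= mul1e probability_setT rising0.
pose h (z : R * R) : \bar R := `|z.1 + z.2 `^ g|%:E.
have mh : mfn h.
  apply/measurable_EFinP; apply: measurableT_comp => //; apply: measurable_funD => //; mp.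
transitivity (\int[P]_w h (echo_pow g n.+1 w, (`|xi_ n.+2 w| * ax (U_ n.+2 w) w)%R))%E.
  by apply: eq_integral => w _; rewrite /h/= -echo_powS ger0_norm ?echo_pow_ge0.
rewrite (echo_step_state (@mpow n g) mh); last by pos.
transitivity (\int[P]_w ((1 + q / n.+1%:R)%:E * (echo_pow g n.+1 w)%:E))%E.
  apply: eq_integral => w _.
  transitivity ((n.+1%:R^-1)%:E * (\sum_(1 <= k < n.+2) (echo_pow g n.+1 w + ax k w `^ g * q)%:E))%E.
    congr (_ * _)%E; apply: eq_bigr => k _.
    have := @int_affine (echo_pow g n.+1 w) 0 (ax k w `^ g) (echo_pow_ge0 _ _ _) (lexx _) (powR_ge0 _ _).
    rewrite mul0r addr0 => <-; apply: eq_integral => w0 _.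
    rewrite /h/= mul0r addr0 ger0_norm ?addr_ge0 ?powR_ge0 ?echo_pow_ge0//.
    by rewrite powRM// [in RHS]mulrC.
  rewrite sumEFin -!EFinM; congr EFin; rewrite big_split/= -mulr_suml.
  rewrite -/(echo_pow g n.+1 w) sumr_const_nat subn1/= -[echo_pow g n.+1 w *+ _]mulr_natr.
  set N := (n.+1%:R : R); have N0 : N != 0 by rewrite pnatr_eq0.
  by field.
rewrite ge0_integralZl//; last 3 first.
- by apply/measurable_EFinP; exact: measurable_echo_pow.
- by move=> w _; rewrite lee_fin echo_pow_ge0.
- by rewrite lee_fin addr_ge0// divr_ge0.
by rewrite IH risingS -EFinM mulrC.
Qed.
Let mS n : mfn (fun w => (echo_sum n w `^ g)%:E).
Proof.
apply/measurable_EFinP.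
exact: (measurableT_comp (measurable_powR g) (measurable_echo_sum n)).
Qed.

(** [powR_add_le] with x the current sum and y the new node: the mixed term contributes g m / (n +
    1) times the current g-th moment, and the last term is controlled by the mean of [echo_pow],
    known exactly. *)
Lemma moment_echo_sumS n :
  (\int[P]_w (echo_sum n.+2 w `^ g)%:E <=
   (1 + g * m / n.+1%:R)%:E * \int[P]_w (echo_sum n.+1 w `^ g)%:E +
   (q / n.+1%:R * rising q n)%:E)%E.
Proof.
have /andP[g1 g2] := g12; have gp : 0 < g by lra.
pose h (z : R * R) := ((z.1 + z.2) `^ g)%:E.
have mh : mfn h.
  apply/measurable_EFinP; apply: (measurableT_comp (measurable_powR g)); mp.
have h0 z : (0 <= h z)%E by pos.
have -> : (\int[P]_w (echo_sum n.+2 w `^ g)%:E =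
    \int[P]_w h (echo_sum n.+1 w, (`|xi_ n.+2 w| * ax (U_ n.+2 w) w)%R))%E.
  by apply: eq_integral => w _; rewrite /h/= echo_sumS.
rewrite (echo_step_state (@msum n) mh h0).
rewrite EFinM -mean_echo_pow -ge0_integralZl//; last 2 first.
- by pos.
- by rewrite lee_fin addr_ge0// divr_ge0// mulr_ge0// ltW.
rewrite -ge0_integralZl//; last 3 first.
- by apply/measurable_EFinP; exact: measurable_echo_pow.
- by move=> w _; rewrite lee_fin echo_pow_ge0.
- by rewrite lee_fin divr_ge0.
rewrite -ge0_integralD//; last 4 first.
- by move=> w _; rewrite mule_ge0// lee_fin ?powR_ge0// addr_ge0// divr_ge0// mulr_ge0// ltW.
- by meas.
- by move=> w _; rewrite mule_ge0// lee_fin ?echo_pow_ge0// divr_ge0.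
- by apply: emeasurable_funM => //; apply/measurable_EFinP; exact: measurable_echo_pow.
have inner w : ((n.+1%:R^-1)%:E * \sum_(1 <= k < n.+2)
      \int[P0]_w0 h (echo_sum n.+1 w, (`|xi w0| * ax k w)%R) <=
    (1 + g * m / n.+1%:R)%:E * (echo_sum n.+1 w `^ g)%:E +
    (q / n.+1%:R)%:E * (echo_pow g n.+1 w)%:E)%E.
  set s := echo_sum n.+1 w; have s0 : 0 <= s by exact: echo_sum_ge0.
  apply: (@le_trans _ _ ((n.+1%:R^-1)%:E * \sum_(1 <= k < n.+2)
     (s `^ g + g * (s `^ (g - 1) * ax k w) * m + ax k w `^ g * q)%:E)%E).
    rewrite lee_wpmul2l//.
    apply: lee_sum => k _; rewrite -int_affine ?powR_ge0//; mp.
    apply: ge0_le_integral => //; mp.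
    - move=> w0 _; rewrite lee_fin (le_trans (powR_add_le s0 _ g12)) ?mulr_ge0//.
      rewrite /= powRM//; apply: eqle; ring.
  rewrite sumEFin -!EFinM -EFinD lee_fin; apply: eqle.
  rewrite !big_split/= sumr_const_nat subn1/= -!mulr_suml -/(echo_pow g n.+1 w).
  rewrite -!mulr_sumr -/(echo_sum n.+1 w) -/s -[s `^ g *+ _]mulr_natr.
  set N := (n.+1%:R : R); have N0 : N != 0 by rewrite pnatr_eq0.
  by rewrite -(@mulr_powRB1 _ s g)//; field.
apply: ge0_le_integral => //.
- move=> w _; rewrite mule_ge0 ?lee_fin ?invr_ge0// sume_ge0// => k _.
  by apply: integral_ge0 => w0 _; rewrite lee_fin powR_ge0.
- apply: emeasurable_funM => //; apply: esum_meas => k /andP[k1 _].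
  apply: (@measurable_fun_fubini_tonelli_F _ _ T T0 R P0
    (fun z => h (echo_sum n.+1 z.1, (`|xi z.2| * ax k z.1)%R))) => //.
  apply: (measurableT_comp mh); apply: measurable_fun_pair.
    exact: (measurableT_comp (measurable_echo_sum n.+1) measurable_fst).
  apply: measurable_funM; first by meas.
  exact: (measurableT_comp (max_ k1) measurable_fst).
- by apply: emeasurable_funD; apply: emeasurable_funM => //;
    apply/measurable_EFinP; exact: measurable_echo_pow.
Qed.

(** [moment_recursion] with c = g m: the strict inequality is what bounds the normalised sums in
    L^g. *)
Lemma moment_echo_sum : q < g * m -> exists2 C : R, 0 <= C & forall n,
  (\int[P]_w (echo_sum n.+1 w `^ g)%:E <= (C * n.+1%:R `^ (g * m))%:E)%E.
Proof.
move=> qgm; have /andP[g1 g2] := g12; have gp : 0 < g by lra.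
have cq : 0 < g * m - q by lra.
exists ((1 + q / (g * m - q)) * (1 + g * m)); mp.
pose a n := fine (\int[P]_w (echo_sum n.+1 w `^ g)%:E).
have fin n : (\int[P]_w (echo_sum n.+1 w `^ g)%:E)%E = (a n)%:E.
  rewrite /a fineK// ge0_fin_numE; last by apply: integral_ge0 => w _; rewrite lee_fin powR_ge0.
  elim: n => [|n IH].
    under eq_integral do rewrite echo_sum1 powR1.
    by rewrite (@integral_cst _ _ _ P _ measurableT 1%E)/= mul1e probability_setT ltry.
  rewrite (le_lt_trans (moment_echo_sumS n))// lte_add_pinfty ?ltry//.
  by rewrite lte_mul_pinfty// lee_fin addr_ge0// divr_ge0// mulr_ge0// ltW.
move=> n; rewrite fin lee_fin -mulrA.
have gm0 : 0 <= g * m by pos.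
apply: (@le_trans _ _ ((1 + q / (g * m - q)) * rising (g * m) n)).
  apply: moment_recursion => //.
    rewrite -lee_fin -fin.
    under eq_integral do rewrite echo_sum1 powR1.
    by rewrite (@integral_cst _ _ _ P _ measurableT 1%E)/= mul1e probability_setT.
  move=> k; rewrite -lee_fin -fin (le_trans (moment_echo_sumS k))// fin.
  by rewrite EFinD EFinM.
rewrite ler_wpM2l ?rising_le'// addr_ge0// divr_ge0// ltW//.
Qed.

End echo_moments.

(** * Integration against a density and affine changes of variable *)

Section density.
Local Open Scope ereal_scope.
Context {d} {T : measurableType d} {R : realType}.
Variables (mu nu : {measure set T -> \bar R}) (p : T -> R).
Hypotheses (mp : mfn p) (p0 : forall x, (0 <= p x)%R).
Hypothesis nuE : forall A, measurable A -> nu A = \int[mu]_(x in A) (p x)%:E.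

Import HBNNSimple.

Let mp' : mfn (EFin \o p). Proof. by meas. Qed.
Let density_indic E : measurable E ->
  \int[nu]_x (\1_E x)%:E = \int[mu]_x ((\1_E x)%:E * (p x)%:E).
Proof.
move=> mE; rewrite integral_indic//= setIT nuE// integral_mkcond/=.
apply: eq_integral => x _; rewrite patchE indicE; case: ifPn => xE.
  by rewrite mul1e.
by rewrite mul0e.
Qed.
Let density_nnsfun (f : {nnsfun T >-> R}) :
  \int[nu]_x (f x)%:E = \int[mu]_x ((f x)%:E * (p x)%:E).
Proof.
under [LHS]eq_integral do rewrite fimfunE -fsumEFin//.
rewrite [LHS]ge0_integral_fsum//; last 2 first.
  - by move=> r; exact/measurable_EFinP/measurableT_comp.
  - by move=> n x _; rewrite EFinM nnfun_muleindic_ge0.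
under [RHS]eq_integral.
  move=> x xD; rewrite fimfunE -fsumEFin// ge0_mule_fsuml; last by move=> r; rewrite EFinM nnfun_muleindic_ge0.
  over.
rewrite [RHS]ge0_integral_fsum//; last 2 first.
  - move=> r; apply: emeasurable_funM => //; apply/measurable_EFinP.
    by do 2 apply/measurableT_comp => //.
  - move=> n x _; rewrite EFinM mule_ge0//; last by pos.
    by rewrite nnfun_muleindic_ge0.
apply: eq_fsbigr => r rf.
rewrite integralZl_indic_nnsfun//= density_indic//.
have r0 : (0 <= r)%R by move: rf; rewrite inE => -[x _ <-].
under [RHS]eq_integral do rewrite EFinM -muleA.
rewrite ge0_integralZl//.
- by apply: emeasurable_funM => //; exact/measurable_EFinP/measurable_indic.
- by move=> x _; rewrite mule_ge0// lee_fin.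
Qed.

Lemma ge0_integral_density (f : T -> \bar R) :
  mfn f -> (forall x, 0 <= f x) ->
  \int[nu]_x f x = \int[mu]_x (f x * (p x)%:E).
Proof.
move=> mf f0.
pose f_ := nnsfun_approx measurableT mf.
transitivity (lim (\int[nu]_x (f_ n x)%:E @[n --> \oo])).
  rewrite -monotone_convergence//=.
  - apply: eq_integral => ? /[!inE] xD; apply/esym/cvg_lim => //=.
    exact: cvg_nnsfun_approx.
  - by meas.
  - by move=> n ? _; rewrite lee_fin.
  - by move=> ? _ ? ? mn; rewrite lee_fin; exact/lefP/nd_nnsfun_approx.
transitivity (lim (\int[mu]_x ((f_ n x)%:E * (p x)%:E) @[n --> \oo])).
  by apply: congr_lim; apply/funext => n /=; exact: density_nnsfun.
rewrite -monotone_convergence//=.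
- apply: eq_integral => x _; apply/cvg_lim => //=.
  apply: cvgeZr => //; exact: cvg_nnsfun_approx.
- move=> n; apply: emeasurable_funM => //; mp.
- by move=> n ? _; rewrite mule_ge0// lee_fin.
- move=> x _ k l kl; rewrite lee_wpmul2r ?lee_fin//.
  exact/lefP/nd_nnsfun_approx.
Qed.

End density.

Section affine_substitution.
Context {R : realType}.
Notation mu := (@lebesgue_measure R).

Let maff (a b : R) : mfn
  (fun x : measurableTypeR R => a * x + b : measurableTypeR R).
Proof. by apply: measurable_funD => //; meas. Qed.

(** The rescaled image measure has the right mass on half-open intervals, which characterises
    Lebesgue measure. *)
Lemma ge0_integral_affine (a b : R) (f : R -> \bar R) : 0 < a ->
  mfn f -> (forall x, 0 <= f x)%E ->
  (\int[mu]_x f x = a%:E * \int[mu]_x f (a * x + b)%R)%E.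
Proof.
move=> a0 mf f0.
pose nu : {measure set (measurableTypeR R) -> \bar R} :=
  mscale (NngNum (ltW a0)) (pushm mu (maff a b)).
have H A : measurable A -> mu A = nu A.
  move=> mA; apply: (@lebesgue_measure_unique R nu _ _ mA) => _ [[c e] _ <-].
  transitivity (a%:E * mu `]((c - b) / a)%R, ((e - b) / a)%R]%classic)%E; last first.
    rewrite -[RHS]/(a%:E * mu ((fun x : R => a * x + b)%R @^-1` `]c, e]%classic))%E.
    congr (_ * mu _)%E; apply/seteqP.
    by split => x /=; rewrite !in_itv/= ltr_pdivrMr// ler_pdivlMr// ![_ * a]mulrC ltrBlDr lerBrDr.
  rewrite !lebesgue_measure_itv/= !lte_fin ltr_pM2r ?invr_gt0// ltrD2r.
  case: ifPn => _; last by rewrite mule0.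
  rewrite -!EFinD -EFinM; congr EFin; field; by rewrite gt_eqF.
transitivity (\int[nu]_x f x)%E.
  by apply: eq_measure_integral => A mA _; exact: H.
rewrite ge0_integral_mscale//=; congr (_ * _)%E.
by rewrite (@ge0_integral_pushforward _ _ _ _ _ _ (maff a b) mu setT).
Qed.

End affine_substitution.

(** * Exponential and uniform laws; sum and ratio of two exponentials *)

Section exponential_law.
Context {R : realType}.
Notation mu := (@lebesgue_measure R).

Let mid : mfn (fun x : measurableTypeR R => x : R).
Proof. by meas. Qed.
Let ex0 : probability (measurableTypeR R) R.
Proof. by refine (exponential_prob (1 : R)); exact: ltr01. Defined.

(** The image under the identity moves the law from [measurableTypeR R] to [R], the space on which
    the integrands live. *)
Definition ex : probability R R := distribution ex0 (mkmfun mid).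

Definition unif : probability R R :=
  distribution (uniform_prob (@ltr01 R)) (mkmfun mid).

Definition expdens (x : R) : R := if 0 < x then expR (- x) else 0.

Lemma expdens_ge0 x : 0 <= expdens x.
Proof. by rewrite /expdens; case: ifP => // _; pos. Qed.

Lemma measurable_expdens : mfn expdens.
Proof.
apply: measurable_fun_ifT => //.
- exact: measurable_fun_ltr.
- by apply: measurableT_comp => //; meas.
Qed.

Lemma ge0_integral_ex (f : R -> \bar R) :
  mfn f -> (forall x, 0 <= f x)%E ->
  (\int[ex]_x f x = \int[mu]_x (f x * (expdens x)%:E))%E.
Proof.
move=> mf f0.
rewrite (@ge0_integral_pushforward _ _ _ _ _ _ mid _ setT)//= ?preimage_setT.
rewrite (@ge0_integral_density _ (measurableTypeR R) _ mu ex0 (exponential_pdf 1))//; last 2 first.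
- exact: measurable_exponential_pdf.
- by move=> x; exact: exponential_pdf_ge0.
apply: ae_eq_integral => //.
- apply: emeasurable_funM => //; apply/measurable_EFinP.
  exact: measurable_exponential_pdf.
- by apply: emeasurable_funM => //; apply/measurable_EFinP; exact: measurable_expdens.
- exists [set 0]; split => //; first exact: lebesgue_measure_set1.
  move=> x /=; apply: contra_notP => /eqP x0 _; congr (_ * _%:E)%E.
  rewrite /exponential_pdf /expdens patchE; case: ifPn.
    rewrite inE/= in_itv/= andbT => x0'.
    by rewrite lt_def x0 x0' mul1r mulN1r.
  rewrite notin_setE/= in_itv/= andbT => /negP; rewrite -ltNge => x0'.
  by rewrite ltNge (ltW x0').
Qed.

Lemma ge0_integral_unif (f : R -> \bar R) :
  mfn f -> (forall x, 0 <= f x)%E ->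
  (\int[unif]_x f x = \int[mu]_(x in `[0%R, 1%R]) f x)%E.
Proof.
move=> mf f0; rewrite (@ge0_integral_pushforward _ _ _ _ _ _ mid _ setT)//= ?preimage_setT.
by rewrite integral_uniform// subr0 invr1 mul1e.
Qed.

Lemma measurable_split (G : R * R -> \bar R) :
  mfn G -> (forall z, 0 <= G z)%E ->
  mfn (fun z : R => \int[unif]_v G (z * v, z * (1 - v))%R)%E.
Proof.
move=> mG G0.
apply: (@measurable_fun_fubini_tonelli_F _ _ R R R unif
  (fun p => G (p.1 * p.2, p.1 * (1 - p.2))%R)) => //; mp.
Qed.

(* The sum and the ratio of two independent exponential variables. *)
Lemma exponential_split (H : R * R -> \bar R) :
  mfn H -> (forall z, 0 <= H z)%E ->
  (\int[ex]_x \int[ex]_y H (x, y) =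
   \int[ex]_z (`|z|%:E * \int[unif]_v H (z * v, z * (1 - v))%R))%E.
Proof.
move=> mH H0.
(* The joint density exp (- z) on 0 < x < z of x and z = x + y, times H at (x, z - x). Its integrals
   in the two orders are the two sides of the identity. *)
pose K (xz : R * R) : \bar R :=
  ((if 0 < xz.1 then 1 else 0 : R)%:E * (if xz.1 < xz.2 then 1 else 0 : R)%:E *
   (expR (- xz.2))%:E * H (xz.1, (xz.2 - xz.1)%R))%E.
have mK : mfn K.
  apply: emeasurable_funM.
    apply: emeasurable_funM.
      apply: emeasurable_funM; apply/measurable_EFinP; apply: measurable_fun_ifT => //.
      - exact: measurable_fun_ltr.
      - exact: measurable_fun_ltr.
    by meas.
  by meas.
have K0 z : (0 <= K z)%E.
  by rewrite !mule_ge0// ?lee_fin ?expR_ge0//; case: ifP.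
have mH1 x : mfn (fun y => H (x, y)) by exact: measurable_fun_pair2.
have LHS : (\int[ex]_x \int[ex]_y H (x, y) = \int[mu]_x \int[mu]_z K (x, z))%E.
  rewrite ge0_integral_ex//; last 2 first.
  - exact: measurable_fun_fubini_tonelli_F.
  - by move=> x; exact: integral_ge0.
  apply: eq_integral => x _; rewrite ge0_integral_ex//.
  rewrite [RHS](@ge0_integral_affine _ 1 x)//; last exact: measurable_fun_pair2.
  rewrite mul1e -ge0_integralZr//; last 3 first.
  - apply: emeasurable_funM; first exact: mH1.
    by apply/measurable_EFinP; exact: measurable_expdens.
  - by move=> y _; rewrite mule_ge0// lee_fin expdens_ge0.
  - by rewrite lee_fin expdens_ge0.
  apply: eq_integral => y _; rewrite /K/= mul1r addrK /expdens.
  rewrite ltrDr; case: ifP => y0; case: ifP => x0; rewrite ?(mul0e, mule0)//.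
  by rewrite !mul1e muleAC -muleA -EFinM -expRD opprD addrC muleC [(- y + _)%R]addrC.
have RHS : (\int[ex]_z (`|z|%:E * \int[unif]_v H (z * v, z * (1 - v))%R) =
    \int[mu]_z \int[mu]_x K (x, z))%E.
  rewrite ge0_integral_ex; last 2 first.
  - apply: emeasurable_funM; first by meas.
    exact: measurable_split.
  - by move=> z; rewrite mule_ge0//; exact: integral_ge0.
  apply: eq_integral => z _; rewrite /expdens; case: ifPn => z0; last first.
    rewrite mule0; apply/esym; apply: integral0_eq => x _; rewrite /K/=.
    case: ifPn => x0; last by rewrite !mul0e.
    case: ifPn => xz; last by rewrite mule0 !mul0e.
    by move: z0; rewrite (lt_trans x0 xz).
  have mHz : mfn (fun v => H (z * v, z * (1 - v))%R).
    apply: (measurableT_comp mH); apply: measurable_fun_pair; first exact: measurable_funM.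
    by apply: measurable_funM => //; exact: measurable_funB.
  rewrite ge0_integral_unif// gtr0_norm//.
  rewrite [RHS](@ge0_integral_affine _ z 0)//; last by meas.
  rewrite -muleA; congr (_ * _)%E; rewrite integral_mkcond -ge0_integralZr//; last 2 first.
  - by apply/(measurable_restrictT _ _).1 => //; exact: measurable_funTS.
  - by move=> v _; rewrite patchE; case: ifP.
  apply: ae_eq_integral => //.
  - apply: emeasurable_funM => //.
    by apply/(measurable_restrictT _ _).1 => //; exact: measurable_funTS.
  - apply: (@measurableT_comp _ _ _ _ _ _ (fun x => K (x, z))); mp.
    by apply: measurable_funD => //; meas.
  (* Strict and weak inequalities at the ends of [0, 1] differ only on this null set. *)
  - exists ([set 0] `|` [set 1]); split.
    + exact: measurableU.
    + apply/eqP; rewrite eq_le measure_ge0 andbT.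
      rewrite (le_trans (measureU2 _ _ _))//.
      have m0 x : mu [set x] = 0%E := lebesgue_measure_set1 x.
      by rewrite -[X in (X <= _)%E]/(mu [set 0%R] + mu [set 1%R])%E !m0 adde0.
    + move=> v /=; apply: contra_notP => /not_orP[/eqP v0 /eqP v1] _.
      rewrite patchE addr0.
      rewrite -[RHS]/((if 0 < z * v then 1 else 0 : R)%:E * (if z * v < z then 1 else 0 : R)%:E *
        (expR (- z))%:E * H ((z * v)%R, (z - z * v)%R))%E.
      have -> : (z * v < z) = (v < 1) by rewrite -[X in _ < X]mulr1 ltr_pM2l.
      rewrite pmulr_rgt0//.
      have -> : z - z * v = z * (1 - v) by rewrite mulrBr mulr1.
      case: ifPn.
        rewrite inE/= in_itv/= => /andP[v0' v1'].
        have -> : 0 < v by rewrite lt_def v0 v0'.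
        have -> : v < 1 by rewrite lt_def eq_sym v1 v1'.
        by rewrite !mul1e muleC.
      rewrite notin_setE/= in_itv/= => /negP; rewrite mul0e.
      case: ifPn => v0'; last by rewrite !mul0e.
      case: ifPn => v1'; last by rewrite mule0 !mul0e.
      by rewrite (ltW v0') (ltW v1').
rewrite LHS RHS.
exact: (@fubini_tonelli _ _ (measurableTypeR R) (measurableTypeR R) R mu mu K mK K0).
Qed.

End exponential_law.

#[global] Opaque ex unif.

(** * The function Gamma (1 + s) as a moment of the exponential law *)

Section gamma.
Context {R : realType}.
Notation mu := (@lebesgue_measure R).
Notation ex := (@ex R).
Notation unif := (@unif R).

Lemma measurable_nrm_powR (s : R) :
  mfn (fun t : R => (`|t| `^ s)%:E).
Proof. by meas. Qed.

Lemma nrm_powR_ge0 (s t : R) : (0 <= (`|t| `^ s)%:E)%E.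
Proof. by pos. Qed.

Lemma prob_int1 {d} {T : measurableType d} (P : probability T R) :
  (\int[P]__ 1 = 1)%E.
Proof. by rewrite (@integral_cst _ _ _ P _ measurableT 1%:E)/= probability_setT mule1. Qed.

Lemma ae_ex_gt0 : {ae ex, forall t, 0 < t}.
Proof.
exists (`]-oo, 0]%classic); split => //.
  rewrite -[X in ex X]setIT -integral_indic// ge0_integral_ex//; last by apply/measurable_EFinP; exact: measurable_indic.
  apply: integral0_eq => x _; rewrite indicE /expdens; case: ifPn => x0.
    by rewrite memNset ?mul0e//= in_itv/= leNgt x0.
  by rewrite mule0.
by move=> x/=; rewrite in_itv/= leNgt => /negP.
Qed.

Lemma ae_unif_01 : {ae unif, forall v, 0 < v < 1}.
Proof.
exists (~` `]0, 1[%classic); split.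
- exact: measurableC.
- rewrite -[X in unif X]setIT -integral_indic//; last exact: measurableC.
  rewrite ge0_integral_unif//; last by apply/measurable_EFinP; apply: measurable_indic; exact: measurableC.
  rewrite -integral_itv_obnd_cbnd; last by apply/measurable_funTS/measurable_EFinP; apply: measurable_indic; exact: measurableC.
  rewrite -integral_itv_bndo_bndc; last by apply/measurable_funTS/measurable_EFinP; apply: measurable_indic; exact: measurableC.
  by apply: integral0_eq => x x01; rewrite indicE memNset//; apply.
- by move=> x/=; rewrite in_itv/=.
Qed.

Lemma integral_expdens : (\int[mu]_x (expdens x)%:E = 1)%E.
Proof.
have := @ge0_integral_ex R (cst 1%E) (measurable_cst _) (fun=> lee01).
rewrite prob_int1 => ->.
by apply: eq_integral => x _; rewrite mul1e.
Qed.

(** Half of the exponential absorbs the power: x^s <= (2 s)^s exp (x / 2), because x / (2 s) <= exp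
    (x / (2 s)). *)
Lemma ex_powR_lty (s : R) : 0 <= s -> (\int[ex]_t (`|t| `^ s)%:E < +oo)%E.
Proof.
rewrite le_eqVlt => /predU1P[<-|s0].
  under eq_integral do rewrite powRr0.
  by rewrite prob_int1 ltry.
pose C := (2 * s) `^ s; rewrite ge0_integral_ex//; last by meas.
have h2 : (0 < 2^-1 :> R) by pos.
have mE : mfn (fun x : R => (expdens (2^-1 * x + 0))%:E).
  apply/measurable_EFinP; apply: (measurableT_comp measurable_expdens).
  by apply: measurable_funD => //; meas.
have := @ge0_integral_affine R 2^-1 0 (fun x => (expdens x)%:E) h2.
rewrite integral_expdens => /(_ _ _)/esym I2.
apply: (@le_lt_trans _ _ (\int[mu]_x (C%:E * (expdens (2^-1 * x + 0))%:E))%E).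
  apply: ge0_le_integral => //; mp.
  - by move=> x _; rewrite mule_ge0// lee_fin ?powR_ge0 ?expdens_ge0.
  - apply: emeasurable_funM; first exact: measurable_nrm_powR.
    by apply/measurable_EFinP; exact: measurable_expdens.
  - move=> x _; rewrite addr0 /expdens pmulr_rgt0//; case: ifPn => x0; last by rewrite !mule0.
    rewrite -!EFinM lee_fin gtr0_norm//.
    have -> : expR (- x) = expR (2^-1 * - x) * expR (- (2^-1 * x)).
      by rewrite -expRD; congr expR; field.
    rewrite mulrA ler_wpM2r ?expR_ge0//.
    rewrite mulrN expRN ler_pdivrMr ?expR_gt0//.
    have x1 : (0 : R) <= x / (2 * s) by pos.
    have -> : x `^ s = C * (x / (2 * s)) `^ s.
      have {1}-> : (x : R) = 2 * s * (x / (2 * s)) by field; rewrite gt_eqF.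
      by rewrite (@powRM R)// mulr_ge0// ltW.
    have -> : expR (2^-1 * x) = expR (x / (2 * s)) `^ s.
      rewrite -expRM; congr expR; field; by rewrite gt_eqF.
    rewrite ler_wpM2l ?powR_ge0//.
    rewrite ge0_ler_powR ?nnegrE ?(ltW s0) ?expR_ge0//.
    by rewrite (le_trans _ (expR_ge1Dx _))// lerDr.
have {}I2 : ((2^-1)%:E * \int[mu]_x (expdens (2^-1 * x + 0))%:E)%E = 1%E.
  apply: I2; first by apply/measurable_EFinP; exact: measurable_expdens.
  by move=> x; rewrite lee_fin expdens_ge0.
have -> : (\int[mu]_x (C%:E * (expdens (2^-1 * x + 0))%:E) =
           C%:E * \int[mu]_x (expdens (2^-1 * x + 0))%:E)%E.
  apply: (@ge0_integralZl _ (measurableTypeR R) _ mu setT measurableT); mp.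
  - by move=> x _; rewrite lee_fin expdens_ge0.
move: I2; case: (\int[mu]_x _)%E => [r _|I2|I2]; first by rewrite -EFinM ltry.
- by move: I2; rewrite gt0_muley// lte_fin.
- by move: I2; rewrite gt0_muleNy// lte_fin.
Qed.

(** This is Gamma (1 + s), by [Gamma_gam]. As an exponential moment it gets its Beta integral and
    its functional equation from [exponential_split]. *)
Definition gam (s : R) : R := fine (\int[ex]_t (`|t| `^ s)%:E)%E.

Lemma gamE (s : R) : 0 <= s -> (\int[ex]_t (`|t| `^ s)%:E = (gam s)%:E)%E.
Proof.
move=> s0; rewrite /gam fineK// ge0_fin_numE; first exact: ex_powR_lty.
by apply: integral_ge0 => t _; rewrite lee_fin powR_ge0.
Qed.

Lemma gam0 : gam 0 = 1.
Proof.
rewrite /gam; under eq_integral do rewrite powRr0.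
by rewrite prob_int1.
Qed.

Lemma Gamma_gam (s : R) : Gamma (1 + s) = gam s.
Proof.
rewrite /Gamma /gam /Rintegral ge0_integral_ex; [|by meas|by move=> x; rewrite lee_fin powR_ge0].
congr fine.
rewrite integral_mkcond; apply: eq_integral => t _; rewrite patchE /expdens.
rewrite mem_setE in_itv/= andbT; case: ifPn => t0; last by rewrite mule0.
by rewrite EFinM gtr0_norm// addrAC subrr add0r.
Qed.

#[global] Opaque gam.

Lemma gam_gt0 (s : R) : 0 <= s -> 0 < gam s.
Proof.
move=> s0; rewrite lt_def -lee_fin -gamE// integral_ge0 ?andbT; last by pos.
apply/eqP => g0.
have : (\int[ex]_t (`|t| `^ s)%:E = 0)%E by rewrite gamE// g0.
under eq_integral => t _ do rewrite -[(`|t| `^ s)%:E]gee0_abs ?lee_fin ?powR_ge0//.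
move/(ae_eq_integral_abs ex measurableT (measurable_nrm_powR s)) => ae0.
have : {ae ex, forall t : R, False}.
  apply: filterS2 ae0 ae_ex_gt0 => t /= /(_ Logic.I) [/eqP + t0].
  by rewrite powR_eq0 normr_eq0 gt_eqF.
move=> [A [mA A0 sA]]; have : (ex setT <= ex A)%E.
  by rewrite le_measure ?inE// => t _; apply: sA.
by rewrite A0 probability_setT lee_fin ler10.
Qed.

(** For s < 0 the integrand is unbounded at 0: the fundamental theorem is applied on
    [1 / (n + 2), 1], and n tends to infinity. *)
Lemma integral_unif_powR (s : R) : -1 < s ->
  (\int[unif]_v (`|v| `^ s)%:E = ((1 + s)^-1)%:E)%E.
Proof.
move=> s1; have s1' : 0 < 1 + s by lra.
rewrite ge0_integral_unif; [|by meas|by move=> x; rewrite lee_fin powR_ge0].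
rewrite -integral_itv_obnd_cbnd; last by apply: measurable_funTS; by meas.
pose e (n : nat) : R := n.+2%:R^-1.
have e01 n : 0 < e n < 1 by rewrite invr_gt0 ltr0n/= invf_lt1 ?ltr0n// ltr1n.
pose F (n : nat) : set R := `[e n, 1]%classic.
have UF : \bigcup_n F n = `]0, 1]%classic.
  apply/seteqP; split => [x [n _]|x]; rewrite /F/= !in_itv/=.
    by move=> /andP[en ->]; rewrite (lt_le_trans _ en)//; have /andP[] := e01 n.
  move=> /andP[x0 x1]; exists (Num.truncn x^-1) => //=; rewrite in_itv/= x1 andbT.
  rewrite /e -[leRHS]invrK lef_pV2 ?posrE ?invr_gt0// ltW//.
  apply: (lt_trans (Num.Theory.truncnS_gt x^-1)).
  by rewrite ltr_nat.
have cF : (\int[mu]_(x in F n) (`|x| `^ s)%:E @[n --> \oo] -->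
           \int[mu]_(x in \bigcup_n F n) (`|x| `^ s)%:E)%E.
  apply: ge0_nondecreasing_set_cvg_integral => //.
  - move=> m n mn; apply/subsetPset => x; rewrite /F/= !in_itv/= => /andP[em ->].
    by rewrite (le_trans _ em)// lef_pV2 ?posrE// ler_nat !ltnS.
  - by meas.
  - by move=> n; apply: measurable_funTS; exact: measurable_nrm_powR.
rewrite -UF.
suff /cvg_unique : (\int[mu]_(x in F n) (`|x| `^ s)%:E @[n --> \oo] --> ((1 + s)^-1)%:E)%E.
  by move=> /(_ (@ereal_hausdorff R)) /(_ _ cF).
have IF n : (\int[mu]_(x in F n) (`|x| `^ s)%:E =
    ((1 + s)^-1 - (1 + s)^-1 * e n `^ (1 + s))%:E)%E.
  have /andP[e0 e1] := e01 n.
  transitivity (\int[mu]_(x in F n) (x `^ s)%:E)%E.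
    apply: eq_integral => x; rewrite inE /F/= in_itv/= => /andP[ex _].
    by rewrite gtr0_norm// (lt_le_trans e0).
  rewrite (@continuous_FTC2 _ _ (fun x => (1 + s)^-1 * x `^ (1 + s)))//.
  - by rewrite powR1 mulr1 -EFinB.
  - apply: derivable_within_continuous => x; rewrite in_itv/= => /andP[ex _].
    by apply: derivable_powR; rewrite in_itv/= andbT (lt_le_trans e0).
  - have dF (x : R) : 0 < x -> derivable (fun x : R => (1 + s)^-1 * x `^ (1 + s)) x 1.
      by move=> x0; apply: derivableM => //; apply: derivable_powR; rewrite in_itv/= andbT.
    have cF' (x : R) : 0 < x -> {for x, continuous (fun x : R => (1 + s)^-1 * x `^ (1 + s))}.
      move=> x0; apply: (@differentiable_continuous _ R^o R^o).
      by apply/derivable1_diffP/dF.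
    split.
    + move=> x; rewrite in_itv/= => /andP[ex _]; apply: dF; exact: lt_trans ex.
    + by apply: cvg_at_right_filter; exact: cF'.
    + by apply: cvg_at_left_filter; exact: cF'.
  - move=> x; rewrite in_itv/= => /andP[ex _].
    have x0 : 0 < x := lt_trans e0 ex.
    rewrite derive1E deriveZ/=; last by apply: derivable_powR; rewrite in_itv/= andbT.
    rewrite -derive1E powR_derive1 ?in_itv/= ?andbT//.
    rewrite /GRing.scale/= mulrA mulVf ?gt_eqF// mul1r; congr (_ `^ _); lra.
under eq_fun do rewrite IF.
apply: cvg_EFin; first exact: nearW.
rewrite -[X in _ --> X]subr0 -[X in _ --> _ - X](mulr0 (1 + s)^-1).
apply: cvgB; first exact: cvg_cst.
apply: cvgMr; rewrite -[X in _ --> X](@powR0 _ (1 + s)) ?gt_eqF//.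
apply: cvg_powR => //.
- by move=> n; rewrite ltW//; have /andP[] := e01 n.
- have : ((n.+1%:R : R)^-1) @[n --> \oo] --> (0:R) by exact: cvg_harmonic.
  by rewrite -(@cvg_shiftS R (fun n => n.+1%:R^-1) (nbhs (0:R))).
Qed.

(** The Beta integral: in [exponential_split] for x^a y^b, the power z^(a + b + 1) of the sum
    separates from the ratio. *)
Lemma gam_split (a b : R) : 0 <= a -> 0 <= b ->
  ((gam a * gam b)%:E =
   (gam (a + b + 1))%:E * \int[unif]_v (`|v| `^ a * `|1 - v| `^ b)%:E)%E.
Proof.
move=> a0 b0.
pose H (z : R * R) : \bar R := ((`|z.1| `^ a)%:E * (`|z.2| `^ b)%:E)%E.
have mH : mfn H.
  by apply: emeasurable_funM; [apply: (measurableT_comp (measurable_nrm_powR a))|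
     apply: (measurableT_comp (measurable_nrm_powR b))].
have := @exponential_split R H mH (fun z => mule_ge0 (nrm_powR_ge0 _ _) (nrm_powR_ge0 _ _)).
have -> : (\int[ex]_x \int[ex]_y H (x, y) = (gam a * gam b)%:E)%E.
  transitivity (\int[ex]_x ((`|x| `^ a)%:E * (gam b)%:E))%E.
    apply: eq_integral => x _; rewrite -gamE//.
    under eq_integral do rewrite /H/=.
    apply: (@ge0_integralZl _ _ _ ex setT measurableT (fun y : R => (`|y| `^ b)%:E)).
    - by meas.
    - by pos.
    - by pos.
  rewrite (@ge0_integralZr _ _ _ ex setT measurableT (fun y => (`|y| `^ a)%:E)).
  - by rewrite gamE.
  - by meas.
  - by pos.
  - by pos.
move=> ->.
have mU : mfn (fun v : R => (`|v| `^ a * `|1 - v| `^ b)%:E).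
  under eq_fun do rewrite EFinM.
  apply: emeasurable_funM; first by meas.
  apply: (measurableT_comp (measurable_nrm_powR b)).
  exact: measurable_funB.
have U0 (v : R) : (0 <= (`|v| `^ a * `|1 - v| `^ b)%:E)%E.
  by rewrite lee_fin mulr_ge0 ?powR_ge0.
rewrite -gamE; last by pos.
set U := (\int[unif]_v _)%E; have U0' : (0 <= U)%E by apply: integral_ge0 => v _.
rewrite -(@ge0_integralZr _ _ _ ex setT measurableT (fun t => (`|t| `^ (a + b + 1))%:E)); last 3 first.
- by meas.
- by pos.
- by pos.
apply: eq_integral => z _.
under eq_integral => v _.
  rewrite /H/= !normrM !powRM// -EFinM mulrACA EFinM; over.
rewrite (@ge0_integralZl _ _ _ unif setT measurableT
  (fun v => (`|v| `^ a * `|1 - v| `^ b)%:E) mU); [|by move=> v _; exact: U0|by rewrite lee_fin mulr_ge0 ?powR_ge0].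
rewrite muleA -EFinM; congr (_%:E * _)%E.
have p1 : 0 < a + b + 1 by rewrite ltr_wpDl// addr_ge0.
have -> : `|z| `^ (a + b + 1) = `|z| * `|z| `^ (a + b).
  by rewrite -(@mulr_powRB1 _ _ _ _ p1)// addrK.
congr (_ * _).
have [->|z0] := eqVneq z 0; last by rewrite powRD// normr_eq0 z0 implybT.
rewrite normr0; have [->|an0] := eqVneq a 0; first by rewrite add0r powRr0 mul1r.
have ab0 : 0 < a + b by rewrite ltr_pwDl// lt_def an0.
by rewrite [in RHS]powR0 ?gt_eqF// (powR0 an0) mul0r.
Qed.

(** The Beta integral with b = 0 has the value 1 / (1 + s). *)
Lemma gamS (s : R) : 0 <= s -> gam (s + 1) = (1 + s) * gam s.
Proof.
move=> s0; have := gam_split s0 (lexx 0); rewrite gam0 mulr1 addr0.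
under eq_integral do rewrite powRr0 mulr1.
rewrite integral_unif_powR; last by lra.
rewrite -EFinM => -[->]; rewrite mulrCA divff ?mulr1//; apply/eqP; lra.
Qed.

Lemma gam_nat (n : nat) : gam n%:R = n`!%:R.
Proof.
elim: n => [|n IH]; first by rewrite gam0.
by rewrite -natr1 gamS ?ler0n// IH factS natrM -natr1 addrC.
Qed.

Lemma gam1 : gam 1 = 1.
Proof. exact: (gam_nat 1). Qed.
Let monem : mfn (fun x : measurableTypeR R => 1 - x : measurableTypeR R).
Proof. exact: measurable_funB. Qed.

Lemma unif_sym (f : R -> \bar R) : mfn f -> (forall v, 0 <= f v)%E ->
  (\int[unif]_v f (1 - v)%R = \int[unif]_v f v)%E.
Proof.
move=> mf f0; have mf1 : mfn (fun v : R => f (1 - v)%R) by meas.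
rewrite !ge0_integral_unif//; apply/esym.
transitivity (\int[pushm mu monem]_(x in `[0%R, 1%R]) f x)%E.
  apply: eq_measure_integral => A mA _.
  apply: (@lebesgue_measure_unique R (pushm mu monem) _ _ mA) => _ [[a b] _ <-].
  rewrite -[RHS]/(mu ((fun x : R => 1 - x) @^-1` `]a, b]%classic)).
  rewrite (_ : _ @^-1` _ = `[1 - b, 1 - a[%classic); last by apply/seteqP; split => x /=; rewrite !in_itv/= => /andP[? ?]; apply/andP; split; lra.
  rewrite !lebesgue_measure_itv/= !lte_fin ltrD2l ltrN2; case: ifPn => // _.
  by rewrite -!EFinD; congr EFin; ring.
rewrite (@ge0_integral_pushforward _ _ _ _ _ _ monem mu)//; last exact: measurable_funTS.
congr (integral _ _ _); apply/seteqP.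
by split => x /=; rewrite !in_itv/= => /andP[? ?]; apply/andP; split; lra.
Qed.

(** Bernoulli at t / (a + 1), integrated against t^a exp (- t), under which t has mean a + 1 after
    normalisation. *)
Lemma gam_le (a u : R) : 0 <= a -> 0 <= u <= 1 ->
  gam (a + u) <= gam a * (a + 1) `^ u.
Proof.
move=> a0 /andP[u0 u1].
have a1 : 0 < a + 1 by lra.
rewrite -lee_fin -gamE ?addr_ge0//.
have -> : gam a = (1 - u) * gam a + u / (a + 1) * gam (a + 1).
  by rewrite gamS// (addrC 1 a) mulrA divfK ?gt_eqF//; ring.
have -> : (((1 - u) * gam a + u / (a + 1) * gam (a + 1)) * (a + 1) `^ u)%:E =
   (\int[ex]_t (((a + 1) `^ u * (1 - u))%:E * (`|t| `^ a)%:E +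
                ((a + 1) `^ u * (u / (a + 1)))%:E * (`|t| `^ (a + 1))%:E))%E.
  have c1 : 0 <= (a + 1) `^ u * (1 - u) by rewrite mulr_ge0 ?powR_ge0 ?subr_ge0.
  have c2 : 0 <= (a + 1) `^ u * (u / (a + 1)) by pos.
  rewrite (@ge0_integralD _ _ _ ex setT measurableT); last 4 first.
  - by move=> t _; rewrite mule_ge0 ?lee_fin ?powR_ge0.
  - by meas.
  - by move=> t _; rewrite mule_ge0 ?lee_fin ?powR_ge0.
  - by meas.
  have Z (c s : R) : 0 <= c -> 0 <= s ->
      (\int[ex]_t (c%:E * (`|t| `^ s)%:E) = (c * gam s)%:E)%E.
    move=> c0 s0; rewrite EFinM -gamE//.
    apply: (@ge0_integralZl _ _ _ ex setT measurableT).
    - by meas.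
    - by pos.
    - by pos.
  by rewrite !Z ?addr_ge0// -EFinD; congr EFin; ring.
apply: (@ge0_le_integral _ _ _ ex setT measurableT).
- by pos.
- by meas.
- apply: emeasurable_funD; apply: emeasurable_funM => //; by meas.
move=> t _; rewrite -!EFinM -EFinD lee_fin.
have [t0|t0] := eqVneq t 0.
  rewrite t0 normr0; have [au0|au0] := eqVneq (a + u) 0.
    have -> : a = 0 by lra. have -> : u = 0 by lra.
    by rewrite addr0 add0r !powRr0 !mul1r subr0 mul0r mul0r mulr1 addr0.
  by rewrite powR0// addr_ge0// !mulr_ge0 ?powR_ge0 ?subr_ge0// invr_ge0 ltW.
have tp : 0 < `|t| by rewrite normr_gt0.
rewrite !powRD ?(gt_eqF tp) ?implybT// powRr1//.
have h : (`|t| / (a + 1)) `^ u <= 1 + u * (`|t| / (a + 1) - 1).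
  by apply: powR_bernoulli; rewrite ?u0// divr_ge0// ltW.
have -> : `|t| `^ u = (a + 1) `^ u * (`|t| / (a + 1)) `^ u.
  by rewrite -powRM// ?divr_ge0 ?ltW// mulrCA divff ?mulr1// gt_eqF.
set A := _ `^ a; set B := (a + 1) `^ u.
apply: (@le_trans _ _ (A * (B * (1 + u * (`|t| / (a + 1) - 1))))).
  by rewrite ler_wpM2l ?powR_ge0// ler_wpM2l// powR_ge0.
apply: eqle; field; by rewrite gt_eqF.
Qed.

Lemma rising_gam (x : R) n : 0 <= x -> rising x n * gam x * gam n%:R = gam (n%:R + x).
Proof.
move=> x0; elim: n => [|n IH]; first by rewrite rising0 mul1r gam0 mulr1 add0r.
have -> : n.+1%:R + x = n%:R + x + 1 :> R by rewrite -natr1 addrAC.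
have nx0 : 0 <= n%:R + x by pos.
rewrite (gamS nx0) -IH risingS -(natr1 n) (gamS (ler0n _ n)).
field; by rewrite gt_eqF// ltr_pwDr.
Qed.

Lemma risingD1 (x : R) n : 0 <= x ->
  rising (x + 1) n = (n%:R + x + 1) / (x + 1) * rising x n.
Proof.
move=> x0; have x1 : x + 1 != 0 by rewrite gt_eqF// ltr_wpDl.
have := @rising_gam (x + 1) n; rewrite addrA addr_ge0// => /(_ isT).
rewrite !gamS ?addr_ge0 ?ler0n// -rising_gam// => h.
have g1 : gam x != 0 by rewrite gt_eqF// gam_gt0.
have g2 : gam n%:R != 0 by rewrite gt_eqF// gam_gt0// ler0n.
apply: (mulIf g1); apply: (mulIf g2); apply: (mulfI x1).
have -> : (x + 1) * (rising (x + 1) n * gam x * gam n%:R) =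
  rising (x + 1) n * ((1 + x) * gam x) * gam n%:R by ring.
rewrite h; field; exact: x1.
Qed.

(** For x in [0, 1] the ratio is squeezed by [gam_le], used once from n to n + x and once from n + x
    to n + 1. Larger x come down by 1 through [risingD1] and [gamS]. *)
Lemma cvg_rising (x : R) : 0 <= x ->
  rising x n / n.+1%:R `^ x @[n --> \oo] --> (gam x)^-1.
Proof.
move=> x0; have : x <= (Num.truncn x).+1%:R by rewrite ltW// Num.Theory.truncnS_gt.
move: (Num.truncn x) => k; elim: k x x0 => [|k IH] x x0.
  move=> x1; have gx0 : 0 < gam x by exact: gam_gt0.
  have hc : ((n.+1%:R : R) / n.+2%:R) @[n --> \oo] --> (1 : R).
    have -> : (fun n => n.+1%:R / n.+2%:R : R) = (fun n => 1 - n.+2%:R^-1).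
      apply/funext => n; rewrite -(natr1 n.+1).
      set N := (n.+1%:R : R); have N0 : N + 1 != 0 by rewrite natr1 pnatr_eq0.
      by field.
    rewrite -[X in _ --> X]subr0; apply: cvgB; first exact: cvg_cst.
    have : ((n.+1%:R : R)^-1) @[n --> \oo] --> (0:R) by exact: cvg_harmonic.
    by rewrite -(@cvg_shiftS R (fun n => n.+1%:R^-1) (nbhs (0:R))).
  have L : (n.+1%:R / n.+2%:R / gam x) @[n --> \oo] --> (gam x)^-1.
    by rewrite -[X in _ --> X]mul1r; apply: cvgMl.
  apply: (squeeze_cvgr _ L (cvg_cst (gam x)^-1)); apply: nearW => n.
  have gn0 : 0 < gam n%:R by rewrite gam_gt0// ler0n.
  have px0 : 0 < n.+1%:R `^ x :> R by pos.
  have -> : rising x n = gam (n%:R + x) / gam n%:R / gam x.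
    by rewrite -rising_gam//; field; rewrite !gt_eqF.
  have U : gam (n%:R + x) <= gam n%:R * n.+1%:R `^ x.
    by rewrite -natr1 gam_le ?ler0n// x0.
  have D : n.+1%:R * gam n%:R <= gam (n%:R + x) * n.+2%:R `^ (1 - x).
    have -> : n.+1%:R * gam n%:R = gam (n%:R + x + (1 - x)).
      by rewrite -addrA (addrC x) subrK gamS ?ler0n// -natr1 addrC.
    apply: (le_trans (gam_le _ _)); [by rewrite addr_ge0 ?ler0n|lra|].
    have nx0 : 0 <= n%:R + x by pos.
    apply: ler_wpM2l; first by pos.
    have x1' : 0 <= 1 - x by rewrite subr_ge0.
    apply: ge0_ler_powR => //; [by rewrite nnegrE addr_ge0|by pos|].
    by rewrite -(natr1 n.+1) -(natr1 n); lra.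
  have p2 : 0 < n.+2%:R `^ (1 - x) :> R by pos.
  apply/andP; split; last first.
    rewrite ler_pdivrMr// ler_pdivrMr// mulrAC mulVf ?gt_eqF// mul1r ler_pdivrMr//.
    by rewrite mulrC.
  rewrite (ler_pdivlMr _ _ px0) mulrAC ler_pM2r ?invr_gt0// (ler_pdivlMr _ _ gn0) mulrAC.
  rewrite -(ler_pM2r p2); apply: le_trans D.
  have -> : n.+1%:R / n.+2%:R * gam n%:R * n.+1%:R `^ x * n.+2%:R `^ (1 - x) =
    (n.+1%:R `^ x * (n.+2%:R `^ (1 - x) / n.+2%:R)) * (n.+1%:R * gam n%:R) :> R.
    set N2 := (n.+2%:R : R) ; set A := N2 `^ _; ring.
  rewrite -[leRHS]mul1r ler_wpM2r ?mulr_ge0 ?ler0n ?(ltW gn0)//.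
  have -> : n.+2%:R `^ (1 - x) / n.+2%:R = (n.+2%:R `^ x)^-1 :> R.
    rewrite powRB ?pnatr_eq0 ?implybT// powRr1 ?ler0n//.
    by rewrite mulrAC divff ?mul1r// pnatr_eq0.
  rewrite ler_pdivrMr ?powR_gt0 ?ltr0n// mul1r.
  by apply: ge0_ler_powR; rewrite ?nnegrE ?ler0n// ler_nat.
move=> xk; have [x1|x1] := leP x k.+1%:R; first exact: IH.
have x10 : 0 <= x - 1.
  by rewrite subr_ge0 (le_trans _ (ltW x1))// ler1n.
have := IH _ x10 _; rewrite lerBlDr natr1 => /(_ xk) h.
have {1}-> : x = (x - 1) + 1 by rewrite subrK.
under eq_fun do rewrite risingD1// subrK.
have -> : (gam x)^-1 = 1 / x * (gam (x - 1))^-1.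
  have {1}-> : x = (x - 1) + 1 by rewrite subrK.
  by rewrite gamS// addrC subrK invfM mul1r.
have -> : (fun n : nat => (n%:R + (x - 1) + 1) / x * rising (x - 1) n / n.+1%:R `^ x) =
  (fun n => ((1 + (x - 1) * n.+1%:R^-1) / x) * (rising (x - 1) n / n.+1%:R `^ (x - 1))).
  apply/funext => n; rewrite -(@mulr_powRB1 _ _ x) ?ler0n//; last by lra.
  have : n.+1%:R `^ (x - 1) != 0 :> R by rewrite gt_eqF// powR_gt0 ltr0n.
  have -> : n%:R = n.+1%:R - 1 :> R by rewrite -natr1 addrK.
  set N := (n.+1%:R : R); have N0 : N != 0 by rewrite pnatr_eq0.
  move: (N `^ _) (rising _ _) => p r p0; field.
  rewrite p0/= nat1r -/N N0 andbT gt_eqF//; lra.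
apply: cvgM => //; apply: cvgMl.
rewrite -[X in _ --> X]addr0 -[X in _ --> _ + X](mulr0 (x - 1)).
apply: cvgD; first exact: cvg_cst.
apply: cvgMr; exact: cvg_harmonic.
Qed.

End gamma.

(** * Step functions on [0, 1] *)

Section step_functions.
Context {R : realType}.
Notation unif := (@unif R).

Lemma bmf_indic {d} {T : measurableType d} (A : set T) :
  measurable A -> bmf (\1_A : T -> R).
Proof.
move=> mA; apply: bmf01; first exact: measurable_indic.
by move=> v; rewrite indicE; case: (_ \in _); rewrite ?lexx ?ler01.
Qed.

Lemma integral_unif_itv (a b : R) : 0 <= a -> a <= b -> b <= 1 ->
  \int[unif]_v (\1_(`[a, b[%classic) v : R) = b - a.
Proof.
move=> a0 ab b1; apply: EFin_inj; rewrite bint_EFin; last exact: bmf_indic.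
rewrite ge0_integral_unif; last 2 first.
- by apply/measurable_EFinP; exact: measurable_indic.
- by pos.
rewrite (@integral_indic _ (measurableTypeR R))//.
rewrite (_ : `[a, b[ `&` `[0, 1] = `[a, b[)%classic; last first.
  apply/seteqP; split => x /=; rewrite !in_itv/=; first by case.
  move=> /andP[ax xb]; split; first by rewrite ax.
  by rewrite (le_trans a0 ax) (le_trans (ltW xb)).
rewrite -[LHS]/(@lebesgue_measure R `[a, b[%classic) lebesgue_measure_itv/= lte_fin.
case: ltP => [//|ba].
by rewrite (@le_anti _ _ a b) ?subrr// ab ba.
Qed.

(** A mean over M indices becomes an integral under [unif], to which bounded convergence applies;
    see [integral_step] and [step_eval]. *)
Definition step (M : nat) (F : nat -> R) (v : R) : R :=
  \sum_(i <- index_iota 0 M) F i * \1_(`[i%:R / M%:R, i.+1%:R / M%:R[%classic) v.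

Lemma bmf_step M F : bmf (step M F).
Proof.
apply: bmf_sum => i; apply: bmfM; first by meas.
exact: bmf_indic.
Qed.

Lemma integral_step M F : (0 < M)%N ->
  \int[unif]_v step M F v = M%:R^-1 * \sum_(0 <= i < M) F i.
Proof.
move=> M0; rewrite bint_sum; last by move=> i; apply: bmfM; [by meas|exact: bmf_indic].
rewrite mulr_sumr big_seq [RHS]big_seq; apply: eq_bigr => i.
rewrite mem_index_iota => /andP[_ iM].
rewrite bintZl; last exact: bmf_indic.
have Mp : 0 < M%:R :> R by rewrite ltr0n.
rewrite integral_unif_itv; mp.
- by rewrite -mulrBl -natr1 addrAC subrr add0r mul1r mulrC.
- by rewrite ler_pM2r ?invr_gt0// ler_nat.
- by rewrite ler_pdivrMr// mul1r ler_nat.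
Qed.

Lemma step_eval M F (v : R) : (0 < M)%N -> 0 <= v < 1 ->
  step M F v = F (Num.truncn (v * M%:R)).
Proof.
move=> M0 /andP[v0 v1]; have Mp : 0 < M%:R :> R by rewrite ltr0n.
have vM : 0 <= v * M%:R by pos.
have inE i : \1_(`[i%:R / M%:R, i.+1%:R / M%:R[%classic) v =
    (i == Num.truncn (v * M%:R))%:R :> R.
  rewrite indicE mem_setE in_itv/= ler_pdivrMr// ltr_pdivlMr//.
  by rewrite eq_sym truncn_eq.
have tM : (Num.truncn (v * M%:R) < M)%N.
  by rewrite truncn_lt_nat// -[ltRHS]mul1r ltr_pM2r.
rewrite /step (bigD1_seq (Num.truncn (v * M%:R))) ?iota_uniq ?mem_index_iota//=.
rewrite inE eqxx mulr1 big1 ?addr0// => i iv.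
by rewrite inE (negbTE iv) mulr0.
Qed.

Lemma step_bound M F (B v : R) : (0 < M)%N -> 0 <= B -> (forall i, `|F i| <= B) ->
  `|step M F v| <= B.
Proof.
move=> M0 B0 FB; have [v01|v01] := boolP (0 <= v < 1); first by rewrite step_eval.
have Mp : 0 < M%:R :> R by rewrite ltr0n.
rewrite /step big_seq big1 ?normr0// => i; rewrite mem_index_iota => /andP[_ iM].
rewrite indicE mem_setE in_itv/=; case: (boolP (i%:R / M%:R <= v < i.+1%:R / M%:R)) => [|_]; last by rewrite mulr0.
move=> /andP[vi iv]; case/negP: v01; rewrite (le_trans _ vi) ?divr_ge0//=.
by rewrite (lt_le_trans iv)// ler_pdivrMr// mul1r ler_nat.
Qed.

Lemma cvg_truncn (v : R) : 0 <= v ->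
  (Num.truncn (v * n.+1%:R)).+1%:R / n.+2%:R @[n --> \oo] --> v.
Proof.
move=> v0; apply/cvgrPdist_le => /= e; move: (e : R) => {}e e0.
have h : ((n.+1%:R : R)^-1) @[n --> \oo] --> (0:R) by exact: cvg_harmonic.
have e1 : 0 < e / (1 + v) by rewrite divr_gt0//; lra.
move/cvgrPdist_le : h => /(_ _ e1); apply: filterS => n.
rewrite sub0r normrN ger0_norm ?invr_ge0// => hn.
have Np : 0 < n.+1%:R :> R by rewrite ltr0n.
have vN : 0 <= v * n.+1%:R by pos.
have /andP[] := truncn_itv vN.
rewrite -[n.+2%:R]natr1 -[(Num.truncn _).+1%:R]natr1.
move: {vN} (Num.truncn (v * n.+1%:R))%:R => t; move: hn Np.
set N : R := n.+1%:R; move: N t => N t hn Np t1 t2.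
have eN : 1 + v <= e * N.
  move: hn; rewrite ler_pdivlMr; last by lra.
  by rewrite mulrC ler_pdivrMr.
rewrite ler_distlC; apply/andP; split.
- rewrite ler_pdivlMr//; nra.
- rewrite ler_pdivrMr//; nra.
Qed.

End step_functions.

(** * Existence of an exponent g with E Z^g < g m *)

Section subcritical_exponent.
Context {R : realType} {d} {T : measurableType d}
  (P : probability T R).
Variables (Z : T -> R) (m a : R).
Hypotheses (mZ : mfn Z) (Z0 : forall w, 0 <= Z w).
Hypothesis Zm : (\int[P]_w (Z w)%:E = m%:E)%E.
Hypothesis a1 : 1 < a.
Hypothesis Za : (\int[P]_w (Z w `^ a)%:E < +oo)%E.
Hypothesis Zln : (\int[P]_w (Z w * ln (Z w))%:E < m%:E)%E.

Let c := (a - 1) / 2.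
Let c0 : 0 < c. Proof. by rewrite divr_gt0// subr_gt0. Qed.
(** A domination uniform in h <= c = (a - 1) / 2. For x > 1 the logarithm costs at most x^c / c, and
    1 + 2 c = a; for x <= 1 the product is at most 1 because - ln x <= 1 / x. *)
Let powln_bound (x h : R) : 0 <= x -> 0 <= h <= c ->
  `|x `^ (1 + h) * ln x| <= 1 + c^-1 * x `^ a.
Proof.
move=> x0 /andP[h0 hc].
have G0 : 0 <= c^-1 * x `^ a by pos.
have [->|xn0] := eqVneq x 0; first by rewrite (@ln0 R 0) ?mulr0 ?normr0 ?addr_ge0// mulr_ge0 ?invr_ge0 ?powR_ge0 ?ltW.
have xp : 0 < x by rewrite lt_def xn0.
rewrite normrM ger0_norm ?powR_ge0//.
have [x1|x1] := leP x 1.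
  rewrite ler0_norm ?ln_le0//.
  apply: (@le_trans _ _ 1); last by rewrite lerDl.
  have l1 : - ln x <= x^-1.
    by rewrite -lnV ?posrE// ltW// ln_sublinear// invr_gt0.
  have l2 : x `^ (1 + h) <= x.
    by rewrite -[leRHS]powRr1//; apply: ger_powR; rewrite ?xp ?x1//; lra.
  apply: (@le_trans _ _ (x * x^-1)); last by rewrite divff.
  apply: ler_pM => //; first by pos.
  by rewrite oppr_ge0 ln_le0.
have lx0 : 0 <= ln x by rewrite ln_ge0// ltW.
rewrite ger0_norm//.
apply: (@le_trans _ _ (c^-1 * x `^ a)); last by rewrite lerDr.
have l1 : ln x <= c^-1 * x `^ c.
  rewrite ler_pdivlMl// -ln_powR ltW// ln_sublinear//; mp.
have l2 : x `^ (1 + h) <= x `^ (1 + c) by apply: ler_powR; [exact: ltW|rewrite lerD2l].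
apply: (@le_trans _ _ (x `^ (1 + c) * (c^-1 * x `^ c))).
  by apply: ler_pM => //; pos.
have -> : x `^ a = x `^ (1 + c) * x `^ c.
  rewrite -powRD ?xn0 ?implybT//; congr (_ `^ _); by rewrite /c; field.
by rewrite mulrCA.
Qed.
(** Multiply 1 - h ln x <= x^(- h) by x^(1 + h): convexity of g -> x^g, with the slope taken at the
    right end. *)
Let powln_ge (x h : R) : 0 <= x -> 0 < h ->
  x `^ (1 + h) <= x + h * (x `^ (1 + h) * ln x).
Proof.
move=> x0 h0; have [->|xn0] := eqVneq x 0.
  rewrite (@ln0 R 0)// !mulr0 addr0 powR0 ?gt_eqF//; lra.
have xp : 0 < x by rewrite lt_def xn0.
have e : 1 - h * ln x <= x `^ (- h).
  rewrite /powR (negbTE xn0) (le_trans _ (expR_ge1Dx _))//; lra.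
have p0 : 0 < x `^ (1 + h) by pos.
have : x `^ (1 + h) * (1 - h * ln x) <= x `^ (1 + h) * x `^ (- h).
  by rewrite ler_pM2l.
rewrite -powRD ?xn0 ?implybT// addrK powRr1//; lra.
Qed.

(** The functions g -> E Z^g and g -> g m agree at g = 1, where their slopes are E[Z ln Z] and m.
    The first slope is smaller, so the first function lies below the second just to the right of
    1. *)
Lemma exists_subcritical : exists g q : R,
  [/\ 1 < g <= 2, (\int[P]_w (Z w `^ g)%:E = q%:E)%E & q < g * m].
Proof.
(* Keeps g = 1 + h in ]1, 2] and h in the range of [powln_bound]. *)
pose D := Order.min 1 c.
have D0 : 0 < D by rewrite lt_min ltr01 c0.
pose h (n : nat) := D / n.+1%:R.
have h0 n : 0 < h n by rewrite divr_gt0.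
have hD n : h n <= D.
  by rewrite ler_pdivrMr// ler_peMr ?(ltW D0)// ler1n.
have h1 n : h n <= 1 by rewrite (le_trans (hD n))// ge_min lexx.
have hc n : h n <= c by rewrite (le_trans (hD n))// ge_min lexx orbT.
pose f n w := Z w `^ (1 + h n) * ln (Z w).
have mpow b : mfn (fun w => Z w `^ b) by meas.
have mln : mfn (fun w => ln (Z w)) by exact: measurableT_comp.
have mf n : mfn (f n) by exact: measurable_funM.
have G_int : P.-integrable setT (fun w => (1 + c^-1 * Z w `^ a)%:E).
  apply/integrableP; split.
    by meas.
  have E : (\int[P]_w `|(1 + c^-1 * Z w `^ a)%:E| =
      1 + (c^-1)%:E * \int[P]_w (Z w `^ a)%:E)%E.
    transitivity (\int[P]_w (1%:E + (c^-1)%:E * (Z w `^ a)%:E))%E.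
      apply: eq_integral => w _; rewrite gee0_abs ?EFinD ?EFinM// -EFinM -EFinD lee_fin; mp.
    rewrite ge0_integralD//; last 2 first.
    - by move=> w _; rewrite mule_ge0 ?lee_fin ?powR_ge0 ?invr_ge0 ?ltW.
    - by meas.
    rewrite (@integral_cst _ _ _ P _ measurableT 1%:E)/= probability_setT mule1.
    congr (_ + _)%E; apply: ge0_integralZl => //; mp.
    - by rewrite lee_fin invr_ge0 ltW.
  rewrite E lte_add_pinfty ?ltry// lte_mul_pinfty ?lee_fin ?invr_ge0 ?ltW//.
have [] := @dominated_convergence _ _ _ P setT measurableT
  (fun n w => (f n w)%:E) (fun w => (Z w * ln (Z w))%:E) (fun w => (1 + c^-1 * Z w `^ a)%:E).
- by meas.
- by meas.
- apply: aeW => w _; apply: cvg_EFin; first exact: nearW.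
  have [Zw0|Zn0] := eqVneq (Z w) 0.
    have -> : fine \o (fun n : nat => (f n w)%:E) = fun=> Z w * ln (Z w).
      by apply/funext => n; rewrite /f/= Zw0 (@ln0 R 0)// !mulr0.
    exact: cvg_cst.
  apply: cvgMl.
  rewrite -[X in _ --> X]powRr1// /powR (negbTE Zn0).
  apply: (@cvg_comp _ _ _ (fun n => (1 + h n) * ln (Z w)) expR _ (nbhs (1 * ln (Z w)))).
    apply: cvgMl; rewrite -[X in _ --> X]addr0; apply: cvgD; first exact: cvg_cst.
    rewrite -(mulr0 D); apply: cvgMr; exact: cvg_harmonic.
  exact: continuous_expR.
- exact: G_int.
- by apply: aeW => w n _ /=; rewrite lee_fin powln_bound// ltW// hc.
move=> fi _; rewrite -(fineK (integrable_fin_num measurableT fi)) => /fine_cvgP[_ fcv].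
have fiR : fine (\int[P]_w (Z w * ln (Z w))%:E) < m.
  by rewrite -lte_fin fineK//; exact: integrable_fin_num.
have : \forall n \near \oo, fine (\int[P]_w (f n w)%:E) < m.
  by apply: (cvgr_lt _ fcv).
move=> [n _ /(_ n (leqnn _))/= fn].
have ifn : P.-integrable setT (fun w => (f n w)%:E).
  apply: (le_integrable _ _ _ G_int) => //; first by meas.
  move=> w _ /=; rewrite lee_fin (le_trans (powln_bound _ _))//.
    by rewrite ltW//= hc.
  by rewrite ler_norm.
have iZ : P.-integrable setT (fun w => (Z w)%:E).
  apply/integrableP; split; first by meas.
  under eq_integral => w _ do rewrite gee0_abs ?lee_fin//.
  by rewrite Zm ltry.
have q_le : (\int[P]_w (Z w `^ (1 + h n))%:E <=
    (m + h n * fine (\int[P]_w (f n w)%:E))%:E)%E.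
  rewrite EFinD EFinM fineK; last exact: integrable_fin_num.
  rewrite -Zm -integralZl// -integralD//; last exact: integrableZl.
  apply: ge0_le_integral => //; mp.
  - apply: emeasurable_funD; first by meas.
    by meas.
  - by move=> w _; rewrite -EFinM -EFinD lee_fin powln_ge.
have qf : (\int[P]_w (Z w `^ (1 + h n))%:E)%E \is a fin_num.
  rewrite ge0_fin_numE ?(le_lt_trans q_le) ?ltry//.
  by apply: integral_ge0 => w _; rewrite lee_fin powR_ge0.
exists (1 + h n), (fine (\int[P]_w (Z w `^ (1 + h n))%:E)%E); split.
- by rewrite ltrDl h0/=; have := h1 n; lra.
- by rewrite fineK.
- rewrite -lte_fin fineK// (le_lt_trans q_le)// lte_fin.
  by rewrite mulrDl mul1r ltrD2l ltr_pM2l.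
Qed.

End subcritical_exponent.

(** What is kept of the process, with Z for |xi| and Y for |L|. The field [el_lap] is the Laplace
    form of the equation Y = V^m Y' + Z (1 - V)^m Y'' in law, [el_Ym] fixes the scale, and [el_q]
    makes the equation contract g-th moments. *)
Record echo_law {R : realType} (m g q : R)
    {d0} {T0 : measurableType d0} (P0 : probability T0 R)
    (Z : T0 -> R) {d} {T : measurableType d}
    (P : probability T R) (Y : T -> R) : Prop := EchoLaw {
  el_mZ : mfn Z;
  el_Z0 : forall w, 0 <= Z w;
  el_mY : mfn Y;
  el_Y0 : forall w, 0 <= Y w;
  el_m : 0 < m;
  el_g : 1 < g <= 2;
  el_Zm : (\int[P0]_w (Z w)%:E = m%:E)%E;
  el_Zg : (\int[P0]_w (Z w `^ g)%:E = q%:E)%E;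
  el_q : q < g * m;
  el_Ym : (\int[P]_w (Y w)%:E = ((gam m)^-1)%:E)%E;
  el_Yg : (\int[P]_w (Y w `^ g)%:E < +oo)%E;
  el_lap : forall t : R, 0 <= t ->
    \int[P]_w expR (- (t * Y w)) =
    \int[unif]_v ((\int[P]_w expR (- (t * `|v| `^ m * Y w))) *
      \int[P0]_z \int[P]_w expR (- (t * `|1 - v| `^ m * Z z * Y w))) }.

(** * Mean and subcritical exponent of [xi] *)

Section echo_step_mean.
Context {R : realType} {d0} {T0 : measurableType d0}
  (P0 : probability T0 R) (xi : {RV P0 >-> R}).
Hypothesis xi_ge0 : {ae P0, forall w, 0 <= xi w}.
Hypothesis xi_nz : (P0 (xi @^-1` [set 0%R]) < 1)%E.
Hypothesis xi_La : exists2 a : R, 1 < a & (xi : T0 -> R) \in Lfun P0 a%:E.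
Hypothesis xi_log : ('E_P0[(fun w => xi w * ln (xi w))%R] < 'E_P0[xi])%E.

Let m := fine 'E_P0[xi].

Lemma echo_mean : (\int[P0]_w `|xi w|%:E = m%:E)%E.
Proof.
have [a a1 La] := xi_La.
have mx : mfn (fun w => `|xi w|) by meas.
have /integrableP[_ ia] := Lfun_integrable (ltW a1) La.
have {}ia : (\int[P0]_w (`|xi w| `^ a)%:E < +oo)%E.
  move: ia; under eq_integral do rewrite gee0_abs ?lee_fin ?powR_ge0//.
  by [].
have ix : P0.-integrable setT (EFin \o (fun w => `|xi w|)).
  apply: (@ge0_integrable_powR _ _ _ _ a (fine (\int[P0]_w (`|xi w| `^ a)%:E)) a1) => //.
  rewrite fineK// ge0_fin_numE//; apply: integral_ge0 => w _; mp.
have E : (\int[P0]_w `|xi w|%:E = 'E_P0[xi])%E.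
  rewrite expectation_def; apply: ae_eq_integral => //; mp.
  - by apply: filterS xi_ge0 => w xw _; rewrite ger0_norm.
rewrite E /m fineK// -E; exact: (integrable_fin_num measurableT ix).
Qed.

Lemma echo_mean_gt0 : 0 < m.
Proof.
rewrite lt_def -(lee_fin 0) -echo_mean integral_ge0 ?andbT; last by pos.
apply/eqP => m0; have := echo_mean; rewrite m0.
under eq_integral do rewrite -abse_EFin.
move/(ae_eq_integral_abs P0 measurableT (iffRL (measurable_EFinP _ _) (measurable_funPT xi))).
move=> ae0; move: xi_nz; rewrite ltNge => /negP; apply.
rewrite -(@probability_setT _ _ _ P0).
case: ae0 => N [mN N0 sN].
apply: (@le_trans _ _ (P0 ((xi @^-1` [set 0%R]) `|` N))).
  apply: le_measure; rewrite ?inE//; first exact: measurableU.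
  move=> w _; have [x0|x0] := eqVneq (xi w) 0; [by left|right].
  by apply: sN => /= /(_ Logic.I) [] /eqP; rewrite (negbTE x0).
apply: (@le_trans _ _ (P0 (xi @^-1` [set 0%R]) + P0 N)%E); first exact: measureU2.
by rewrite N0 adde0.
Qed.

Lemma echo_subcritical : exists g q : R,
  [/\ 1 < g <= 2, (\int[P0]_w (`|xi w| `^ g)%:E = q%:E)%E & q < g * m].
Proof.
have [a a1 La] := xi_La.
have mx : mfn (fun w => `|xi w|) by meas.
apply: (@exists_subcritical _ _ _ P0 (fun w => `|xi w|) m a) => //.
- exact: echo_mean.
- have /integrableP[_] := Lfun_integrable (ltW a1) La.
  by under eq_integral do rewrite gee0_abs ?lee_fin ?powR_ge0//.
- rewrite /m fineK; last first.
    have -> : ('E_P0[xi] = \int[P0]_w `|xi w|%:E)%E; last by rewrite echo_mean.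
    rewrite expectation_def; apply: ae_eq_integral => //; mp.
    + by apply: filterS xi_ge0 => w xw _; rewrite ger0_norm.
  apply: le_lt_trans xi_log; apply: eqle.
  rewrite unlock; apply: ae_eq_integral => //.
  + by apply/measurable_EFinP; apply: measurable_funM => //; exact: measurableT_comp.
  + by apply/measurable_EFinP; apply: measurable_funM => //; exact: measurableT_comp.
  + by apply: filterS xi_ge0 => w xw _; rewrite ger0_norm.
Qed.

End echo_step_mean.

(** * Passage to the limit in the splitting identity *)

Section echo_limit_law.
Context {R : realType} {d0} {T0 : measurableType d0}
  (P0 : probability T0 R) (xi : {RV P0 >-> R}).
Context {d} {T : measurableType d} (P : probability T R).
Variables (xi_ : nat -> {RV P >-> R}) (U_ : nat -> {RV P >-> nat})
  (X : nat -> T -> R).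
Hypothesis inputs : echo_inputs xi xi_ U_.
Hypothesis recX : echo_recursion xi_ U_ X.
Variables (m g q : R) (Y : T -> R).
Hypotheses (mY : mfn Y) (Y0 : forall w, 0 <= Y w).
Hypothesis m0 : 0 < m.
Hypothesis xi_m : (\int[P0]_w `|xi w|%:E = m%:E)%E.
Hypothesis xi_q : (\int[P0]_w (`|xi w| `^ g)%:E = q%:E)%E.
Hypothesis g12 : 1 < g <= 2.
Hypothesis qgm : q < g * m.

Notation S := (echo_sum X).
Hypothesis cvgS : {ae P, forall w, n.+1%:R `^ (- m) * S n.+1 w @[n --> \oo] --> Y w}.

Let mS n : mfn (S n). Proof. exact: measurable_echo_sum inputs recX _. Qed.
Let S0 n w : 0 <= S n w. Proof. exact: echo_sum_ge0. Qed.
Let mxi : mfn (fun w => `|xi w|). Proof. by meas. Qed.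
Let Y_ n w : R := n.+1%:R `^ (- m) * S n.+1 w.

Let mY_ n : mfn (Y_ n). Proof. exact: measurable_funM. Qed.
Let Y_0 n w : 0 <= Y_ n w. Proof. by rewrite mulr_ge0 ?powR_ge0. Qed.
Let bndY : exists C : R, forall n, (\int[P]_w (Y_ n w `^ g)%:E <= C%:E)%E.
Proof.
have [C C0 HC] := moment_echo_sum inputs recX xi_m xi_q g12 qgm.
exists C => n.
have p0 : 0 < n.+1%:R `^ (g * m) :> R by pos.
have -> : (\int[P]_w (Y_ n w `^ g)%:E =
    ((n.+1%:R `^ (g * m))^-1)%:E * \int[P]_w (S n.+1 w `^ g)%:E)%E.
  rewrite -ge0_integralZl//; mp.
  - apply: eq_integral => w _; rewrite -EFinM; congr EFin.
    by rewrite /Y_ powRM ?powR_ge0// -powRrM mulNr powRN [m * g]mulrC.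
apply: (@le_trans _ _ (((n.+1%:R `^ (g * m))^-1)%:E * (C * n.+1%:R `^ (g * m))%:E)%E).
  by rewrite lee_wpmul2l ?lee_fin ?invr_ge0 ?(ltW p0)//; exact: HC.
by rewrite -EFinM lee_fin mulrC mulfK// gt_eqF.
Qed.

Lemma echo_limit_moment : (\int[P]_w (Y w `^ g)%:E < +oo)%E.
Proof.
have [C HC] := bndY; have g1 : 1 < g by move: g12; lra.
apply: le_lt_trans (ltry C).
exact: (fatou_moment mY_ mY Y_0 Y0 g1 cvgS HC).
Qed.

(** The normalised means are exactly [rising m n] over (n + 1)^m. They converge by [cvg_rising], and
    to the mean of Y by uniform integrability. *)
Lemma echo_limit_mean : (\int[P]_w (Y w)%:E = ((gam m)^-1)%:E)%E.
Proof.
have [C HC] := bndY; have g1 : 1 < g by move: g12; lra.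
have c := cvg_mean mY_ mY Y_0 Y0 g1 cvgS HC.
have E n : \int[P]_w Y_ n w = rising m n / n.+1%:R `^ m.
  rewrite /Rintegral.
  have -> : (\int[P]_w (Y_ n w)%:E =
      ((n.+1%:R `^ m)^-1)%:E * \int[P]_w (S n.+1 w)%:E)%E.
    rewrite -ge0_integralZl//; mp.
    - by apply: eq_integral => w _; rewrite -EFinM /Y_ powRN.
    - by move=> w _; rewrite lee_fin.
  by rewrite (mean_echo_sum inputs recX xi_m xi_q) -EFinM/= mulrC.
have c' : \int[P]_w Y_ n w @[n --> \oo] --> (gam m)^-1.
  under eq_fun do rewrite E; exact: (cvg_rising (ltW m0)).
have iY : P.-integrable setT (EFin \o Y).
  apply: (@ge0_integrable_powR _ _ _ _ g C g1) => //.
  exact: (fatou_moment mY_ mY Y_0 Y0 g1 cvgS HC).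
rewrite -(Rint_EFin iY); congr EFin.
exact: (@cvg_unique _ (@norm_hausdorff _ R) _ _ _ _ c c').
Qed.
Let e (y : R) : R := expR (- `|y|).

Let ne : nbm e.
Proof.
split; last by pos.
by apply: bmf_expN => //; meas.
Qed.
Let lapS n x : 0 <= x -> Psi P X e n x = \int[P]_w expR (- (x * S n w)).
Proof.
move=> x0; apply: eq_Rintegral => w _; rewrite /PP /echo_sum.
elim/big_rec2 : _ => [|i y1 y2 _ ->]; first by rewrite mulr0 oppr0 expR0.
rewrite /e ger0_norm; last by pos.
by rewrite -expRD mulrDr opprD.
Qed.
Let bexp (f : T -> R) c : mfn f -> (forall w, 0 <= f w) -> 0 <= c ->
  bmf (fun w => expR (- (c * f w))).
Proof. by meas. Qed.
Let l t := \int[P]_w expR (- (t * Y w)).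

(** A tree holding a fraction u of the nodes, normalised by the full size, behaves like u^m Y. *)
Let cvgPsi (j : nat -> nat) (u s : R) : 0 < u -> 0 <= s ->
  (j n).+1%:R / n.+2%:R @[n --> \oo] --> u ->
  Psi P X e (j n).+1 (s * n.+2%:R `^ (- m)) @[n --> \oo] --> l (s * u `^ m).
Proof.
move=> u0 s0 ju.
under eq_fun do rewrite lapS ?mulr_ge0 ?powR_ge0//.
have joo : j n @[n --> \oo] --> \oo.
  apply/cvgnyPge => A.
  have u2 : u / 2 < u by lra.
  have h : \forall n \near \oo, u / 2 < (j n).+1%:R / n.+2%:R by exact: (cvgr_gt _ ju).
  near=> n.
  have h1 : u / 2 < (j n).+1%:R / n.+2%:R by near: n.
  have h2 : (Num.truncn (A.+1%:R / (u / 2)) <= n)%N by near: n; exact: nbhs_infty_ge.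
  have h3 : A.+1%:R < (j n).+1%:R :> R.
    apply: (@lt_trans _ _ (u / 2 * n.+2%:R)); last by rewrite -ltr_pdivlMr.
    rewrite mulrC -ltr_pdivrMr ?divr_gt0//; apply: lt_le_trans (truncnS_gt _) _.
    by rewrite ler_nat ltnS ltnW.
  by move: h3; rewrite ltr_nat !ltnS => /ltnW.
apply: (@bint_cvg _ _ _ _ _ _ 1).
- by move=> n; case: (bexp (mS (j n).+1) (S0 _) (mulr_ge0 s0 (powR_ge0 n.+2%:R (- m)))).
- by case: (bexp mY Y0 (mulr_ge0 s0 (powR_ge0 u m))).
- move=> n w; rewrite ger0_norm ?expR_ge0// expR_le1 oppr_le0.
  by rewrite !mulr_ge0 ?powR_ge0.
- apply: filterS cvgS => w Sw.
  apply: (@cvg_comp _ _ _ (fun n => - (s * n.+2%:R `^ (- m) * S (j n).+1 w)) expR _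
    (nbhs (- (s * u `^ m * Y w)))); last exact: continuous_expR.
  apply: cvgN.
  have -> : (fun n => s * n.+2%:R `^ (- m) * S (j n).+1 w) =
    (fun n => s * ((j n).+1%:R / n.+2%:R) `^ m * ((j n).+1%:R `^ (- m) * S (j n).+1 w)).
    apply/funext => n; rewrite powRM ?invr_ge0//.
    have -> : (n.+2%:R^-1) `^ m = (n.+2%:R `^ m)^-1 :> R.
      by rewrite -powR_inv1// -powRrM mulN1r powRN.
    rewrite !powRN.
    have : (j n).+1%:R `^ m != 0 :> R by rewrite gt_eqF// powR_gt0.
    have : n.+2%:R `^ m != 0 :> R by rewrite gt_eqF// powR_gt0.
    by move=> a0 b0; field; rewrite a0 b0.
  apply: cvgM.
    by apply: cvgMr; apply: cvg_powR => // n; rewrite divr_ge0.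
  exact: (@cvg_comp _ _ _ j (fun k => k.+1%:R `^ (- m) * S k.+1 w) _ _ _ joo Sw).
Unshelve. all: by end_near.
Qed.
Let bK x n : 0 <= x -> bmf (fun w0 => Psi P X e n (x * `|xi w0|)).
Proof.
move=> x0.
have -> : (fun w0 => Psi P X e n (x * `|xi w0|)) =
  (fun w0 => \int[P]_w expR (- (x * `|xi w0| * S n w))).
  by apply/funext => w0; rewrite lapS// mulr_ge0.
apply: (@bmf_fubini1 _ _ _ _ _ (fun z : T0 * T => expR (- (x * `|xi z.1| * S n z.2)))).
apply: bmf_expN.
  apply: measurable_funM; last exact: (measurableT_comp (mS n) measurable_snd); mp.
by move=> z; rewrite !mulr_ge0.
Qed.
Let lK t := \int[P0]_z l (t * `|xi z|).

Let Psi01 n x : 0 <= x -> 0 <= Psi P X e n x <= 1.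
Proof.
move=> x0; rewrite lapS//; apply: bint_01; first by case: (bexp (mS n) (S0 n) x0).
by move=> w; rewrite expR_ge0/= expR_le1 oppr_le0 mulr_ge0.
Qed.
Let blxi (d' : measure_display) (S : measurableType d') (h : S -> R) :
  mfn h -> (forall x, 0 <= h x) -> bmf (fun x => l (h x)).
Proof.
move=> mh h0.
apply: (@bmf_fubini1 _ _ _ _ _ (fun z : S * T => expR (- (h z.1 * Y z.2)))); mp.
Qed.
Let cvgKap (j : nat -> nat) (u s : R) : 0 < u -> 0 <= s ->
  (j n).+1%:R / n.+2%:R @[n --> \oo] --> u ->
  Kap xi P X e (j n).+1 (s * n.+2%:R `^ (- m)) @[n --> \oo] --> lK (s * u `^ m).
Proof.
move=> u0 s0 ju; apply: (@bint_cvg _ _ _ _ _ _ 1).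
- by move=> n; case: (@bK (s * n.+2%:R `^ (- m)) (j n).+1); rewrite ?mulr_ge0 ?powR_ge0.
- have [] // := @blxi _ T0 (fun z => s * u `^ m * `|xi z|).
  + by meas.
  + by pos.
- move=> n w; have xx : 0 <= s * n.+2%:R `^ (- m) * `|xi w| by pos.
  by have /andP[a b] := Psi01 (j n).+1 xx; rewrite ger0_norm.
- apply: aeW => z.
  have -> : s * u `^ m * `|xi z| = s * `|xi z| * u `^ m by rewrite mulrAC.
  under eq_fun do rewrite mulrAC.
  by apply: cvgPsi => //; rewrite mulr_ge0.
Qed.

(** The splitting identity for f (y) = exp (- |y|) at the scale t (n + 2)^(- m). The average over
    subtree sizes is a step function whose value at v tends to the product of the limits for the
    fractions v and 1 - v. *)
Lemma echo_limit_laplace (t : R) : 0 <= t ->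
  l t = \int[unif]_v (l (t * `|v| `^ m) *
     \int[P0]_z \int[P]_w expR (- (t * `|1 - v| `^ m * `|xi z| * Y w))).
Proof.
move=> t0.
pose x n : R := t * n.+2%:R `^ (- m).
have x0 n : 0 <= x n by rewrite mulr_ge0 ?powR_ge0.
(* There are i + 1 nodes on the root side and n - i + 1 in the subtree of node 2: n + 2 in all. *)
pose F n i := Psi P X e i.+1 (x n) * Kap xi P X e (n - i).+1 (x n).
have E n : Psi P X e n.+2 (x n) = \int[unif]_v step n.+1 (F n) v.
  rewrite integral_step//; apply: (mulfI (_ : n.+1%:R != 0 :> R)); first by rewrite pnatr_eq0.
  rewrite mulVKf ?pnatr_eq0// (Psi_split inputs recX n (x n) ne).
  rewrite big_add1 big_nat_rev; apply: eq_big_nat => i /andP[_ iN].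
  have -> : (n.+2 - (0 + n.+1 - i.+1).+1)%N = i.+1 by lia.
  by have -> : (0 + n.+1 - i.+1)%N = (n - i)%N by lia.
have c1 : Psi P X e n.+2 (x n) @[n --> \oo] --> l t.
  have := @cvgPsi succn 1 t ltr01 t0; rewrite powR1 mulr1; apply.
  by under eq_fun do rewrite divff ?pnatr_eq0//; exact: cvg_cst.
apply: (@cvg_unique _ (@norm_hausdorff _ R) _ _ _ _ c1).
rewrite /=; under eq_fun do rewrite E.
apply: (@bint_cvg _ _ _ _ _ _ 1).
- by move=> n; case: (bmf_step n.+1 (F n)).
- have [] // : bmf (fun v : R => l (t * `|v| `^ m) *
     \int[P0]_z \int[P]_w expR (- (t * `|1 - v| `^ m * `|xi z| * Y w))).
  have mpw (f : R -> R) : mfn f -> mfn (fun v => t * `|f v| `^ m) by meas.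
  apply: bmfM.
    by apply: blxi; [exact: mpw|move=> v; rewrite mulr_ge0 ?powR_ge0].
  apply: (@bmf_fubini1 _ _ _ _ _ (fun p : R * T0 => l (t * `|1 - p.1| `^ m * `|xi p.2|))).
  apply: blxi; last by pos.
  by meas.
- move=> n v; apply: step_bound => // i; rewrite /F.
  have /andP[a b] := Psi01 i.+1 (x0 n).
  have /andP[a' b'] : 0 <= Kap xi P X e (n - i).+1 (x n) <= 1.
    apply: bint_01; first by case: (bK (n - i).+1 (x0 n)).
    by move=> w; apply: Psi01; rewrite mulr_ge0.
  by rewrite ger0_norm ?mulr_ge0// mulr_ile1.
- apply: filterS ae_unif_01 => v /andP[v0 v1].
  have vv : 0 <= v < 1 by rewrite ltW.
  under eq_fun do rewrite step_eval//.
  rewrite gtr0_norm//; apply: cvgM.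
    by apply: cvgPsi => //; apply: cvg_truncn; pos.
  rewrite gtr0_norm ?subr_gt0//.
  have := @cvgKap (fun n => n - Num.truncn (v * n.+1%:R))%N (1 - v) t.
  rewrite subr_gt0 /lK /l; apply => //.
  have -> : (fun n => (n - Num.truncn (v * n.+1%:R)).+1%:R / n.+2%:R) =
     (fun n => 1 - (Num.truncn (v * n.+1%:R)).+1%:R / n.+2%:R) :> (nat -> R).
    apply/funext => n.
    have tM : (Num.truncn (v * n.+1%:R) <= n)%N.
      by rewrite -ltnS truncn_lt_nat ?mulr_ge0 ?ltW// -[ltRHS]mul1r ltr_pM2r.
    rewrite -subSn// -subSS natrB ?ltnS; last by rewrite ltnW.
    by rewrite mulrBl divff ?pnatr_eq0.
  apply: cvgB; first exact: cvg_cst.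
  by apply: cvg_truncn; pos.
Qed.

Lemma echo_law_of_cvg : echo_law m g q P0 (fun w => `|xi w|) P Y.
Proof.
split => //.
- exact: echo_limit_mean.
- exact: echo_limit_moment.
- exact: echo_limit_laplace.
Qed.

End echo_limit_law.

(** [echo_sum] is built from absolute values. Almost surely all factors are nonnegative, so it
    coincides with the sum that defines L, and the limit is nonnegative. *)
Lemma echo_limit_cvg {R : realType} {d0} {T0 : measurableType d0}
    (P0 : probability T0 R) (xi : {RV P0 >-> R})
    {d} {T : measurableType d} (P : probability T R)
    (L : {RV P >-> R}) (xi_ : nat -> {RV P >-> R}) (U_ : nat -> {RV P >-> nat})
    (X : nat -> T -> R) :
  {ae P0, forall w, 0 <= xi w} -> echo_inputs xi xi_ U_ -> echo_recursion xi_ U_ X ->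
  {ae P, forall w, (n%:R `^ (- fine 'E_P0[xi]) * \sum_(1 <= k < n.+1) X k w)
          @[n --> \oo] --> (L w : R)} ->
  {ae P, forall w, n.+1%:R `^ (- fine 'E_P0[xi]) * echo_sum X n.+1 w @[n --> \oo] --> L w /\ 0 <= L w}.
Proof.
move=> xi0 inputs recX cL.
have xin n : {ae P, forall w, (2 <= n)%N -> 0 <= xi_ n w}.
  have [n2|n2] := leqP 2 n; last by apply: aeW => w.
  exists (xi_ n @^-1` `]-oo, (0:R)[%classic); split; mp.
  - rewrite (echo_copies inputs n2)//; case: xi0 => N [mN N0 sN].
    apply/eqP; rewrite eq_le measure_ge0 andbT -N0; apply: le_measure; rewrite ?inE//; mp.
    by move=> w /=; rewrite in_itv/= => xw; apply: sN => /=; rewrite leNgt xw.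
  - by move=> w /= H; rewrite in_itv/= ltNge; apply/negP => h; apply: H.
have xiN : {ae P, forall w, forall n, (2 <= n)%N -> 0 <= xi_ n w}.
  by apply/ae_foralln.
apply: filterS2 xiN cL => w xw cw.
have [X1 XS] := recX.
have X0 k : (1 <= k)%N -> 0 <= X k w.
  elim/ltn_ind : k => k IH k1.
  have [->|kn1] := eqVneq k 1%N; first by rewrite X1.
  have k2 : (2 <= k)%N by lia.
  have /andP[U1 Uk] := echo_range inputs w k2.
  by rewrite XS// mulr_ge0 ?xw// IH.
have SE n : echo_sum X n w = \sum_(1 <= k < n.+1) X k w.
  by apply: eq_big_nat => k /andP[k1 _]; rewrite /ax ger0_norm ?X0.
have c1 : n.+1%:R `^ (- fine 'E_P0[xi]) * echo_sum X n.+1 w @[n --> \oo] --> L w.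
  under eq_fun do rewrite SE.
  by have := cw; rewrite -cvg_shiftS.
split => //; apply: (cvgr_to_ge c1); apply: nearW => n.
by rewrite mulr_ge0 ?powR_ge0// echo_sum_ge0.
Qed.

(** * Transfer of integrals between equal laws *)

Section equal_laws.
Context {R : realType} {d1 d2 d : measure_display} {T1 : measurableType d1}
  {T2 : measurableType d2} {S : measurableType d}
  (P1 : probability T1 R) (P2 : probability T2 R) (X1 : T1 -> S) (X2 : T2 -> S).
Hypotheses (mX1 : mfn X1) (mX2 : mfn X2).
Hypothesis XX : eq_law P1 P2 X1 X2.

Lemma eq_law_ge0 (h : S -> \bar R) : mfn h -> (forall x, 0 <= h x)%E ->
  (\int[P1]_w h (X1 w) = \int[P2]_w h (X2 w))%E.
Proof.
move=> mh h0.
transitivity (\int[pushm P1 mX1]_x h x)%E.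
  by rewrite (@ge0_integral_pushforward _ _ _ _ _ _ mX1 P1 setT).
transitivity (\int[pushm P2 mX2]_x h x)%E; last by rewrite (@ge0_integral_pushforward _ _ _ _ _ _ mX2 P2 setT).
by apply: eq_measure_integral => A mA _; exact: XX.
Qed.

Lemma eq_law_bint (h : S -> R) : bmf h -> \int[P1]_w h (X1 w) = \int[P2]_w h (X2 w).
Proof.
move=> [mh [M hM]].
have bh1 : bmf (fun w => h (X1 w)).
  by apply: (@bmf_le _ _ _ _ M) => [|w]; [by meas|exact: hM].
have bh2 : bmf (fun w => h (X2 w)).
  by apply: (@bmf_le _ _ _ _ M) => [|w]; [by meas|exact: hM].
have := @eq_law_ge0 (fun x => (h x + M)%:E) _ _.
have mM : mfn (fun x => (h x + M)%:E) by meas.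
have M0 x : (0 <= (h x + M)%:E)%E.
  by rewrite lee_fin -lerBlDr sub0r; have := hM x; rewrite ler_norml => /andP[].
move=> /(_ mM M0).
rewrite -bint_EFin; last by meas.
rewrite -bint_EFin; last by meas.
move=> [].
rewrite bintD//; last by meas.
by rewrite bintD ?bint_cst//; [move/addIr|by meas].
Qed.

End equal_laws.

Lemma prob_intc {R : realType} {d} {T : measurableType d}
  (P : probability T R) (c : R) : (\int[P]__ c%:E = c%:E)%E.
Proof. by rewrite (@integral_cst _ _ _ P _ measurableT c%:E)/= probability_setT mule1. Qed.

Section unif_powers.
Context {R : realType}.
Notation unif := (@unif R).

Lemma integral_unif_powR1 (s : R) : -1 < s ->
  (\int[unif]_v (`|1 - v| `^ s)%:E = ((1 + s)^-1)%:E)%E.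
Proof.
move=> s1; rewrite -(integral_unif_powR s1).
rewrite (@unif_sym _ (fun v => (`|v| `^ s)%:E))//; by meas.
Qed.

End unif_powers.

Definition oball {R : realType} (x e : R) : set R := `]x - e, x + e[%classic.

Lemma oballE {R : realType} (x e y : R) : oball x e y = (x - e < y < x + e) :> Prop.
Proof. by rewrite /oball/= in_itv. Qed.

Lemma measurable_oball {R : realType} (x e : R) : measurable (oball x e).
Proof. by meas. Qed.

Lemma pprodX {R : realType} {d1 d2 : measure_display} {T1 : measurableType d1}
  {T2 : measurableType d2} (P1 : probability T1 R) (P2 : probability T2 R)
  (A : set T1) (B : set T2) : measurable A -> measurable B ->
  pprod P1 P2 (A `*` B) = (P1 A * P2 B)%E.
Proof. by move=> mA mB; exact: product_measure1E. Qed.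

(** * Support of a law *)

Section positive_support.
Context {R : realType} {d} {T : measurableType d}
  (P : probability T R) (Y : T -> R).
Hypothesis mY : mfn Y.

Definition psupp (x : R) : Prop :=
  forall e : R, 0 < e -> (0 < P (Y @^-1` (oball x e)))%E.

Lemma prob_eq0 (A : set T) : ~ (0 < P A)%E -> P A = 0%E.
Proof. by move=> /negP; rewrite -leNgt => PA; apply/eqP; rewrite eq_le PA measure_ge0. Qed.

(** A point outside the support lies in an interval of mass 0 with rational ends, and there are
    countably many of these; [A] enumerates them. *)
Lemma ae_psupp : {ae P, forall w, psupp (Y w)}.
Proof.
pose A (n : nat) : set R :=
  if (unpickle n : option (rat * rat)) is Some (r, s) then `]ratr r, ratr s[%classic else set0.
have mA n : measurable (A n).
  by rewrite /A; case: unpickle => [[r s]|]; [by meas|exact: measurable0].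
have H n : {ae P, forall w, P (Y @^-1` (A n)) = 0%E -> ~ A n (Y w)}.
  have [PA|PA] := eqVneq (P (Y @^-1` (A n))) 0%E; last by apply: aeW => w PA0; rewrite PA0 eqxx in PA.
  exists (Y @^-1` (A n)); split => //; first exact: preimage_measurable.
  by move=> w /= /not_implyP[_ /contrapT].
have /ae_foralln {}H := H.
apply: filterS H => w Hw e e0; apply: contrapT => /prob_eq0 PA.
have [r] : exists r, ratr r \in `](Y w - e), (Y w)[ by apply: rat_in_itvoo; rewrite ltrBlDr ltrDl.
rewrite in_itv/= => /andP[r1 r2].
have [s] : exists s, ratr s \in `](Y w), (Y w + e)[ by apply: rat_in_itvoo; rewrite ltrDl.
rewrite in_itv/= => /andP[s1 s2].
have AE : A (pickle (r, s)) = `]ratr r, ratr s[%classic by rewrite /A pickleK.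
apply: (Hw (pickle (r, s))); rewrite AE; last by rewrite /= in_itv/= r2 s1.
apply/eqP; rewrite eq_le measure_ge0 andbT -PA; apply: le_measure; rewrite ?inE; mp.
- move=> z /=; rewrite oballE in_itv/= => /andP[z1 z2].
  by rewrite (lt_trans r1 z1) (lt_trans z2 s2).
Qed.

Lemma psupp_nbhs x (U : set R) : nbhs x U -> psupp x ->
  exists2 A : set R, measurable A & A `<=` U /\ (0 < P (Y @^-1` A))%E.
Proof.
move=> /nbhs_ballP[e /= e0 eU] sx.
exists (oball x e); first by meas.
split; last exact: sx.
move=> y; rewrite /oball/= in_itv/= => /andP[y1 y2]; apply: eU; rewrite /ball/=.
by rewrite ltr_norml; apply/andP; split; lra.
Qed.

End positive_support.

Lemma nonempty_ae {R : realType} {d} {T : measurableType d}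
  (P : probability T R) (Q : T -> Prop) : {ae P, forall w, Q w} -> exists w, Q w.
Proof.
move=> aeQ; apply: contrapT => nQ.
have : {ae P, forall w, False} by apply: filterS aeQ => w Qw; apply: nQ; exists w.
move=> [A [mA A0 sA]]; have : (P setT <= P A)%E.
  by rewrite le_measure ?inE// => t _; apply: sA.
by rewrite A0 probability_setT lee_fin ler10.
Qed.

(** * Level sets of v -> a v^m + b (1 - v)^m *)

Section root_counting.
Context {R : realType}.
Variables (m a b x : R).
Hypotheses (m0 : 0 < m) (m1 : m != 1) (x0 : 0 < x).

Let h (v : R) : R := a * v `^ m + b * (1 - v) `^ m.
Let dh (v : R) : R := m * (a * v `^ (m - 1) - b * (1 - v) `^ (m - 1)).

Let is_derive_h (v : R) : 0 < v < 1 -> is_derive v 1 h (dh v).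
Proof.
move=> /andP[v0 v1].
have pd (u : R) : 0 < u -> is_derive u 1 (fun y : R => y `^ m) (m * u `^ (m - 1)).
  move=> u0; apply: DeriveDef.
    by apply: derivable_powR; rewrite in_itv/= andbT.
  by rewrite -derive1E powR_derive1// in_itv/= andbT.
have d1 : is_derive v 1 (fun y : R => 1 - y) (-1).
  have -> : (fun y : R => 1 - y) = (cst 1 - id) :> (R -> R) by [].
  by apply: is_derive_eq; rewrite sub0r.
have u0 : 0 < 1 - v by rewrite subr_gt0.
have d2 : is_derive v 1 (fun y : R => (1 - y) `^ m) (- (m * (1 - v) `^ (m - 1))).
  have := @is_derive1_comp R (fun y : R => y `^ m) (fun y : R => 1 - y) v _ _ (pd _ u0) d1.
  by rewrite mulrN1.
have := @is_deriveD _ _ _ _ _ _ _ _ _ (is_deriveZ a (pd v v0)) (is_deriveZ b d2).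
move=> H; apply: is_derive_eq; rewrite /dh /GRing.scale/=; ring.
Qed.
Let cont_h (u v : R) : 0 < u -> v < 1 -> {within `[u, v], continuous h}.
Proof.
move=> u0 v1; apply: derivable_within_continuous => z; rewrite in_itv/= => /andP[uz zv].
have z01 : 0 < z < 1 by rewrite (lt_le_trans u0 uz) (le_lt_trans zv v1).
by have [] := is_derive_h z01.
Qed.
(** A critical point satisfies a c^(m - 1) = b (1 - c)^(m - 1); as m differs from 1, this fixes the
    ratio c / (1 - c). *)
Let crit_unique (c1 c2 : R) : 0 < c1 < 1 -> 0 < c2 < 1 -> (a != 0) || (b != 0) ->
  dh c1 = 0 -> dh c2 = 0 -> c1 = c2.
Proof.
move=> /andP[p1 q1] /andP[p2 q2] ab E1 E2.
have s0 : m - 1 != 0 by rewrite subr_eq0.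
have eqc (c : R) : 0 < c -> c < 1 -> dh c = 0 -> a * c `^ (m - 1) = b * (1 - c) `^ (m - 1).
  move=> _ _ /eqP; rewrite /dh mulf_eq0 gt_eqF//= subr_eq0 => /eqP ->; by [].
have {}E1 := eqc _ p1 q1 E1; have {}E2 := eqc _ p2 q2 E2.
have pp1 : 0 < c1 `^ (m - 1) by pos.
have pp2 : 0 < c2 `^ (m - 1) by pos.
have qq1 : 0 < (1 - c1) `^ (m - 1) by rewrite powR_gt0// subr_gt0.
have bn0 : b != 0.
  apply/negP => /eqP bz; move: ab; rewrite bz eqxx orbF => /negP; apply.
  by move/eqP : E1; rewrite bz mul0r mulf_eq0 (gt_eqF pp1) orbF.
have an0 : a != 0.
  apply/negP => /eqP az; move/negP: bn0; apply.
  by move/esym/eqP : E1; rewrite az mul0r mulf_eq0 (gt_eqF qq1) orbF.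
have E : (c1 * (1 - c2)) `^ (m - 1) = (c2 * (1 - c1)) `^ (m - 1).
  rewrite !powRM ?subr_ge0 ?ltW//.
  apply: (mulfI an0); apply: (mulfI bn0).
  rewrite [a * _]mulrA E1 [a * (c2 `^ _ * _)]mulrA E2; ring.
have {}E : c1 * (1 - c2) = c2 * (1 - c1).
  have l1 : 0 < c1 * (1 - c2) by rewrite mulr_gt0// subr_gt0.
  have l2 : 0 < c2 * (1 - c1) by rewrite mulr_gt0// subr_gt0.
  apply: (@ln_inj R); rewrite ?posrE//.
  by apply: (mulfI s0); rewrite -!ln_powR E.
by move: E; lra.
Qed.
Let no_three (v1 v2 v3 : R) : 0 < v1 -> v1 < v2 -> v2 < v3 -> v3 < 1 ->
  h v1 = x -> h v2 = x -> h v3 = x -> False.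
Proof.
move=> p1 p12 p23 p3 E1 E2 E3.
have ab : (a != 0) || (b != 0).
  rewrite -negb_and; apply/negP => /andP[/eqP az /eqP bz].
  by move: E1 x0; rewrite /h az bz !mul0r addr0 => <-; rewrite ltxx.
have dr (u v : R) : 0 < u -> v < 1 -> forall z, z \in `]u, v[ -> derivable h z 1.
  move=> u0 v1' z; rewrite in_itv/= => /andP[uz zv].
  have z01 : 0 < z < 1 by rewrite (lt_trans u0 uz) (lt_trans zv v1').
  by have [] := is_derive_h z01.
have v21 : v2 < 1 by exact: lt_trans p3.
have v20 : 0 < v2 by exact: lt_trans p12.
have [c1] := Rolle p12 (dr _ _ p1 v21) (cont_h p1 v21) (etrans E1 (esym E2)).
rewrite in_itv/= => /andP[c1a c1b] d1.
have [c2] := Rolle p23 (dr _ _ v20 p3) (cont_h v20 p3) (etrans E2 (esym E3)).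
rewrite in_itv/= => /andP[c2a c2b] d2.
have i1 : 0 < c1 < 1 by rewrite (lt_trans p1 c1a) (lt_trans c1b v21).
have i2 : 0 < c2 < 1 by rewrite (lt_trans v20 c2a) (lt_trans c2b p3).
have e1 : dh c1 = 0.
  by rewrite -(@derive_val _ _ _ _ _ _ _ d1) (@derive_val _ _ _ _ _ _ _ (is_derive_h i1)).
have e2 : dh c2 = 0.
  by rewrite -(@derive_val _ _ _ _ _ _ _ d2) (@derive_val _ _ _ _ _ _ _ (is_derive_h i2)).
have := crit_unique i1 i2 ab e1 e2.
by move=> c12; move: (lt_trans c1b c2a); rewrite c12 ltxx.
Qed.

(** By Rolle's theorem three solutions would give two critical points. The condition x > 0 rules out
    a = b = 0. *)
Lemma level_set_pair : exists c1 c2 : R, forall v, 0 < v < 1 -> h v = x -> v = c1 \/ v = c2.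
Proof.
have [[c1 [c10 c1x]]|H] := pselect (exists c, 0 < c < 1 /\ h c = x); last by exists 0, 0 => v v01 vx; exfalso; apply: H; exists v.
have [[c2 [c20 c2x c12]]|H] := pselect (exists c, [/\ 0 < c < 1, h c = x & c != c1]); last first.
  exists c1, c1 => v v01 vx; left; apply: contrapT => vc1; apply: H; exists v; split => //.
  exact/eqP.
exists c1, c2 => v v01 vx; apply: contrapT => /not_orP[/eqP n1 /eqP n2].
move: v01 c10 c20 => /andP[va vb] /andP[c1a c1b] /andP[c2a c2b].
case/lt_total/orP : n1 => n1; case/lt_total/orP : n2 => n2; case/lt_total/orP : c12 => n3.
- exact: (no_three va n2 n3 c1b).
- exact: (no_three va n1 n3 c2b).
- exact: (no_three c2a n2 n1 c1b).
- by move: (lt_trans n1 (lt_trans n3 n2)); rewrite ltxx.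
- by move: (lt_trans n1 (lt_trans n2 n3)); rewrite ltxx.
- exact: (no_three c1a n1 n2 c2b).
- exact: (no_three c2a n3 n1 vb).
- exact: (no_three c1a n3 n2 vb).
Qed.

End root_counting.

(** * Probabilities as integrals of indicators; point masses *)

Section point_masses.
Context {R : realType} {d} {T : measurableType d}
  (P : probability T R) (Y : T -> R).
Hypothesis mY : mfn Y.

Lemma bmf_indic_comp (A : set R) : measurable A -> bmf (fun w => \1_A (Y w) : R).
Proof.
move=> mA; have [m1 [M h]] := @bmf_indic R _ _ A mA.
by apply: (@bmf_le _ _ _ _ M) => [|w]; [by meas|exact: h].
Qed.

Lemma prob_bint (A : set R) : measurable A ->
  P (Y @^-1` A) = (\int[P]_w (\1_A (Y w) : R))%:E.
Proof.
move=> mA; rewrite bint_EFin; last exact: bmf_indic_comp.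
rewrite -[X in P X]setIT -(@integral_indic _ _ _ P _ measurableT)//; mp.
Qed.

Lemma ae_of_mass1 (x : R) : \int[P]_w (\1_[set x] (Y w) : R) = 1 -> {ae P, forall w, Y w = x}.
Proof.
move=> I1; have mx : measurable (Y @^-1` [set x]) by meas.
exists (~` (Y @^-1` [set x])); split; first exact: measurableC.
  by rewrite probability_setC// prob_bint// I1 subee.
by [].
Qed.

End point_masses.

Lemma unif_set1 {R : realType} (c : R) : {ae (@unif R), forall v, v != c}.
Proof.
exists [set c]; split => //.
  rewrite -[X in unif X]setIT -(@integral_indic _ _ _ (@unif R) _ measurableT)//.
  rewrite ge0_integral_unif//; last by apply/measurable_EFinP; exact: measurable_indic.
  apply/eqP; rewrite eq_le; apply/andP; split; last by apply: integral_ge0 => v _; rewrite lee_fin.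
  apply: (@le_trans _ _ (\int[lebesgue_measure]_x (\1_[set c] x)%:E)%E).
    apply: ge0_subset_integral => //.
    by apply/measurable_EFinP; exact: measurable_indic.
  rewrite (@integral_indic _ (measurableTypeR R))// setIT.
  by rewrite -[leLHS]/(@lebesgue_measure R [set c]) lebesgue_measure_set1.
by move=> v /=; apply: contra_notP => /eqP.
Qed.

(** The bound is asked for all t > 0, as scaling arguments require. For values in [0, 1] and b > 0
    it follows from the bound for large t, with a larger C. *)
Definition decays {R : realType} (g : R -> R) (b : R) : Prop :=
  exists2 C : R, 0 <= C & forall t : R, 0 < t -> g t <= C * t `^ (- b).

Lemma pow_decay {R : realType} (a t x : R) : 0 < a -> 0 < t -> 0 < x ->
  (t * x) `^ (- a) = t `^ (- a) * x `^ (- a).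
Proof. by move=> a0 t0 x0; rewrite powRM ?ltW. Qed.

Lemma powRN_decr {R : realType} (s x y : R) : 0 < s -> 0 < x -> x <= y ->
  y `^ (- s) <= x `^ (- s).
Proof.
move=> s0 x0 xy; have y0 : 0 < y by exact: lt_le_trans xy.
rewrite !powRN lef_pV2 ?posrE ?powR_gt0//.
by apply: ge0_ler_powR => //; rewrite ?nnegrE; pos.
Qed.

Lemma ge0_integral_lin {R : realType} {d} {T : measurableType d}
    (P : probability T R) (f k : T -> R) (a b : R) :
  mfn f -> mfn k -> (forall x, 0 <= f x) ->
  (forall x, 0 <= k x) -> 0 <= a -> 0 <= b ->
  (\int[P]_x (a * f x + b * k x)%:E =
    a%:E * \int[P]_x (f x)%:E + b%:E * \int[P]_x (k x)%:E)%E.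
Proof.
move=> mf mk f0 k0 a0 b0; under eq_integral do rewrite EFinD.
rewrite ge0_integralD//=.
- under eq_integral do rewrite EFinM.
  rewrite ge0_integralZl_EFin//=; mp.
  + congr (_ + _)%E; under eq_integral do rewrite EFinM.
    rewrite ge0_integralZl_EFin//=; last by meas.
    by pos.
- by move=> x _; rewrite lee_fin mulr_ge0.
- by meas.
- by move=> x _; rewrite lee_fin mulr_ge0.
- by meas.
Qed.

Lemma half_compl {R : realType} (v : R) : v < 2^-1 -> 2^-1 <= 1 - v.
Proof. by lra. Qed.

Lemma bint_EFin_le {R : realType} {d} {T : measurableType d}
    (P : probability T R) (f k : T -> R) :
  bmf f -> (forall x, 0 <= f x) -> mfn k -> (forall x, 0 <= k x) ->
  {ae P, forall x, f x <= k x} -> ((\int[P]_x f x)%:E <= \int[P]_x (k x)%:E)%E.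
Proof.
move=> bf f0 mk k0 fk; rewrite bint_EFin//; case: bf => mf _.
apply: ae_ge0_le_integral => //; try by meas.
- by pos.
- by pos.
- by apply: filterS fk => x h _; rewrite lee_fin.
Qed.

(** * Bootstrap of power decay from a product inequality *)

Section decay.
Context {R : realType} {d0} {T0 : measurableType d0}
  (P0 : probability T0 R) (Z : T0 -> R).
Variables (m : R) (g : R -> R).
Hypotheses (mZ : mfn Z) (Z0 : forall u, 0 <= Z u) (m0 : 0 < m).
Hypotheses (mg : mfn g) (g01 : forall t, 0 <= g t <= 1).
Notation unif := (@unif R).
Let G (t v : R) : R := \int[P0]_u g (t * `|1 - v| `^ m * Z u).
Hypothesis geq : forall t : R, 0 < t -> g t <= \int[unif]_v (g (t * `|v| `^ m) * G t v).

Let mp : mfn (fun v : R => `|v| `^ m).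
Proof. by meas. Qed.
Let bg (t : R) : bmf (fun v : R => g (t * `|v| `^ m)).
Proof.
apply: bmf01 => // ; apply: (measurableT_comp mg); by meas.
Qed.
Let bZ (t : R) : bmf (fun p : R * T0 => g (t * `|1 - p.1| `^ m * Z p.2)).
Proof.
apply: bmf01 => //; apply: (measurableT_comp mg); apply: measurable_funM.
  by meas.
by meas.
Qed.
Let bG (t : R) : bmf (G t).
Proof. exact: (bmf_fubini1 (bZ t) P0). Qed.
Let G01 t v : 0 <= G t v <= 1.
Proof. by apply: bint_01 => //; case: (bmf_pair1 (bZ t) v). Qed.
(** Smallness beyond T1 and the trivial bound 1 before it, in one formula. *)
Let cut (a e T1 s : R) : 0 < a -> 0 < e -> 0 < T1 -> (forall t : R, T1 <= t -> g t <= e) ->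
  0 < s -> g s <= e + T1 `^ a * s `^ (- a).
Proof.
move=> a0 e0 T10 h s0; have p0 : 0 <= T1 `^ a * s `^ (- a) by pos.
have [/h le|sT] := leP T1 s; first by apply: le_trans le _; rewrite lerDl.
have /andP[_ g1] := g01 s; apply: (le_trans g1).
suff h1 : 1 <= T1 `^ a * s `^ (- a) by rewrite -[1]add0r lerD// ltW.
have -> : 1 = s `^ a * s `^ (- a) :> R.
  by rewrite -powRD ?addrN ?powRr0// (gt_eqF s0) implybT.
rewrite ler_pM2r ?powR_gt0//; apply: ge0_ler_powR; rewrite ?nnegrE; exact: ltW.
Qed.

Section first_order.
Variables (a A0 : R).
Hypotheses (a0 : 0 < a) (am : a * m < 1).
Hypothesis Zpos : {ae P0, forall u, 0 < Z u}.
Hypothesis Za : (\int[P0]_u (Z u `^ (- a))%:E = A0%:E)%E.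
Hypothesis gto0 : forall e : R, 0 < e -> exists2 T1 : R, 0 < T1 & forall t : R, T1 <= t -> g t <= e.

Let A00 : 0 <= A0.
Proof.
by rewrite -lee_fin -Za; apply: integral_ge0 => u _; rewrite lee_fin powR_ge0.
Qed.
Let powm (f : R -> R) : mfn f ->
  mfn (fun v : R => `|f v| `^ (- (a * m))).
Proof. by meas. Qed.
Let powm0 : mfn (fun v : R => `|v| `^ (- (a * m))).
Proof. by meas. Qed.
Let Gle (e T1 t v : R) : 0 < e -> 0 < T1 -> (forall t : R, T1 <= t -> g t <= e) ->
  0 < t -> 0 < v < 1 -> G t v <= e + T1 `^ a * A0 * t `^ (- a) * `|1 - v| `^ (- (a * m)).
Proof.
move=> e0 T10 h t0 /andP[v0 v1]; rewrite -lee_fin.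
have u0 : 0 < `|1 - v| by rewrite normr_gt0 subr_eq0 gt_eqF.
pose k u := e + (T1 `^ a * t `^ (- a) * `|1 - v| `^ (- (a * m))) * Z u `^ (- a).
have k0 u : 0 <= k u by rewrite /k addr_ge0 ?(ltW e0)// !mulr_ge0 ?powR_ge0.
have mZa : mfn (fun u => Z u `^ (- a)) by meas.
have mk : mfn k.
  by apply: measurable_funD => //; apply: measurable_funM.
apply: (@le_trans _ _ (\int[P0]_u (k u)%:E)%E).
  apply: bint_EFin_le => //; first exact: (bmf_pair1 (bZ t) v).
    by move=> u; case/andP: (g01 (t * `|1 - v| `^ m * Z u)).
  apply: filterS Zpos => u u1.
  have s0 : 0 < t * `|1 - v| `^ m * Z u by pos.
  apply: (le_trans (cut a0 e0 T10 h s0)).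
  rewrite /k lerD2l !pow_decay// ?mulr_gt0 ?powR_gt0// -powRrM mulrN (mulrC m).
  by rewrite !mulrA.
rewrite /k; under eq_integral do rewrite -[X in X + _]mulr1.
rewrite (@ge0_integral_lin _ _ _ P0 (fun=> 1) (fun u => Z u `^ (- a)))//; mp.
rewrite prob_intc mule1 Za -EFinM -EFinD lee_fin lerD2l; apply: eqle; ring.
Qed.
(** Only the second factor is estimated, by [cut]; a m < 1 makes (1 - v)^(- a m) integrable. *)
Let step1 (e : R) : 0 < e -> exists2 B : R, 0 <= B &
  forall t : R, 0 < t -> g t <= e * \int[unif]_v g (t * `|v| `^ m) + B * t `^ (- a).
Proof.
move=> e0; have [T1 T10 h] := gto0 e0.
have am1 : 0 < 1 - a * m by rewrite subr_gt0.
exists (T1 `^ a * A0 / (1 - a * m)); first by pos.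
move=> t t0; apply: (le_trans (geq t0)); rewrite -lee_fin.
pose c := T1 `^ a * A0 * t `^ (- a).
have c0 : 0 <= c by rewrite !mulr_ge0 ?powR_ge0.
have m1 : mfn (fun v : R => 1 - v) by exact: measurable_funB.
have g0 s : 0 <= g s by case/andP: (g01 s).
pose k (v : R) := e * g (t * `|v| `^ m) + c * `|1 - v| `^ (- (a * m)).
have mg1 : mfn (fun v : R => g (t * `|v| `^ m)) by case: (bg t).
have mk : mfn k.
  by apply: measurable_funD; apply: measurable_funM => //; exact: powm.
have k0 v : 0 <= k v by rewrite addr_ge0// mulr_ge0 ?(ltW e0) ?powR_ge0.
apply: (@le_trans _ _ (\int[unif]_v (k v)%:E)%E).
  apply: bint_EFin_le => //; mp.
  apply: filterS ae_unif_01 => v v01.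
  apply: (le_trans (ler_wpM2l (g0 _) (Gle e0 T10 h t0 v01))).
  rewrite mulrDr /k [e * _]mulrC lerD2l ler_piMl//; mp.
  by case/andP: (g01 (t * `|v| `^ m)).
rewrite /k (@ge0_integral_lin _ _ _ unif (fun v : R => g (t * `|v| `^ m))
  (fun v : R => `|1 - v| `^ (- (a * m))))//; mp.
rewrite integral_unif_powR1; last by rewrite ltrN2.
rewrite -bint_EFin; last exact: bg.
by rewrite -!EFinM -EFinD lee_fin lerD2l /c mulrAC.
Qed.

(** By [step1], g is at most e times an average of itself plus B t^(- a). Iterating from g <= 1
    gives the bound 2 B t^(- a) + e^n. *)
Lemma decays_first : decays g a.
Proof.
have am1 : 0 < 1 - a * m by rewrite subr_gt0.
(* Averaging (t v^m)^(- a) over v costs the factor 1 / (1 - a m); this e turns it into 1 / 2, so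
   that the constant 2 B reproduces itself. *)
pose e := (1 - a * m) / 2; have e0 : 0 < e by rewrite divr_gt0.
have e1 : e < 1.
  by rewrite /e ltr_pdivrMr// mul1r; have := mulr_gt0 a0 m0; lra.
have [B B0 hB] := step1 e0; exists (2 * B); first by pos.
have ind n : forall t : R, 0 < t -> g t <= 2 * B * t `^ (- a) + e ^+ n.
  elim: n => [t t0|n IH t t0].
    rewrite expr0; have /andP[_ g1] := g01 t; apply: (le_trans g1).
    by rewrite lerDr mulr_ge0 ?powR_ge0// mulr_ge0.
  apply: (le_trans (hB t t0)).
  suff I : \int[unif]_v g (t * `|v| `^ m) <= 2 * B * t `^ (- a) / (1 - a * m) + e ^+ n.
    apply: (@le_trans _ _ (e * (2 * B * t `^ (- a) / (1 - a * m) + e ^+ n) + B * t `^ (- a))).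
      by rewrite lerD2r ler_wpM2l ?(ltW e0).
    rewrite exprS /e; apply: eqle; field.
    by rewrite gt_eqF.
  rewrite -lee_fin.
  pose k (v : R) := 2 * B * t `^ (- a) * `|v| `^ (- (a * m)) + e ^+ n.
  have c0 : 0 <= 2 * B * t `^ (- a) by pos.
  have en0 : 0 <= e ^+ n by pos.
  have mk : mfn k.
    by apply: measurable_funD => //; apply: measurable_funM => //; exact: powm0.
  have k0 v : 0 <= k v by rewrite addr_ge0// mulr_ge0 ?powR_ge0.
  apply: (@le_trans _ _ (\int[unif]_v (k v)%:E)%E).
    apply: bint_EFin_le => //.
      by move=> v; case/andP: (g01 (t * `|v| `^ m)).
    apply: filterS ae_unif_01 => v /andP[v0 v1].
    have pv : 0 < `|v| `^ m by rewrite powR_gt0// normr_gt0 gt_eqF.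
    apply: (le_trans (IH _ (mulr_gt0 t0 pv))).
    rewrite /k lerD2r pow_decay// -powRrM mulrN (mulrC m) mulrA.
    exact: lexx.
  rewrite /k; under eq_integral do rewrite -[X in _ + X]mulr1.
  rewrite (@ge0_integral_lin _ _ _ unif (fun v : R => `|v| `^ (- (a * m))) (fun=> 1))//.
  rewrite integral_unif_powR; last by rewrite ltrN2.
  by rewrite prob_intc mule1.
move=> t t0; rewrite -subr_le0; apply: le0_eps => eps eps0; rewrite lerBlDl.
have : e ^+ n @[n --> \oo] --> (0 : R).
  by apply: cvg_expr; rewrite ger0_norm ?(ltW e0).
move=> /cvgrPdist_lt /(_ _ eps0) [N _ /(_ N (leqnn N))] /=.
rewrite sub0r normrN ger0_norm ?exprn_ge0 ?(ltW e0)// => /ltW h.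
by apply: (le_trans (ind N t t0)); rewrite lerD2l.
Qed.

End first_order.

Section boost.
Variables (a b e : R).
Hypotheses (a0 : 0 < a) (am : a * m < 1) (b0 : 0 < b) (e0 : 0 < e).
Hypothesis Ze : {ae P0, forall u, e <= Z u}.

Let powm (f : R -> R) : mfn f ->
  mfn (fun v : R => `|f v| `^ (- (a * m))).
Proof. by meas. Qed.
Let Gdec (s C t v : R) : 0 < s -> 0 <= C -> (forall t : R, 0 < t -> g t <= C * t `^ (- s)) ->
  0 < t -> 0 < v < 1 -> G t v <= C * e `^ (- s) * (t `^ (- s) * (`|1 - v| `^ m) `^ (- s)).
Proof.
move=> s0 C0 h t0 /andP[v0 v1].
have w0 : 0 < `|1 - v| `^ m by rewrite powR_gt0// normr_gt0 subr_eq0 gt_eqF.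
rewrite -lee_fin -[leRHS](prob_intc P0).
apply: (@bint_EFin_le _ _ _ _ _ (fun _ => C * e `^ (- s) * (t `^ (- s) * (`|1 - v| `^ m) `^ (- s)))) => //; mp.
- exact: (bmf_pair1 (bZ t) v).
- by move=> u; case/andP: (g01 (t * `|1 - v| `^ m * Z u)).
apply: filterS Ze => u eu; have u0 : 0 < Z u by exact: lt_le_trans eu.
apply: (le_trans (h _ _)); first by pos.
rewrite -[leRHS]mulrA ler_wpM2l// pow_decay ?mulr_gt0// pow_decay// mulrC.
by rewrite ler_wpM2r ?mulr_ge0 ?powR_ge0// powRN_decr.
Qed.
Let pow_half (v : R) : 2^-1 <= v -> (`|v| `^ m) `^ (- b) <= (2^-1 `^ m) `^ (- b).
Proof.
move=> v2; have h2 : (0 < 2^-1 :> R) by pos.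
apply: powRN_decr => //.
have v0 : 0 < v by exact: lt_le_trans v2.
by rewrite gtr0_norm//; apply: ge0_ler_powR => //; rewrite ?nnegrE; pos.
Qed.

(** One of v and 1 - v is at least 1 / 2. The factor with that argument takes the order b without
    singularity, the other one the order a, whose singularity is integrable as a m < 1. The lower
    bound on Z lets the second factor decay uniformly in u. *)
Lemma decays_boost : decays g a -> decays g b -> decays g (a + b).
Proof.
move=> [Ca Ca0 ha] [Cb Cb0 hb].
have am1 : 0 < 1 - a * m by rewrite subr_gt0.
pose p := 2^-1 `^ m : R; have p0 : 0 < p by rewrite powR_gt0// invr_gt0.
pose K := Ca * Cb * p `^ (- b) * (e `^ (- a) + e `^ (- b)).
have K0 : 0 <= K by rewrite !mulr_ge0 ?powR_ge0// addr_ge0 ?powR_ge0.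
exists (K * (2 / (1 - a * m))); first by pos.
move=> t t0; apply: (le_trans (geq t0)); rewrite -lee_fin.
have m1 : mfn (fun v : R => 1 - v) by exact: measurable_funB.
have g0 s : 0 <= g s by case/andP: (g01 s).
pose Kt := K * t `^ (- (a + b)); have Kt0 : 0 <= Kt by rewrite mulr_ge0 ?powR_ge0.
pose k (v : R) := Kt * (`|v| `^ (- (a * m)) + `|1 - v| `^ (- (a * m))).
have mk : mfn k.
  apply: measurable_funM => //; apply: measurable_funD; last exact: powm; mp.
have k0 v : 0 <= k v by rewrite mulr_ge0// addr_ge0 ?powR_ge0.
apply: (@le_trans _ _ (\int[unif]_v (k v)%:E)%E); last first.
  rewrite /k; under eq_integral do rewrite mulrDr.
  rewrite (@ge0_integral_lin _ _ _ unif (fun v : R => `|v| `^ (- (a * m)))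
    (fun v : R => `|1 - v| `^ (- (a * m))))//; mp.
  rewrite integral_unif_powR ?integral_unif_powR1 ?ltrN2//.
  rewrite -!EFinM -EFinD lee_fin /Kt; apply: eqle; field.
  by rewrite gt_eqF.
apply: bint_EFin_le => //; mp.
apply: filterS ae_unif_01 => v v01; have /andP[v0 v1] := v01.
have pv : 0 < `|v| `^ m by rewrite powR_gt0// normr_gt0 gt_eqF.
have ta : t `^ (- (a + b)) = t `^ (- a) * t `^ (- b).
  by rewrite opprD powRD// (gt_eqF t0) implybT.
have E1 : (`|v| `^ m) `^ (- a) = `|v| `^ (- (a * m)) by rewrite -powRrM mulrN (mulrC m).
have E2 : (`|1 - v| `^ m) `^ (- a) = `|1 - v| `^ (- (a * m)) by rewrite -powRrM mulrN (mulrC m).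
have GG : 0 <= G t v by case/andP: (G01 t v).
have gv := g0 (t * `|v| `^ m); clear g0 k0 mk.
set x := `|v| `^ (- (a * m)); set y := `|1 - v| `^ (- (a * m)).
have x0 : 0 <= x by pos.
have y0 : 0 <= y by pos.
have [v2|v2] := leP 2^-1 v.
- have le1 : g (t * `|v| `^ m) <= Cb * (t `^ (- b) * p `^ (- b)).
    apply: (le_trans (hb _ (mulr_gt0 t0 pv))); rewrite (pow_decay b0 t0 pv).
    exact: (ler_wpM2l Cb0 (ler_wpM2l (powR_ge0 _ _) (pow_half v2))).
  have le2 := Gdec a0 Ca0 ha t0 v01; rewrite E2 -/y in le2.
  apply: (le_trans (ler_pM gv GG le1 le2)).
  have -> : k v = Cb * (t `^ (- b) * p `^ (- b)) * (Ca * e `^ (- a) * (t `^ (- a) * y)) +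
     (Ca * Cb * p `^ (- b) * t `^ (- a) * t `^ (- b)) * (e `^ (- a) * x + e `^ (- b) * (x + y)).
    by rewrite /k /Kt /K ta -/x -/y; ring.
  by rewrite lerDl !mulr_ge0 ?powR_ge0// addr_ge0 ?mulr_ge0 ?powR_ge0 ?addr_ge0.
- have le1 : g (t * `|v| `^ m) <= Ca * (t `^ (- a) * x).
    by apply: (le_trans (ha _ (mulr_gt0 t0 pv))); rewrite (pow_decay a0 t0 pv) E1.
  have le2 : G t v <= Cb * e `^ (- b) * (t `^ (- b) * p `^ (- b)).
    apply: (le_trans (Gdec b0 Cb0 hb t0 v01)).
    have v3 : 2^-1 <= 1 - v by exact: half_compl.
    exact: (ler_wpM2l (mulr_ge0 Cb0 (powR_ge0 _ _)) (ler_wpM2l (powR_ge0 _ _) (pow_half v3))).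
  apply: (le_trans (ler_pM gv GG le1 le2)).
  have -> : k v = Ca * (t `^ (- a) * x) * (Cb * e `^ (- b) * (t `^ (- b) * p `^ (- b))) +
     (Ca * Cb * p `^ (- b) * t `^ (- a) * t `^ (- b)) * (e `^ (- b) * y + e `^ (- a) * (x + y)).
    by rewrite /k /Kt /K ta -/x -/y; ring.
  by rewrite lerDl !mulr_ge0 ?powR_ge0// addr_ge0 ?mulr_ge0 ?powR_ge0 ?addr_ge0.
Qed.

End boost.

Lemma decays_le (a b : R) : 0 < a -> a <= b -> decays g b -> decays g a.
Proof.
move=> a0 ab [C C0 h]; exists (C + 1); first by pos.
move=> t t0; have [t1|t1] := leP t 1.
  have /andP[_ g1] := g01 t; apply: (le_trans g1).
  have h1 : 1 <= t `^ (- a).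
    by have := powRN_decr a0 t0 t1; rewrite powR1.
  by rewrite -[leLHS]mul1r ler_pM// lerDr.
apply: (le_trans (h t t0)); apply: ler_pM => //; first by pos.
  by rewrite lerDl.
by rewrite ler_powR ?lerN2// ltW.
Qed.

Section all_orders.
Variable e : R.
Hypotheses (e0 : 0 < e) (Ze : {ae P0, forall u, e <= Z u}).
Hypothesis gto0 : forall e : R, 0 < e -> exists2 T1 : R, 0 < T1 & forall t : R, T1 <= t -> g t <= e.

(** The order a = 1 / (2 m) has a m = 1 / 2, so [decays_first] reaches it; boosting gives all its
    multiples, and [decays_le] every order in between. *)
Lemma decays_all (s : R) : 0 < s -> decays g s.
Proof.
move=> s0; pose a := (2 * m)^-1; have a0 : 0 < a by rewrite invr_gt0 mulr_gt0.
have am : a * m < 1.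
  by rewrite /a invfM -mulrA mulVf ?gt_eqF// mulr1 invf_lt1// ltr1n.
have mZa : mfn (fun u => (Z u `^ (- a))%:E) by meas.
have fin : (\int[P0]_u (Z u `^ (- a))%:E <= (e `^ (- a))%:E)%E.
  rewrite -(prob_intc P0); apply: ae_ge0_le_integral => //; mp.
  by apply: filterS Ze => u eu _; rewrite lee_fin powRN_decr.
have [A0 ZA] : exists A0 : R, (\int[P0]_u (Z u `^ (- a))%:E = A0%:E)%E.
  exists (fine (\int[P0]_u (Z u `^ (- a))%:E)); rewrite fineK// ge0_fin_numE.
    by rewrite (le_lt_trans fin)// ltry.
  by apply: integral_ge0 => u _; rewrite lee_fin powR_ge0.
have Zpos : {ae P0, forall u, 0 < Z u} by apply: filterS Ze => u; exact: lt_le_trans.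
have d1 := decays_first a0 am Zpos ZA gto0.
have dn n : decays g (n.+1%:R * a).
  elim: n => [|n IH]; first by rewrite mul1r.
  have -> : n.+2%:R * a = a + n.+1%:R * a by rewrite -[n.+2]addn1 natrD; ring.
  by apply: (decays_boost a0 am _ e0 Ze) => //; rewrite mulr_gt0.
pose n := Num.truncn (s / a).
apply: (@decays_le s (n.+1%:R * a)) => //.
rewrite -ler_pdivrMr// ltW// truncnS_gt//.
Qed.

End all_orders.

End decay.

(** * Modulus, real and imaginary parts of a characteristic function *)

Lemma cauchy2 {R : realType} (c s a b : R) :
  c * a + s * b <= Num.sqrt (c ^+ 2 + s ^+ 2) * Num.sqrt (a ^+ 2 + b ^+ 2).
Proof.
have n0 (x y : R) : 0 <= x ^+ 2 + y ^+ 2 by pos.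
rewrite -sqrtrM//; apply: (le_trans (ler_norm _)); rewrite -sqrtr_sqr ler_wsqrtr//.
rewrite -subr_ge0 (_ : _ - _ = (c * b - s * a) ^+ 2); last by ring.
by pos.
Qed.

Section modulus.
Context {R : realType} {d} {T : measurableType d}
  (P : probability T R).

Lemma bmf_modulus (A B : T -> R) : bmf A -> bmf B ->
  bmf (fun x => Num.sqrt (A x ^+ 2 + B x ^+ 2)).
Proof.
move=> [mA [a hA]] [mB [b hB]]; apply: (@bmf_le _ _ _ _ (a + b)).
  have := measurableT_comp (continuous_measurable_fun (@sqrt_continuous R)).
  by apply; apply: measurable_funD; meas.
move=> x; rewrite ger0_norm ?sqrtr_ge0//.
have h : A x ^+ 2 + B x ^+ 2 <= (`|A x| + `|B x|) ^+ 2.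
  rewrite sqrrD !real_normK ?num_real// addrAC lerDl mulrn_wge0//.
apply: (le_trans (ler_wsqrtr h)); rewrite sqrtr_sqr ger0_norm ?addr_ge0//.
exact: lerD.
Qed.

(** Projection on the direction (c, s) of the mean, then Cauchy-Schwarz. Complex values are kept as
    pairs of real integrals. *)
Lemma modulus_bint (A B : T -> R) : bmf A -> bmf B ->
  Num.sqrt ((\int[P]_x A x) ^+ 2 + (\int[P]_x B x) ^+ 2) <=
  \int[P]_x Num.sqrt (A x ^+ 2 + B x ^+ 2).
Proof.
move=> bA bB; set c := \int[P]_x A x; set s := \int[P]_x B x; set N := Num.sqrt _.
have bm := bmf_modulus bA bB.
have N0 : 0 <= N by exact: sqrtr_ge0.
have [Nz|Nn] := eqVneq N 0.
  by rewrite Nz; apply: bint_ge0 => x; exact: sqrtr_ge0.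
have Np : 0 < N by rewrite lt_neqAle eq_sym Nn.
rewrite -(ler_pM2l Np) -expr2 /N sqr_sqrtr ?addr_ge0 ?sqr_ge0// -/N -bintZl//.
have -> : c ^+ 2 + s ^+ 2 = \int[P]_x (c * A x + s * B x).
  by rewrite bintD ?bintZl// ?expr2//; apply: bmfM => //; meas.
apply: bint_le => [||x]; last exact: cauchy2; mp.
Qed.

Lemma bint_jensen2 (f : T -> R) : bmf f -> (\int[P]_x f x) ^+ 2 <= \int[P]_x (f x ^+ 2).
Proof.
move=> bf; set c := \int[P]_x f x.
have b2 : bmf (fun x => f x ^+ 2) by rewrite (_ : (fun x => _) = (fun x => f x * f x))//; by meas.
have : 0 <= \int[P]_x (f x ^+ 2 - (2 * c * f x - c ^+ 2)).
  apply: bint_ge0 => x; rewrite (_ : _ - _ = (f x - c) ^+ 2) ?sqr_ge0//; ring.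
have bc : bmf (fun x => 2 * c * f x) by meas.
rewrite bintB//; last by meas.
rewrite bintB//; last by meas.
by rewrite bintZl// bint_cst -/c; lra.
Qed.

End modulus.

Section charfun_parts.
Context {R : realType} {d} {T : measurableType d}
  (P : probability T R) (Y : T -> R).
Hypothesis mY : mfn Y.

Definition cosT (t : R) : R := \int[P]_w cos (t * Y w).
Definition sinT (t : R) : R := \int[P]_w sin (t * Y w).
Definition modT (t : R) : R := Num.sqrt (cosT t ^+ 2 + sinT t ^+ 2).

Let mtY : mfn (fun p : R * T => p.1 * Y p.2).
Proof. by meas. Qed.

Lemma bmf_cos_mul (t : R) : bmf (fun w => cos (t * Y w)).
Proof. by meas. Qed.

Lemma bmf_sin_mul (t : R) : bmf (fun w => sin (t * Y w)).
Proof. by meas. Qed.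

Lemma bmf_cosT : bmf cosT.
Proof. by have := bmf_fubini1 (bmf_cos mtY) P. Qed.

Lemma bmf_sinT : bmf sinT.
Proof. by have := bmf_fubini1 (bmf_sin mtY) P. Qed.

Lemma bmf_modT : bmf modT.
Proof. exact: (bmf_modulus bmf_cosT bmf_sinT). Qed.

Lemma modT01 (t : R) : 0 <= modT t <= 1.
Proof.
rewrite sqrtr_ge0/=; apply: (le_trans (modulus_bint P (bmf_cos_mul t) (bmf_sin_mul t))).
by under eq_Rintegral do rewrite cos2Dsin2 sqrtr1; rewrite bint_cst.
Qed.

Lemma cosTN t : cosT (- t) = cosT t.
Proof. by apply: eq_Rintegral => w _; rewrite mulNr cosN. Qed.

Lemma sinTN t : sinT (- t) = - sinT t.
Proof.
rewrite /sinT; under eq_Rintegral do rewrite mulNr sinN -mulN1r.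
by rewrite bintZl ?mulN1r//; meas.
Qed.

Lemma modTN t : modT (- t) = modT t.
Proof. by rewrite /modT cosTN sinTN sqrrN. Qed.

(** Symmetrisation: |phi|^2 is the characteristic function of Y - Y', for an independent copy Y'. *)
Lemma modT_sqr (t : R) : modT t ^+ 2 = \int[P]_w \int[P]_w' cos (t * (Y w - Y w')).
Proof.
have bc := bmf_cos_mul t; have bs := bmf_sin_mul t.
rewrite sqr_sqrtr ?addr_ge0 ?sqr_ge0//.
transitivity (\int[P]_w (cos (t * Y w) * cosT t + sin (t * Y w) * sinT t)).
  rewrite bintD ?bintZr//; mp.
apply: eq_Rintegral => w _; rewrite /cosT /sinT -!bintZl// -bintD; mp.
- by apply: eq_Rintegral => w' _; rewrite mulrBr cosB.
Qed.

End charfun_parts.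

Lemma is_derive_pow {R : realType} (s u : R) : 0 < u ->
  is_derive u 1 (fun y : R => y `^ s) (s * u `^ (s - 1)).
Proof.
move=> u0; apply: DeriveDef; first by apply: derivable_powR; rewrite in_itv/= andbT.
by rewrite -derive1E powR_derive1// in_itv/= andbT.
Qed.

Lemma is_derive_cts {R : realType} (f : R -> R) (x l : R) :
  is_derive x 1 f l -> {for x, continuous f}.
Proof. by move=> [D _]; apply: differentiable_continuous; exact/derivable1_diffP. Qed.

Lemma is_derive_addlin {R : realType} (F : R -> R) (M x l : R) :
  is_derive x 1 F l -> is_derive x 1 (fun v : R => F v + M * v) (l + M).
Proof.
move=> D; have D2 : is_derive x 1 (fun v : R => M * v) (M * 1).
  exact: (is_deriveZ M (is_derive_id x 1)).
by have := is_deriveD D D2; rewrite mulr1.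
Qed.

Lemma FTC_closed {R : realType} (f F : R -> R) (a b : R) : a < b ->
  (forall x, a <= x <= b -> {for x, continuous f}) ->
  (forall x, a <= x <= b -> is_derive x 1 F (f x)) ->
  (\int[lebesgue_measure]_(x in `[a, b]) (f x)%:E = (F b - F a)%:E)%E.
Proof.
move=> ab cf dF; rewrite (@continuous_FTC2 _ f F)//.
- apply: continuous_in_subspaceT => x; rewrite inE/= in_itv/=; exact: cf.
- split.
  + by move=> x; rewrite in_itv/= => /andP[x1 x2]; have [] := dF x _; rewrite ?(ltW x1) ?(ltW x2).
  + by apply: cvg_at_right_filter; apply: (is_derive_cts (dF a _)); rewrite lexx ltW.
  + by apply: cvg_at_left_filter; apply: (is_derive_cts (dF b _)); rewrite lexx ltW.
- move=> x; rewrite in_itv/= => /andP[x1 x2]; rewrite derive1E.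
  by apply: derive_val; apply: dF; rewrite !ltW.
Qed.

(** * Oscillation of cos (s V^m) *)

Section riemann_lebesgue.
Context {R : realType}.
Variable m : R.
Hypothesis m0 : 0 < m.
Notation unif := (@unif R).
Notation mu := (@lebesgue_measure R).

(** The integrand may change sign: it is raised by its bound M, and the contribution of the
    constant, found by the same [key], is subtracted. *)
Lemma unif_FTC (f F : R -> R) (a M : R) : 0 < a -> a < 1 ->
  bmf (fun v : R => \1_(`[a, 1%R]%classic) v * f v) ->
  (forall x, `|\1_(`[a, 1%R]%classic) x * f x| <= M) ->
  (forall x, a <= x <= 1 -> {for x, continuous f}) ->
  (forall x, a <= x <= 1 -> is_derive x 1 F (f x)) ->
  \int[unif]_v (\1_(`[a, 1%R]%classic) v * f v) = F 1 - F a.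
Proof.
move=> a0 a1 bf hM cf dF.
set I : set R := `[a, 1%R]%classic.
have mI : measurable I by meas.
have bI : bmf (\1_I : R -> R) by exact: bmf_indic.
pose k (v : R) : R := \1_I v * (f v + M).
have kE v : k v = \1_I v * f v + \1_I v * M by rewrite /k mulrDr.
have bIM : bmf (fun v : R => \1_I v * M) by meas.
have bk : bmf k by rewrite (funext kE); by meas.
have k0 v : 0 <= k v.
  have [vI|vI] := boolP (v \in I); last by rewrite /k indicE (negbTE vI) mul0r.
  have := hM v; rewrite /k indicE vI !mul1r => h.
  by move: h; rewrite ler_norml => /andP[+ _]; rewrite -subr_ge0 opprK.
have sub : `[a, 1%R] `<=` `[0%R, 1%R]%classic.
  move=> x /=; rewrite !in_itv/= => /andP[ax ->]; rewrite andbT.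
  exact: le_trans (ltW a0) ax.
have key (h H : R -> R) : bmf (fun v => \1_I v * h v) -> (forall v, 0 <= \1_I v * h v) ->
   (forall x, a <= x <= 1 -> {for x, continuous h}) ->
   (forall x, a <= x <= 1 -> is_derive x 1 H (h x)) ->
   \int[unif]_v (\1_I v * h v) = H 1 - H a.
  move=> bh h0 ch dh; apply: EFin_inj; rewrite bint_EFin// ge0_integral_unif; last 2 first.
  - by apply/measurable_EFinP; case: bh.
  - by pos.
  rewrite -(FTC_closed a1 ch dh) [RHS]integral_mkcond [LHS]integral_mkcond.
  apply: eq_integral => x _; rewrite !patchE.
  have [xI|xI] := boolP (x \in I).
    rewrite ifT; last by move: xI; rewrite !inE; exact: sub.
    by rewrite indicE xI mul1r.
  by rewrite indicE (negbTE xI) mul0r; case: ifP.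
have K := key (fun v => f v + M) (fun v => F v + M * v) bk k0.
have Ik : \int[unif]_v (\1_I v * (f v + M)) =
    \int[unif]_v (\1_I v * f v) + \int[unif]_v (\1_I v : R) * M.
  by under eq_Rintegral do rewrite mulrDr; rewrite bintD// bintZr.
have I1 : \int[unif]_v (\1_I v : R) = 1 - a.
  have := key (fun=> 1) (fun v => v).
  under eq_fun do rewrite mulr1.
  by apply => // x _; exact: cvg_cst.
have c2 x : a <= x <= 1 -> {for x, continuous (fun v : R => f v + M)}.
  by move=> xx; apply: cvgD; [exact: cf|exact: cvg_cst].
have d2 x : a <= x <= 1 -> is_derive x 1 (fun v : R => F v + M * v) (f x + M).
  by move=> xx; apply: is_derive_addlin; exact: dF.
by move: (K c2 d2); rewrite Ik I1 => K'; apply: (addIr ((1 - a) * M)); rewrite K'; ring.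
Qed.

Definition cosU (s : R) : R := \int[unif]_v cos (s * `|v| `^ m).

Let bcos (s : R) : bmf (fun v : R => cos (s * `|v| `^ m)).
Proof. by meas. Qed.

Lemma cosUN s : cosU (- s) = cosU s.
Proof. by apply: eq_Rintegral => v _; rewrite mulNr cosN. Qed.

Lemma cosU_le1 s : `|cosU s| <= 1.
Proof. by apply: bint_bound => // x; rewrite ler_norml cos_geN1 cos_le1. Qed.

Lemma bmf_cosU : bmf cosU.
Proof.
apply: (@bmf_fubini1 _ _ _ _ _ (fun p : R * R => cos (p.1 * `|p.2| `^ m))); mp.
Qed.
(** The derivative of [F]. Integration by parts takes the form cos (s v^m) = F' minus a term of
    order 1 / s away from v = 0. *)
Let H (s v : R) : R := cos (s * v `^ m) + (1 - m) / (s * m) * (sin (s * v `^ m) * v `^ (- m)).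
Let F (s v : R) : R := (s * m)^-1 * (sin (s * v `^ m) * v `^ (1 - m)).

Let is_derive_F (s v : R) : 0 < s -> 0 < v -> is_derive v 1 (F s) (H s v).
Proof.
move=> s0 v0.
have D1 : is_derive v 1 (fun y : R => s * y `^ m) (s * (m * v `^ (m - 1))).
  exact: (is_deriveZ s (is_derive_pow m v0)).
have D2 : is_derive v 1 (fun y : R => sin (s * y `^ m)) (s * (m * v `^ (m - 1)) * cos (s * v `^ m)).
  by have := @is_derive1_comp R (@sin R) (fun y : R => s * y `^ m) v _ _ (is_derive_sin _) D1; rewrite mulrC.
have D3 := is_derive_pow (1 - m) v0.
have := is_deriveZ (s * m)^-1 (is_deriveM D2 D3).
move=> D; apply: is_derive_eq; rewrite /GRing.scale/= /H.
have E1 : v `^ (m - 1) * v `^ (1 - m) = 1.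
  by rewrite -powRD ?(gt_eqF v0) ?implybT// (_ : m - 1 + (1 - m) = 0) ?powRr0//; ring.
rewrite (_ : 1 - m - 1 = - m); last by ring.
transitivity ((s * m)^-1 * (sin (s * v `^ m) * ((1 - m) * v `^ (- m)) +
   (v `^ (m - 1) * v `^ (1 - m)) * (s * m * cos (s * v `^ m)))); first by ring.
by rewrite E1; field; rewrite !gt_eqF.
Qed.
Let cont_H (s v : R) : 0 < v -> {for v, continuous (H s)}.
Proof.
move=> v0.
have c1 : {for v, continuous (fun y : R => s * y `^ m)}.
  by apply: cvgM; [exact: cvg_cst|exact: (is_derive_cts (is_derive_pow m v0))].
apply: cvgD.
  by apply: continuous_comp => //; exact: continuous_cos.
apply: cvgM; first exact: cvg_cst.
apply: cvgM; last exact: (is_derive_cts (is_derive_pow _ v0)).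
by apply: continuous_comp => //; exact: continuous_sin.
Qed.
Let mcos (s : R) : mfn (fun v : R => cos (s * v `^ m)).
Proof. by meas. Qed.

(** The interval [0, a[ contributes at most a; on [a, 1] the boundary values of [F] and the
    remainder are O(1 / s) for fixed a. *)
Lemma cosU_to0 (e : R) : 0 < e -> exists S : R, forall s : R, S <= `|s| -> `|cosU s| <= e.
Proof.
move=> e0; pose a := Order.min (e / 2) 2^-1.
have a0 : 0 < a by rewrite lt_min; apply/andP; split; rewrite ?divr_gt0 ?invr_gt0.
have a1 : a < 1 by rewrite /a gt_min invf_lt1// ltr1n orbT.
have ae : a <= e / 2 by rewrite /a ge_min lexx.
(* Collects the bound r on the remainder and the two boundary values: r + (1 + a^(1 - m)) / (s m) =
   K / s. *)
pose K := (`|1 - m| * a `^ (- m) + 1 + a `^ (1 - m)) / m.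
have K0 : 0 < K.
  by rewrite divr_gt0// ltr_wpDr ?powR_ge0// ltr_wpDl// mulr_ge0 ?powR_ge0.
exists (2 * K / e).
suff pos (s : R) : 2 * K / e <= s -> `|cosU s| <= e.
  move=> s; have [s0|s0] := leP 0 s; first by rewrite ger0_norm// => /pos.
  by rewrite ltr0_norm// => /pos; rewrite cosUN.
move=> sS; have s0 : 0 < s by apply: lt_le_trans sS; rewrite divr_gt0// mulr_gt0.
set I : set R := `[a, 1%R]%classic.
have mI : measurable I by meas.
have bI : bmf (\1_I : R -> R) by exact: bmf_indic.
pose J : set R := `[0%R, a[%classic.
have mJ : measurable J by meas.
have bJ : bmf (\1_J : R -> R) by exact: bmf_indic.
pose r := `|1 - m| * a `^ (- m) / (s * m).
have r0 : 0 <= r by rewrite divr_ge0 ?mulr_ge0 ?powR_ge0// ltW// mulr_gt0.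
have sm : 0 < s * m by pos.
have rem (v : R) : a <= v -> `|(1 - m) / (s * m) * (sin (s * v `^ m) * v `^ (- m))| <= r.
  move=> av; rewrite !normrM normfV (gtr0_norm sm) (ger0_norm (powR_ge0 _ _)).
  rewrite /r -!mulrA ler_wpM2l// [leRHS]mulrC ler_wpM2l ?invr_ge0 ?(ltW sm)//.
  rewrite -[leRHS]mul1r ler_pM ?powR_ge0//.
    by rewrite ler_norml sin_geN1 sin_le1.
  exact: powRN_decr.
have mH : mfn (H s).
  apply: measurable_funD => //; apply: measurable_funM => //; by meas.
have hM (x : R) : `|\1_I x * H s x| <= 1 + r.
  have [xI|xI] := boolP (x \in I); last by rewrite indicE (negbTE xI) mul0r normr0 addr_ge0.
  rewrite indicE xI mul1r; apply: (le_trans (ler_normD _ _)); apply: lerD.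
    by rewrite ler_norml cos_geN1 cos_le1.
  by apply: rem; move: xI; rewrite inE /I/= in_itv/= => /andP[].
have bH : bmf (fun v : R => \1_I v * H s v).
  by apply: (@bmf_le _ _ _ _ (1 + r)) => //; apply: measurable_funM => //; case: bI.
have IH : \int[unif]_v (\1_I v * H s v) = F s 1 - F s a.
  apply: (@unif_FTC (H s) (F s) a (1 + r)) => //.
  - by move=> x /andP[ax _]; apply: cont_H; exact: lt_le_trans ax.
  - by move=> x /andP[ax _]; apply: is_derive_F => //; exact: lt_le_trans ax.
have d1 : `|cosU s - (F s 1 - F s a)| <= a + r.
  rewrite -IH -bintB//; apply: le_trans (bint_norm _ _) _; first by meas.
  have IJ : \int[unif]_v (\1_J v : R) = a by rewrite integral_unif_itv ?subr0// ltW.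
  have -> : a + r = \int[unif]_v (\1_J v + r).
    by rewrite bintD// ?IJ ?bint_cst//; meas.
  rewrite -lee_fin !bint_EFin//; last 2 first.
  - by meas.
  - by apply: bmf_norm; meas.
  apply: ae_ge0_le_integral => //; mp.
  - by move=> x _; rewrite lee_fin addr_ge0.
  apply: filterS ae_unif_01 => v /andP[v0 v1] _; rewrite lee_fin (gtr0_norm v0).
  have [av|av] := leP a v.
    have vI : v \in I by rewrite inE /I/= in_itv/= av ltW.
    rewrite [\1_I v]indicE vI mul1r /H opprD addNKr normrN.
    by apply: (le_trans (rem v av)); rewrite lerDr.
  have vI : (v \in I) = false by apply/negbTE; rewrite notin_setE /I/= in_itv/= leNgt av.
  have vJ : v \in J by rewrite inE /J/= in_itv/= av ltW.
  rewrite [\1_I v]indicE vI mul0r subr0 [\1_J v]indicE vJ.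
  by rewrite ler_wpDr// ler_norml cos_geN1 cos_le1.
have d2 : `|F s 1 - F s a| <= (1 + a `^ (1 - m)) / (s * m).
  have FF (v : R) : `|F s v| <= v `^ (1 - m) / (s * m).
    rewrite /F normrM normfV (gtr0_norm sm) mulrC ler_wpM2r ?invr_ge0 ?(ltW sm)//.
    rewrite normrM (ger0_norm (powR_ge0 _ _)) -[leRHS]mul1r ler_wpM2r ?powR_ge0//.
    by rewrite ler_norml sin_geN1 sin_le1.
  apply: (le_trans (ler_normB _ _)); rewrite mulrDl; apply: lerD => //.
  by have := FF 1; rewrite powR1.
have d3 : r + (1 + a `^ (1 - m)) / (s * m) = K / s.
  by rewrite /r /K; field; rewrite !gt_eqF.
have d4 : K / s <= e / 2.
  rewrite ler_pdivrMr// mulrAC ler_pdivlMr// mulrC.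
  by move: sS; rewrite ler_pdivrMr// [s * e]mulrC.
rewrite -[cosU s](subrK (F s 1 - F s a)); apply: (le_trans (ler_normD _ _)).
apply: (le_trans (lerD d1 d2)); rewrite -addrA d3.
by apply: (le_trans (lerD ae d4)); rewrite -splitr.
Qed.

End riemann_lebesgue.

(** * Negative powers against dyadic exponentials *)

Section dyadic_bound.
Context {R : realType}.
Variable s : R.
Hypothesis s0 : 0 < s.

Definition dyadic (n : nat) : R := expR 1 * (2 ^ n.+1)%:R `^ s.

Lemma dyadic_ge0 n : 0 <= dyadic n.
Proof. by rewrite mulr_ge0 ?expR_ge0 ?powR_ge0. Qed.

(** For y < 1 choose n with 2^n <= 1 / y < 2^(n + 1): then exp (- 2^n y) >= exp (-1) and y^(- s) <=
    2^((n + 1) s). Negative moments are thereby reduced to Laplace transforms at powers of 2. *)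
Lemma negpow_dyadic (y : R) : 0 < y ->
  y `^ (- s) <= 1 \/ exists n, y `^ (- s) <= dyadic n * expR (- ((2 ^ n)%:R * y)).
Proof.
move=> y0; have [y1|y1] := leP 1 y.
  by left; have := powRN_decr s0 ltr01 y1; rewrite powR1.
right; pose N := Num.truncn y^-1; pose n := trunc_log 2 N.
have yV0 : 0 <= y^-1 by pos.
have /andP[N1 N2] : N%:R <= y^-1 < N.+1%:R := truncn_itv yV0.
have N0 : (0 < N)%N.
  by rewrite -ltnS -(ltr_nat R); apply: lt_trans N2; rewrite invf_gt1.
have nN : (2 ^ n <= N)%N by exact: trunc_logP.
have Nn : (N < 2 ^ n.+1)%N by exact: trunc_log_ltn.
exists n.
have e1 : expR (-1) <= expR (- ((2 ^ n)%:R * y)).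
  rewrite ler_expR lerN2 -ler_pdivlMr// mul1r; apply: le_trans N1.
  by rewrite ler_nat.
have e2 : y `^ (- s) <= (2 ^ n.+1)%:R `^ s.
  have -> : y `^ (- s) = y^-1 `^ s by rewrite -[y^-1]powR_inv1 ?(ltW y0)// -powRrM mulN1r.
  apply: ge0_ler_powR; rewrite ?nnegrE ?ler0n// ?(ltW s0)//.
  by apply: (le_trans (ltW N2)); rewrite ler_nat.
apply: (le_trans e2); rewrite /dyadic mulrAC -[leLHS]mul1r ler_wpM2r ?powR_ge0//.
apply: (@le_trans _ _ (expR 1 * expR (-1))); first by rewrite -expRD subrr expR0.
by rewrite ler_wpM2l ?expR_ge0.
Qed.

End dyadic_bound.

(** * Measures given by a density *)

Section density_measure.
Context {d} {T : measurableType d} {R : realType}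
  (mu : {measure set T -> \bar R}) (p : T -> R).
Hypotheses (mp : mfn p) (p0 : forall x, 0 <= p x).

Definition dens_fun (A : set T) : \bar R := (\int[mu]_(x in A) (p x)%:E)%E.

Let dens0 : dens_fun set0 = 0%E. Proof. by rewrite /dens_fun integral_set0. Qed.
Let dens_ge0 A : (0 <= dens_fun A)%E.
Proof. by apply: integral_ge0 => x _; rewrite lee_fin. Qed.
Let dens_sigma : semi_sigma_additive dens_fun.
Proof.
move=> /= F mF tF mUF; apply: cvg_toP.
  apply: ereal_nondecreasing_is_cvgn => m n mn.
  by apply: lee_sum_nneg_natr => // k _ _; pos.
rewrite /dens_fun ge0_integral_bigcup//=; mp.
- by apply/measurable_funTS/measurable_EFinP.
Qed.

HB.instance Definition _ := isMeasure.Build _ _ _ dens_fun dens0 dens_ge0 dens_sigma.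

Definition densm : {measure set T -> \bar R} := dens_fun.

Hypothesis p1 : (\int[mu]_x (p x)%:E = 1)%E.

Let densT : dens_fun setT = 1%E. Proof. exact: p1. Qed.

HB.instance Definition _ := @Measure_isProbability.Build _ _ R dens_fun densT.

Definition densp : probability T R := dens_fun.

End density_measure.

(** * The Pareto law as a reference measure on ]0, +oo[ *)

Section pareto.
Context {R : realType}.
Variable b : R.
Hypothesis b0 : 0 < b.
Notation mu := (@lebesgue_measure R).

(** On t > 0 the weight [wt] is the inverse of this density, which turns Lebesgue integrals over ]0,
    +oo[ into integrals under a probability. A bounded function of order |t|^(- 1 - b) at infinity
    stays bounded after weighting, so the lemmas on bounded functions apply. *)
Definition parp (t : R) : R := if 0 < t then b * (1 + t) `^ (- (1 + b)) else 0.

Lemma parp_ge0 t : 0 <= parp t.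
Proof. by rewrite /parp; case: ifP => // _; rewrite mulr_ge0 ?powR_ge0 ?ltW. Qed.
Let m1 : mfn (fun t : R => b * (1 + t) `^ (- (1 + b))).
Proof.
apply: measurable_funM => //; apply: (measurableT_comp (measurable_powR _)).
exact: measurable_funD.
Qed.

Lemma measurable_parp : mfn parp.
Proof. by apply: measurable_fun_ifT => //; apply: measurable_fun_ltr. Qed.
Let is_derive_par (t : R) : -1 < t ->
  is_derive t 1 (fun y : R => - (1 + y) `^ (- b)) (b * (1 + t) `^ (- (1 + b))).
Proof.
move=> t1; have u0 : 0 < 1 + t by rewrite -ltrBlDl sub0r.
have D1 : is_derive t 1 (fun y : R => 1 + y) 1.
  have -> : (fun y : R => 1 + y) = (cst 1 + id) :> (R -> R) by [].
  by apply: is_derive_eq; rewrite add0r.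
have := @is_derive1_comp R (fun y : R => y `^ (- b)) (fun y : R => 1 + y) t _ _
  (is_derive_pow (- b) u0) D1.
move=> /(@is_deriveN _ _ _ _ _ _ _); rewrite mulr1 mulNr opprK.
by rewrite (_ : - b - 1 = - (1 + b)) //; ring.
Qed.

Lemma integral_parp : (\int[mu]_x (parp x)%:E = 1)%E.
Proof.
transitivity (\int[mu]_(x in `]0%R, +oo[) (b * (1 + x) `^ (- (1 + b)))%:E)%E.
  rewrite [RHS]integral_mkcond; apply: eq_integral => x _; rewrite patchE /parp.
  by rewrite mem_setE in_itv/= andbT; case: ifP.
rewrite integral_itv_obnd_cbnd; last by apply/measurable_funTS/measurable_EFinP.
have c0 x : -1 < x -> {for x, continuous (fun t : R => b * (1 + t) `^ (- (1 + b)))}.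
  move=> x1; have u0 : 0 < 1 + x by rewrite -ltrBlDl sub0r.
  apply: cvgM; first exact: cvg_cst.
  apply: (@continuous_comp _ _ _ (fun t : R => 1 + t) (fun y : R => y `^ (- (1 + b)))).
    by apply: cvgD; [exact: cvg_cst|exact: cvg_id].
  exact: (is_derive_cts (is_derive_pow _ u0)).
rewrite (@ge0_continuous_FTC2y _ _ (fun y : R => - (1 + y) `^ (- b)) 0 0); mp.
- by rewrite addr0 powR1 EFinN oppeK add0e.
- apply: continuous_in_subspaceT => x; rewrite inE/= in_itv/= andbT => x0.
  by apply: c0; apply: lt_le_trans x0; rewrite ltrN10.
- rewrite -oppr0; apply: cvgN.
  have -> : (fun y : R => (1 + y) `^ (- b)) = (fun y => ((1 + y) `^ b)^-1).
    by apply/funext => y; rewrite powRN.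
  have pos : \forall y \near +oo, 0 < (1 + y) `^ b.
    near=> y; apply: powR_gt0; apply: addr_gt0 => //; near: y; exact: nbhs_pinfty_gt.
  apply/(gtr0_cvgV0 pos)/cvgryPge => A; near=> y.
  have y0 : 0 < y by near: y; exact: nbhs_pinfty_gt.
  have A1 : (`|A| `^ b^-1) <= y by near: y; apply: nbhs_pinfty_ge; rewrite num_real.
  apply: (le_trans (ler_norm A)).
  have -> : `|A| = (`|A| `^ b^-1) `^ b by rewrite -powRrM mulVf ?gt_eqF// powRr1.
  apply: ge0_ler_powR; rewrite ?nnegrE ?powR_ge0 ?(ltW b0) ?addr_ge0 ?(ltW y0)//.
  by apply: (le_trans A1); rewrite lerDr.
- by move=> x x0; have [] := is_derive_par (lt_trans (ltrN10 R) x0).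
- by apply: cvg_at_right_filter; exact: (is_derive_cts (is_derive_par (ltrN10 R))).
- move=> x; rewrite in_itv/= andbT => x0; rewrite derive1E.
  by apply: derive_val; apply: is_derive_par; exact: lt_trans x0.
Unshelve. all: by end_near. Qed.
Let mid : mfn (fun x : measurableTypeR R => x : R).
Proof. by meas. Qed.
Let rho0 : probability (measurableTypeR R) R :=
  @densp _ (measurableTypeR R) R mu parp measurable_parp parp_ge0 integral_parp.

Definition rho : probability R R := distribution rho0 (mkmfun mid).

Lemma ge0_integral_rho (f : R -> \bar R) :
  mfn f -> (forall x, 0 <= f x)%E ->
  (\int[rho]_x f x = \int[mu]_x (f x * (parp x)%:E))%E.
Proof.
move=> mf f0.
rewrite (@ge0_integral_pushforward _ _ _ _ _ _ mid _ setT)//= ?preimage_setT.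
rewrite (@ge0_integral_density _ (measurableTypeR R) _ mu rho0 parp)//.
- exact: measurable_parp.
- exact: parp_ge0.
Qed.

Definition wt (t : R) : R := (1 + `|t|) `^ (1 + b) / b.

Lemma wt_ge0 t : 0 <= wt t.
Proof. by rewrite divr_ge0 ?powR_ge0 ?ltW. Qed.

Lemma measurable_wt : mfn wt.
Proof.
apply: measurable_funM => //; apply: (measurableT_comp (measurable_powR _)); mp.
Qed.

Lemma wt_parp (t : R) : 0 < t -> wt t * parp t = 1.
Proof.
move=> t0; rewrite /wt /parp t0 (gtr0_norm t0) powRN; field.
by rewrite !gt_eqF// powR_gt0// addr_gt0.
Qed.
Let ex_rho0 (k : R -> R) (s : R) : 0 < s -> mfn k -> (forall t, 0 <= k t) ->
  ((s^-1)%:E * \int[ex]_x (k (x / s))%:E =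
   \int[rho]_t (k t * wt t * expR (- (s * `|t|)))%:E)%E.
Proof.
move=> s0 mk k0.
have mks : mfn (fun x : R => k (x / s)) by meas.
have mr : mfn (fun t : R => (k t * wt t * expR (- (s * `|t|)))%:E).
  apply/measurable_EFinP; apply: measurable_funM.
    by apply: measurable_funM => //; exact: measurable_wt.
  by meas.
rewrite ge0_integral_ex; mp.
rewrite ge0_integral_rho//; last by move=> t; rewrite lee_fin (mulr_ge0 (mulr_ge0 (k0 t) (wt_ge0 t)) (expR_ge0 _)).
rewrite (ge0_integral_affine 0 s0); last 2 first.
- apply: emeasurable_funM; apply/measurable_EFinP => //; exact: measurable_expdens.
- by move=> x; rewrite mule_ge0// lee_fin ?expdens_ge0.
rewrite muleA -EFinM mulVf ?gt_eqF// mul1e; apply: eq_integral => t _.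
rewrite addr0 mulrAC divff ?gt_eqF// mul1r /expdens pmulr_rgt0//.
rewrite -!EFinM; congr EFin; have [t0|t0] := ltP 0 t.
  by rewrite (gtr0_norm t0) mulrAC -[k t * wt t * _]mulrA wt_parp// mulr1.
by rewrite /parp ltNge t0/= !mulr0.
Qed.

Lemma bmf_wt_exp (k : R -> R) (s : R) : 0 <= s -> bmf (fun t => k t * wt t) ->
  bmf (fun t : R => k t * wt t * expR (- (s * `|t|))).
Proof.
move=> s0 bk; apply: bmfM => //; apply: bmf_expN => [|t]; last by pos.
by meas.
Qed.

(** Both sides are the integral of k (t) exp (- s t) over t > 0; the positive and negative parts of
    k are treated separately. *)
Lemma ex_rho (k : R -> R) (s : R) : 0 < s -> bmf k -> bmf (fun t => k t * wt t) ->
  s^-1 * \int[ex]_x k (x / s) = \int[rho]_t (k t * wt t * expR (- (s * `|t|))).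
Proof.
move=> s0 bk bkw.
have pos (h : R -> R) : bmf h -> bmf (fun t => h t * wt t) -> (forall t, 0 <= h t) ->
    s^-1 * \int[ex]_x h (x / s) = \int[rho]_t (h t * wt t * expR (- (s * `|t|))).
  move=> bh bhw h0; apply: EFin_inj; rewrite EFinM !bint_EFin; mp.
  - by apply: ex_rho0 => //; case: bh.
pose kp t := (`|k t| + k t) / 2; pose kn t := (`|k t| - k t) / 2.
have bkp : bmf kp by apply: bmfM; [apply: bmfD => //; exact: bmf_norm|by meas].
have bkn : bmf kn by apply: bmfM; [apply: bmfB => //; exact: bmf_norm|by meas].
have nE t : `|k t| * wt t = `|k t * wt t| by rewrite normrM (ger0_norm (wt_ge0 t)).
have bkpw : bmf (fun t => kp t * wt t).
  have -> : (fun t => kp t * wt t) = (fun t => (`|k t * wt t| + k t * wt t) / 2).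
    by apply/funext => t; rewrite -nE /kp; field.
  by apply: bmfM; [apply: bmfD => //; exact: bmf_norm|by meas].
have bknw : bmf (fun t => kn t * wt t).
  have -> : (fun t => kn t * wt t) = (fun t => (`|k t * wt t| - k t * wt t) / 2).
    by apply/funext => t; rewrite -nE /kn; field.
  by apply: bmfM; [apply: bmfB => //; exact: bmf_norm|by meas].
have kE t : k t = kp t - kn t by rewrite /kp /kn; field.
have kp0 t : 0 <= kp t by rewrite divr_ge0// -[X in _ + X]opprK subr_ge0 -normrN ler_norm.
have kn0 t : 0 <= kn t by rewrite divr_ge0// subr_ge0 ler_norm.
have bs (h : R -> R) : bmf h -> bmf (fun x : R => h (x / s)) by meas.
transitivity (s^-1 * \int[ex]_x (kp (x / s) - kn (x / s))).
  by congr (_ * _); apply: eq_Rintegral => x _; rewrite kE.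
rewrite bintB ?mulrBr; [|exact: bs|exact: bs].
rewrite !pos// -bintB; [|by meas|by meas].
by apply: eq_Rintegral => t _; rewrite kE; ring.
Qed.

End pareto.

(** * Cosine transform of the exponential law *)

Section exponential_cosine.
Context {R : realType}.
Notation mu := (@lebesgue_measure R).
Variable c : R.

Let q := (1 + c ^+ 2)^-1.
Let q1 : 1 + c ^+ 2 != 0. Proof. by rewrite gt_eqF// ltr_pwDl// sqr_ge0. Qed.
Let F (t : R) : R := expR (- t) * (q * (c * sin (c * t) - cos (c * t)) - 1).
Let f (t : R) : R := expR (- t) * (1 + cos (c * t)).

Let is_derive_F (t : R) : is_derive t 1 F (f t).
Proof.
have D1 : is_derive t 1 (fun y : R => c * y) c.
  by have := is_deriveZ c (is_derive_id t 1); rewrite /GRing.scale/= mulr1.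
have D2 : is_derive t 1 (fun y : R => - y) (-1).
  exact: (is_deriveN (is_derive_id t 1)).
have DE : is_derive t 1 (fun y : R => expR (- y)) (- expR (- t)).
  by have := @is_derive1_comp R (@expR R) (fun y : R => - y) t _ _ (is_derive_expR _) D2; rewrite mulrN1.
have DS : is_derive t 1 (fun y : R => sin (c * y)) (cos (c * t) * c).
  exact: (@is_derive1_comp R (@sin R) (fun y : R => c * y) t _ _ (is_derive_sin _) D1).
have DC : is_derive t 1 (fun y : R => cos (c * y)) (- sin (c * t) * c).
  exact: (@is_derive1_comp R (@cos R) (fun y : R => c * y) t _ _ (is_derive_cos _) D1).
have DG := is_deriveB (is_deriveZ q (is_deriveB (is_deriveZ c DS) DC)) (is_derive_cst (1 : R) t 1).
have D := is_deriveM DE DG.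
apply: is_derive_eq; rewrite /GRing.scale/= /f.
rewrite [X in _ + X * _](_ : _ = q * (c * sin (c * t) - cos (c * t)) - 1)//.
have qq : q * c ^+ 2 = 1 - q by rewrite /q; field.
transitivity (expR (- t) * (q * cos (c * t) + q * c ^+ 2 * cos (c * t) + 1)); first by ring.
by rewrite qq; ring.
Qed.
Let cont_f (t : R) : {for t, continuous f}.
Proof.
have ce : {for t, continuous (fun y : R => expR (- y))}.
  apply: (@continuous_comp _ _ _ (fun y : R => - y) (@expR R)); last exact: continuous_expR.
  by apply: cvgN; exact: cvg_id.
apply: cvgM => //; apply: cvgD; first exact: cvg_cst.
apply: (@continuous_comp _ _ _ (fun y : R => c * y) (@cos R)); last exact: continuous_cos.
by apply: cvgM; [exact: cvg_cst|exact: cvg_id].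
Qed.

(** The cosine is raised by 1 so that a nonnegative function is integrated, with the explicit
    primitive [F]. *)
Lemma ex_cos : \int[ex]_x cos (x * c) = (1 + c ^+ 2)^-1 :> R.
Proof.
have bc : bmf (fun x : R => cos (x * c)) by meas.
apply: (addrI 1); rewrite -[X in X + \int[ex]_x _](bint_cst (@ex R)) -bintD//; last by meas.
have bs : bmf (fun x : R => 1 + cos (x * c)) by meas.
have mfE : mfn f by apply: continuous_measurable_fun => t; exact: cont_f.
apply: EFin_inj; rewrite bint_EFin// ge0_integral_ex; last 2 first.
- by meas.
- by move=> x; rewrite lee_fin mulrC.
transitivity (\int[mu]_(x in `]0%R, +oo[) (f x)%:E)%E.
  rewrite [RHS]integral_mkcond; apply: eq_integral => x _; rewrite patchE /expdens.
  rewrite mem_setE in_itv/= andbT; case: ifP => _; last by rewrite mule0.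
  by rewrite -EFinM; congr EFin; rewrite /f mulrC [x * c]mulrC.
rewrite integral_itv_obnd_cbnd; last by apply/measurable_funTS/measurable_EFinP.
rewrite (@ge0_continuous_FTC2y _ f F 0 0).
- rewrite /F oppr0 expR0 mul1r mulr0 sin0 cos0 mulr0 sub0r mulrN1 -EFinB; congr EFin.
  by rewrite /q; ring.
- by move=> x _; rewrite mulr_ge0 ?expR_ge0.
- by apply: continuous_in_subspaceT => x _; exact: cont_f.
- pose M := q * (`|c| + 1) + 1.
  have q0 : 0 <= q by rewrite invr_ge0 addr_ge0 ?sqr_ge0.
  have bnd (y : R) : `|F y| <= expR (- y) * M.
    rewrite normrM (ger0_norm (expR_ge0 _)) ler_wpM2l ?expR_ge0//.
    apply: (le_trans (ler_normB _ _)); rewrite normr1 lerD2r normrM (ger0_norm q0) ler_wpM2l//.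
    apply: (le_trans (ler_normB _ _)); apply: lerD; last by rewrite ler_norml cos_geN1 cos_le1.
    by rewrite normrM ler_piMr// ler_norml sin_geN1 sin_le1.
  have lim0 : expR (- y) * M @[y --> +oo] --> (0 : R).
    by rewrite -[X in _ --> X](mul0r M); apply: cvgM; [exact: cvgr_expR|exact: cvg_cst].
  apply/cvgr0Pnorm_le => e e0; near=> y; apply: (le_trans (bnd y)).
  apply: (le_trans (ler_norm _)); near: y.
  by move/cvgr0Pnorm_le : lim0; apply.
- by move=> x _; have [] := is_derive_F x.
- by apply: cvg_at_right_filter; exact: (is_derive_cts (is_derive_F 0)).
- by move=> x _; rewrite derive1E; apply: derive_val; exact: is_derive_F.
Unshelve. all: by end_near. Qed.

End exponential_cosine.

(** * Fourier integrals and their derivatives *)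

Section fourier.
Context {R : realType}.
Variable rh : probability R R.

Definition fou (A B : R -> R) (x : R) : R :=
  \int[rh]_t (A t * cos (t * x) + B t * sin (t * x)).

Lemma bmf_fou2 (A B : R -> R) : bmf A -> bmf B ->
  bmf (fun p : R * R => A p.2 * cos (p.2 * p.1) + B p.2 * sin (p.2 * p.1)).
Proof. by meas. Qed.

Lemma bmf_fou1 (A B : R -> R) (x : R) : bmf A -> bmf B ->
  bmf (fun t : R => A t * cos (t * x) + B t * sin (t * x)).
Proof. by meas. Qed.

Lemma bmf_fou (A B : R -> R) : bmf A -> bmf B -> bmf (fou A B).
Proof. by move=> bA bB; exact: (bmf_fubini1 (bmf_fou2 bA bB) rh). Qed.

Lemma continuous_fou (A B : R -> R) : bmf A -> bmf B -> continuous (fou A B).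
Proof.
move=> bA bB x; apply/(@cvg_nbhsP _ R^o) => u ux.
have [_ [M hM]] := bmf_fou2 bA bB.
apply: (@bint_cvg _ _ _ rh _ _ M); mp.
- by move=> n t; exact: (hM (u n, t)).
apply: aeW => t; apply: cvgD; (apply: cvgM; first exact: cvg_cst).
  apply: (continuous_cvg _ (@continuous_cos R (t * x))).
  by apply: cvgM => //; exact: cvg_cst.
apply: (continuous_cvg _ (@continuous_sin R (t * x))).
by apply: cvgM => //; exact: cvg_cst.
Qed.
Let cosB_le (y h : R) : `|cos (y + h) - cos y| <= `|h|.
Proof.
wlog h0 : y h / 0 < h.
  move=> H; have [h0|h0|->] := ltgtP h 0.
  - have := H (y + h) (- h); rewrite addrK distrC normrN; apply.
    by rewrite oppr_gt0.
  - exact: H.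
  - by rewrite addr0 subrr !normr0.
have yh : y < y + h by rewrite ltrDl.
have [c _ ->] := @MVT R (@cos R) (fun z => - sin z) y (y + h) yh
  (fun z _ => is_derive_cos z) (continuous_subspaceT (@continuous_cos R)).
rewrite normrM normrN addrC addKr -[leRHS]mul1r ler_wpM2r//.
by rewrite ler_norml sin_geN1 sin_le1.
Qed.
Let sinB_le (y h : R) : `|sin (y + h) - sin y| <= `|h|.
Proof.
wlog h0 : y h / 0 < h.
  move=> H; have [h0|h0|->] := ltgtP h 0.
  - have := H (y + h) (- h); rewrite addrK distrC normrN; apply.
    by rewrite oppr_gt0.
  - exact: H.
  - by rewrite addr0 subrr !normr0.
have yh : y < y + h by rewrite ltrDl.
have [c _ ->] := @MVT R (@sin R) (fun z => cos z) y (y + h) yh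
  (fun z _ => is_derive_sin z) (continuous_subspaceT (@continuous_sin R)).
rewrite normrM addrC addKr -[leRHS]mul1r ler_wpM2r//.
by rewrite ler_norml cos_geN1 cos_le1.
Qed.
Let cos_taylor (y h : R) : `|cos (y + h) - cos y + h * sin y| <= h ^+ 2.
Proof.
wlog h0 : y h / 0 < h.
  move=> H; have [h0|h0|->] := ltgtP h 0.
  - have := H (- y) (- h); rewrite -opprD !cosN sinN mulrNN sqrrN; apply.
    by rewrite oppr_gt0.
  - exact: H.
  - by rewrite addr0 subrr mul0r addr0 normr0 expr2 mulr0.
have yh : y < y + h by rewrite ltrDl.
have [c] := @MVT R (@cos R) (fun z => - sin z) y (y + h) yh
  (fun z _ => is_derive_cos z) (continuous_subspaceT (@continuous_cos R)).
rewrite in_itv/= => /andP[c1 c2] ->; rewrite [y + h - y]addrC addKr.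
rewrite (_ : - sin c * h + h * sin y = h * (sin y - sin (y + (c - y)))); last by rewrite (addrC y) subrK; ring.
rewrite normrM distrC (gtr0_norm h0) expr2 ler_wpM2l ?(ltW h0)//.
apply: (le_trans (sinB_le _ _)); rewrite ger0_norm ?subr_ge0 ?(ltW c1)//.
by rewrite lerBlDl (ltW c2).
Qed.
Let sin_taylor (y h : R) : `|sin (y + h) - sin y - h * cos y| <= h ^+ 2.
Proof.
wlog h0 : y h / 0 < h.
  move=> H; have [h0|h0|->] := ltgtP h 0.
  - have := H (- y) (- h); rewrite -opprD !sinN cosN sqrrN.
    rewrite (_ : - sin (y + h) - _ - _ = - (sin (y + h) - sin y - h * cos y)); last by ring.
    rewrite normrN.
    by apply; rewrite oppr_gt0.
  - exact: H.
  - by rewrite addr0 subrr mul0r subr0 normr0 expr2 mulr0.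
have yh : y < y + h by rewrite ltrDl.
have [c] := @MVT R (@sin R) (fun z => cos z) y (y + h) yh
  (fun z _ => is_derive_sin z) (continuous_subspaceT (@continuous_sin R)).
rewrite in_itv/= => /andP[c1 c2] ->; rewrite [y + h - y]addrC addKr.
rewrite (_ : cos c * h - h * cos y = h * (cos (y + (c - y)) - cos y)); last by rewrite (addrC y) subrK; ring.
rewrite normrM (gtr0_norm h0) expr2 ler_wpM2l ?(ltW h0)//.
apply: (le_trans (cosB_le _ _)); rewrite ger0_norm ?subr_ge0 ?(ltW c1)//.
by rewrite lerBlDl (ltW c2).
Qed.

Lemma is_derive_quadratic (F : R -> R) (x l K : R) : 0 <= K ->
  (forall h, `|F (x + h) - F x - h * l| <= K * h ^+ 2) -> is_derive x 1 (F : R -> R^o) l.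
Proof.
move=> K0 H.
have cv : h^-1 *: ((F \o shift x) (h *: 1) - F x) @[h --> 0^'] --> l.
  apply/cvgrPdist_le => e e0; near=> h.
  have h0 : h != 0 by near: h; exact: nbhs_dnbhs_neq.
  rewrite /= /GRing.scale/= mulr1 [h + x]addrC distrC.
  rewrite (_ : h^-1 * (F (x + h) - F x) - l = h^-1 * (F (x + h) - F x - h * l)); last by field.
  rewrite normrM normfV ler_pdivrMl ?normr_gt0//; apply: (le_trans (H h)).
  rewrite expr2 -[h * h]ger0_norm; last by pos.
  rewrite normrM mulrCA ler_wpM2l//.
  have : `|h| <= e / (K + 1).
    near: h; apply: dnbhs0_le; by rewrite divr_gt0// ltr_wpDl.
  rewrite ler_pdivlMr; last by rewrite ltr_wpDl.
  by apply: le_trans; rewrite mulrC ler_wpM2l// lerDl.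
by apply: DeriveDef; [apply/cvg_ex; exists l|apply: cvg_lim].
Unshelve. all: by end_near. Qed.

(** Second-order bounds on cos and sin leave a remainder of at most (Ka + Kb) h^2, where Ka and Kb
    bound t^2 A and t^2 B. *)
Lemma is_derive_fou (A B : R -> R) (x : R) : bmf A -> bmf B ->
  bmf (fun t : R => t * A t) -> bmf (fun t : R => t * B t) ->
  bmf (fun t : R => t ^+ 2 * A t) -> bmf (fun t : R => t ^+ 2 * B t) ->
  is_derive x 1 (fou A B : R -> R^o) (fou (fun t : R => t * B t) (fun t : R => - (t * A t)) x).
Proof.
move=> bA bB bA1 bB1 bA2 bB2.
have [_ [Ka hA]] := bA2; have [_ [Kb hB]] := bB2.
have K0 : 0 <= Ka + Kb.
  by rewrite addr_ge0// ?(le_trans (normr_ge0 _) (hA 0)) ?(le_trans (normr_ge0 _) (hB 0)).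
apply: (is_derive_quadratic K0) => h.
have b1 := bmf_fou1 (x + h) bA bB; have b0 := bmf_fou1 x bA bB.
have bN : bmf (fun t : R => - (t * A t)) by meas.
have bd := bmf_fou1 x bB1 bN.
rewrite /fou -bintB// -bintZl// -bintB//; mp.
apply: bint_bound; mp.
move=> t; set c := cos (t * x); set s := sin (t * x).
rewrite (_ : _ - _ = A t * (cos (t * x + t * h) - c + t * h * s) +
    B t * (sin (t * x + t * h) - s - t * h * c)); last by rewrite -mulrDr /c /s; ring.
apply: (le_trans (ler_normD _ _)); rewrite !normrM mulrDl; apply: lerD.
  apply: (le_trans (ler_wpM2l (normr_ge0 _) (cos_taylor _ _))).
  have := hA t; rewrite normrM [`|t ^+ 2|]ger0_norm ?sqr_ge0// exprMn => le1.
  by rewrite mulrA ler_wpM2r ?sqr_ge0// mulrC.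
apply: (le_trans (ler_wpM2l (normr_ge0 _) (sin_taylor _ _))).
have := hB t; rewrite normrM [`|t ^+ 2|]ger0_norm ?sqr_ge0// exprMn => le1.
by rewrite mulrA ler_wpM2r ?sqr_ge0// mulrC.
Qed.

(** The derivative is again a Fourier integral, with coefficients t B and - t A, and the hypotheses
    on all powers of t pass to this pair; hence an induction over all A and B. *)
Lemma smooth_fou (A B : R -> R) :
  (forall k : nat, bmf (fun t : R => t ^+ k * A t)) ->
  (forall k : nat, bmf (fun t : R => t ^+ k * B t)) -> forall c : R,
  smooth (fun x => c * fou A B x).
Proof.
move=> hA hB c n x; move: A B hA hB c x.
have mono (A : R -> R) : (forall k : nat, bmf (fun t : R => t ^+ k * A t)) ->
   forall k : nat, bmf (fun t : R => t ^+ k * (t * A t)).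
  move=> hA k; have := hA k.+1; congr bmf; apply/funext => t.
  by rewrite exprSr mulrA.
have zero (A : R -> R) : (forall k : nat, bmf (fun t : R => t ^+ k * A t)) -> bmf A.
  by move=> /(_ 0%N); congr bmf; apply/funext => t; rewrite expr0 mul1r.
have D (A B : R -> R) (c x : R) : (forall k : nat, bmf (fun t : R => t ^+ k * A t)) ->
    (forall k : nat, bmf (fun t : R => t ^+ k * B t)) ->
    is_derive x 1 ((fun x => c * fou A B x) : R -> R^o)
      (c * fou (fun t : R => t * B t) (fun t : R => - (t * A t)) x).
  move=> hA hB; apply: (is_deriveZ c); apply: is_derive_fou => //.
  - exact: zero.
  - exact: zero.
  - exact: (hA 1%N).
  - exact: (hB 1%N).
elim: n => [|n IH] A B hA hB c x.
  by rewrite derive1n0; have [] := D A B c x hA hB.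
rewrite derive1Sn.
have -> : (fun x => c * fou A B x : R^o)^`()%classic =
    (fun x => c * fou (fun t : R => t * B t) (fun t : R => - (t * A t)) x).
  by apply/funext => y; rewrite derive1E; apply: derive_val; exact: D.
apply: IH; first exact: mono.
move=> k; have := bmfN (mono _ hA k); congr bmf; apply/funext => t.
by rewrite mulrN.
Qed.

End fourier.

Lemma unif_FTC01 {R : realType} (f F : R -> R) : bmf f -> (forall x, 0 <= f x) ->
  (forall x, {for x, continuous f}) -> (forall x : R, is_derive x 1 F (f x)) ->
  \int[unif]_v f v = F 1 - F 0.
Proof.
move=> bf f0 cf dF; apply: EFin_inj; rewrite bint_EFin// ge0_integral_unif; mp.
by rewrite (FTC_closed ltr01 (fun x _ => cf x) (fun x _ => dF x)).
Qed.

Lemma integral_itv_unif {R : realType} (h : R -> R) (A B : R) : A < B ->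
  mfn h -> (forall x, 0 <= h x) ->
  (\int[lebesgue_measure]_(x in `]A, B]) (h x)%:E =
   (B - A)%:E * \int[unif]_v (h (A + (B - A) * v))%:E)%E.
Proof.
move=> AB mh h0; have BA : 0 < B - A by rewrite subr_gt0.
rewrite integral_itv_obnd_cbnd; last exact/measurable_funTS/measurable_EFinP.
rewrite integral_mkcond.
have mf : mfn (fun x : R => ((\1_(`[A, B]%classic) x * h x)%:E)).
  by apply/measurable_EFinP; apply: measurable_funM => //; meas.
transitivity (\int[lebesgue_measure]_x ((\1_(`[A, B]%classic) x * h x)%:E))%E.
  apply: eq_integral => x _; rewrite patchE indicE.
  by case: ifP => _; rewrite ?mul1r ?mul0r.
rewrite (ge0_integral_affine A BA mf); last by move=> x; rewrite lee_fin mulr_ge0.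
rewrite ge0_integral_unif; last 2 first.
- apply/measurable_EFinP; apply: (measurableT_comp mh); exact: measurable_funD.
- by pos.
congr (_ * _)%E; rewrite [RHS]integral_mkcond; apply: eq_integral => x _.
rewrite patchE indicE !mem_setE !in_itv/=.
have -> : (A <= (B - A) * x + A <= B) = (0 <= x <= 1).
  rewrite -lerBlDr subrr pmulr_rge0// -lerBrDr -[leRHS in _ && (_ <= leRHS)]mulr1.
  by rewrite ler_pM2l.
by case: ifP => _; rewrite ?mul0r// mul1r addrC.
Qed.

(** * Fourier inversion with the Poisson kernel *)

Section inversion.
Context {R : realType} {d} {T : measurableType d}
  (P : probability T R) (Y : T -> R).
Hypothesis mY : mfn Y.
Variables (b M : R).
Hypothesis b0 : 0 < b.
Hypothesis modM : forall t : R, modT P Y t * wt b t <= M.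
Hypothesis noatom : forall x : R, P (Y @^-1` [set x]) = 0%E.
Notation cosY := (cosT P Y).
Notation sinY := (sinT P Y).
Notation modY := (modT P Y).
Notation rh := (rho b0).
Notation w := (wt b).

(** The real part of exp (- i t x) phi (t). *)
Let u (t x : R) : R := cosY t * cos (t * x) + sinY t * sin (t * x).

Let uE t x : u t x = \int[P]_z cos (t * (Y z - x)).
Proof.
have bc := bmf_cos_mul mY t; have bs := bmf_sin_mul mY t.
rewrite /u /cosT /sinT -!bintZr// -bintD; mp.
by apply: eq_Rintegral => z _; rewrite mulrBr cosB.
Qed.
Let u_le t x : `|u t x| <= modY t.
Proof.
have one (e : R) : e ^+ 2 = 1 -> e * u t x <= modY t.
  move=> e1; rewrite /u mulrDr !mulrA; apply: (le_trans (cauchy2 _ _ _ _)).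
  by rewrite cos2Dsin2 sqrtr1 mulr1 !exprMn e1 !mul1r.
rewrite ler_norml; apply/andP; split.
  by rewrite lerNl -mulN1r; apply: one; rewrite sqrrN expr1n.
by rewrite -[u t x]mul1r; apply: one; rewrite expr1n.
Qed.
Let mw : mfn w. Proof. exact: measurable_wt. Qed.
Let w0 t : 0 <= w t. Proof. exact: wt_ge0. Qed.

Definition Aw (t : R) : R := cosY t * w t.
Definition Bw (t : R) : R := sinY t * w t.

Let le_mod (c s : R) : `|c| <= Num.sqrt (c ^+ 2 + s ^+ 2).
Proof. by rewrite -sqrtr_sqr ler_wsqrtr// lerDl sqr_ge0. Qed.

Lemma Aw_le t : `|Aw t| <= modY t * w t.
Proof. by rewrite normrM (ger0_norm (w0 t)) ler_wpM2r//; exact: le_mod. Qed.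

Lemma Bw_le t : `|Bw t| <= modY t * w t.
Proof. by rewrite normrM (ger0_norm (w0 t)) ler_wpM2r// /modT addrC; exact: le_mod. Qed.

Lemma measurable_Aw : mfn Aw.
Proof. by apply: measurable_funM => //; case: (bmf_cosT P mY). Qed.

Lemma measurable_Bw : mfn Bw.
Proof. by apply: measurable_funM => //; case: (bmf_sinT P mY). Qed.

Lemma bmf_Aw : bmf Aw.
Proof.
apply: (@bmf_le _ _ _ _ M); first exact: measurable_Aw.
by move=> t; apply: (le_trans (Aw_le t)).
Qed.

Lemma bmf_Bw : bmf Bw.
Proof.
apply: (@bmf_le _ _ _ _ M); first exact: measurable_Bw.
by move=> t; apply: (le_trans (Bw_le t)).
Qed.

(** The inversion formula with the whole line folded onto t > 0, so that 1 / (2 pi) becomes 1 /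
    pi. *)
Definition dens (x : R) : R := pi^-1 * fou rh Aw Bw x.

Let uw t x : u t x * w t = Aw t * cos (t * x) + Bw t * sin (t * x).
Proof. by rewrite /u /Aw /Bw; ring. Qed.
Let densE x : dens x = pi^-1 * \int[rh]_t (u t x * w t).
Proof. by congr (_ * _); apply: eq_Rintegral => t _; rewrite uw. Qed.
Let buw x : bmf (fun t : R => u t x * w t).
Proof. by under eq_fun do rewrite uw; apply: bmf_fou1; [exact: bmf_Aw|exact: bmf_Bw]. Qed.
Let uw_le t x : `|u t x * w t| <= M.
Proof.
apply: le_trans (modM t); rewrite normrM (ger0_norm (w0 t)) ler_wpM2r//; exact: u_le.
Qed.
Let pi0 : 0 < pi^-1 :> R. Proof. by rewrite invr_gt0 pi_gt0. Qed.

Lemma continuous_dens : continuous dens.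
Proof.
move=> x; have := @continuous_fou R rh Aw Bw bmf_Aw bmf_Bw x.
by apply: cvgM; exact: cvg_cst.
Qed.

Lemma bmf_dens : bmf dens.
Proof. by apply: bmfM; [by meas|exact: (bmf_fou rh bmf_Aw bmf_Bw)]. Qed.
Let bu x : bmf (fun t : R => u t x).
Proof.
by apply: bmf_fou1; [exact: (bmf_cosT P mY)|exact: (bmf_sinT P mY)].
Qed.
(** The Cauchy density of scale s centred at x, which comes from the damping factor exp (- s
    |t|). *)
Let pois (s x y : R) : R := pi^-1 * (s^-1 * (1 + ((y - x) / s) ^+ 2)^-1).

Let pois_ge0 (s x y : R) : 0 < s -> 0 <= pois s x y.
Proof.
move=> s0; rewrite mulr_ge0 ?(ltW pi0)// mulr_ge0 ?invr_ge0 ?(ltW s0)//; mp.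
Qed.
Let densS (s x : R) : R := pi^-1 * \int[rh]_t (u t x * w t * expR (- (s * `|t|))).

(** [ex_rho] turns the damped integral into an exponential mean, which [ex_cos] evaluates after
    Fubini. *)
Let densS_pois s x : 0 < s -> densS s x = \int[P]_z pois s x (Y z).
Proof.
move=> s0; have sn : s != 0 by rewrite gt_eqF.
have mj : mfn (fun p : R * T => p.1 * ((Y p.2 - x) / s)) by meas.
have bj := bmf_cos mj.
rewrite /densS -(ex_rho b0 s0 (bu x) (buw x)) /pois.
transitivity (pi^-1 * (s^-1 * \int[P]_z (1 + ((Y z - x) / s) ^+ 2)^-1)).
  congr (_ * (_ * _)).
  transitivity (\int[ex]_t \int[P]_z cos (t * ((Y z - x) / s))).
    apply: eq_Rintegral => t _; rewrite uE; apply: eq_Rintegral => z _.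
    by congr cos; field.
  rewrite -(bint_fubini1 bj) (bint_fubini2 bj); apply: eq_Rintegral => z _ /=.
  exact: ex_cos.
have bq : bmf (fun z => (1 + ((Y z - x) / s) ^+ 2)^-1).
  have := bmf_fubini2 bj (@ex R); congr bmf; apply/funext => z /=; exact: ex_cos.
rewrite bintZl; first by rewrite bintZl.
by meas.
Qed.
Let densS_cvg x : densS n.+1%:R^-1 x @[n --> \oo] --> dens x.
Proof.
rewrite densE; apply: cvgM; first exact: cvg_cst.
apply: (@bint_cvg _ _ _ rh _ _ M).
- move=> n; have n0 : 0 <= n.+1%:R^-1 :> R by pos.
  by have [] := bmf_wt_exp (k := u^~ x) n0 (buw x).
- by case: (buw x).
- move=> n t; rewrite normrM -[leRHS]mulr1; apply: ler_pM => //.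
  rewrite ger0_norm ?expR_ge0// -expR0 ler_expR oppr_le0 mulr_ge0// invr_ge0//.
apply: aeW => t; rewrite -[X in _ --> X]mulr1; apply: cvgM; first exact: cvg_cst.
suff : expR (- (n.+1%:R^-1 * `|t|)) @[n --> \oo] --> expR (- (0 * `|t|)).
  by rewrite mul0r oppr0 expR0.
apply: (continuous_cvg _ (@continuous_expR R _)); apply: cvgN; apply: cvgM; last exact: cvg_cst.
exact: cvg_harmonic.
Qed.

(** A limit of the smoothed densities, which are means of a nonnegative kernel. *)
Lemma dens_ge0 x : 0 <= dens x.
Proof.
have cv := @densS_cvg x; rewrite -(cvg_lim (@Rhausdorff R) cv); apply: limr_ge.
  by apply/cvg_ex; exists (dens x).
near=> n; rewrite densS_pois ?invr_gt0//; apply: bint_ge0 => z.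
by apply: pois_ge0; rewrite invr_gt0.
Unshelve. all: by end_near. Qed.

Lemma dens_le x : dens x <= pi^-1 * M.
Proof.
rewrite densE ler_wpM2l ?(ltW pi0)//; apply: (le_trans (ler_norm _)).
by apply: bint_bound => // t; exact: uw_le.
Qed.
Let bdensS s : 0 < s -> bmf (densS s) /\ forall x, `|densS s x| <= pi^-1 * M.
Proof.
move=> s0.
have E : densS s = fun x => pi^-1 * fou rh (fun t => Aw t * expR (- (s * `|t|)))
    (fun t => Bw t * expR (- (s * `|t|))) x.
  apply/funext => x; congr (_ * _); apply: eq_Rintegral => t _; rewrite uw; ring.
have me : mfn (fun t : R => s * `|t|) by meas.
have be : bmf (fun t : R => expR (- (s * `|t|))) by meas.
split.
  rewrite E; apply: bmfM; first by meas.
  by apply: bmf_fou; apply: bmfM => //; [exact: bmf_Aw|exact: bmf_Bw].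
move=> x; rewrite normrM (gtr0_norm pi0) ler_wpM2l ?(ltW pi0)//.
apply: bint_bound; first by meas.
move=> t; rewrite normrM -[leRHS]mulr1; apply: ler_pM => //.
by rewrite ger0_norm ?expR_ge0// -expR0 ler_expR oppr_le0 mulr_ge0// ltW.
Qed.
Let H (A B s y : R) (v : R) : R := pi^-1 * atan ((A + (B - A) * v - y) / s).

Let is_derive_H (A B s y v : R) : 0 < s ->
  is_derive v 1 (H A B s y) ((B - A) * pois s (A + (B - A) * v) y).
Proof.
move=> s0; have sn : s != 0 by rewrite gt_eqF.
have D1 : is_derive v 1 (fun v : R => (A + (B - A) * v - y) / s) ((B - A) / s).
  have -> : (fun v : R => (A + (B - A) * v - y) / s) =
    (fun v : R => (A - y) / s + (B - A) / s * v) by apply/funext => z; field.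
  by have := is_derive_addlin ((B - A) / s) (is_derive_cst ((A - y) / s) v 1); rewrite add0r.
have D2 := @is_derive1_comp R (@atan R) _ v _ _ (is_derive1_atan _) D1.
have := is_deriveZ pi^-1 D2 => D; apply: is_derive_eq; rewrite /GRing.scale/= /pois.
have -> : ((y - (A + (B - A) * v)) / s) ^+ 2 = ((A + (B - A) * v - y) / s) ^+ 2.
  by rewrite -sqrrN -mulNr opprB.
by ring.
Qed.
Let cont_pois (A B s y v : R) :
  {for v, continuous (fun v : R => (B - A) * pois s (A + (B - A) * v) y)}.
Proof.
apply: cvgM; first exact: cvg_cst.
apply: cvgM; first exact: cvg_cst.
apply: cvgM; first exact: cvg_cst.
apply: cvgV; first by rewrite gt_eqF// ltr_pwDl// sqr_ge0.
apply: cvgD; first exact: cvg_cst.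
have c1 : {for v, continuous (fun v : R => (y - (A + (B - A) * v)) / s)}.
  apply: cvgM; last exact: cvg_cst.
  apply: cvgB; first exact: cvg_cst.
  apply: cvgD; first exact: cvg_cst.
  by apply: cvgM; [exact: cvg_cst|exact: cvg_id].
by under eq_fun do rewrite expr2; rewrite expr2; apply: cvgM.
Qed.
Let integral_densS (A B s : R) : A < B -> 0 < s ->
  (B - A) * \int[unif]_v densS s (A + (B - A) * v) =
  \int[P]_z (pi^-1 * atan ((B - Y z) / s) - pi^-1 * atan ((A - Y z) / s)).
Proof.
move=> AB s0; have BA : 0 < B - A by rewrite subr_gt0.
have mj : mfn (fun p : R * T => (B - A) * pois s (A + (B - A) * p.1) (Y p.2)).
  rewrite /pois; apply: measurable_funM => //; apply: measurable_funM => //; apply: measurable_funM => //.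
  apply: (@measurableT_comp _ _ _ _ _ _ (fun z : R => (1 + z ^+ 2)^-1)).
    apply: continuous_measurable_fun; exact: continuous_oneDsqrV.
  by meas.
have bj : bmf (fun p : R * T => (B - A) * pois s (A + (B - A) * p.1) (Y p.2)).
  apply: (@bmf_le _ _ _ _ ((B - A) * (pi^-1 * s^-1))) => // p.
  rewrite ger0_norm; last by rewrite mulr_ge0 ?(ltW BA)// pois_ge0.
  rewrite ler_wpM2l ?(ltW BA)// ler_wpM2l ?(ltW pi0)// ler_piMr ?invr_ge0 ?(ltW s0)//.
  by rewrite invf_le1 ?lerDl ?sqr_ge0// ltr_pwDl// sqr_ge0.
have [bS _] := bdensS s0.
have bSv : bmf (fun v : R => densS s (A + (B - A) * v)).
  case: bS => mS hS; apply: (bmf_comp mS hS); exact: measurable_funD.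
rewrite -bintZl//.
transitivity (\int[unif]_v \int[P]_z ((B - A) * pois s (A + (B - A) * v) (Y z))).
  apply: eq_Rintegral => v _; rewrite densS_pois// bintZl//.
  have := bmfM (bmf_cst (B - A)^-1) (bmf_pair1 bj v); congr bmf; apply/funext => z /=.
  by rewrite mulKf// gt_eqF.
rewrite -(bint_fubini1 bj) (bint_fubini2 bj); apply: eq_Rintegral => z _ /=.
have p0 (v : R) : 0 <= (B - A) * pois s (A + (B - A) * v) (Y z).
  by rewrite mulr_ge0 ?(ltW BA)// pois_ge0.
rewrite [LHS](@unif_FTC01 R (fun v => (B - A) * pois s (A + (B - A) * v) (Y z)) (H A B s (Y z))
  (bmf_pair2 bj z) p0 (@cont_pois A B s (Y z)) (fun v => is_derive_H A B (Y z) v s0)).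
by rewrite /H mulr1 mulr0 addr0 [A + _]addrC subrK.
Qed.
Let atan_cvg (D : R) : D != 0 ->
  pi^-1 * atan (D / n.+1%:R^-1) @[n --> \oo] --> (Num.sg D / 2 : R).
Proof.
have piN : pi != 0 :> R by rewrite gt_eqF ?pi_gt0.
have pos (E : R) : 0 < E -> pi^-1 * atan (E / n.+1%:R^-1) @[n --> \oo] --> (2^-1 : R).
  move=> E0; have -> : 2^-1 = pi^-1 * (pi / 2) :> R by rewrite mulKf.
  apply: cvgM; first exact: cvg_cst.
  apply: (cvg_comp _ _ _ (@cvgy_atan R)).
  apply/cvgryPge => K; near=> n; rewrite invrK mulrC -ler_pdivrMr//.
  apply: (@le_trans _ _ n%:R); last by rewrite ler_nat.
  by near: n; exact: nbhs_infty_ger.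
move=> D0; have [Dn|Dp|Dz] := ltgtP D 0; last by rewrite Dz eqxx in D0.
  rewrite ltr0_sg// mulN1r.
  have -> : (fun n : nat => pi^-1 * atan (D / n.+1%:R^-1)) =
    (fun n => - (pi^-1 * atan (- D / n.+1%:R^-1))).
    by apply/funext => n; rewrite mulNr atanN mulrN opprK.
  by apply: cvgN; apply: pos; rewrite oppr_gt0.
by rewrite gtr0_sg// mul1r; exact: pos.
Unshelve. all: by end_near. Qed.
Let ae_ne (x : R) : {ae P, forall z, x - Y z != 0}.
Proof.
exists (Y @^-1` [set x]); split; [by meas|exact: noatom|].
by move=> z /= /negP/negPn; rewrite subr_eq0 => /eqP.
Qed.

(** The smoothed densities integrate to differences of arctangents. As s tends to 0 these tend to
    the indicator of the interval except at its ends, which carry no mass. *)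
Lemma integral_dens_itv (A B : R) : A < B ->
  (B - A) * \int[unif]_v dens (A + (B - A) * v) = \int[P]_z (\1_(`]A, B]%classic) (Y z) : R).
Proof.
move=> AB; have BA : 0 < B - A by rewrite subr_gt0.
have mv : mfn (fun v : R => A + (B - A) * v).
  by apply: measurable_funD => //; meas.
have cv1 : (B - A) * \int[unif]_v densS n.+1%:R^-1 (A + (B - A) * v) @[n --> \oo] -->
    (B - A) * \int[unif]_v dens (A + (B - A) * v).
  apply: cvgM; first exact: cvg_cst.
  apply: (@bint_cvg _ _ _ unif _ _ (pi^-1 * M)).
  - move=> n; have [[mS _] _] := @bdensS n.+1%:R^-1 (ltac:(by rewrite invr_gt0)); mp.
  - by apply: measurableT_comp mv; case: bmf_dens.
  - move=> n v; have [_] := @bdensS n.+1%:R^-1 (ltac:(by rewrite invr_gt0)); exact.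
  by apply: aeW => v; exact: densS_cvg.
have cv2 : \int[P]_z (pi^-1 * atan ((B - Y z) / n.+1%:R^-1) - pi^-1 * atan ((A - Y z) / n.+1%:R^-1))
    @[n --> \oo] --> \int[P]_z (\1_(`]A, B]%classic) (Y z) : R).
  have ma (C s : R) : mfn (fun z => pi^-1 * atan ((C - Y z) / s)).
    apply: measurable_funM => //; apply: measurableT_comp.
      by apply: continuous_measurable_fun => x; exact: continuous_atan.
    by meas.
  have ba (C s : R) z : `|pi^-1 * atan ((C - Y z) / s)| <= 2^-1.
    rewrite normrM (gtr0_norm pi0) -ler_pdivlMl// invrK ler_norml.
    by rewrite -mulNr !ltW ?atan_ltpi2// mulNr atan_gtNpi2.
  apply: (@bint_cvg _ _ _ P _ _ 1); mp.
  - by move=> n; exact: measurable_funB.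
  - move=> n z; apply: (le_trans (ler_normB _ _)); apply: (le_trans (lerD (ba _ _ _) (ba _ _ _))).
    by apply: eqle; field.
  apply: filterS2 (ae_ne A) (ae_ne B) => z hA hB.
  have -> : \1_(`]A, B]%classic) (Y z) = Num.sg (B - Y z) / 2 - Num.sg (A - Y z) / 2 :> R.
    rewrite indicE mem_setE in_itv/=.
    have [c1|c1|c1] := ltgtP A (Y z); last by rewrite c1 subrr eqxx in hA.
    - rewrite [Num.sg (A - _)]ltr0_sg ?subr_lt0//=.
      have [c2|c2|c2] := ltgtP (Y z) B; last by rewrite c2 subrr eqxx in hB.
        by rewrite gtr0_sg ?subr_gt0// -[LHS]/(1%:R : R); field.
      by rewrite ltr0_sg ?subr_lt0// -[LHS]/(0%:R : R); field.
    - rewrite [Num.sg (A - _)]gtr0_sg ?subr_gt0//= gtr0_sg ?subrr//.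
      by rewrite subr_gt0; exact: lt_trans AB.
  by apply: cvgB; exact: atan_cvg.
have E : (fun n : nat => (B - A) * \int[unif]_v densS n.+1%:R^-1 (A + (B - A) * v)) =
  (fun n => \int[P]_z (pi^-1 * atan ((B - Y z) / n.+1%:R^-1) - pi^-1 * atan ((A - Y z) / n.+1%:R^-1))).
  by apply/funext => n; rewrite integral_densS// invr_gt0.
rewrite E in cv1; exact: (cvg_unique _ cv1 cv2).
Qed.

Lemma law_dens (X : set R) : measurable X ->
  P (Y @^-1` X) = (\int[lebesgue_measure]_(x in X) (dens x)%:E)%E.
Proof.
have mdens : mfn dens by case: bmf_dens.
pose nu := @densm _ (measurableTypeR R) R lebesgue_measure dens mdens dens_ge0.
have mYr : mfn (Y : T -> measurableTypeR R) by meas.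
pose lw : probability (measurableTypeR R) R := distribution P (mkmfun mYr).
have H1 (A B : R) : A < B -> lw (`]A, B]%classic) = nu (`]A, B]%classic).
  move=> AB; have mI : measurable (`]A, B]%classic : set R) by meas.
  rewrite [RHS](integral_itv_unif AB mdens dens_ge0).
  have bd : bmf (fun v : R => dens (A + (B - A) * v)).
    case: bmf_dens => mS hS; apply: (bmf_comp mS hS); exact: measurable_funD.
  by rewrite -bint_EFin// -EFinM integral_dens_itv// -(prob_bint P mY mI).
move=> mX; transitivity (lw X); first by []; transitivity (nu X); last by [].
apply: (@measure_unique _ R (measurableTypeR R) (@ocitv R) (fun n => `](- n%:R), n%:R]%classic)
  _ _ _ _ lw nu) => //.
- exact: ocitvI.
- by move=> n; exact: is_ocitv.
- apply/seteqP; split => // x _; exists (Num.truncn `|x|).+1 => //=.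
  have := truncnS_gt `|x|; rewrite ltr_norml in_itv/= => /andP[-> h]; exact: ltW.
- move=> _ [[A B] /= _ <-]; have [AB|AB] := ltP A B; first exact: H1.
  have -> : `]A, B]%classic = set0 :> set R by rewrite set_itv_ge// bnd_simp -leNgt.
  by rewrite measure0 [RHS]integral_set0.
- by move=> n; rewrite (le_lt_trans (probability_le1 _ _)) ?ltry.
Qed.

End inversion.

Lemma powR_lipschitz {R : realType} (m : R) : 0 < m -> exists2 L : R, 0 < L &
  forall v w : R, 4^-1 <= v <= 1 -> 4^-1 <= w <= 1 -> `|v `^ m - w `^ m| <= L * `|v - w|.
Proof.
move=> m0; have q0 : (0 < 4^-1 :> R) by rewrite invr_gt0.
(* On [1/4, 1] the derivative m c^(m - 1) is at most m 4^(1 - m) when m < 1, and at most m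
   otherwise. *)
exists (m * (4^-1 `^ (m - 1) + 1)).
  by rewrite mulr_gt0// ltr_wpDl// powR_ge0.
have der (c : R) : 4^-1 <= c <= 1 -> `|m * c `^ (m - 1)| <= m * (4^-1 `^ (m - 1) + 1).
  move=> /andP[c1 c2]; have c0 : 0 < c by exact: lt_le_trans c1.
  rewrite ger0_norm ?mulr_ge0 ?powR_ge0 ?(ltW m0)// ler_wpM2l ?(ltW m0)//.
  have [m1|m1|m1] := ltgtP m 1.
  - apply: (@le_trans _ _ (4^-1 `^ (m - 1))); last by rewrite lerDl.
    rewrite -[m - 1]opprB; apply: powRN_decr => //; by rewrite subr_gt0.
  - apply: (@le_trans _ _ 1); last by rewrite lerDr powR_ge0.
    have p1 : 1 `^ (m - 1) = 1 :> R by rewrite powR1.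
    rewrite -[leRHS]p1; apply: ge0_ler_powR; rewrite ?nnegrE ?(ltW c0)//.
    by rewrite subr_ge0 ltW.
  - by rewrite m1 subrr !powRr0 lerDl.
move=> v w; wlog vw : v w / w < v.
  move=> H hv hw; have [vw|vw|->] := ltgtP v w; last by rewrite !subrr normr0 mulr0.
  - by rewrite distrC [`|v - w|]distrC; exact: H.
  - exact: H.
move=> /andP[v1 v2] /andP[w1 w2].
have w0 : 0 < w by exact: lt_le_trans w1.
have [||c] := @MVT R (fun y : R => y `^ m) (fun y => m * y `^ (m - 1)) w v vw.
- move=> c; rewrite in_itv/= => /andP[c1 c2]; apply: is_derive_pow; exact: lt_trans c1.
- apply: derivable_within_continuous => c; rewrite in_itv/= => /andP[c1 c2].
  by have [] := is_derive_pow m (lt_le_trans w0 c1).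
rewrite in_itv/= => /andP[c1 c2] ->; rewrite normrM ler_wpM2r//; apply: der.
by rewrite (le_trans w1 (ltW c1)) (le_trans (ltW c2) v2).
Qed.

Section weighted_modulus.
Context {R : realType} {d} {T : measurableType d}
  (P : probability T R) (Y : T -> R).
Hypothesis mY : mfn Y.
Variable b : R.
Hypothesis b0 : 0 < b.
Notation w := (wt b).

(** [wt] grows like |t|^(1 + b), so k further powers call for the decay order 1 + b + k; for |t| <=
    1 all factors are bounded. *)
Lemma weighted_modulus (k : nat) : decays (modT P Y) (1 + b + k%:R) ->
  exists M : R, forall t : R, `|t| ^+ k * (modT P Y t * w t) <= M.
Proof.
move=> [C C0 hC]; exists (2 `^ (1 + b) / b * (1 + C)) => t.
have /andP[M0 M1] := modT01 P mY t.
have p0 : 0 <= 2 `^ (1 + b) / b by pos.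
have [t1|t1] := leP `|t| 1.
  have wle : w t <= 2 `^ (1 + b) / b.
    rewrite /wt ler_wpM2r ?invr_ge0 ?(ltW b0)//.
    apply: ge0_ler_powR; rewrite ?nnegrE ?addr_ge0 ?(ltW b0)//.
    by rewrite -[leRHS]/(1 + 1) lerD2l.
  apply: (@le_trans _ _ (1 * (1 * (2 `^ (1 + b) / b)))).
    apply: ler_pM; [by pos|exact: (mulr_ge0 M0 (wt_ge0 b0 t))|exact: exprn_ile1|].
    exact: (ler_pM M0 (wt_ge0 b0 t)).
  by rewrite !mul1r ler_peMr// lerDl.
have t0 : 0 < `|t| by exact: lt_trans t1.
have Me : modT P Y t <= C * `|t| `^ (- (1 + b + k%:R)).
  have -> : modT P Y t = modT P Y `|t|.
    by have [h|h] := leP 0 t; [rewrite ger0_norm|rewrite ltr0_norm// modTN].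
  exact: hC.
have wle : w t <= 2 `^ (1 + b) / b * `|t| `^ (1 + b).
  rewrite mulrAC /wt ler_wpM2r ?invr_ge0 ?(ltW b0)// -powRM//.
  apply: ge0_ler_powR; rewrite ?nnegrE ?addr_ge0 ?mulr_ge0 ?(ltW b0)//.
  by rewrite mulr_natl mulr2n lerD2r ltW.
apply: (@le_trans _ _ (`|t| ^+ k * ((C * `|t| `^ (- (1 + b + k%:R))) *
    (2 `^ (1 + b) / b * `|t| `^ (1 + b))))).
  apply: ler_wpM2l; first by pos.
  exact: (ler_pM M0 (wt_ge0 b0 t)).
have E : `|t| ^+ k * `|t| `^ (- (1 + b + k%:R)) * `|t| `^ (1 + b) = 1.
  rewrite -powR_mulrn// -!powRD ?(gt_eqF t0) ?implybT//.
  by rewrite (_ : k%:R + - (1 + b + k%:R) + (1 + b) = 0) ?powRr0//; ring.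
rewrite [leLHS](_ : _ = 2 `^ (1 + b) / b * C * (`|t| ^+ k * `|t| `^ (- (1 + b + k%:R)) * `|t| `^ (1 + b))); last by ring.
by rewrite E mulr1 ler_wpM2l// lerDr.
Qed.

End weighted_modulus.

(* Named so that automation does not try these hypotheses on every goal. *)
Definition nng {R : realType} {T : Type} (f : T -> R) : Prop := forall x, 0 <= f x.
Definition unitv {R : realType} {T : Type} (f : T -> R) : Prop := forall x, 0 <= f x <= 1.

Lemma window_quarters {R : realType} (v w r : R) : 3 / 8 <= w -> w <= 5 / 8 ->
  r <= 16^-1 -> w - r <= v -> v < w + r -> 4^-1 <= v <= 3 / 4.
Proof. by move=> *; apply/andP; split; lra. Qed.

Lemma window_range {R : realType} (w r : R) : 3 / 8 <= w -> w <= 5 / 8 -> 0 < r ->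
  r <= 16^-1 -> [/\ 0 <= w - r, w - r <= w + r & w + r <= 1].
Proof. by move=> *; split; lra. Qed.

(** * The fixed-point equation in law *)

Section echo_fixed_point.
Context {R : realType} {d0} {T0 : measurableType d0}
  (P0 : probability T0 R) (Z : T0 -> R)
  {d} {T : measurableType d} (P : probability T R) (Y : T -> R).
Variables (m g q : R).
Hypothesis el : echo_law m g q P0 Z P Y.
Notation unif := (@unif R).

Let mZ := el_mZ el.
Let mY := el_mY el.
Let Z0 := el_Z0 el.
Let Y0 := el_Y0 el.
Let m0 := el_m el.

Section fixed_point.

(** The law of the independent quadruple (V, Z, Y, Y') of the equation, grouped as ((V, Z), (Y,
    Y')). *)
Definition fpQ := pprod (pprod unif P0) (pprod P P).
Definition fpX (z : (R * T0) * (T * T)) : R :=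
  `|z.1.1| `^ m * Y z.2.1 + `|1 - z.1.1| `^ m * Z z.1.2 * Y z.2.2.

Let mleft : mfn (fun z : (R * T0) * (T * T) => `|z.1.1| `^ m * Y z.2.1).
Proof. by meas. Qed.
Let mright : mfn
  (fun z : (R * T0) * (T * T) => `|1 - z.1.1| `^ m * Z z.1.2 * Y z.2.2).
Proof. by meas. Qed.

Lemma measurable_fpX : mfn fpX.
Proof. exact: measurable_funD. Qed.

Lemma fpX_ge0 z : 0 <= fpX z.
Proof. by rewrite addr_ge0// !mulr_ge0 ?powR_ge0. Qed.

Lemma fpQ_bint (h : (R * T0) * (T * T) -> R) : bmf h ->
  \int[fpQ]_z h z = \int[unif]_v \int[P0]_u \int[P]_w \int[P]_w' h ((v, u), (w, w')).
Proof.
move=> bh; rewrite bint_fubini1// bint_fubini1; last exact: bmf_fubini1.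
apply: eq_Rintegral => v _; apply: eq_Rintegral => u _.
by rewrite bint_fubini1//; exact: bmf_pair1.
Qed.

Lemma fpQ_ge0 (h : (R * T0) * (T * T) -> \bar R) : mfn h ->
  (forall z, 0 <= h z)%E ->
  (\int[fpQ]_z h z =
   \int[unif]_v \int[P0]_u \int[P]_w \int[P]_w' h ((v, u), (w, w')))%E.
Proof.
move=> mh h0.
rewrite (@fubini_tonelli1 _ _ _ _ _ (pprod unif P0) (pprod P P) h mh h0) /fubini_F.
rewrite (@fubini_tonelli1 _ _ _ _ _ unif P0 (fun x => \int[pprod P P]_y h (x, y))%E); last 2 first.
- exact: (@measurable_fun_fubini_tonelli_F _ _ _ _ _ (pprod P P)).
- by move=> x; apply: integral_ge0 => y _; exact: h0.
rewrite /fubini_F; apply: eq_integral => v _; apply: eq_integral => u _.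
rewrite (@fubini_tonelli1 _ _ _ _ _ P P (fun y => h ((v, u), y)))//.
exact: (measurable_fun_pair2 (v, u) mh).
Qed.

(** The Laplace transform of [fpX] factorises over the two copies of Y into the right side of
    [el_lap]. *)
Lemma fp_law : eq_law P fpQ Y fpX.
Proof.
move=> A mA; apply: laplace_uniqueness => //; first exact: measurable_fpX.
- exact: fpX_ge0.
move=> n; have n0 : 0 <= n%:R :> R by [].
rewrite (el_lap el n0) fpQ_bint; last first.
  apply: bmf_expN; first by apply: measurable_funM => //; exact: measurable_fpX.
  by move=> z; rewrite mulr_ge0// fpX_ge0.
have bY (c : R) : 0 <= c -> bmf (fun w => expR (- (c * Y w))).
  move=> c0; apply: bmf_expN; first by meas.
  by pos.
apply: eq_Rintegral => v _.
rewrite -bintZl; last first.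
  apply: (@bmf_fubini1 _ _ _ _ _ (fun p : T0 * T => expR (- (n%:R * `|1 - v| `^ m * Z p.1 * Y p.2)))); mp.
apply: eq_Rintegral => u _.
rewrite -bintZr; last by apply: bY; rewrite mulr_ge0 ?powR_ge0.
apply: eq_Rintegral => w _.
rewrite -bintZl; last by apply: bY; rewrite !mulr_ge0 ?powR_ge0.
apply: eq_Rintegral => w' _; rewrite -expRD; congr expR.
by rewrite /fpX/=; ring.
Qed.

Lemma fp_bint (h : R -> R) : bmf h ->
  \int[P]_w h (Y w) = \int[unif]_v \int[P0]_u \int[P]_w \int[P]_w'
     h (`|v| `^ m * Y w + `|1 - v| `^ m * Z u * Y w').
Proof.
move=> bh; rewrite (eq_law_bint mY measurable_fpX fp_law bh) fpQ_bint//.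
have [mh [M hM]] := bh; apply: (@bmf_le _ _ _ _ M) => [|z]; last exact: hM.
exact: (measurableT_comp mh measurable_fpX).
Qed.

End fixed_point.

(** * Integer moments of the limit *)

Section moments.

Lemma fpQ_prod (f1 : R -> R) (f2 : T0 -> R) (f3 f4 : T -> R) :
  mfn f1 -> mfn f2 ->
  mfn f3 -> mfn f4 ->
  (forall x, 0 <= f1 x) -> (forall x, 0 <= f2 x) ->
  (forall x, 0 <= f3 x) -> (forall x, 0 <= f4 x) ->
  (\int[fpQ]_z (f1 z.1.1 * (f2 z.1.2 * (f3 z.2.1 * f4 z.2.2)))%:E =
   \int[unif]_v (f1 v)%:E * (\int[P0]_u (f2 u)%:E *
     (\int[P]_w (f3 w)%:E * \int[P]_w (f4 w)%:E)))%E.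
Proof.
move=> m1 m2 m3 m4 p1 p2 p3 p4.
rewrite fpQ_ge0; last 2 first.
- by meas.
- by move=> z; rewrite lee_fin !mulr_ge0.
have I4 : (0 <= \int[P]_w (f4 w)%:E)%E by apply: integral_ge0 => w _; rewrite lee_fin.
have I3 : (0 <= \int[P]_w (f3 w)%:E)%E by apply: integral_ge0 => w _; rewrite lee_fin.
have I2 : (0 <= \int[P0]_w (f2 w)%:E)%E by apply: integral_ge0 => w _; rewrite lee_fin.
have Zl d' (T' : measurableType d') (Q : probability T' R) (f : T' -> R) (c : R) :
    mfn f -> (forall x, 0 <= f x) -> 0 <= c ->
    (\int[Q]_w (c * f w)%:E = c%:E * \int[Q]_w (f w)%:E)%E.
  move=> mf f0 c0; under eq_integral do rewrite EFinM.
  apply: ge0_integralZl => //; first by meas.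
  by move=> x _; rewrite lee_fin.
have Zr d' (T' : measurableType d') (Q : probability T' R) (f : T' -> R) (c : \bar R) :
    mfn f -> (forall x, 0 <= f x) -> (0 <= c)%E ->
    (\int[Q]_w ((f w)%:E * c) = \int[Q]_w (f w)%:E * c)%E.
  move=> mf f0 c0; apply: ge0_integralZr => //; first by meas.
  by move=> x _; rewrite lee_fin.
rewrite -Zr//; last by rewrite !mule_ge0.
apply: eq_integral => v _.
rewrite -Zr//; last by rewrite mule_ge0.
transitivity (\int[P0]_x ((f1 v)%:E * ((f2 x)%:E * (\int[P]_w (f3 w)%:E * \int[P]_w (f4 w)%:E))))%E.
  apply: eq_integral => u _ /=; rewrite -Zr//.
  transitivity (\int[P]_w ((f1 v * f2 u)%:E * ((f3 w)%:E * \int[P]_w' (f4 w')%:E)))%E.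
    apply: eq_integral => w _; rewrite !muleA -!EFinM -Zl ?mulr_ge0//.
    by apply: eq_integral => w' _; rewrite !mulrA.
  rewrite muleA -EFinM; apply: ge0_integralZl => //; mp.
  - by move=> w _; apply: mule_ge0; [rewrite lee_fin|].
  - by rewrite lee_fin mulr_ge0.
apply: ge0_integralZl => //; mp.
- by move=> u _; apply: mule_ge0; [rewrite lee_fin|rewrite mule_ge0].
Qed.

Lemma fpQ_le (h : (R * T0) * (T * T) -> R) (f : R * T0 -> R) :
  mfn h -> (forall z, 0 <= h z) -> mfn f ->
  (forall v u, \int[P]_w \int[P]_w' (h ((v, u), (w, w')))%:E <= (f (v, u))%:E)%E ->
  (\int[fpQ]_z (h z)%:E <= \int[unif]_v \int[P0]_u (f (v, u))%:E)%E.
Proof.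
move=> mh h0 mf hf.
have mhE : mfn (fun z => (h z)%:E) by meas.
have h0E z : (0 <= (h z)%:E)%E by pos.
have I x : (\int[pprod P P]_y (h (x, y))%:E = \int[P]_w \int[P]_w' (h (x, (w, w')))%:E)%E.
  rewrite (@fubini_tonelli1 _ _ _ _ _ P P (fun y => (h (x, y))%:E))//.
  exact: (measurable_fun_pair2 x mhE).
have f0 x : (0 <= (f x)%:E)%E.
  case: x => v u; apply: le_trans (hf v u).
  by apply: integral_ge0 => w _; apply: integral_ge0 => w' _; rewrite lee_fin.
rewrite (@fubini_tonelli1 _ _ _ _ _ (pprod unif P0) (pprod P P) _ mhE h0E) /fubini_F.
apply: (@le_trans _ _ (\int[pprod unif P0]_x (f x)%:E)%E).
  apply: ge0_le_integral => //; mp.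
  - by move=> x _; apply: integral_ge0 => y _; rewrite lee_fin.
  - exact: (@measurable_fun_fubini_tonelli_F _ _ _ _ _ (pprod P P) (fun z => (h z)%:E)).
  - by move=> [v u] _; rewrite I.
rewrite (@fubini_tonelli1 _ _ _ _ _ unif P0 (fun x => (f x)%:E))//; mp.
Qed.

Definition MY (k : nat) : \bar R := (\int[P]_w (Y w ^+ k)%:E)%E.
Definition MZ (k : nat) : \bar R := (\int[P0]_u (Z u ^+ k)%:E)%E.
(** The Beta integral of v^((k - i) m) (1 - v)^(i m), by [integral_bet]. *)
Definition bet (k i : nat) : R :=
  gam ((k - i)%:R * m) * gam (i%:R * m) / gam (k%:R * m + 1).

Let gam_pos (k : nat) : 0 < gam (k%:R * m).
Proof. by apply: gam_gt0; rewrite mulr_ge0// ltW. Qed.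
Let gam_pos1 (k : nat) : 0 < gam (k%:R * m + 1).
Proof. by apply: gam_gt0; rewrite addr_ge0// mulr_ge0// ltW. Qed.

Lemma bet_gt0 k i : 0 < bet k i.
Proof. by rewrite divr_gt0// mulr_gt0. Qed.

Lemma bet0 k : bet k 0 = (1 + k%:R * m)^-1.
Proof.
rewrite /bet subn0 mul0r gam0 mulr1 gamS; last by pos.
by rewrite invfM mulrCA divff ?mulr1// gt_eqF.
Qed.

Lemma betk k : bet k k = (1 + k%:R * m)^-1.
Proof. by rewrite -bet0 /bet subnn subn0 [gam (0%:R * m) * _]mulrC. Qed.
Let pow_mul (x : R) (j : nat) : (`|x| `^ m) ^+ j = `|x| `^ (j%:R * m).
Proof. by rewrite mulrC powRrM powR_mulrn// powR_ge0. Qed.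

Lemma integral_bet k i : (i <= k)%N ->
  (\int[unif]_v ((`|v| `^ m) ^+ (k - i) * (`|1 - v| `^ m) ^+ i)%:E = (bet k i)%:E)%E.
Proof.
move=> ik; under eq_integral do rewrite !pow_mul.
have a0 : 0 <= (k - i)%:R * m by pos.
have b0 : 0 <= i%:R * m by pos.
have := gam_split a0 b0; rewrite -mulrDl -natrD subnK//.
set I := (\int[unif]_v _)%E => E.
have g1 := gam_pos1 k.
have Ifin : I \is a fin_num.
  rewrite ge0_fin_numE; last by apply: integral_ge0 => v _; rewrite lee_fin mulr_ge0 ?powR_ge0.
  rewrite ltey; apply/eqP => Ioo; move: E; rewrite Ioo gt0_muley ?lte_fin//.
rewrite -(fineK Ifin); congr EFin; move: E; rewrite -(fineK Ifin) -EFinM => -[E].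
by rewrite /bet E/= mulrAC divff ?mul1r// gt_eqF.
Qed.

Definition mterm k i (z : (R * T0) * (T * T)) : R :=
  ('C(k, i)%:R * ((`|z.1.1| `^ m) ^+ (k - i) * (`|1 - z.1.1| `^ m) ^+ i)) *
     (Z z.1.2 ^+ i * (Y z.2.1 ^+ (k - i) * Y z.2.2 ^+ i)).

Let mp j (f : R -> R) : mfn f ->
  mfn (fun v => (`|f v| `^ m) ^+ j).
Proof. by meas. Qed.
Let m1 : mfn (fun v : R => 1 - v). Proof. exact: measurable_funB. Qed.
Let f10 k i (v : R) : 0 <= 'C(k, i)%:R * ((`|v| `^ m) ^+ (k - i) * (`|1 - v| `^ m) ^+ i).
Proof. by pos. Qed.
Let mmterm k i : mfn (mterm k i).
Proof.
apply: measurable_funM.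
  by meas.
by meas.
Qed.
Let mterm_ge0 k i z : 0 <= mterm k i z.
Proof. by rewrite /mterm mulr_ge0// !mulr_ge0 ?exprn_ge0. Qed.
Let integral_mterm k i : (i <= k)%N -> (\int[fpQ]_z (mterm k i z)%:E =
  ('C(k, i)%:R * bet k i)%:E * (MZ i * (MY (k - i) * MY i)))%E.
Proof.
move=> ik; rewrite [LHS](@fpQ_prod
  (fun v => 'C(k, i)%:R * ((`|v| `^ m) ^+ (k - i) * (`|1 - v| `^ m) ^+ i))
  (fun u => Z u ^+ i) (fun w => Y w ^+ (k - i)) (fun w => Y w ^+ i)); last first.
- by pos.
- by pos.
- by pos.
- exact: f10.
- by meas.
- by meas.
- by meas.
- by meas.
congr (_ * _)%E; rewrite EFinM -integral_bet//.
under eq_integral do rewrite EFinM.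
apply: ge0_integralZl => //; mp.
Qed.
Let integral_mterms k (s : seq nat) :
  (\int[fpQ]_z \sum_(i <- s) (mterm k i z)%:E =
   \sum_(i <- s) \int[fpQ]_z (mterm k i z)%:E)%E.
Proof.
rewrite ge0_integral_sum// => i; first exact/measurable_EFinP.
by move=> z _; rewrite lee_fin.
Qed.
Let fpX_moment (h : R -> R) : mfn h -> (forall y, 0 <= h y) ->
  (\int[P]_w (h (Y w))%:E = \int[fpQ]_z (h (fpX z))%:E)%E.
Proof.
move=> mh h0.
apply: (eq_law_ge0 mY (measurable_fpX) (fp_law) (h := fun y => (h y)%:E)).
  by meas.
by move=> y; rewrite lee_fin.
Qed.

(** Binomial expansion of the fixed-point equation. It is stated in the extended reals, and so can
    be used before any moment is known to be finite. *)
Lemma moment_eq k : (MY k = \sum_(0 <= i < k.+1)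
  ('C(k, i)%:R * bet k i)%:E * (MZ i * (MY (k - i) * MY i)))%E.
Proof.
transitivity (\int[fpQ]_z (fpX z ^+ k)%:E)%E.
  transitivity (\int[P]_w (`|Y w| ^+ k)%:E)%E.
    by apply: eq_integral => w _; rewrite ger0_norm.
  rewrite (@fpX_moment (fun y => `|y| ^+ k)); mp.
  by apply: eq_integral => z _; rewrite ger0_norm// (fpX_ge0).
transitivity (\int[fpQ]_z \sum_(0 <= i < k.+1) (mterm k i z)%:E)%E.
  apply: eq_integral => z _; rewrite sumEFin; congr EFin.
  rewrite /fpX exprDn big_mkord; apply: eq_bigr => i _.
  by rewrite /mterm !exprMn -mulr_natl; ring.
rewrite integral_mterms; apply: eq_big_nat => i /andP[_ ik].
exact: integral_mterm.
Qed.
Let coef_ge0 k i : 0 <= 'C(k, i)%:R * bet k i.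
Proof. by rewrite mulr_ge0// ltW// bet_gt0. Qed.

Lemma MY0 : MY 0 = 1%E.
Proof. by rewrite /MY; under eq_integral do rewrite expr0; exact: prob_int1. Qed.

Lemma MZ0 : MZ 0 = 1%E.
Proof. by rewrite /MZ; under eq_integral do rewrite expr0; exact: prob_int1. Qed.

Lemma MY1 : MY 1 = ((gam m)^-1)%:E.
Proof. by rewrite /MY; under eq_integral do rewrite expr1; exact: el_Ym el. Qed.

Lemma MY_ge0 k : (0 <= MY k)%E.
Proof. by apply: integral_ge0 => w _; rewrite lee_fin exprn_ge0. Qed.

Lemma MZ_ge0 k : (0 <= MZ k)%E.
Proof. by apply: integral_ge0 => w _; rewrite lee_fin exprn_ge0. Qed.
Let pos_moment d' (T' : measurableType d') (Q : probability T' R) (f : T' -> R) k :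
  mfn f -> (forall x, 0 <= f x) -> (0 < \int[Q]_x (f x)%:E)%E ->
  (0 < \int[Q]_x (f x ^+ k)%:E)%E.
Proof.
move=> mf f0 If; rewrite lt_def integral_ge0 ?andbT; last by move=> x _; rewrite lee_fin exprn_ge0.
apply/eqP => I0; move: If; apply/negP; rewrite -leNgt le_eqVlt; apply/orP; left.
have mfk : mfn (fun x => (f x ^+ k)%:E) by meas.
have : (\int[Q]_x `|(f x ^+ k)%:E| = 0)%E.
  by rewrite -[RHS]I0; apply: eq_integral => x _; rewrite gee0_abs// lee_fin exprn_ge0.
move/(ae_eq_integral_abs Q measurableT mfk) => ae0.
apply/eqP; transitivity (\int[Q]_x 0)%E; last by rewrite integral0.
apply: ae_eq_integral => //; first by meas.
apply: filterS ae0 => x /(_ Logic.I)[/eqP]; rewrite expf_eq0 => /andP[_ /eqP fx0] _.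
by rewrite fx0.
Qed.

Lemma MY_gt0 k : (0 < MY k)%E.
Proof.
apply: pos_moment => //; rewrite (el_Ym el) lte_fin invr_gt0 gam_gt0//; mp.
Qed.

Lemma MZ_gt0 k : (0 < MZ k)%E.
Proof. by apply: pos_moment => //; rewrite (el_Zm el) lte_fin. Qed.

Definition cross k : \bar R := (\sum_(1 <= i < k)
  ('C(k, i)%:R * bet k i)%:E * (MZ i * (MY (k - i) * MY i)))%E.

Lemma moment_eq2 k : (2 <= k)%N ->
  (MY k = ((1 + k%:R * m)^-1)%:E * MY k + ((1 + k%:R * m)^-1)%:E * (MZ k * MY k) + cross k)%E.
Proof.
case: k => [//|k] k1; rewrite {1}moment_eq big_nat_recr//= big_nat_recl//=.
rewrite bin0 binn !mul1r bet0 betk subn0 subnn MZ0 MY0 mule1 !mul1e /cross.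
by rewrite big_add1/= -addeA [X in (_ + X)%E]addeC addeA.
Qed.

(** With finite terms [moment_eq2] reads (k m - MZ k) MY k = (1 + k m) cross k, and the cross terms
    are positive. An infinite MZ k would make its right side infinite. *)
Lemma MZ_lt_of_MY k : (2 <= k)%N -> (MY k < +oo)%E -> (MZ k < (k%:R * m)%:E)%E.
Proof.
move=> k2 Mfin; have eq := moment_eq2 k2.
have kp : 0 < 1 + k%:R * m by rewrite ltr_wpDr// mulr_ge0// ltW.
have rp : 0 < (1 + k%:R * m)^-1 by pos.
have Mp := MY_gt0 k.
have Yf : MY k \is a fin_num by rewrite ge0_fin_numE ?MY_ge0.
have c0 : (0 < cross k)%E.
  have k1 : (1 < k)%N by [].
  rewrite /cross big_ltn//; apply: (@lt_le_trans _ _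
    (('C(k, 1)%:R * bet k 1)%:E * (MZ 1 * (MY (k - 1) * MY 1)))%E).
    apply: mule_gt0; last by rewrite !mule_gt0 ?MZ_gt0 ?MY_gt0.
    by rewrite lte_fin mulr_gt0 ?(bet_gt0 k 1)// ltr0n bin_gt0 ltnW.
  rewrite leeDl//; apply: sume_ge0 => i _.
  by rewrite !mule_ge0 ?MZ_ge0 ?MY_ge0 ?lee_fin ?coef_ge0.
have Zfin : MZ k \is a fin_num.
  rewrite ge0_fin_numE ?MZ_ge0// ltey; apply/eqP => Zoo.
  move: eq; rewrite Zoo gt0_mulye// gt0_muley ?lte_fin//.
  have : (((1 + k%:R * m)^-1)%:E * MY k + +oo + cross k = +oo)%E.
    rewrite addey ?addye//.
    + by rewrite -ltNye (lt_trans _ c0)// ltNyr.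
    + by rewrite -ltNye (lt_le_trans (ltNyr 0))// mule_ge0 ?MY_ge0// lee_fin ltW.
  move=> -> Moo; by move: Mfin; rewrite Moo.
have cfin : cross k \is a fin_num.
  rewrite ge0_fin_numE ?(ltW c0)//; apply: le_lt_trans Mfin.
  rewrite [leRHS]eq leeDr// adde_ge0// ?mule_ge0 ?MY_ge0 ?MZ_ge0// lee_fin ltW//.
move: eq c0 Mp; rewrite -(fineK Yf) -(fineK Zfin) -(fineK cfin).
move: (fine (MY k)) (fine (MZ k)) (fine (cross k)) => y z c.
rewrite -!EFinM -!EFinD !lte_fin => -[eq] c0 y0.
have {}eq : y * (k%:R * m - z) = c * (1 + k%:R * m).
  have : (1 + k%:R * m) * y = (1 + k%:R * m) * ((1 + k%:R * m)^-1 * y + (1 + k%:R * m)^-1 * (z * y) + c).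
    by rewrite -eq.
  have -> : (1 + k%:R * m) * ((1 + k%:R * m)^-1 * y + (1 + k%:R * m)^-1 * (z * y) + c) =
     y + z * y + c * (1 + k%:R * m) by field; rewrite gt_eqF.
  by lra.
have : 0 < y * (k%:R * m - z) by rewrite eq mulr_gt0.
by rewrite pmulr_rgt0// subr_gt0.
Qed.
Let gg : 0 < g. Proof. by have := el_g el; lra. Qed.

Section truncation.
Variables (k : nat).
Hypothesis k2 : (2 <= k)%N.
Hypothesis Zk : (MZ k < (k%:R * m)%:E)%E.
Hypothesis lower : forall i, (i < k)%N -> (MY i < +oo)%E.
Hypothesis lowerZ : forall i, (i < k)%N -> (MZ i < +oo)%E.

Let zk := fine (MZ k).
Let zkE : MZ k = zk%:E.
Proof. by rewrite /zk fineK// ge0_fin_numE ?MZ_ge0// (lt_trans Zk) ?ltry. Qed.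
Let zk0 : 0 <= zk. Proof. by rewrite -lee_fin -zkE MZ_ge0. Qed.
Let zkm : zk < k%:R * m. Proof. by rewrite -lte_fin -zkE. Qed.
Let C0 := fine (cross k).
Let C0E : cross k = C0%:E.
Proof.
rewrite /C0 fineK// /cross big_nat; apply/sum_fin_numP => /= i _ /andP[i1 ik].
rewrite !fin_numM// ge0_fin_numE ?MY_ge0 ?MZ_ge0//.
- exact: lowerZ.
- by apply: lower; lia.
- exact: lower.
Qed.
Let C00 : 0 <= C0.
Proof.
rewrite -lee_fin -C0E; apply: sume_ge0 => i _.
by rewrite !mule_ge0 ?MZ_ge0 ?MY_ge0 ?lee_fin ?coef_ge0.
Qed.
Let km0 : 0 < 1 + k%:R * m. Proof. by rewrite ltr_wpDr// mulr_ge0// ltW. Qed.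
Let gm0 : 0 < 1 + g * m. Proof. by pos. Qed.
(** As E V^s = 1 / (1 + s), [rho] and [rhog] are the factors of the fixed-point map on k-th and g-th
    powers; both are below 1. [A] is the fixed point of A = C0 + rho A. *)
Let rho := (1 + zk) / (1 + k%:R * m).
Let rhog := (1 + q) / (1 + g * m).
Let A := C0 / (1 - rho).
Let rho1 : rho < 1. Proof. by rewrite /rho ltr_pdivrMr// mul1r ltrD2l. Qed.
Let AE : A = C0 + rho * A.
Proof. by rewrite /A; field; rewrite gt_eqF// subr_gt0. Qed.
Let A0 : 0 <= A. Proof. by rewrite /A divr_ge0// subr_ge0 ltW. Qed.
Let q0 : 0 <= q.
Proof. by rewrite -lee_fin -(el_Zg el) integral_ge0// => w _; rewrite lee_fin powR_ge0. Qed.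
Let rhog0 : 0 <= rhog. Proof. exact: (divr_ge0 (addr_ge0 ler01 q0) (ltW gm0)). Qed.
Let rhog1 : rhog < 1.
Proof. by rewrite /rhog ltr_pdivrMr// mul1r ltrD2l; exact: el_q el. Qed.
Let c := fine (\int[P]_w (Y w `^ g)%:E)%E.
Let cE : (\int[P]_w (Y w `^ g)%:E = c%:E)%E.
Proof.
rewrite /c fineK// ge0_fin_numE; first exact: el_Yg el.
by apply: integral_ge0 => w _; rewrite lee_fin powR_ge0.
Qed.
Let c0 : 0 <= c.
Proof. by rewrite -lee_fin -cE integral_ge0// => w _; rewrite lee_fin powR_ge0. Qed.
Let mtr (K a : R) : mfn (fun w => Order.min (a * Y w) K ^+ k).
Proof.
apply: measurable_funX; apply: measurable_minr => //; by meas.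
Qed.
Let kg : 0 <= k%:R - g.
Proof.
have : 2 <= k%:R :> R by rewrite (ler_nat R 2 k).
by have := el_g el; lra.
Qed.
(** Since min (a Y, K) = a min (Y, K / a), a bound for Y becomes one for a Y in which the two terms
    scale like a^k and a^g. *)
Let G_step (B : R) :
  (forall K : R, 0 < K -> (\int[P]_w (Order.min (Y w) K ^+ k)%:E <=
     (A + B * K `^ (k%:R - g))%:E)%E) -> 0 <= B ->
  forall a K : R, 0 <= a -> 0 < K -> (\int[P]_w (Order.min (a * Y w) K ^+ k)%:E <=
     (A * a ^+ k + B * K `^ (k%:R - g) * a `^ g)%:E)%E.
Proof.
move=> H B0 a K; rewrite le_eqVlt => /predU1P[<-|a0] K0.
  under eq_integral do rewrite mul0r min_l ?(ltW K0)// expr0n gtn_eqF ?(ltnW k2)//.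
  rewrite integral0 lee_fin addr_ge0//.
    by rewrite mulr_ge0// exprn_ge0.
  by pos.
have -> : (\int[P]_w (Order.min (a * Y w) K ^+ k)%:E =
   (a ^+ k)%:E * \int[P]_w (Order.min (Y w) (K / a) ^+ k)%:E)%E.
  rewrite -ge0_integralZl//.
  - apply: eq_integral => w _; rewrite -EFinM -exprMn; congr (_ ^+ k)%:E.
    have -> : K = a * (K / a) by rewrite mulrCA divff ?mulr1// gt_eqF.
    by rewrite -minr_pMr ?(ltW a0)// mulrCA divff ?mulr1// gt_eqF.
  - apply/measurable_EFinP; have := mtr (K / a) 1.
    by under eq_fun do rewrite mul1r.
  - by move=> w _; rewrite lee_fin exprn_ge0// le_min Y0 divr_ge0// ltW.
  - by rewrite lee_fin exprn_ge0// ltW.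
apply: (@le_trans _ _ ((a ^+ k)%:E * (A + B * (K / a) `^ (k%:R - g))%:E)%E).
  by rewrite lee_wpmul2l ?lee_fin ?exprn_ge0 ?(ltW a0)// H// divr_gt0.
rewrite -EFinM lee_fin mulrDr [a ^+ k * A]mulrC lerD2l.
have ai0 : 0 <= a^-1 by pos.
rewrite (powRM _ (ltW K0) ai0).
have -> : a^-1 `^ (k%:R - g) = a `^ g / a ^+ k.
  rewrite -powR_inv1 ?(ltW a0)// -powRrM mulN1r opprB powRB; last by rewrite (gt_eqF a0) implybT.
  by rewrite powR_mulrn// ltW.
apply: eqle; field.
by rewrite expf_neq0// gt_eqF.
Qed.
(** Truncation is subadditive; after expanding the k-th power it is dropped from the mixed terms,
    which involve lower moments only. *)
Let min_expand (x y K : R) : 0 <= x -> 0 <= y -> 0 < K ->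
  Order.min (x + y) K ^+ k <= Order.min x K ^+ k + Order.min y K ^+ k +
    \sum_(1 <= i < k) 'C(k, i)%:R * (x ^+ (k - i) * y ^+ i).
Proof.
move=> x0 y0 K0.
have mx0 : 0 <= Order.min x K by rewrite le_min x0 ltW.
have my0 : 0 <= Order.min y K by rewrite le_min y0 ltW.
have mxx : Order.min x K <= x by rewrite ge_min lexx.
have myy : Order.min y K <= y by rewrite ge_min lexx.
apply: (@le_trans _ _ ((Order.min x K + Order.min y K) ^+ k)).
  apply: lerXn2r; rewrite ?nnegrE ?addr_ge0//; first by rewrite le_min addr_ge0// ltW.
  rewrite ge_min; case: (leP x K) => xK; case: (leP y K) => yK;
    rewrite ?lexx ?orbT//; apply/orP; right; lra.
rewrite exprDn -(big_mkord predT (fun i => (Order.min x K ^+ (k - i) * Order.min y K ^+ i) *+ 'C(k, i))).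
case: k k2 => [//|k'] k2'; rewrite big_nat_recr//= big_nat_recl//=.
rewrite bin0 binn !mulr1n subn0 subnn !expr0 mulr1 mul1r -addrA [X in _ + X]addrC addrA.
rewrite lerD2l [leRHS]big_add1/=; apply: ler_sum => i _.
rewrite -mulr_natl ler_wpM2l//; apply: ler_pM; rewrite ?exprn_ge0//; exact: lerXn2r.
Qed.
Let pow_g (x : R) : (`|x| `^ m) `^ g = `|x| `^ (g * m).
Proof. by rewrite mulrC powRrM. Qed.
Let unif_comb (f : R -> R) (a b : R) : 0 <= a -> 0 <= b -> mfn f ->
  (forall s : R, -1 < s -> (\int[unif]_v (`|f v| `^ s)%:E = ((1 + s)^-1)%:E)%E) ->
  (\int[unif]_v (a * (`|f v| `^ m) ^+ k + b * (`|f v| `^ m) `^ g)%:E =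
   (a / (1 + k%:R * m) + b / (1 + g * m))%:E)%E.
Proof.
move=> a0 b0 mf H.
have ms (s : R) : mfn (fun v => (`|f v| `^ s)%:E) by meas.
have Is (x s : R) : 0 <= x -> -1 < s -> (\int[unif]_v (x%:E * (`|f v| `^ s)%:E) = (x / (1 + s))%:E)%E.
  move=> x0 s1; rewrite EFinM -H//; apply: ge0_integralZl => //.
transitivity (\int[unif]_v (a%:E * (`|f v| `^ (k%:R * m))%:E + b%:E * (`|f v| `^ (g * m))%:E))%E.
  by apply: eq_integral => v _; rewrite pow_mul pow_g.
rewrite ge0_integralD//; mp.
- rewrite !Is// ?EFinD//; apply: (@lt_le_trans _ _ 0); rewrite ?ltrN10// mulr_ge0// ltW//.
- by move=> v _; rewrite mule_ge0 ?lee_fin ?powR_ge0.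
- by move=> v _; rewrite mule_ge0 ?lee_fin ?powR_ge0.
Qed.
(** The start is min (Y, K)^k <= K^(k - g) Y^g. Each use of the fixed-point equation reproduces [A]
    and multiplies the error by [rhog] < 1, so that the dependence on K dies out as n grows. The
    k-th moment of Y, possibly infinite, never appears. *)
Let trunc_bound n (K : R) : 0 < K ->
  (\int[P]_w (Order.min (Y w) K ^+ k)%:E <=
   (A + c * rhog ^+ n * K `^ (k%:R - g))%:E)%E.
Proof.
elim: n K => [|n IH] K K0.
  apply: (@le_trans _ _ (\int[P]_w ((K `^ (k%:R - g))%:E * (Y w `^ g)%:E))%E).
    apply: ge0_le_integral => //; mp.
    - by move=> w _; rewrite lee_fin exprn_ge0// le_min Y0 ltW.
    - by apply/measurable_EFinP; have := mtr K 1; under eq_fun do rewrite mul1r.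
    - move=> w _; have mk0 : 0 <= Order.min (Y w) K by rewrite le_min Y0 ltW.
      have kgn : k%:R - g + g != 0 by rewrite subrK pnatr_eq0 -lt0n ltnW.
      have -> : Order.min (Y w) K ^+ k = Order.min (Y w) K `^ (k%:R - g) * Order.min (Y w) K `^ g.
        by rewrite -powRD ?(negbTE kgn)// subrK powR_mulrn.
      rewrite -EFinM lee_fin; apply: ler_pM; rewrite ?powR_ge0//.
        by apply: ge0_ler_powR; rewrite ?nnegrE ?(ltW K0)// ge_min lexx orbT.
      by apply: ge0_ler_powR; rewrite ?nnegrE ?(ltW gg) ?Y0// ge_min lexx.
  rewrite ge0_integralZl//.
  - rewrite cE -EFinM lee_fin expr0 mulr1 mulrC lerDr//.
  - by meas.
  - by move=> w _; rewrite lee_fin powR_ge0.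
  - by pos.
have B0 : 0 <= c * rhog ^+ n by pos.
have GS := G_step IH B0.
set B := c * rhog ^+ n * K `^ (k%:R - g).
have B1 : 0 <= B by rewrite mulr_ge0// powR_ge0.
pose tl (z : (R * T0) * (T * T)) := Order.min (`|z.1.1| `^ m * Y z.2.1) K ^+ k.
pose tr (z : (R * T0) * (T * T)) := Order.min (`|1 - z.1.1| `^ m * Z z.1.2 * Y z.2.2) K ^+ k.
have mid : mfn (fun v : R => v) by [].
have mtl : mfn tl.
  apply: measurable_funX; apply: measurable_minr => //; apply: measurable_funM.
    by meas.
  by meas.
have mtr' : mfn tr.
  apply: measurable_funX; apply: measurable_minr => //; apply: measurable_funM.
    by meas.
  by meas.
have tl0 z : 0 <= tl z by rewrite exprn_ge0// le_min (ltW K0) andbT mulr_ge0 ?powR_ge0.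
have tr0 z : 0 <= tr z by rewrite exprn_ge0// le_min (ltW K0) andbT !mulr_ge0 ?powR_ge0.
have Itl : (\int[fpQ]_z (tl z)%:E <= (A / (1 + k%:R * m) + B / (1 + g * m))%:E)%E.
  rewrite -(@unif_comb id)//; last exact: integral_unif_powR.
  have -> : (\int[unif]_v (A * (`|v| `^ m) ^+ k + B * (`|v| `^ m) `^ g)%:E =
     \int[unif]_v \int[P0]_u (A * (`|v| `^ m) ^+ k + B * (`|v| `^ m) `^ g)%:E)%E.
    by apply: eq_integral => v _; rewrite prob_intc.
  apply: (@fpQ_le tl (fun p => A * (`|p.1| `^ m) ^+ k + B * (`|p.1| `^ m) `^ g)) => //; mp.
  move=> v u; rewrite /tl/=.
  under eq_integral do rewrite prob_intc.
  by apply: GS => //; pos.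
have Itr : (\int[fpQ]_z (tr z)%:E <= (A * zk / (1 + k%:R * m) + B * q / (1 + g * m))%:E)%E.
  rewrite -(@unif_comb (fun v => 1 - v)); last 4 first.
  - by pos.
  - by pos.
  - by meas.
  - by move=> t t1; exact: integral_unif_powR1.
  pose f (p : R * T0) := A * (`|1 - p.1| `^ m * Z p.2) ^+ k + B * (`|1 - p.1| `^ m * Z p.2) `^ g.
  have mbz : mfn (fun p : R * T0 => `|1 - p.1| `^ m * Z p.2) by meas.
  have -> : (\int[unif]_v (A * zk * (`|1 - v| `^ m) ^+ k + B * q * (`|1 - v| `^ m) `^ g)%:E =
     \int[unif]_v \int[P0]_u (f (v, u))%:E)%E.
    apply: eq_integral => v _; rewrite /f/=.
    have b0 : 0 <= `|1 - v| `^ m by pos.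
    transitivity (\int[P0]_u ((A * (`|1 - v| `^ m) ^+ k)%:E * (Z u ^+ k)%:E +
       (B * (`|1 - v| `^ m) `^ g)%:E * (Z u `^ g)%:E))%E; last first.
      apply: eq_integral => u _; rewrite -!EFinM -EFinD; congr EFin.
      by rewrite exprMn (powRM _ b0 (Z0 u)) !mulrA.
    rewrite ge0_integralD//.
    - rewrite ge0_integralZl//.
      + rewrite ge0_integralZl//.
        * rewrite (el_Zg el) -/(MZ k) zkE -!EFinM -EFinD; congr EFin; ring.
        * by meas.
        * by move=> u _; rewrite lee_fin powR_ge0.
        * by rewrite lee_fin mulr_ge0// powR_ge0.
      + by meas.
      + by move=> u _; rewrite lee_fin exprn_ge0.
      + by rewrite lee_fin mulr_ge0// exprn_ge0.
    - by move=> u _; rewrite -EFinM lee_fin mulr_ge0 ?exprn_ge0// mulr_ge0// exprn_ge0.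
    - by meas.
    - by move=> u _; rewrite -EFinM lee_fin mulr_ge0 ?powR_ge0// mulr_ge0// powR_ge0.
    - by meas.
  apply: (@fpQ_le tr f) => //.
    apply: measurable_funD; apply: measurable_funM => //; first by meas.
    by meas.
  move=> v u; rewrite /tr/=; set J := (\int[P]_w' (Order.min (_ * Y w') K ^+ k)%:E)%E.
  rewrite (@integral_cst _ _ _ P _ measurableT J)/= probability_setT mule1.
  by apply: GS => //; rewrite mulr_ge0 ?powR_ge0.
have -> : A + c * rhog ^+ n.+1 * K `^ (k%:R - g) =
  (A / (1 + k%:R * m) + B / (1 + g * m)) + (A * zk / (1 + k%:R * m) + B * q / (1 + g * m)) + C0.
  have -> : c * rhog ^+ n.+1 * K `^ (k%:R - g) = rhog * B by rewrite exprS /B; ring.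
  by rewrite {1}AE /rho /rhog; ring.
rewrite !EFinD; apply: (@le_trans _ _ (\int[fpQ]_z ((tl z)%:E + (tr z)%:E + \sum_(1 <= i < k) (mterm k i z)%:E))%E); last first.
  rewrite ge0_integralD//.
  - rewrite ge0_integralD//.
    + rewrite integral_mterms; apply: leeD; first exact: leeD.
      rewrite -C0E /cross; apply: eqle.
      apply: eq_big_nat => i /andP[_ ik]; apply: integral_mterm; exact: ltnW.
    + by move=> z _; rewrite lee_fin.
    + by meas.
    + by move=> z _; rewrite lee_fin.
    + by meas.
  - by move=> z _; rewrite adde_ge0 ?lee_fin.
  - by apply: emeasurable_funD; meas.
  - by move=> z _; apply: sume_ge0 => i _; rewrite lee_fin.
  - by apply: emeasurable_sum => i; exact/measurable_EFinP.
pose h (y : R) := `|Order.min y K| ^+ k.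
have mh : mfn h.
  apply: measurable_funX; apply: measurableT_comp => //; exact: measurable_minr.
have -> : (\int[P]_w (Order.min (Y w) K ^+ k)%:E = \int[P]_w (h (Y w))%:E)%E.
  by apply: eq_integral => w _; rewrite /h ger0_norm// le_min Y0 ltW.
rewrite (fpX_moment mh); last by move=> y; rewrite exprn_ge0.
apply: ge0_le_integral => //.
- by move=> z _; rewrite lee_fin exprn_ge0.
- by apply/measurable_EFinP; exact: (measurableT_comp mh (measurable_fpX)).
- apply: emeasurable_funD; first by apply: emeasurable_funD; by meas.
  by apply: emeasurable_sum => i; exact/measurable_EFinP.
- move=> z _; rewrite sumEFin -!EFinD lee_fin /h ger0_norm; last by rewrite le_min (fpX_ge0) ltW.
  have l0 : 0 <= `|z.1.1| `^ m * Y z.2.1 by pos.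
  have r0 : 0 <= `|1 - z.1.1| `^ m * Z z.1.2 * Y z.2.2 by pos.
  apply: le_trans (min_expand l0 r0 K0) _.
  rewrite lerD2l; apply: ler_sum => i _; rewrite /mterm.
  by apply: eqle; rewrite !exprMn; ring.
Qed.

(** First n tends to infinity at fixed K, which leaves a bound uniform in K; Fatou then removes the
    truncation. *)
Lemma trunc_moment : (MY k < +oo)%E.
Proof.
have H (K : R) : 0 < K -> (\int[P]_w (Order.min (Y w) K ^+ k)%:E <= A%:E)%E.
  move=> K0; apply/lee_addgt0Pr => e e0.
  have c1 : (c * rhog ^+ n * K `^ (k%:R - g)) @[n --> \oo] --> (0 : R).
    rewrite -[X in _ --> X](mul0r (K `^ (k%:R - g))); apply: cvgMl.
    rewrite -[X in _ --> X](mulr0 c); apply: cvgMr; apply: cvg_expr.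
    by rewrite ger0_norm.
  have /cvgrPdist_lt/(_ _ e0)[n _ /(_ n (leqnn _))/=] := c1.
  rewrite sub0r normrN => hn; apply: (le_trans (trunc_bound n K0)).
  by rewrite -EFinD lee_fin lerD2l (le_trans (ler_norm _))// ltW.
apply: (@le_lt_trans _ _ A%:E); last exact: ltry.
have k1 : 1 < k%:R :> R by rewrite ltr1n.
have -> : MY k = (\int[P]_w (Y w `^ k%:R)%:E)%E.
  by apply: eq_integral => w _; rewrite powR_mulrn.
apply: (@fatou_moment _ _ _ P (fun n w => Order.min (Y w) n.+1%:R) Y k%:R A) => //.
- by move=> n; exact: measurable_minr.
- by move=> n w; rewrite le_min Y0/=.
- apply: aeW => w; apply: cvg_near_cst; exists (Num.truncn (Y w)) => // n /= Yn.
  by rewrite min_l// ltW// (lt_le_trans (truncnS_gt _))// ler_nat ltnS.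
- move=> n; have -> : (\int[P]_w (Order.min (Y w) n.+1%:R `^ k%:R)%:E =
      \int[P]_w (Order.min (Y w) n.+1%:R ^+ k)%:E)%E; last exact: H.
    by apply: eq_integral => w _; rewrite powR_mulrn// le_min Y0/=.
Qed.

End truncation.

Let interp (x : R) (i k : nat) : (1 <= i <= k)%N -> (2 <= k)%N -> 0 <= x ->
  x ^+ i <= (1 - i.-1%:R / k.-1%:R) * x + i.-1%:R / k.-1%:R * x ^+ k.
Proof.
move: i k => [|j] [|n]// /andP[_ jn] n2 x0; rewrite /=.
have n0 : 0 < n%:R :> R by rewrite ltr0n; lia.
set u : R := j%:R / n%:R.
have u01 : 0 <= u <= 1.
  by rewrite /u divr_ge0//= ler_pdivrMr// mul1r ler_nat -ltnS.
have := @powR_bernoulli R (x ^+ n) u (exprn_ge0 n x0) u01.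
have -> : (x ^+ n) `^ u = x ^+ j.
  rewrite -powR_mulrn// -powRrM /u mulrCA divff ?gt_eqF// mulr1 powR_mulrn//.
move=> h; have : x * x ^+ j <= x * (1 + u * (x ^+ n - 1)) by rewrite ler_wpM2l.
by rewrite !exprS; lra.
Qed.

(** Bernoulli for x^(i - 1) = (x^(k - 1))^u with u = (i - 1) / (k - 1) interpolates between m and MZ
    k. As (1 - u) + u k = i, the condition at k passes to the smaller i. *)
Lemma MZ_interp i k : (1 <= i <= k)%N -> (2 <= k)%N -> (MZ k < (k%:R * m)%:E)%E ->
  (MZ i < +oo)%E /\ ((2 <= i)%N -> (MZ i < (i%:R * m)%:E)%E).
Proof.
move=> ik k2 Zk.
have zf : MZ k \is a fin_num by rewrite ge0_fin_numE ?MZ_ge0// (lt_trans Zk) ?ltry.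
set u : R := i.-1%:R / k.-1%:R.
have k0 : 0 < k.-1%:R :> R by rewrite ltr0n; lia.
have u0 : 0 <= u by rewrite divr_ge0.
have u1 : 0 <= 1 - u by rewrite subr_ge0 ler_pdivrMr// mul1r ler_nat; lia.
have H : (MZ i <= ((1 - u) * m + u * fine (MZ k))%:E)%E.
  apply: (@le_trans _ _ (\int[P0]_w ((1 - u)%:E * (Z w)%:E + u%:E * (Z w ^+ k)%:E))%E).
    apply: ge0_le_integral => //; mp.
    - by move=> w _; rewrite lee_fin exprn_ge0.
    - apply: emeasurable_funD; apply: emeasurable_funM => //; apply/measurable_EFinP => //; mp.
    - by move=> w _; rewrite -!EFinM -EFinD lee_fin interp.
  rewrite ge0_integralD//.
  - rewrite ge0_integralZl//; [|by meas|by move=> w _; rewrite lee_fin].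
    rewrite ge0_integralZl//; last 2 first.
    + by meas.
    + by move=> w _; rewrite lee_fin exprn_ge0.
    by rewrite (el_Zm el) -/(MZ k) -{1}(fineK zf) -!EFinM -EFinD.
  - by move=> w _; rewrite -EFinM lee_fin mulr_ge0.
  - by meas.
  - by move=> w _; rewrite -EFinM lee_fin mulr_ge0// exprn_ge0.
  - by meas.
split; first by rewrite (le_lt_trans H)// ltry.
move=> i2; apply: (le_lt_trans H); rewrite lte_fin.
have up : 0 < u by rewrite divr_gt0// ltr0n -subn1 subn_gt0.
have : fine (MZ k) < k%:R * m by rewrite -lte_fin fineK.
move=> zk; apply: (@lt_le_trans _ _ ((1 - u) * m + u * (k%:R * m))).
  by rewrite ltrD2l ltr_pM2l.
have kE : k%:R = k.-1%:R + 1 :> R by rewrite natr1 prednK// (leq_trans _ k2).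
have iE : i%:R = i.-1%:R + 1 :> R by rewrite natr1 prednK//; case/andP: ik.
apply: eqle; rewrite kE iE /u; field.
by rewrite gt_eqF.
Qed.

Lemma MY_lty k : (MZ k < (k%:R * m)%:E)%E -> (2 <= k)%N -> (MY k < +oo)%E.
Proof.
elim/ltn_ind: k => k IH Zk k2.
apply: trunc_moment => // i ik.
- case: i ik => [|[|i]] ik; first by rewrite MY0 ltry.
    by rewrite MY1 ltry.
  have ik' : (1 <= i.+2 <= k)%N by lia.
  by apply: IH => //; apply: (MZ_interp ik' k2 Zk).2.
- case: i ik => [|i] ik; first by rewrite MZ0 ltry.
  have ik' : (1 <= i.+1 <= k)%N by lia.
  by apply: (MZ_interp ik' k2 Zk).1.
Qed.

Lemma MY_formula k : (2 <= k)%N -> (MZ k < (k%:R * m)%:E)%E ->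
  (MY k = ((gam (k%:R * m))^-1 / (k%:R * m - fine (MZ k)) *
    \sum_(1 <= i < k) 'C(k, i)%:R * fine (MZ i) * gam (i%:R * m) *
      gam ((k - i)%:R * m) * fine (MY i) * fine (MY (k - i)))%:E)%E.
Proof.
move=> k2 Zk; have Yk := MY_lty Zk k2; have := moment_eq2 k2.
have fY i : (i < k)%N -> MY i \is a fin_num.
  move=> ik; rewrite ge0_fin_numE ?MY_ge0//.
  case: i ik => [|[|i]] ik; first by rewrite MY0 ltry.
    by rewrite MY1 ltry.
  have ik' : (1 <= i.+2 <= k)%N by lia.
  by apply: MY_lty => //; apply: (MZ_interp ik' k2 Zk).2.
have fZ i : (1 <= i <= k)%N -> MZ i \is a fin_num.
  by move=> ik; rewrite ge0_fin_numE ?MZ_ge0//; apply: (MZ_interp ik k2 Zk).1.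
have -> : cross k = ((\sum_(1 <= i < k) 'C(k, i)%:R * fine (MZ i) * gam (i%:R * m) *
      gam ((k - i)%:R * m) * fine (MY i) * fine (MY (k - i))) / gam (k%:R * m + 1))%:E.
  rewrite /cross mulr_suml -sumEFin; apply: eq_big_nat => i /andP[i1 ik].
  have -> : MZ i = (fine (MZ i))%:E by rewrite fineK// fZ// i1 ltnW.
  have -> : MY i = (fine (MY i))%:E by rewrite fineK// fY.
  have -> : MY (k - i) = (fine (MY (k - i)))%:E by rewrite fineK// fY//; lia.
  by rewrite -!EFinM /bet/=; congr EFin; ring.
have Yf : MY k \is a fin_num by rewrite ge0_fin_numE ?MY_ge0.
have Zf : MZ k \is a fin_num by apply: fZ; lia.
have zk : fine (MZ k) < k%:R * m by rewrite -lte_fin fineK.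
rewrite -(fineK Yf) -{1}(fineK Zf) -!EFinM -!EFinD => -[]; set S := \sum_(1 <= i < k) _.
rewrite gamS; last by pos.
have := gam_pos k; move: zk; move: (fine (MY k)) (fine (MZ k)) (gam (k%:R * m)) S => y z G S zk G0 E.
congr EFin.
have km : 0 < 1 + k%:R * m by rewrite ltr_wpDr// mulr_ge0// ltW.
have {}E : y * (k%:R * m - z) = S / G.
  have : (1 + k%:R * m) * y = (1 + k%:R * m) * ((1 + k%:R * m)^-1 * y +
      (1 + k%:R * m)^-1 * (z * y) + S / ((1 + k%:R * m) * G)) by rewrite -E.
  have -> : (1 + k%:R * m) * ((1 + k%:R * m)^-1 * y +
      (1 + k%:R * m)^-1 * (z * y) + S / ((1 + k%:R * m) * G)) = y + z * y + S / G.
    by field; rewrite !gt_eqF.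
  by lra.
have kz : k%:R * m - z != 0 by rewrite subr_eq0 gt_eqF.
by apply: (mulIf kz); rewrite E; field; rewrite kz gt_eqF.
Qed.

End moments.

(** * Support of the limit *)

Section support.

Let cvg_nrm_pow (S : Type) (F : set_system S) {FF : ProperFilter F} (f : S -> R) (l : R) :
  f x @[x --> F] --> l -> `|f x| `^ m @[x --> F] --> `|l| `^ m.
Proof. by move=> fl; apply: cvg_powR => //; exact: cvg_norm. Qed.

Lemma unif_itv_gt0 (v e : R) : 0 < v < 1 -> 0 < e ->
  (0 < unif (oball v e))%E.
Proof.
move=> /andP[v0 v1] e0.
pose b := Order.min (v + e) 1.
have vb : v < b by rewrite lt_min v1 ltrDl e0.
apply: (@lt_le_trans _ _ (unif `[v, b[%classic)).
  have -> : unif `[v, b[%classic = (b - v)%:E.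
    rewrite -integral_unif_itv ?(ltW v0) ?(ltW vb)//; last by rewrite ge_min lexx orbT.
    rewrite bint_EFin; last exact: bmf_indic.
    by rewrite integral_indic// setIT.
  by rewrite lte_fin subr_gt0.
apply: le_measure; rewrite ?inE//; first by meas.
move=> x; rewrite oballE/= in_itv/= lt_min => /andP[vx /andP[xe _]].
by rewrite xe andbT (lt_le_trans _ vx)// ltrBlDr ltrDl.
Qed.

(** The map of the fixed-point equation is continuous, and by independence small neighbourhoods of
    v, z, x and y have positive joint mass. *)
Lemma psupp_fp (v x y z : R) : 0 < v < 1 -> psupp P Y x -> psupp P Y y -> psupp P0 Z z ->
  psupp P Y (`|v| `^ m * x + `|1 - v| `^ m * z * y).
Proof.
move=> v01 sx sy sz e e0; set t := (X in oball X e).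
have mI (i : interval R) : measurable [set` i] by meas.
rewrite (fp_law); last exact: mI.
pose F (p : (R * R) * (R * R)) : R :=
  `|p.1.1| `^ m * p.2.1 + `|1 - p.1.1| `^ m * p.1.2 * p.2.2.
have cF : F p @[p --> ((v, z), (x, y))] --> t.
  have c11 : p.1.1 @[p --> ((v, z), (x, y))] --> v.
    by apply: (cvg_comp _ _ cvg_fst); exact: cvg_fst.
  have c12 : p.1.2 @[p --> ((v, z), (x, y))] --> z.
    by apply: (cvg_comp _ _ cvg_fst); exact: cvg_snd.
  have c21 : p.2.1 @[p --> ((v, z), (x, y))] --> x.
    by apply: (cvg_comp _ _ cvg_snd); exact: cvg_fst.
  have c22 : p.2.2 @[p --> ((v, z), (x, y))] --> y.
    by apply: (cvg_comp _ _ cvg_snd); exact: cvg_snd.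
  apply: cvgD.
    by apply: cvgM => //; exact: cvg_nrm_pow.
  apply: cvgM => //; apply: cvgM => //; apply: cvg_nrm_pow.
  by apply: cvgB => //; exact: cvg_cst.
have := cF (oball t e).
have nt : nbhs t (oball t e).
  apply: open_nbhs_nbhs; split; first exact: interval_open.
  by rewrite oballE ltrBlDr !ltrDl e0.
move=> /(_ nt) [[U W] /= [[[U1 U2] /= [hU1 hU2] sU] [[W1 W2] /= [hW1 hW2] sW]] sUW].
have [e1 /= e10 eU1] := (iffLR (nbhs_ballP _ _) hU1).
have [A2 mA2 [sA2 pA2]] := psupp_nbhs hU2 sz.
have [B1 mB1 [sB1 pB1]] := psupp_nbhs hW1 sx.
have [B2 mB2 [sB2 pB2]] := psupp_nbhs hW2 sy.
pose A1 : set R := oball v e1.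
have mA1 : measurable A1 by exact: mI.
have pA1 : (0 < unif A1)%E by exact: unif_itv_gt0.
have mZA : measurable (Z @^-1` A2) by meas.
have mYB1 : measurable (Y @^-1` B1) by meas.
have mYB2 : measurable (Y @^-1` B2) by meas.
apply: (@lt_le_trans _ _ (fpQ ((A1 `*` (Z @^-1` A2)) `*` ((Y @^-1` B1) `*` (Y @^-1` B2))))).
  rewrite /fpQ pprodX; [|exact: measurableX|exact: measurableX].
  by rewrite !pprodX// !mule_gt0.
apply: le_measure; rewrite ?inE.
- by apply: measurableX; exact: measurableX.
- by apply: preimage_measurable; [exact: (measurable_fpX)|exact: mI].
- move=> [[a u] [w w']] /= [[a1 u2] [w1 w2]].
  apply: (sUW ((a, Z u), (Y w, Y w'))); split => /=.
    apply: (sU (a, Z u)); split => /=; last exact: sA2.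
    apply: eU1; rewrite /ball/=; move: a1; rewrite /A1 /oball/= in_itv/= => /andP[l r].
    by rewrite ltr_norml; apply/andP; split; lra.
  by apply: (sW (Y w, Y w')); split => /=; [exact: sB1|exact: sB2].
Qed.

(** Taking the two points of [psupp_fp] equal multiplies them by this number, which is 1 at v =
    1. *)
Definition mult (z v : R) := `|v| `^ m + `|1 - v| `^ m * z.

Lemma mult1 z : mult z 1 = 1.
Proof. by rewrite /mult normr1 powR1 subrr normr0 powR0 ?gt_eqF// mul0r addr0. Qed.

Lemma continuous_mult z : continuous (mult z).
Proof.
move=> v; apply: cvgD; first exact: (@cvg_nrm_pow _ (nbhs v) _ id v (@cvg_id _ _)).
apply: cvgMl; apply: (@cvg_nrm_pow _ (nbhs v) _ (fun x => 1 - x)).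
by apply: cvgB; [exact: cvg_cst|exact: cvg_id].
Qed.

Lemma psupp_mult (z v x : R) : psupp P0 Z z -> 0 < v < 1 -> psupp P Y x ->
  psupp P Y (mult z v * x).
Proof.
move=> sz v01 sx; have := psupp_fp v01 sx sx sz.
by rewrite /mult mulrDl.
Qed.

Hypothesis Zne1 : (P0 (Z @^-1` [set 1%R]) < 1)%E.

Let not_ae1 : ~ {ae P0, forall u, Z u = 1}.
Proof.
move=> [N [mN N0 sN]]; move: Zne1; rewrite ltNge => /negP; apply.
rewrite -(@probability_setT _ _ _ P0).
have m1 : measurable (Z @^-1` [set 1]) by meas.
apply: (@le_trans _ _ (P0 (Z @^-1` [set 1%R] `|` N))).
  apply: le_measure; rewrite ?inE//; first exact: measurableU.
  move=> u _; have [z1|z1] := eqVneq (Z u) 1; [by left|right].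
  by apply: sN => /= /eqP; rewrite (negbTE z1).
apply: (@le_trans _ _ (P0 (Z @^-1` [set 1%R]) + P0 N)%E); first exact: measureU2.
by rewrite N0 adde0.
Qed.
Let mZE : mfn (fun u => (Z u)%:E). Proof. by meas. Qed.
Let Z_ge_mean (c : R) : {ae P0, forall u, c <= Z u} -> 0 <= c -> c <= m.
Proof.
move=> h c0; rewrite -lee_fin -(el_Zm el).
have -> : c%:E = (\int[P0]_u c%:E)%E.
  by rewrite (@integral_cst _ _ _ P0 _ measurableT c%:E)/= probability_setT mule1.
apply: ae_ge0_le_integral => //; mp.
- by apply: filterS h => u hu _; rewrite lee_fin.
Qed.
Let Z_le_mean (c : R) : {ae P0, forall u, Z u <= c} -> 0 <= c -> m <= c.
Proof.
move=> h c0; rewrite -lee_fin -(el_Zm el).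
have -> : c%:E = (\int[P0]_u c%:E)%E.
  by rewrite (@integral_cst _ _ _ P0 _ measurableT c%:E)/= probability_setT mule1.
apply: ae_ge0_le_integral => //; mp.
- by apply: filterS h => u hu _; rewrite lee_fin.
Qed.
Let exists_supp (A : R -> Prop) : ~ {ae P0, forall u, ~ A (Z u)} ->
  exists2 z, psupp P0 Z z & A z /\ 0 <= z.
Proof.
move=> nA; apply: contrapT => H; apply: nA.
apply: filterS (ae_psupp P0 mZ) => u su Au; apply: H.
by exists (Z u).
Qed.
Let exists_pos : exists2 z, psupp P0 Z z & 0 < z.
Proof.
have [|z sz [z0 _]] := @exists_supp (fun z => 0 < z); last by exists z.
move=> h; have : m <= 0.
  by apply: Z_le_mean => //; apply: filterS h => u /negP; rewrite -leNgt.
by rewrite leNgt m0.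
Qed.
Let exists_lt : m <= 1 -> exists2 z, psupp P0 Z z & 0 <= z < 1.
Proof.
move=> m1; have [|z sz [z1 z0]] := @exists_supp (fun z => z < 1); last by exists z; rewrite ?z0.
move=> h; have {}h : {ae P0, forall u, 1 <= Z u}.
  by apply: filterS h => u /negP; rewrite -leNgt.
have mE : m = 1 by apply/eqP; rewrite eq_le m1 Z_ge_mean.
apply: not_ae1.
have I0 : (\int[P0]_u `|(Z u - 1)%:E| = 0)%E.
  transitivity (\int[P0]_u ((Z u)%:E - 1%:E))%E.
    apply: ae_eq_integral => //.
    - by apply: measurableT_comp => //; apply/measurable_EFinP; meas.
    - by apply/measurable_EFinP; meas.
    - by apply: filterS h => u hu _; rewrite gee0_abs// lee_fin subr_ge0.
  rewrite integralB//.
  - rewrite (el_Zm el) (@integral_cst _ _ _ P0 _ measurableT 1%:E)/= probability_setT mule1.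
    by rewrite mE subee.
  - apply/integrableP; split => //.
    under eq_integral do rewrite gee0_abs ?lee_fin//.
    by rewrite (el_Zm el) ltry.
  - exact: finite_measure_integrable_cst.
have := (ae_eq_integral_abs P0 measurableT _).1 I0.
have mz1 : mfn (fun u => (Z u - 1)%:E) by meas.
move=> /(_ mz1); apply: filterS => u /(_ Logic.I) [/eqP].
by rewrite subr_eq0 => /eqP.
Qed.
Let exists_gt : 1 <= m -> exists2 z, psupp P0 Z z & 1 < z.
Proof.
move=> m1; have [|z sz [z1 _]] := @exists_supp (fun z => 1 < z); last by exists z.
move=> h; have {}h : {ae P0, forall u, Z u <= 1}.
  by apply: filterS h => u /negP; rewrite -leNgt.
have mE : m = 1 by apply/eqP; rewrite eq_le m1 Z_le_mean.
apply: not_ae1.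
have I0 : (\int[P0]_u `|(1 - Z u)%:E| = 0)%E.
  transitivity (\int[P0]_u (1%:E - (Z u)%:E))%E.
    apply: ae_eq_integral => //.
    - by apply: measurableT_comp => //; apply/measurable_EFinP; meas.
    - by apply/measurable_EFinP; meas.
    - by apply: filterS h => u hu _; rewrite gee0_abs// lee_fin subr_ge0.
  rewrite integralB//.
  - rewrite (el_Zm el) (@integral_cst _ _ _ P0 _ measurableT 1%:E)/= probability_setT mule1.
    by rewrite mE subee.
  - exact: finite_measure_integrable_cst.
  - apply/integrableP; split => //.
    under eq_integral do rewrite gee0_abs ?lee_fin//.
    by rewrite (el_Zm el) ltry.
have := (ae_eq_integral_abs P0 measurableT _).1 I0.
have mz1 : mfn (fun u => (1 - Z u)%:E) by meas.
move=> /(_ mz1); apply: filterS => u /(_ Logic.I) [/eqP].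
by rewrite subr_eq0 => /eqP.
Qed.
Let root (c s : R) : 0 < c < 1 -> 0 < s -> exists2 u : R, 0 < u < 1 & u `^ s = c.
Proof.
move=> /andP[c0 c1] s0; exists (c `^ s^-1).
  rewrite powR_gt0//=; have := @gt0_ltr_powR R s^-1 _ c 1.
  by rewrite powR1; apply; rewrite ?invr_gt0// ?nnegrE ?ler01// ltW.
by rewrite -powRrM mulVf ?gt_eqF// powRr1// ltW.
Qed.

(** For m <= 1 the support of Z has a point z < 1, otherwise Z >= 1 with mean m <= 1 would force Z =
    1; then v^m = (1 - z) / 2. For m > 1 any z > 0 works with v close to 1, where z (1 - v)^m is
    below 1 - v. *)
Lemma mult_lt1 : exists z v : R, [/\ psupp P0 Z z, 0 < v < 1 & 0 <= mult z v < 1].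
Proof.
have mge (z v : R) : 0 <= z -> 0 <= mult z v.
  by move=> z0; rewrite addr_ge0 ?mulr_ge0 ?powR_ge0.
have [m1|m1] := leP m 1.
  have [z sz /andP[z0 z1]] := exists_lt m1.
  have c01 : 0 < (1 - z) / 2 < 1 by lra.
  have [v v01 vE] := root c01 m0; exists z, v; split => //; rewrite mge//=.
  have /andP[v0 v1] := v01.
  rewrite /mult gtr0_norm// vE gtr0_norm ?subr_gt0//.
  have : (1 - v) `^ m <= 1.
    rewrite [leRHS](_ : 1 = 1 `^ m); last by rewrite powR1.
    by apply: ge0_ler_powR; rewrite ?nnegrE ?(ltW m0) ?subr_ge0 ?(ltW v1)// lerBlDr lerDl ltW.
  by move=> h; have := ler_wpM2r z0 h; rewrite mul1r; lra.
have [z sz z0] := exists_pos.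
have c01 : 0 < (2 * (1 + z))^-1 < 1.
  have h : 1 < 2 * (1 + z) by lra.
  by rewrite invr_gt0 (lt_trans ltr01 h)/= invf_lt1// (lt_trans ltr01 h).
have s0 : 0 < m - 1 by lra.
have [u u01 uE] := root c01 s0; have /andP[u0 u1] := u01.
exists z, (1 - u); split => //; first by lra.
rewrite mge ?(ltW z0)//= /mult (_ : 1 - (1 - u) = u); last by ring.
rewrite gtr0_norm ?subr_gt0// gtr0_norm//.
have h1 : (1 - u) `^ m <= 1 - u by apply: ge1r_powR; lra.
have h2 : u `^ m * z < u.
  rewrite -(@mulr_powRB1 _ u m) ?(ltW u0)// uE -mulrA -[ltRHS]mulr1 ltr_pM2l//.
  by rewrite mulrC ltr_pdivrMr; lra.
by lra.
Qed.

(** For m >= 1 the support of Z has a point z > 1, and u = 1 - v with u^m = z^(- 1/2) gives z u^m =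
    z^(1/2) > 1. For m < 1 any z > 0 works with v close to 1, where z u^m exceeds u. *)
Lemma mult_gt1 : exists z v : R, [/\ psupp P0 Z z, 0 < v < 1 & 1 < mult z v].
Proof.
have [m1|m1] := leP 1 m.
  have [z sz z1] := exists_gt m1.
  have z0 : 0 < z by lra.
  have c01 : 0 < z `^ (- 2^-1) < 1.
    rewrite powR_gt0//= powRN invf_lt1 ?powR_gt0//.
    have := @gt0_ltr_powR R 2^-1 _ 1 z; rewrite powR1; apply; rewrite ?nnegrE ?ltW//; lra.
  have [u u01 uE] := root c01 m0; have /andP[u0 u1] := u01.
  exists z, (1 - u); split => //; first by lra.
  rewrite /mult (_ : 1 - (1 - u) = u); last by ring.
  rewrite (gtr0_norm u0) uE.
  have -> : z `^ (- 2^-1) * z = z `^ 2^-1.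
    rewrite -[X in _ * X]powRr1 ?(ltW z0)// -powRD; last by rewrite (gt_eqF z0) implybT.
    by congr (_ `^ _); field.
  have : 1 < z `^ 2^-1.
    have := @gt0_ltr_powR R 2^-1 _ 1 z; rewrite powR1; apply; rewrite ?nnegrE ?ltW//; lra.
  by have := powR_ge0 `|1 - u| m; lra.
have [z sz z0] := exists_pos.
have s0 : 0 < 1 - m by lra.
have c01 : 0 < Order.min (z / 2) 2^-1 < 1.
  rewrite lt_min divr_gt0//= invr_gt0 ltr0n/= gt_min; apply/orP; right; lra.
have [u u01 uE] := root c01 s0; have /andP[u0 u1] := u01.
exists z, (1 - u); split => //; first by lra.
rewrite /mult (_ : 1 - (1 - u) = u); last by ring.
rewrite (gtr0_norm u0) gtr0_norm ?subr_gt0//.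
have h1 : 1 - u <= (1 - u) `^ m by apply: ger1_powR; lra.
have h2 : u < u `^ m * z.
  have uz : u `^ (1 - m) < z by rewrite uE gt_min; apply/orP; left; lra.
  have {1}-> : u = u `^ m * u `^ (1 - m).
    by rewrite -powRD ?(gt_eqF u0) ?implybT// addrC subrK powRr1// ltW.
  by rewrite ltr_pM2l// powR_gt0.
by lra.
Qed.
Let psupp_iter (th x : R) n : (forall y, psupp P Y y -> psupp P Y (th * y)) ->
  psupp P Y x -> psupp P Y (th ^+ n * x).
Proof.
move=> H sx; elim: n => [|n IH]; first by rewrite expr0 mul1r.
by rewrite exprS -mulrA; exact: H.
Qed.
(** For n large the n-th root of t / x lies between [mult z v0] and 1. By continuity it is itself a
    multiplier, and n steps lead from x to t. *)
Let psupp_down (x t : R) : psupp P Y x -> 0 < t <= x -> psupp P Y t.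
Proof.
move=> sx /andP[t0]; rewrite le_eqVlt => /predU1P[->//|tx].
have [z [v0 [sz /andP[v00 v01] /andP[a0 a1]]]] := mult_lt1.
have x0 : 0 < x := lt_trans t0 tx.
have r0 : 0 < t / x by pos.
have r1 : t / x < 1 by rewrite ltr_pdivrMr// mul1r.
have [n n0 hn] : exists2 n : nat, (0 < n)%N & mult z v0 ^+ n <= t / x.
  have c : mult z v0 ^+ n @[n --> \oo] --> (0 : R) by apply: cvg_expr; rewrite ger0_norm.
  have /cvgrPdist_lt/(_ _ r0)[n _ /(_ n.+1 (leqnSn n))/=] := c.
  by rewrite sub0r normrN ger0_norm ?exprn_ge0// => /ltW h; exists n.+1.
have nR : 0 < n%:R :> R by rewrite ltr0n.
pose th := (t / x) `^ n%:R^-1.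
have thn : th ^+ n = t / x.
  by rewrite -powR_mulrn ?powR_ge0// -powRrM mulVf ?gt_eqF// powRr1// ltW.
have th1 : th < 1.
  have := @gt0_ltr_powR R n%:R^-1 _ (t / x) 1; rewrite powR1; apply => //;
    by rewrite ?invr_gt0 ?nnegrE ?ler01 ?(ltW r0).
have tha : mult z v0 <= th.
  by rewrite -(@ler_pXn2r _ n) ?nnegrE ?powR_ge0// thn.
have -> : t = th ^+ n * x by rewrite thn divfK// gt_eqF.
apply: psupp_iter => // y sy.
have [|c] := @IVT R (mult z) v0 1 th (ltW v01) (continuous_subspaceT (@continuous_mult z)).
  by rewrite mult1 ge_min tha le_max (ltW th1) orbT.
rewrite in_itv/= => /andP[vc c1] thE; rewrite -thE; apply: psupp_mult => //.
rewrite (lt_le_trans v00 vc)/= lt_def c1 andbT eq_sym.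
apply: contraTN th1 => /eqP c1E; rewrite -leNgt.
by rewrite -thE c1E mult1.
Qed.
Let psupp_up (x t : R) : psupp P Y x -> 0 < x <= t -> psupp P Y t.
Proof.
move=> sx /andP[x0]; rewrite le_eqVlt => /predU1P[<-//|xt].
have [z [v0 [sz /andP[v00 v01] a1]]] := mult_gt1.
have r1 : 1 < t / x by rewrite ltr_pdivlMr// mul1r.
have r0 : 0 < t / x by lra.
have [n n0 hn] : exists2 n : nat, (0 < n)%N & t / x <= mult z v0 ^+ n.
  have a0 : 0 < mult z v0 by lra.
  have c : (mult z v0)^-1 ^+ n @[n --> \oo] --> (0 : R).
    by apply: cvg_expr; rewrite ger0_norm ?invr_ge0 ?(ltW a0)// invf_lt1.
  have r0' : 0 < (t / x)^-1 by pos.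
  have /cvgrPdist_lt/(_ _ r0')[n _ /(_ n.+1 (leqnSn n))/=] := c.
  rewrite sub0r normrN ger0_norm ?exprn_ge0 ?invr_ge0 ?(ltW a0)// exprVn => h.
  by exists n.+1 => //; rewrite -lef_pV2 ?posrE ?exprn_gt0// ltW.
have nR : 0 < n%:R :> R by rewrite ltr0n.
pose th := (t / x) `^ n%:R^-1.
have thn : th ^+ n = t / x.
  by rewrite -powR_mulrn ?powR_ge0// -powRrM mulVf ?gt_eqF// powRr1// ltW.
have th1 : 1 < th.
  have := @gt0_ltr_powR R n%:R^-1 _ 1 (t / x); rewrite powR1; apply => //;
    by rewrite ?invr_gt0 ?nnegrE ?ler01 ?(ltW r0).
have tha : th <= mult z v0.
  rewrite -(@ler_pXn2r _ n) ?nnegrE ?powR_ge0// ?thn//; lra.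
have -> : t = th ^+ n * x by rewrite thn divfK// gt_eqF.
apply: psupp_iter => // y sy.
have [|c] := @IVT R (mult z) v0 1 th (ltW v01) (continuous_subspaceT (@continuous_mult z)).
  by rewrite mult1 ge_min (ltW th1) orbT le_max tha.
rewrite in_itv/= => /andP[vc c1] thE; rewrite -thE; apply: psupp_mult => //.
rewrite (lt_le_trans v00 vc)/= lt_def c1 andbT eq_sym.
apply: contraTN th1 => /eqP c1E; rewrite -leNgt.
by rewrite -thE c1E mult1.
Qed.

(** The mean is positive, so the support has a positive point, from which all positive t are
    reached; 0 is a limit of these. *)
Lemma psupp_all (t : R) : 0 <= t -> psupp P Y t.
Proof.
have [x sx x0] : exists2 x, psupp P Y x & 0 < x.
  apply: contrapT => H.
  have ae0 : {ae P, forall w, Y w = 0}.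
    apply: filterS (ae_psupp P mY) => w sw; apply/eqP; rewrite eq_le Y0 andbT leNgt.
    by apply/negP => Yw; apply: H; exists (Y w).
  have := el_Ym el; rewrite (_ : (\int[P]_w (Y w)%:E = 0)%E).
    by move=> [/esym/eqP]; rewrite invr_eq0 gt_eqF// gam_gt0// ltW.
  transitivity (\int[P]_w 0)%E; last by rewrite integral0.
  apply: ae_eq_integral => //; first by meas.
  by apply: filterS ae0 => w -> _.
have pos (s : R) : 0 < s -> psupp P Y s.
  move=> s0; have [sx'|sx'] := leP s x.
    by apply: (psupp_down sx); rewrite s0.
  by apply: (psupp_up sx); rewrite x0 ltW.
rewrite le_eqVlt => /predU1P[<-|]; last exact: pos.
move=> e e0; have e2 : 0 < e / 2 by lra.
apply: (lt_le_trans (pos _ e2 _ e2)); apply: le_measure; rewrite ?inE; mp.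
- move=> w /=; rewrite !oballE => /andP[h1 h2]; apply/andP; split; lra.
Qed.

End support.

(** * Absence of atoms *)

Section atoms.

Let bfp (h : R -> R) : bmf h -> bmf (fun z => h (fpX z)).
Proof.
move=> [mh [M hM]]; apply: (@bmf_le _ _ _ _ M) => [|z]; last exact: hM.
exact: (measurableT_comp mh (measurable_fpX)).
Qed.

Lemma fp_bmf (h : R -> R) : bmf h -> bmf (fun v : R => \int[P0]_u \int[P]_w \int[P]_w'
     h (`|v| `^ m * Y w + `|1 - v| `^ m * Z u * Y w')).
Proof.
move=> bh; have b := bfp bh.
have -> : (fun v : R => \int[P0]_u \int[P]_w \int[P]_w'
     h (`|v| `^ m * Y w + `|1 - v| `^ m * Z u * Y w')) =
   (fun v : R => \int[P0]_u (fun p => \int[pprod P P]_y h (fpX (p, y))) (v, u)).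
  apply/funext => v; apply: eq_Rintegral => u _ /=.
  by rewrite bint_fubini1//; exact: (bmf_pair1 b (v, u)).
exact: (bmf_fubini1 (bmf_fubini1 b (pprod P P)) P0).
Qed.
Let m1 (c : R) : measurable [set c]. Proof. by []. Qed.
Let mass_lt1 d' (T' : measurableType d') (Q : probability T' R) (f : T' -> R) :
  mfn f -> (\int[Q]_w (f w)%:E != 0)%E ->
  \int[Q]_w (\1_[set 0] (f w) : R) != 1.
Proof.
move=> mf; apply: contraNneq => /(ae_of_mass1 mf) ae0; apply/eqP.
transitivity (\int[Q]_w 0)%E; last by rewrite integral0.
apply: ae_eq_integral => //; first by meas.
by apply: filterS ae0 => w -> _.
Qed.

(** The sum vanishes when the first copy does and Z or the second copy does. With p = P (Z = 0) this
    reads r = r (p + (1 - p) r), and p and r differ from 1 because the means are positive. *)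
Lemma law_zero : P (Y @^-1` [set 0%R]) = 0%E.
Proof.
rewrite prob_bint//; congr EFin.
set r := \int[P]_w _; pose p := \int[P0]_u (\1_[set 0] (Z u) : R).
have b0 : bmf (\1_[set 0] : R -> R) by exact: bmf_indic.
have bY : bmf (fun w => \1_[set 0] (Y w) : R) by meas.
have bZ : bmf (fun u => \1_[set 0] (Z u) : R) by meas.
have E : r = r * (p + (1 - p) * r).
  rewrite {1}/r (fp_bint b0).
  rewrite -[RHS](bint_cst unif); apply: ae_eq_Rint; mp.
  - by case: (fp_bmf b0).
  apply: filterS ae_unif_01 => v /andP[v0 v1].
  have a0 : 0 < `|v| `^ m by rewrite powR_gt0// normr_gt0 gt_eqF.
  have c0 : 0 < `|1 - v| `^ m by rewrite powR_gt0// normr_gt0 subr_eq0 gt_eqF.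
  transitivity (\int[P0]_u (r * (\1_[set 0] (Z u) + (1 - \1_[set 0] (Z u)) * r))).
    apply: eq_Rintegral => u _.
    transitivity (\int[P]_w (\1_[set 0] (Y w) * (\1_[set 0] (Z u) + (1 - \1_[set 0] (Z u)) * r) : R)).
      apply: eq_Rintegral => w _.
      transitivity (\int[P]_w' ((\1_[set 0] (Y w) * \1_[set 0] (Z u)) +
          (\1_[set 0] (Y w) * (1 - \1_[set 0] (Z u))) * \1_[set 0] (Y w') : R)).
        apply: eq_Rintegral => w' _; rewrite !indicE.
        have i0 (y : R) : (y \in [set 0]) = (y == 0).
          by apply/idP/eqP => [|->]; rewrite inE.
        rewrite !i0 paddr_eq0 ?mulr_ge0 ?powR_ge0//.
        rewrite !mulf_eq0 (gt_eqF a0) (gt_eqF c0)/=.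
        by case: (Y w == 0); case: (Z u == 0); case: (Y w' == 0); rewrite /=; ring.
      rewrite bintD; [|by meas|by meas].
      rewrite bint_cst bintZl// -/r; ring.
    by rewrite bintZr.
  rewrite bintZl; mp.
  congr (_ * _); rewrite bintD//; mp.
  rewrite bintZr; last by meas.
  by rewrite bintB//; [rewrite bint_cst|by meas].
have p1 : p != 1 by apply: mass_lt1 => //; rewrite (el_Zm el) eqe gt_eqF.
have r1 : r != 1.
  by apply: mass_lt1 => //; rewrite (el_Ym el) eqe invr_eq0 gt_eqF// gam_gt0// ltW.
have {}E : r * ((1 - p) * (1 - r)) = 0 by move: E; nra.
move/eqP : E; rewrite !mulf_eq0 ![1 - _ == 0]subr_eq0 ![1 == _]eq_sym (negbTE p1) (negbTE r1) !orbF.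
by move/eqP.
Qed.

Hypothesis Zne1 : (P0 (Z @^-1` [set 1%R]) < 1)%E.

Let in1 (c y : R) : (\1_[set c] y : R) = (y == c)%:R.
Proof.
rewrite indicE; have -> // : (y \in [set c]) = (y == c).
by apply/idP/eqP => [|->]; rewrite inE.
Qed.
Let swapped (x : R) : \int[P]_w (\1_[set x] (Y w) : R) =
  \int[pprod P P]_y \int[P0]_u \int[unif]_v
    (\1_[set x] (`|v| `^ m * Y y.1 + `|1 - v| `^ m * Z u * Y y.2) : R).
Proof.
have bx : bmf (\1_[set x] : R -> R) by exact: bmf_indic.
rewrite (eq_law_bint mY (measurable_fpX) (fp_law) bx).
rewrite (bint_fubini2 (bfp bx)); apply: eq_Rintegral => y _.
by rewrite (bint_fubini2 (bmf_pair2 (bfp bx) y)).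
Qed.
Let mfv (a b : R) : mfn (fun v : R => `|v| `^ m * a + `|1 - v| `^ m * b).
Proof.
have m1' : mfn (fun v : R => 1 - v) by exact: measurable_funB.
by meas.
Qed.
(** At fixed values of the other variables at most two v reach x. *)
Let atom_ne1 (x : R) : m != 1 -> 0 < x -> \int[P]_w (\1_[set x] (Y w) : R) = 0.
Proof.
move=> mn1 x0; rewrite swapped -[RHS](bint_cst (pprod P P)); apply: eq_Rintegral => y _.
rewrite -[RHS](bint_cst P0); apply: eq_Rintegral => u _.
rewrite -[RHS](bint_cst unif); apply: ae_eq_Rint; mp.
- under eq_fun do rewrite -mulrA.
  by case: (@bmf_indic_comp _ _ _ _ (mfv (Y y.1) (Z u * Y y.2)) [set x] (m1 x)).
have [c1 [c2 H]] := @level_set_pair R m (Y y.1) (Z u * Y y.2) x m0 mn1 x0.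
apply: filterS3 ae_unif_01 (unif_set1 c1) (unif_set1 c2) => v v01 n1 n2.
have /andP[v0 v1] := v01.
rewrite in1; case: eqP => // E; exfalso.
have := H v v01; rewrite -E (gtr0_norm v0) gtr0_norm ?subr_gt0// => /(_ _)[].
- by ring.
- by move/eqP: n1.
- by move/eqP: n2.
Qed.
(** v a + (1 - v) b = x has at most one solution v unless a = b. This leaves r = r s with s = P (Z
    Y' = x). If r > 0, then s = 1, and for some value of Z the variable Y is almost surely constant,
    against its unbounded support. *)
Let atom_eq1 (x : R) : m = 1 -> 0 < x -> \int[P]_w (\1_[set x] (Y w) : R) = 0.
Proof.
move=> mE x0; set r := LHS; pose s := \int[P0]_u \int[P]_w (\1_[set x] (Z u * Y w) : R).
have bxY : bmf (fun w => \1_[set x] (Y w) : R) by exact: bmf_indic_comp.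
have bj : bmf (fun p : T0 * T => \1_[set x] (Z p.1 * Y p.2) : R).
  apply: bmf_indic_comp => //; apply: measurable_funM.
    by meas.
  by meas.
have E : r = r * s.
  rewrite {1}/r swapped.
  transitivity (\int[pprod P P]_y \int[P0]_u (\1_[set x] (Y y.1) * \1_[set x] (Z u * Y y.2) : R)).
    apply: eq_Rintegral => y _; apply: eq_Rintegral => u _.
    rewrite -[RHS](bint_cst unif); apply: ae_eq_Rint; mp.
    - under eq_fun do rewrite -mulrA.
      by case: (@bmf_indic_comp _ _ _ _ (mfv (Y y.1) (Z u * Y y.2)) [set x] (m1 x)).
    set a := Y y.1; set b := Z u * Y y.2.
    have [ab|ab] := eqVneq a b.
      apply: filterS ae_unif_01 => v /andP[v0 v1].
      rewrite (gtr0_norm v0) gtr0_norm ?subr_gt0// mE !powRr1 ?subr_ge0 ?ltW//.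
      rewrite -mulrA -/b -ab !in1 (_ : v * a + (1 - v) * a = a); last by ring.
      by case: (a == x); rewrite ?mulr1 ?mulr0.
    apply: filterS2 ae_unif_01 (unif_set1 ((x - b) / (a - b))) => v /andP[v0 v1] vn.
    rewrite (gtr0_norm v0) gtr0_norm ?subr_gt0// mE !powRr1 ?subr_ge0 ?ltW// -mulrA -/b !in1.
    have abn : a - b != 0 by rewrite subr_eq0.
    case: eqP => [E|_].
      by exfalso; move/eqP : vn; apply; rewrite -E; field.
    have [ax|ax] := eqVneq a x; last by rewrite mul0r.
    by rewrite [b == x](negbTE _) ?mulr0// -ax eq_sym.
  rewrite bint_fubini1; last first.
    apply: (@bmf_fubini1 _ _ _ _ _ (fun p : (T * T) * T0 =>
      \1_[set x] (Y p.1.1) * \1_[set x] (Z p.2 * Y p.1.2) : R)).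
    apply: bmfM.
      apply: bmf_indic_comp => //; apply: (measurableT_comp mY); mp.
    apply: bmf_indic_comp => //; apply: measurable_funM.
      by meas.
    by meas.
  rewrite /s -bintZr//; apply: eq_Rintegral => w _ /=.
  transitivity (\int[P]_w' (\1_[set x] (Y w) * \int[P0]_u (\1_[set x] (Z u * Y w') : R))).
    by apply: eq_Rintegral => w' _; rewrite bintZl//; exact: (bmf_pair2 bj w').
  rewrite bintZl; last exact: (bmf_fubini2 bj).
  by rewrite -(bint_fubini2 bj) (bint_fubini1 bj).
apply/eqP/negPn/negP => r0.
have s1 : s = 1 by apply: (mulfI r0); rewrite mulr1 -E.
have bs : bmf (fun u => \int[P]_w (\1_[set x] (Z u * Y w) : R)) by exact: (bmf_fubini1 bj).
have s01 u : 0 <= \int[P]_w (\1_[set x] (Z u * Y w) : R) <= 1.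
  apply: bint_01; first by meas.
  by move=> w; rewrite in1; case: (_ == _); rewrite ?lexx ?ler01.
have ae1 : {ae P0, forall u, 1 - \int[P]_w (\1_[set x] (Z u * Y w) : R) = 0}.
  have b1 : bmf (fun u => 1 - \int[P]_w (\1_[set x] (Z u * Y w) : R)) by meas.
  have I0 : (\int[P0]_u `|(1 - \int[P]_w (\1_[set x] (Z u * Y w) : R))%:E| = 0)%E.
    transitivity (\int[P0]_u (1 - \int[P]_w (\1_[set x] (Z u * Y w) : R))%:E)%E.
      apply: eq_integral => u _; rewrite gee0_abs// lee_fin subr_ge0.
      by have /andP[] := s01 u.
    rewrite -bint_EFin// bintB//; last by meas.
    by rewrite bint_cst -/s s1 subrr.
  have mb : mfn (fun u => (1 - \int[P]_w (\1_[set x] (Z u * Y w) : R))%:E) by meas.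
  have := (ae_eq_integral_abs P0 measurableT mb).1 I0.
  by apply: filterS => u /(_ Logic.I) [].
have [u /eqP] := nonempty_ae ae1; rewrite subr_eq0 eq_sym => /eqP u1.
have mzu : mfn (fun w => Z u * Y w) by meas.
have aeu := ae_of_mass1 mzu u1.
have zn0 : Z u != 0.
  have [w zw] := nonempty_ae aeu; apply: contraTneq x0 => zu.
  by rewrite -zw zu mul0r ltxx.
set y0 := x / Z u.
have y00 : 0 <= y0 by rewrite divr_ge0 ?(ltW x0).
have y1 : 0 <= y0 + 1 by pos.
have h2 : (0 < 2^-1 :> R) by pos.
have := psupp_all Zne1 y1 h2; apply/negP; rewrite -leNgt.
case: aeu => N [mN N0 sN]; rewrite -N0; apply: le_measure; rewrite ?inE//; mp.
move=> w /=; rewrite oballE => /andP[l _]; apply: sN => /= zw.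
have : Y w = y0 by rewrite /y0 -zw mulrAC divff ?mul1r.
by move=> Yw; move: l; rewrite Yw; lra.
Qed.

Lemma law_atom (x : R) : P (Y @^-1` [set x]) = 0%E.
Proof.
have [x0|x0|->] := ltgtP x 0; last exact: law_zero.
  have -> : Y @^-1` [set x] = set0; last by rewrite measure0.
  by rewrite -subset0 => w /= Yw; move: x0; rewrite -Yw ltNge Y0.
rewrite prob_bint//; congr EFin.
by have [mE|mn] := eqVneq m 1; [exact: atom_eq1|exact: atom_ne1].
Qed.

End atoms.

(** * Decay of the characteristic function *)

Section charfun_decay.
Notation CY := (cosT P Y).
Notation SY := (sinT P Y).
Notation MdY := (modT P Y).

Let bc (t : R) : bmf (fun y : R => cos (t * y)).
Proof. by apply: bmf_cos; exact: measurable_funM. Qed.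
Let bs (t : R) : bmf (fun y : R => sin (t * y)).
Proof. by apply: bmf_sin; exact: measurable_funM. Qed.

Lemma cosT_eq (t : R) : CY t = \int[unif]_v \int[P0]_u
  (CY (t * `|v| `^ m) * CY (t * `|1 - v| `^ m * Z u) -
   SY (t * `|v| `^ m) * SY (t * `|1 - v| `^ m * Z u)).
Proof.
rewrite {1}/cosT (fp_bint (bc t)); apply: eq_Rintegral => v _; apply: eq_Rintegral => u _.
set a := t * `|v| `^ m; set b := t * `|1 - v| `^ m * Z u.
transitivity (\int[P]_w (cos (a * Y w) * CY b - sin (a * Y w) * SY b)); last first.
  rewrite bintB ?bintZr//; by meas.
apply: eq_Rintegral => w _.
have bcb := bmf_cos_mul mY b; have bsb := bmf_sin_mul mY b.
rewrite /cosT /sinT -!bintZl// -bintB; mp.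
apply: eq_Rintegral => w' _; rewrite -cosD; congr (cos _); rewrite /a /b; ring.
Qed.

Lemma sinT_eq (t : R) : SY t = \int[unif]_v \int[P0]_u
  (SY (t * `|v| `^ m) * CY (t * `|1 - v| `^ m * Z u) +
   CY (t * `|v| `^ m) * SY (t * `|1 - v| `^ m * Z u)).
Proof.
rewrite {1}/sinT (fp_bint (bs t)); apply: eq_Rintegral => v _; apply: eq_Rintegral => u _.
set a := t * `|v| `^ m; set b := t * `|1 - v| `^ m * Z u.
transitivity (\int[P]_w (sin (a * Y w) * CY b + cos (a * Y w) * SY b)); last first.
  rewrite bintD ?bintZr//; by meas.
apply: eq_Rintegral => w _.
have bcb := bmf_cos_mul mY b; have bsb := bmf_sin_mul mY b.
rewrite /cosT /sinT -!bintZl// -bintD; mp.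
apply: eq_Rintegral => w' _; rewrite -sinD; congr (sin _); rewrite /a /b; ring.
Qed.
Let m2 (t : R) : mfn (fun p : R * T0 => t * `|1 - p.1| `^ m * Z p.2).
Proof. by meas. Qed.
Let bcomp d' (T' : measurableType d') (h : R -> R) (k : T' -> R) : bmf h -> mfn k ->
  bmf (fun x => h (k x)).
Proof. by meas. Qed.

(** At fixed v and u the characteristic function is a product, whose modulus is the product of the
    moduli; [modulus_bint] does the rest. *)
Lemma modT_le (t : R) : MdY t <= \int[unif]_v (MdY (t * `|v| `^ m) *
   \int[P0]_u MdY (t * `|1 - v| `^ m * Z u)).
Proof.
have bC := bmf_cosT P mY; have bS := bmf_sinT P mY; have bM := bmf_modT P mY.
pose A (p : R * T0) : R := CY (t * `|p.1| `^ m) * CY (t * `|1 - p.1| `^ m * Z p.2) -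
   SY (t * `|p.1| `^ m) * SY (t * `|1 - p.1| `^ m * Z p.2).
pose B (p : R * T0) : R := SY (t * `|p.1| `^ m) * CY (t * `|1 - p.1| `^ m * Z p.2) +
   CY (t * `|p.1| `^ m) * SY (t * `|1 - p.1| `^ m * Z p.2).
have b1 (h : R -> R) : bmf h -> bmf (fun p : R * T0 => h (t * `|p.1| `^ m)) by meas.
have b2 (h : R -> R) : bmf h -> bmf (fun p : R * T0 => h (t * `|1 - p.1| `^ m * Z p.2)) by meas.
have bA : bmf A by apply: bmfB; apply: bmfM; (exact: b1 || exact: b2).
have bB : bmf B by apply: bmfD; apply: bmfM; (exact: b1 || exact: b2).
have bMM : bmf (fun p : R * T0 => MdY (t * `|p.1| `^ m) * MdY (t * `|1 - p.1| `^ m * Z p.2)) by meas.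
rewrite [leLHS]/modT cosT_eq sinT_eq.
rewrite -[X in X ^+ 2 + _](bint_fubini1 bA unif P0) -[X in _ + X ^+ 2](bint_fubini1 bB unif P0).
apply: (le_trans (modulus_bint _ bA bB)).
apply: eqle.
transitivity (\int[pprod unif P0]_p (MdY (t * `|p.1| `^ m) * MdY (t * `|1 - p.1| `^ m * Z p.2))).
  apply: eq_Rintegral => p _; rewrite /modT -sqrtrM ?addr_ge0 ?sqr_ge0//; congr Num.sqrt.
  rewrite /A /B; ring.
rewrite bint_fubini1//; apply: eq_Rintegral => v _ /=; rewrite bintZl//; mp.
Qed.

Hypothesis Zne1 : (P0 (Z @^-1` [set 1%R]) < 1)%E.

Let mD : mfn (fun p : T * T => Y p.1 - Y p.2).
Proof. by meas. Qed.
Let ae_D : {ae pprod P P, forall p : T * T, Y p.1 - Y p.2 != 0}.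
Proof.
exists ((fun p : T * T => Y p.1 - Y p.2) @^-1` [set 0]); split; mp.
- rewrite (prob_bint _ mD)// (bint_fubini1 (bmf_indic_comp mD _))//; congr EFin.
  rewrite -[RHS](bint_cst P); apply: eq_Rintegral => w _ /=.
  apply: EFin_inj; rewrite -[RHS](law_atom Zne1 (Y w)) (prob_bint P mY)//; congr EFin.
  apply: eq_Rintegral => w' _; rewrite !indicE; congr (_%:R).
  congr nat_of_bool; apply/idP/idP; rewrite !inE/=.
    by move/eqP; rewrite subr_eq0 => /eqP ->.
  by move=> ->; rewrite subrr.
- by move=> p /=; apply: contra_notP => /eqP.
Qed.

(** One factor of [modT_le] is bounded by 1, and Jensen gives |phi (t)|^2 <= E |phi (t V^m)|^2 = E
    cosU (t (Y - Y')). Y differs from Y' almost surely for lack of atoms, and [cosU] vanishes at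
    infinity. *)
Lemma modT_to0 (e : R) : 0 < e -> exists2 T1 : R, 0 < T1 & forall t : R, T1 <= t -> MdY t <= e.
Proof.
move=> e0; apply: contrapT => H.
(* Bounded convergence works along sequences: a failure provides t_n >= n + 1 with |phi (t_n)| >
   e. *)
have ex n : exists t : R, n.+1%:R <= t /\ e < MdY t.
  apply: contrapT => Hn; apply: H; exists n.+1%:R => // t nt.
  by rewrite leNgt; apply/negP => et; apply: Hn; exists t.
have [t_ ht] := choice ex.
have bM := bmf_modT P mY.
have sq t : MdY t ^+ 2 <= \int[pprod P P]_p cosU m (t * (Y p.1 - Y p.2)).
  have bj : bmf (fun p : R * (T * T) => cos (t * (Y p.2.1 - Y p.2.2) * `|p.1| `^ m)) by meas.
  have b1 : bmf (fun v : R => MdY (t * `|v| `^ m)) by meas.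
  have le1 : MdY t <= \int[unif]_v MdY (t * `|v| `^ m).
    apply: (le_trans (modT_le t)); apply: bint_le => //.
      apply: bmfM => //.
      exact: (@bmf_fubini1 _ _ _ _ _ (fun p : R * T0 => MdY (t * `|1 - p.1| `^ m * Z p.2)) (bcomp bM (m2 t)) P0).
    move=> v; rewrite ler_piMr//; first by case/andP: (modT01 P mY (t * `|v| `^ m)).
    have /andP[] // : 0 <= \int[P0]_u MdY (t * `|1 - v| `^ m * Z u) <= 1.
    apply: bint_01; last by move=> u; exact: modT01.
    by meas.
  have M0 : 0 <= MdY t by exact: sqrtr_ge0.
  have I0 : 0 <= \int[unif]_v MdY (t * `|v| `^ m) by apply: bint_ge0 => v; exact: sqrtr_ge0.
  apply: (@le_trans _ _ ((\int[unif]_v MdY (t * `|v| `^ m)) ^+ 2)).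
    by rewrite ler_sqr ?nnegrE.
  apply: (le_trans (bint_jensen2 _ b1)).
  apply: eqle.
  rewrite -(bint_fubini2 bj unif (pprod P P)) (bint_fubini1 bj).
  apply: eq_Rintegral => v _; rewrite (modT_sqr P mY) (bint_fubini1 (bmf_pair1 bj v)).
  apply: eq_Rintegral => w _; apply: eq_Rintegral => w' _ /=.
  by congr cos; rewrite mulrAC.
have bU := bmf_cosU m.
have cv : \int[pprod P P]_p cosU m (t_ n * (Y p.1 - Y p.2)) @[n --> \oo] --> \int[pprod P P]_p (0 : R).
  apply: (@bint_cvg _ _ _ (pprod P P) _ _ 1); mp.
  - by move=> n p; exact: cosU_le1.
  apply: filterS ae_D => p Dp; apply/cvgrPdist_le => eps eps0.
  have [S hS] := cosU_to0 m0 eps0.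
  have D0 : 0 < `|Y p.1 - Y p.2| by rewrite normr_gt0.
  near=> n; rewrite sub0r normrN; apply: hS; rewrite normrM -ler_pdivrMr//.
  have [tn _] := ht n; apply: le_trans (ler_norm _); apply: le_trans tn.
  apply: (@le_trans _ _ n%:R); last by rewrite ler_nat.
  by near: n; exact: nbhs_infty_ger.
rewrite bint_cst in cv.
have e2 : 0 < e ^+ 2 by pos.
move/cvgrPdist_lt : cv => /(_ _ e2) [N _ /(_ N (leqnn N))] /=.
rewrite sub0r normrN => hN.
have [_ eN] := ht N.
have := le_lt_trans (le_trans (sq (t_ N)) (ler_norm _)) hN.
by rewrite ltr_sqr ?nnegrE ?sqrtr_ge0 ?(ltW e0)// ltNge (ltW eN).
Unshelve. all: by end_near. Qed.
Let mmod : mfn MdY. Proof. by case: (bmf_modT P mY). Qed.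

Lemma modT_decays (a A0 : R) : 0 < a -> a * m < 1 -> {ae P0, forall u, 0 < Z u} ->
  (\int[P0]_u (Z u `^ (- a))%:E = A0%:E)%E -> decays MdY a.
Proof.
move=> a0 am Zp Za.
exact: (decays_first mZ m0 mmod (modT01 P mY) (fun t _ => modT_le t) a0 am Zp Za modT_to0).
Qed.

Lemma modT_decays_all (e s : R) : 0 < e -> {ae P0, forall u, e <= Z u} -> 0 < s -> decays MdY s.
Proof.
move=> e0 Ze s0.
exact: (decays_all mZ m0 mmod (modT01 P mY) (fun t _ => modT_le t) e0 Ze modT_to0 s0).
Qed.

End charfun_decay.

(** * Negative moments through the Laplace transform *)

Section laplace_decay.

Lemma ae_Y_gt0 : {ae P, forall w, 0 < Y w}.
Proof.
exists (Y @^-1` [set 0]); split; mp.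
- exact: (law_zero).
- by move=> w /= /negP; rewrite -leNgt => h; apply/eqP; rewrite eq_le h Y0.
Qed.

Definition lapT (t : R) : R := \int[P]_w expR (- (`|t| * Y w)).

Let bj : bmf (fun p : R * T => expR (- (`|p.1| * Y p.2))).
Proof. by meas. Qed.
Let mlap : mfn lapT. Proof. by case: (bmf_fubini1 bj P). Qed.
Let lap01 t : 0 <= lapT t <= 1.
Proof.
apply: bint_01; first by meas.
by move=> w; rewrite expR_ge0/= -expR0 ler_expR oppr_le0 mulr_ge0.
Qed.
Let lap_eq (t : R) : 0 < t -> lapT t <= \int[unif]_v (lapT (t * `|v| `^ m) *
   \int[P0]_u lapT (t * `|1 - v| `^ m * Z u)).
Proof.
move=> t0; apply: eqle.
have lapE (x : R) : 0 <= x -> lapT x = \int[P]_w expR (- (x * Y w)).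
  by move=> x0; rewrite /lapT ger0_norm.
rewrite lapE ?(ltW t0)// (el_lap el (ltW t0)).
apply: eq_Rintegral => v _; rewrite lapE; last by pos.
have -> // : \int[P0]_u lapT (t * `|1 - v| `^ m * Z u) =
   \int[P0]_u \int[P]_w expR (- (t * `|1 - v| `^ m * Z u * Y w)).
by apply: eq_Rintegral => u _; rewrite lapE// !mulr_ge0 ?powR_ge0 ?(ltW t0).
Qed.
Let lap_to0 (e : R) : 0 < e -> exists2 T1 : R, 0 < T1 & forall t : R, T1 <= t -> lapT t <= e.
Proof.
move=> e0.
have cv : \int[P]_w expR (- (`|n%:R| * Y w)) @[n --> \oo] --> \int[P]_w (0 : R).
  apply: (@bint_cvg _ _ _ P _ _ 1); mp.
  - move=> n w; rewrite ger0_norm ?expR_ge0// -expR0 ler_expR oppr_le0 mulr_ge0//.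
  apply: filterS ae_Y_gt0 => w w0.
  have -> : (fun n : nat => expR (- (`|n%:R| * Y w))) = (fun n : nat => expR (- Y w) ^+ n).
    by apply/funext => n; rewrite ger0_norm// -mulrN expRM_natl.
  apply: cvg_expr; rewrite ger0_norm ?expR_ge0//.
  by rewrite -expR0 ltr_expR oppr_lt0.
rewrite bint_cst in cv.
move/cvgrPdist_lt : cv => /(_ _ e0) [N _ /(_ N.+1 (leqnSn N))] /=.
rewrite sub0r normrN => hN.
exists N.+1%:R => // t Nt; apply: le_trans (le_trans (ler_norm _) (ltW hN)).
apply: bint_le; [by meas|by meas|].
move=> w; rewrite ler_expR lerN2 ler_wpM2r//.
by rewrite (ger0_norm (ler0n _ _)); apply: le_trans (ler_norm _).
Qed.

Lemma lapT_decays_all (e s : R) : 0 < e -> {ae P0, forall u, e <= Z u} -> 0 < s -> decays lapT s.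
Proof.
move=> e0 Ze s0.
exact: (decays_all mZ m0 mlap lap01 lap_eq e0 Ze lap_to0 s0).
Qed.

(** By [negpow_dyadic] the moment is at most 1 plus the sum over n of [dyadic s n] times the Laplace
    transform at 2^n. *)
Lemma negative_moment (e s : R) : 0 < e -> {ae P0, forall u, e <= Z u} -> 0 < s ->
  (\int[P]_w (Y w `^ (- s))%:E < +oo)%E.
Proof.
move=> e0 Ze s0.
have s1 : 0 < s + 1 by pos.
(* The order s + 1 exceeds by one the growth of [dyadic s n], which leaves a geometric series of
   ratio 1 / 2. *)
have [C C0 hC] := lapT_decays_all e0 Ze s1.
pose h (n : nat) (w : T) : R := dyadic s n * expR (- ((2 ^ n)%:R * Y w)).
have h0 n w : 0 <= h n w by rewrite mulr_ge0 ?dyadic_ge0 ?expR_ge0.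
have mexp (c : R) : mfn (fun w => expR (- (c * Y w))) by meas.
have mh n : mfn (fun w => (h n w)%:E).
  by apply/measurable_EFinP; exact: measurable_funM.
have mS : mfn (fun w => \sum_(n <oo) (h n w)%:E)%E.
  by apply: ge0_emeasurable_sum => // n w _ _; rewrite lee_fin.
have mpow : mfn (fun w => (Y w `^ (- s))%:E) by meas.
have S0 w : (0 <= \sum_(n <oo) (h n w)%:E)%E.
  by apply: nneseries_ge0 => n _ _; rewrite lee_fin.
have Ih n : (\int[P]_w (h n w)%:E <= ((expR 1 * C * 2 `^ s * 2) / (2 ^ n.+1)%:R)%:E)%E.
  rewrite /h; under eq_integral do rewrite EFinM.
  rewrite ge0_integralZl_EFin//; last 2 first.
  - by meas.
  - exact: dyadic_ge0.
  have p0 : (0 < (2 ^ n)%:R :> R) by rewrite ltr0n expn_gt0.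
  have -> : (\int[P]_w (expR (- ((2 ^ n)%:R * Y w)))%:E = (lapT (2 ^ n)%:R)%:E)%E.
    rewrite /lapT (gtr0_norm p0) bint_EFin//; mp.
  rewrite -EFinM lee_fin; apply: (le_trans (ler_wpM2l (dyadic_ge0 s n) (hC _ p0))).
  rewrite /dyadic expnS natrM powRM ?ler0n// opprD powRD ?(gt_eqF p0) ?implybT//.
  rewrite !powRN powRr1 ?(ltW p0)//; apply: eqle; field.
  by rewrite !gt_eqF// powR_gt0.
pose K := expR 1 * C * 2 `^ s * 2.
have K0 : 0 <= K by rewrite !mulr_ge0 ?expR_ge0 ?powR_ge0.
apply: (@le_lt_trans _ _ (1 + K%:E)%E); last by rewrite -EFinD ltry.
apply: (@le_trans _ _ (\int[P]_w (1 + \sum_(n <oo) (h n w)%:E))%E).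
  apply: ae_ge0_le_integral => //; mp.
  - by move=> w _; apply: adde_ge0.
  - exact: emeasurable_funD.
  apply: filterS ae_Y_gt0 => w w0 _.
  have [le1|[n le1]] := negpow_dyadic s0 w0.
    by apply: (@le_trans _ _ 1%E); [rewrite lee_fin|exact: leeDl].
  apply: (@le_trans _ _ (\sum_(n <oo) (h n w)%:E)%E); last exact: leeDr.
  apply: (@le_trans _ _ (h n w)%:E); first by pos.
  have := @nneseries_lim_ge R (fun n => (h n w)%:E) xpredT 0%N n.+1.
  rewrite big_mkord big_ord_recr/= => H; apply: le_trans (H _).
    apply: leeDr; apply: sume_ge0 => i _; by rewrite lee_fin.
  by move=> k _ _; rewrite lee_fin.
rewrite ge0_integralD//.
rewrite prob_intc leeD2l// integral_nneseries//; last by move=> n w _; rewrite lee_fin.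
apply: le_trans (epsilon_trick0 xpredT K0); apply: lee_nneseries => [n _ _|n _]; last exact: Ih.
by apply: integral_ge0 => w _; rewrite lee_fin.
Qed.

End laplace_decay.

(** * Positivity of a continuous density *)

Section local_lower_bound.
Hypothesis Zne1 : (P0 (Z @^-1` [set 1%R]) < 1)%E.

Let bfp (h : R -> R) : bmf h -> bmf (fun z => h (fpX z)).
Proof.
move=> [mh [M hM]]; apply: (@bmf_le _ _ _ _ M) => [|z]; last exact: hM.
exact: (measurableT_comp mh (measurable_fpX)).
Qed.

(* The solution of [v^m y + (1-v)^m c = x] stays in [3/8, 5/8], and
   the left-hand side is Lipschitz in [v] near it. *)
Let window (x y c L Lam h : R) : 0 < x -> 0 <= y -> 0 <= c ->
  (3 / 8) `^ m * y + (5 / 8) `^ m * c <= x -> x <= (5 / 8) `^ m * y ->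
  0 < L -> (forall v w : R, 4^-1 <= v <= 1 -> 4^-1 <= w <= 1 -> `|v `^ m - w `^ m| <= L * `|v - w|) ->
  0 < Lam -> y + c <= Lam -> 0 < h -> h <= L * Lam / 8 ->
  h / (L * Lam) <= \int[unif]_v (\1_(oball x h) (`|v| `^ m * y + `|1 - v| `^ m * c) : R).
Proof.
move=> x0 y0 c0 lo hi L0 lip Lam0 ycL h0 hL.
pose H (v : R) : R := v `^ m * y + (1 - v) `^ m * c.
have LL : 0 < L * Lam by rewrite mulr_gt0.
have H38 : H (3 / 8) <= x.
  by rewrite /H (_ : 1 - 3 / 8 = 5 / 8 :> R)//; field.
have H58 : x <= H (5 / 8).
  by apply: (le_trans hi); rewrite /H lerDl mulr_ge0// powR_ge0.
have in4 (v : R) : 4^-1 <= v <= 3 / 4 -> 4^-1 <= v <= 1 /\ 4^-1 <= 1 - v <= 1.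
  by move=> /andP[a1 a2]; split; apply/andP; split; lra.
have Hlip (v w : R) : 4^-1 <= v <= 3 / 4 -> 4^-1 <= w <= 3 / 4 -> `|H v - H w| <= L * Lam * `|v - w|.
  move=> /in4[v1 v2] /in4[w1 w2].
  rewrite (_ : H v - H w = (v `^ m - w `^ m) * y + ((1 - v) `^ m - (1 - w) `^ m) * c); last by rewrite /H; ring.
  apply: (le_trans (ler_normD _ _)); rewrite !normrM (ger0_norm y0) (ger0_norm c0).
  apply: (@le_trans _ _ (L * `|v - w| * y + L * `|v - w| * c)).
    apply: lerD; apply: ler_wpM2r => //; first exact: lip.
    apply: (le_trans (lip _ _ v2 w2)); rewrite (_ : 1 - v - (1 - w) = w - v); last by ring.
    by rewrite distrC.
  rewrite -mulrDr mulrAC ler_wpM2r// ler_wpM2l// ltW//.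
have ctsH : {within `[(3 / 8), (5 / 8)], continuous H}.
  apply: continuous_in_subspaceT => v; rewrite inE/= in_itv/= => /andP[v1 v2].
  have va : 0 < v by lra.
  have vb : 0 < 1 - v by lra.
  apply: cvgD; (apply: cvgM; last exact: cvg_cst).
    exact: (is_derive_cts (is_derive_pow m va)).
  apply: (@continuous_comp _ _ _ (fun v : R => 1 - v) (fun y : R => y `^ m)).
    by apply: cvgB; [exact: cvg_cst|exact: cvg_id].
  exact: (is_derive_cts (is_derive_pow m vb)).
have le38 : 3 / 8 <= 5 / 8 :> R by lra.
have xr : Order.min (H (3 / 8)) (H (5 / 8)) <= x <= Order.max (H (3 / 8)) (H (5 / 8)).
  by rewrite ge_min H38 le_max H58 orbT.
have [vs] := IVT le38 ctsH xr; rewrite in_itv/= => /andP[vs1 vs2] Hvs.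
pose r := h / (L * Lam) / 2.
have r8 : r <= 16^-1.
  rewrite /r ler_pdivrMr// ler_pdivrMr//; apply: (le_trans hL).
  by apply: eqle; field.
have r0 : 0 < r by rewrite !divr_gt0.
have mI : measurable (`[(vs - r), (vs + r)[%classic : set R) by meas.
have -> : h / (L * Lam) = \int[unif]_v (\1_(`[(vs - r), (vs + r)[%classic) v : R).
  have [? ? ?] := window_range vs1 vs2 r0 r8; rewrite integral_unif_itv//.
  by rewrite /r; field; rewrite !gt_eqF.
apply: bint_le.
- exact: bmf_indic.
- apply: bmf_indic_comp => //; last by meas.
  have mid : mfn (fun v : R => v) by [].
  have m1' : mfn (fun v : R => 1 - v) by exact: measurable_funB.
  by meas.
move=> v; rewrite [leLHS]indicE mem_setE in_itv/=.
case: (boolP (vs - r <= v < vs + r)) => [/andP[v1 v2]|_]; last by rewrite indicE.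
rewrite indicE mem_set// oballE.
have v4 := window_quarters vs1 vs2 r8 v1 v2.
have vs4 : 4^-1 <= vs <= 3 / 4.
  by apply: (window_quarters vs1 vs2 r8); rewrite ?gerBl ?ltrDl// ltW.
have := Hlip v vs v4 vs4; rewrite Hvs => le1.
have : `|H v - x| < h.
  apply: (le_lt_trans le1); rewrite mulrC -ltr_pdivlMr//.
  apply: (@le_lt_trans _ _ r); first by rewrite ler_distl v1 ltW.
  by rewrite /r ltr_pdivrMr// mulr_natr mulr2n ltrDl divr_gt0.
have /andP[va vb] := v4.
rewrite ltr_norml /H (_ : `|v| = v); last by rewrite gtr0_norm//; lra.
rewrite (_ : `|1 - v| = 1 - v); last by rewrite gtr0_norm//; lra.
rewrite ltrBrDl => /andP[-> ]/=; by rewrite ltrBlDl.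
Qed.
Let swapped (A : set R) : measurable A -> \int[P]_w (\1_A (Y w) : R) =
  \int[pprod P P]_y \int[P0]_u \int[unif]_v
    (\1_A (`|v| `^ m * Y y.1 + `|1 - v| `^ m * (Z u * Y y.2)) : R).
Proof.
move=> mA; have bx : bmf (\1_A : R -> R) by exact: bmf_indic.
rewrite (eq_law_bint mY (measurable_fpX) (fp_law) bx).
rewrite (bint_fubini2 (bfp bx)); apply: eq_Rintegral => y _.
rewrite (bint_fubini2 (bmf_pair2 (bfp bx) y)); apply: eq_Rintegral => u _.
by apply: eq_Rintegral => v _; rewrite mulrA.
Qed.

(** Let Y be near y0, Y' near 0 and Z near a point of its support, an event of positive probability.
    Then v^m Y + (1 - v)^m Z Y' = x has a solution in [3/8, 5/8], and by the Lipschitz bound a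
    window of v of length proportional to h stays within h of x. *)
Lemma local_lower_bound (x : R) : 0 < x -> exists kap h0 : R, [/\ 0 < kap, 0 < h0 &
  forall h : R, 0 < h <= h0 -> kap * h <= \int[P]_w (\1_(oball x h) (Y w) : R)].
Proof.
move=> x0; have [L L0 lip] := powR_lipschitz m0.
pose pp := (5 / 8) `^ m : R; pose qq := (3 / 8) `^ m : R.
have pp0 : 0 < pp by rewrite powR_gt0// divr_gt0.
have qq0 : 0 < qq by rewrite powR_gt0// divr_gt0.
have qp : qq < pp.
  by apply: gt0_ltr_powR; rewrite ?nnegrE ?divr_ge0// ltr_pM2r ?invr_gt0// ltr_nat.
(* For y between [lo] and [hi], the solution of v^m y = x lies between 3/8 and 5/8. *)
pose lo := x / pp; pose hi := x / qq.
have lohi : lo < hi by rewrite /lo /hi ltr_pM2l// ltf_pV2 ?posrE.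
have lo0 : 0 < lo by rewrite divr_gt0.
pose e1 := (hi - lo) / 4; have e10 : 0 < e1 by rewrite divr_gt0// subr_gt0.
pose y0 := (lo + hi) / 2.
have y00 : 0 <= y0 by rewrite divr_ge0// addr_ge0// ltW// (lt_trans lo0).
(* The room left for c = Z Y': with y <= hi - e1 and c <= del, the value at v = 3/8 is still at most
   x. *)
pose del := qq * e1 / pp; have del0 : 0 < del by rewrite divr_gt0// mulr_gt0.
have [u0 zs] := nonempty_ae (ae_psupp P0 mZ).
pose K := Z u0 + 1; have K0 : 0 < K by rewrite ltr_wpDl.
pose e2 := del / K; have e20 : 0 < e2 by rewrite divr_gt0.
pose I1 := oball y0 e1; pose I2 := oball 0 e2; pose I3 := oball (Z u0) 1.
have mI1 : measurable I1 by meas.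
have mI2 : measurable I2 by meas.
have mI3 : measurable I3 by meas.
pose a1 := \int[P]_w (\1_I1 (Y w) : R); pose a2 := \int[P]_w (\1_I2 (Y w) : R).
pose a3 := \int[P0]_u (\1_I3 (Z u) : R).
have a10 : 0 < a1 by rewrite -lte_fin -(prob_bint P mY mI1); exact: (psupp_all Zne1 y00).
have a20 : 0 < a2 by rewrite -lte_fin -(prob_bint P mY mI2); exact: (psupp_all Zne1 (lexx 0)).
have a30 : 0 < a3 by rewrite -lte_fin -(prob_bint P0 mZ mI3); exact: zs.
pose Lam := hi + del; have Lam0 : 0 < Lam by rewrite addr_gt0// (lt_trans lo0).
have LL : 0 < L * Lam by rewrite mulr_gt0.
exists (a1 * a2 * a3 / (L * Lam)), (L * Lam / 8); split.
- by rewrite divr_gt0// !mulr_gt0.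
- by rewrite divr_gt0.
move=> h /andP[h0 hL]; rewrite (swapped (measurable_oball x h)).
have b1 : bmf (fun w => \1_I1 (Y w) : R) by exact: bmf_indic_comp.
have b2 : bmf (fun w => \1_I2 (Y w) : R) by exact: bmf_indic_comp.
have b3 : bmf (fun u => \1_I3 (Z u) : R) by exact: bmf_indic_comp.
have b12 : bmf (fun y : T * T => \1_I1 (Y y.1) * \1_I2 (Y y.2) : R).
  apply: bmfM; apply: bmf_indic_comp => //; by meas.
have bo : bmf (\1_(oball x h) : R -> R) by apply: bmf_indic; by meas.
have bfx : bmf (fun z : (R * T0) * (T * T) =>
    \1_(oball x h) (`|z.1.1| `^ m * Y z.2.1 + `|1 - z.1.1| `^ m * (Z z.1.2 * Y z.2.2)) : R).
  by meas.
have bu y : bmf (fun u => \int[unif]_v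
    (\1_(oball x h) (`|v| `^ m * Y y.1 + `|1 - v| `^ m * (Z u * Y y.2)) : R)).
  exact: (bmf_fubini2 (bmf_pair2 bfx y) unif).
have by_ : bmf (fun y : T * T => \int[P0]_u \int[unif]_v
    (\1_(oball x h) (`|v| `^ m * Y y.1 + `|1 - v| `^ m * (Z u * Y y.2)) : R)).
  have := bmf_fubini2 bfx (pprod unif P0); congr bmf; apply/funext => y.
  by rewrite (bint_fubini2 (bmf_pair2 bfx y)).
have -> : a1 * a2 * a3 / (L * Lam) * h =
  \int[pprod P P]_y ((\1_I1 (Y y.1) * \1_I2 (Y y.2)) * (a3 * (h / (L * Lam)))).
  rewrite bintZr// (bint_fubini1 b12).
  have -> : \int[P]_w \int[P]_w' (\1_I1 (Y w) * \1_I2 (Y w') : R) = a1 * a2.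
    by rewrite /a1 -bintZr//; apply: eq_Rintegral => w _ /=; rewrite bintZl.
  by field; rewrite !gt_eqF.
apply: bint_le => //; first by meas.
move=> y.
have [y1|y1] := boolP (Y y.1 \in I1); last first.
  rewrite indicE (negbTE y1) !mul0r; apply: bint_ge0 => u; apply: bint_ge0 => v.
  by rewrite indicE.
have [y2|y2] := boolP (Y y.2 \in I2); last first.
  rewrite [\1_I2 _]indicE (negbTE y2) mulr0 mul0r; apply: bint_ge0 => u; apply: bint_ge0 => v.
  by rewrite indicE.
rewrite !indicE y1 y2 !mul1r /a3 -bintZr//.
apply: bint_le => //; first by meas.
move=> u; have [u1|u1] := boolP (Z u \in I3); last by rewrite indicE (negbTE u1) mul0r; apply: bint_ge0 => v; rewrite indicE.
rewrite indicE u1 mul1r.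
move: y1 y2 u1; rewrite !inE /I1 /I2 /I3 !oballE => /andP[l1 r1] /andP[_ r2] /andP[_ r3].
have c0 : 0 <= Z u * Y y.2 by rewrite mulr_ge0.
have cdel : Z u * Y y.2 <= del.
  have -> : del = K * e2 by rewrite /e2 mulrC divfK// gt_eqF.
  by apply: ler_pM => //; rewrite ?(ltW r3)// -[e2]add0r ltW.
have ylo : lo < Y y.1.
  by apply: lt_trans l1; rewrite /y0 /e1; move: lohi; lra.
have yhi : Y y.1 < hi - e1.
  by rewrite (_ : hi - e1 = y0 + e1)// /y0 /e1; field.
apply: (window x0 (Y0 _) c0 _ _ L0 lip Lam0) => //.
- apply: (@le_trans _ _ (qq * (hi - e1) + pp * del)).
    by apply: lerD; rewrite ler_wpM2l// ?(ltW yhi) ?(ltW qq0) ?(ltW pp0).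
  rewrite /del /hi; apply: eqle; field.
  by rewrite !gt_eqF.
- by rewrite -/pp mulrC -ler_pdivrMr// ltW.
- by rewrite lerD// (ltW (lt_trans yhi _))// ltrBlDr ltrDl.
Qed.

(** If f (x) = 0, continuity leaves probability o(h) for the ball of radius h around x, against
    [local_lower_bound]. *)
Lemma density_gt0 (f : R -> R) (x : R) : continuous f -> (forall x, 0 <= f x) ->
  (forall A : set R, measurable A ->
     P (Y @^-1` A) = (\int[lebesgue_measure]_(x in A) (f x)%:E)%E) ->
  0 < x -> 0 < f x.
Proof.
move=> cf f0 fE x0; rewrite lt_neqAle f0 andbT; apply/negP => /eqP fx.
have [kap [h0 [kap0 h00 H]]] := local_lower_bound x0.
have k4 : 0 < kap / 4 by rewrite divr_gt0.
have mf : mfn f by exact: continuous_measurable_fun.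
have : \forall y \near x, `|f x - f y| < kap / 4.
  by have /cvgrPdist_lt := cf x; apply.
rewrite -fx => /nbhs_ballP[e /= e0 he].
pose h := Order.min h0 e.
have hp : 0 < h by rewrite lt_min h00.
have hh : 0 < h <= h0 by rewrite hp ge_min lexx.
have := H h hh; rewrite -lee_fin -(prob_bint P mY (measurable_oball x h)) fE; last by meas.
apply/negP; rewrite -ltNge.
apply: (@le_lt_trans _ _ (\int[lebesgue_measure]_(y in oball x h) (kap / 4)%:E)%E).
  apply: ge0_le_integral => //.
  - by meas.
  - by move=> y _; rewrite lee_fin.
  - by apply/measurable_funTS/measurable_EFinP.
  move=> y; rewrite oballE => /andP[y1 y2]; rewrite lee_fin.
  have : ball x e y.
    rewrite /ball/= ltr_norml; apply/andP.
    have he' : h <= e by rewrite ge_min lexx orbT.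
    by split; lra.
  by move/he => /=; rewrite sub0r normrN ger0_norm// => /ltW.
rewrite integral_cst//=; last by meas.
rewrite /oball lebesgue_measure_itv/= lte_fin ifT; last by lra.
by rewrite -EFinD -EFinM lte_fin; have := mulr_gt0 kap0 hp; lra.
Qed.

End local_lower_bound.

(** * Continuous and smooth densities of the limit *)

Section densities.
Hypothesis Zne1 : (P0 (Z @^-1` [set 1%R]) < 1)%E.

Definition law_density (f : R -> R) : Prop :=
  [/\ mfn f, forall x, 0 <= f x &
    forall A : set R, measurable A ->
      P (Y @^-1` A) = (\int[lebesgue_measure]_(x in A) (f x)%:E)%E].

Lemma continuous_density (a : R) : 1 < a -> decays (modT P Y) a ->
  exists f : R -> R, [/\ law_density f, continuous f & exists B : R, forall x, f x <= B].
Proof.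
(* b = a - 1 is the weight for which the decay order a is exactly enough. *)
move=> a1 da; have b0 : 0 < a - 1 by rewrite subr_gt0.
have [M hM] : exists M : R, forall t : R, `|t| ^+ 0 * (modT P Y t * wt (a - 1) t) <= M.
  by apply: weighted_modulus => //; rewrite (_ : 1 + (a - 1) + 0%:R = a)//; ring.
have {}hM t : modT P Y t * wt (a - 1) t <= M by have := hM t; rewrite expr0 mul1r.
have na := law_atom Zne1.
exists (dens P Y b0); split.
- split; first by case: (bmf_dens mY b0 hM).
  + exact: (dens_ge0 mY b0 hM).
  + exact: (law_dens mY b0 hM na).
- exact: (@continuous_dens _ _ _ _ _ mY _ _ b0 hM).
- by exists (pi^-1 * M) => x; exact: (dens_le mY b0 hM).
Qed.

Lemma smooth_density : (forall s : R, 0 < s -> decays (modT P Y) s) ->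
  exists f : R -> R, [/\ law_density f, smooth f, exists B : R, forall x, f x <= B &
    forall x, 0 < x -> 0 < f x].
Proof.
move=> dall; have b0 : (0 < 1 :> R) by [].
have H k : exists M : R, forall t : R, `|t| ^+ k * (modT P Y t * wt 1 t) <= M.
  by apply: weighted_modulus => //; apply: dall; rewrite ltr_wpDr.
have [M hM] := H 0%N.
have {}hM t : modT P Y t * wt 1 t <= M by have := hM t; rewrite expr0 mul1r.
have na := law_atom Zne1.
have ld : law_density (dens P Y b0).
  split; first by case: (bmf_dens mY b0 hM).
  + exact: (dens_ge0 mY b0 hM).
  + exact: (law_dens mY b0 hM na).
exists (dens P Y b0); split => //.
- apply: smooth_fou => k; have [Mk hk] := H k; apply: (@bmf_le _ _ _ _ Mk).
  + by apply: measurable_funM => //; exact: measurable_Aw.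
  + move=> t; apply: le_trans (hk t); rewrite normrM normrX ler_wpM2l ?exprn_ge0//.
    exact: Aw_le.
  + by apply: measurable_funM => //; exact: measurable_Bw.
  + move=> t; apply: le_trans (hk t); rewrite normrM normrX ler_wpM2l ?exprn_ge0//.
    exact: Bw_le.
- by exists (pi^-1 * M) => x; exact: (dens_le mY b0 hM).
- move=> x x0; case: ld => _ f0 fE.
  exact: (density_gt0 Zne1 (@continuous_dens _ _ _ _ _ mY _ _ b0 hM) f0 fE x0).
Qed.

End densities.

(** * The transform of L times a power of an exponential variable *)

Section exponential_transform.
Notation ex := (@ex R).
Notation l := (lapT).

Let bj : bmf (fun p : R * T => expR (- (`|p.1| * Y p.2))).
Proof. by meas. Qed.
Let bl : bmf l. Proof. exact: (bmf_fubini1 bj P). Qed.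
Let l01 : unitv l.
Proof.
move=> t; apply: bint_01; first by meas.
by move=> w; rewrite expR_ge0/= -expR0 ler_expR oppr_le0 mulr_ge0.
Qed.
Let lE t : 0 <= t -> l t = \int[P]_w expR (- (t * Y w)).
Proof. by move=> t0; rewrite /lapT ger0_norm. Qed.
Let mpow : mfn (fun v : R => `|v| `^ m).
Proof. by meas. Qed.
Let lcomp d' (T' : measurableType d') (k : T' -> R) : mfn k ->
  bmf (fun x => l (k x)).
Proof. by meas. Qed.

Definition expT (t : R) : R := \int[ex]_z l (t * `|z| `^ m).
Definition expK (t : R) : R := \int[P0]_u expT (t * Z u).

Let b2 : bmf (fun p : R * R => l (p.1 * `|p.2| `^ m)).
Proof. by meas. Qed.

Lemma bmf_expT : bmf expT. Proof. exact: (bmf_fubini1 b2 ex). Qed.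

Lemma expT01 : unitv expT.
Proof. by move=> t; apply: bint_01; [case: (bmf_pair1 b2 t)|move=> z; exact: l01]. Qed.
Let bK2 : bmf (fun p : R * T0 => expT (p.1 * Z p.2)).
Proof.
case: bmf_expT => me he; apply: (bmf_comp me he); apply: measurable_funM => //; mp.
Qed.

Lemma bmf_expK : bmf expK. Proof. exact: (bmf_fubini1 bK2 P0). Qed.
Let K1 (s y : R) : R := \int[P0]_u l (s * `|y| `^ m * Z u).

Let bK1 (s : R) : bmf (K1 s).
Proof.
apply: (@bmf_fubini1 _ _ _ _ _ (fun p : R * T0 => l (s * `|p.1| `^ m * Z p.2))); mp.
Qed.
Let l0 : nng l. Proof. by move=> t; case/andP: (l01 t). Qed.
Let K10 s : nng (K1 s). Proof. by move=> y; apply: bint_ge0 => u; exact: l0. Qed.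
Let expKE s : expK s = \int[ex]_y K1 s y.
Proof.
have bb : bmf (fun p : T0 * R => l (s * Z p.1 * `|p.2| `^ m)) by meas.
rewrite /expK -(bint_fubini1 bb) (bint_fubini2 bb).
by apply: eq_Rintegral => y _; apply: eq_Rintegral => u _; rewrite /= mulrAC.
Qed.
Let lsplit (t : R) : 0 <= t -> l t = \int[unif]_v (l (t * `|v| `^ m) * K1 t (1 - v)).
Proof.
move=> t0; rewrite lE// (el_lap el t0); apply: eq_Rintegral => v _.
rewrite lE; last by pos.
have -> // : K1 t (1 - v) = \int[P0]_u \int[P]_w expR (- (t * `|1 - v| `^ m * Z u * Y w)).
by apply: eq_Rintegral => u _; rewrite lE// !mulr_ge0 ?powR_ge0.
Qed.
Let nrmM (a b : R) : `|a * b| `^ m = `|a| `^ m * `|b| `^ m.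
Proof. by rewrite normrM powRM. Qed.
Let K1M (s z y : R) : K1 (s * `|z| `^ m) y = K1 s (z * y).
Proof. by apply: eq_Rintegral => u _; rewrite nrmM mulrA. Qed.
(** [exponential_split] read backwards: under the weight |z| the parts z v and z (1 - v) are
    independent exponentials, and the two factors of the fixed-point equation decouple. *)
Let size_biased (s : R) : 0 <= s ->
  (\int[ex]_z (`|z| * l (s * `|z| `^ m))%:E = (expT s * expK s)%:E)%E.
Proof.
move=> s0.
pose H (p : R * R) : \bar R := (l (s * `|p.1| `^ m) * K1 s p.2)%:E.
have mH : mfn H.
  apply/measurable_EFinP; apply: measurable_funM; mp.
  by case: (bK1 s) => mK _; exact: (measurableT_comp mK measurable_snd).
have bK := bK1 s.
have bs : bmf (fun x : R => l (s * `|x| `^ m)) := bmf_pair1 b2 s.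
have inner (x : R) : (\int[ex]_y H (x, y) = (l (s * `|x| `^ m) * expK s)%:E)%E.
  rewrite -[LHS](@bint_EFin _ _ _ _ (fun y => l (s * `|x| `^ m) * K1 s y)).
    by rewrite (bintZl _ _ bK) expKE.
  exact: (bmfM (bmf_cst _) bK).
have LHS1 : (\int[ex]_x \int[ex]_y H (x, y) = (expT s * expK s)%:E)%E.
  rewrite (eq_integral (fun x : R => (l (s * `|x| `^ m) * expK s)%:E)); last by move=> x _; exact: inner.
  rewrite -[LHS](@bint_EFin _ _ _ _ (fun x : R => l (s * `|x| `^ m) * expK s)).
    by rewrite (bintZr _ _ bs).
  exact: (bmfM bs (bmf_cst _)).
have H0 p : (0 <= H p)%E by rewrite lee_fin (mulr_ge0 (l0 _) (K10 _ _)).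
rewrite -LHS1 (exponential_split mH H0); clear H0; apply: eq_integral => z _.
rewrite EFinM; congr (_ * _)%E.
rewrite (lsplit (mulr_ge0 s0 (powR_ge0 `|z| m))) bint_EFin.
  by apply: eq_integral => v _; rewrite /H/= nrmM mulrA K1M.
apply: bmfM.
  by apply: lcomp; apply: measurable_funM.
have bK' := bK1 (s * `|z| `^ m); case: bK' => mK hK.
by apply: (bmf_comp mK hK); exact: measurable_funB.
Qed.

(** One exponential is written as z v under the weight |z|; integrating over z at fixed v is
    [size_biased] at t v^m. *)
Lemma expT_eq (t : R) : 0 <= t ->
  expT t = \int[unif]_v (expT (t * `|v| `^ m) * expK (t * `|v| `^ m)).
Proof.
move=> t0.
have bEK : bmf (fun v : R => expT (t * `|v| `^ m) * expK (t * `|v| `^ m)).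
  case: bmf_expT => me he; case: bmf_expK => mk hk.
  by apply: bmfM; [apply: (bmf_comp me he)|apply: (bmf_comp mk hk)]; meas.
pose H (p : R * R) : \bar R := (l (t * `|p.1| `^ m))%:E.
have mH : mfn H.
  by apply/measurable_EFinP; meas.
have H0 p : (0 <= H p)%E by pos.
apply: EFin_inj; rewrite [in RHS](bint_EFin _ bEK).
transitivity (\int[ex]_x \int[ex]_y H (x, y))%E.
  rewrite /expT (bint_EFin _ (bmf_pair1 b2 t)).
  by apply: eq_integral => x _; rewrite /H/= prob_intc.
rewrite (exponential_split mH H0); clear H0.
pose G (p : R * R) : \bar R := (`|p.1| * l (t * `|p.2| `^ m * `|p.1| `^ m))%:E.
have mG : mfn G.
  apply/measurable_EFinP; apply: measurable_funM.
    by meas.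
  by meas.
transitivity (\int[ex]_z \int[unif]_v G (z, v))%E.
  apply: eq_integral => z _; rewrite -ge0_integralZl_EFin.
  - apply: eq_integral => v _; rewrite /H /G/= -EFinM nrmM.
    by rewrite mulrA [t * _ * _]mulrAC.
  - by meas.
  - by pos.
  - apply: (measurableT_comp mH); apply/measurable_fun_pairP; split.
      exact: measurable_funM.
    by apply: measurable_funM => //; exact: measurable_funB.
  - by pos.
have G0 p : (0 <= G p)%E by rewrite lee_fin (mulr_ge0 (normr_ge0 _) (l0 _)).
have := @fubini_tonelli _ _ _ _ R ex unif G mG G0; clear G0.
rewrite /fubini_F /fubini_G => ->; apply: eq_integral => v _.
rewrite /G/=; apply: size_biased; by pos.
Qed.
Let Xp (t : R) (p : R * T) : R := t * `|p.1| `^ m * Y p.2.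

Let mXp t : mfn (Xp t).
Proof.
apply: measurable_funM; last by meas.
by meas.
Qed.
Let Xp0 t p : 0 <= t -> 0 <= Xp t p.
Proof. by move=> t0; rewrite !mulr_ge0 ?powR_ge0. Qed.
Let int_Xp (t s : R) (c : R) : 0 <= t -> 0 < s ->
  (\int[P]_w (Y w `^ s)%:E = c%:E)%E ->
  (\int[pprod ex P]_p (Xp t p `^ s)%:E = (t `^ s * gam (s * m) * c)%:E)%E.
Proof.
move=> t0 s0 Yc.
have mYs : mfn (fun w => (Y w `^ s)%:E) by meas.
have mXs : mfn (fun p => (Xp t p `^ s)%:E) by meas.
have X0 p : (0 <= (Xp t p `^ s)%:E)%E by pos.
have -> : (\int[pprod ex P]_p (Xp t p `^ s)%:E = \int[ex]_z \int[P]_w (Xp t (z, w) `^ s)%:E)%E.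
  by rewrite (@fubini_tonelli1 _ _ _ _ R ex P (fun p => (Xp t p `^ s)%:E)).
have c0 : 0 <= c.
  by rewrite -lee_fin -Yc; apply: integral_ge0 => w _; rewrite lee_fin powR_ge0.
transitivity (\int[ex]_z ((t `^ s * c)%:E * (`|z| `^ (s * m))%:E))%E.
  apply: eq_integral => z _.
  transitivity (\int[P]_w ((t `^ s * `|z| `^ (s * m))%:E * (Y w `^ s)%:E))%E.
    apply: eq_integral => w _; rewrite -EFinM; congr EFin; rewrite /Xp/=.
    by rewrite !powRM ?mulr_ge0 ?powR_ge0// -powRrM [m * s]mulrC.
  rewrite ge0_integralZl_EFin//; mp.
  by rewrite Yc -!EFinM; congr EFin; ring.
rewrite ge0_integralZl_EFin//; mp.
rewrite gamE; last by pos.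
by rewrite -EFinM; congr EFin; ring.
Qed.

(** With E exponential, E^m Y has mean gam m / gam m = 1 and a finite g-th moment, so [expRN_taylor]
    can be integrated. The transforms to be compared thus share the expansion 1 - t + O(t^g), from
    which the contraction starts. *)
Lemma expT_taylor : exists C : R, forall t : R, 0 <= t -> `|expT t - 1 + t| <= C * t `^ g.
Proof.
have /andP[g1 g2] := el_g el; have g0 : 0 < g by exact: lt_trans g1.
pose c := fine (\int[P]_w (Y w `^ g)%:E)%E.
have Yc : (\int[P]_w (Y w `^ g)%:E = c%:E)%E.
  rewrite /c fineK// ge0_fin_numE ?(el_Yg el)//.
  by apply: integral_ge0 => w _; rewrite lee_fin powR_ge0.
exists (gam (g * m) * c) => t t0.
have IX : (\int[pprod ex P]_p (Xp t p)%:E = t%:E)%E.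
  have Y1 : (\int[P]_w (Y w `^ 1)%:E = ((gam m)^-1)%:E)%E.
    by rewrite -(el_Ym el); apply: eq_integral => w _; rewrite powRr1.
  have := int_Xp t0 ltr01 Y1; under eq_integral do rewrite powRr1 ?Xp0//.
  by move=> ->; rewrite powRr1// mul1r -mulrA divff ?mulr1// gt_eqF// gam_gt0// ltW.
have be : bmf (fun p => expR (- Xp t p)) by apply: bmf_expN => // p; exact: Xp0.
have IE : (\int[pprod ex P]_p (expR (- Xp t p))%:E = (expT t)%:E)%E.
  transitivity ((\int[pprod ex P]_p expR (- Xp t p))%:E); first exact: (esym (bint_EFin _ be)).
  apply: (congr1 EFin); rewrite (bint_fubini1 be) /expT; apply: eq_Rintegral => z _.
  by rewrite (lE (mulr_ge0 t0 (powR_ge0 _ _))).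
pose r p := expR (- Xp t p) - 1 + Xp t p.
have r0 p : 0 <= r p.
  by have /andP[] := expRN_taylor (Xp0 p t0) (introT andP (conj (ltW g1) g2)).
have rle p : r p <= Xp t p `^ g.
  by have /andP[] := expRN_taylor (Xp0 p t0) (introT andP (conj (ltW g1) g2)).
have mr : mfn (fun p => (r p)%:E).
  apply/measurable_EFinP; apply: measurable_funD => //; apply: measurable_funB => //; mp.
have Ir : (\int[pprod ex P]_p (r p)%:E <= (t `^ g * gam (g * m) * c)%:E)%E.
  rewrite -(int_Xp t0 g0 Yc); apply: ge0_le_integral => //; mp.
  - by move=> p _; rewrite lee_fin.
have Ir0 : (0 <= \int[pprod ex P]_p (r p)%:E)%E by apply: integral_ge0 => p _; rewrite lee_fin.
have key : ((expT t)%:E + t%:E = 1 + \int[pprod ex P]_p (r p)%:E)%E.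
  rewrite -IE -IX -ge0_integralD//; last 3 first.
  - by meas.
  - by move=> p _; rewrite lee_fin Xp0.
  - by meas.
  rewrite -(prob_intc (pprod ex P) 1) -ge0_integralD//; last by pos.
  by apply: eq_integral => p _; rewrite -!EFinD; congr EFin; rewrite /r; ring.
have [D DE] : exists D : R, (\int[pprod ex P]_p (r p)%:E = D%:E)%E.
  exists (fine (\int[pprod ex P]_p (r p)%:E)%E); rewrite fineK// ge0_fin_numE//.
  by rewrite (le_lt_trans Ir)// ltry.
move: key Ir Ir0; rewrite DE -!EFinD !lee_fin => -[key] Ir Ir0.
have -> : expT t - 1 + t = D by move: key; lra.
by rewrite ger0_norm// (le_trans Ir)//; apply: eqle; ring.
Qed.

End exponential_transform.

End echo_fixed_point.

(** * Uniqueness by contraction at 0 *)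

Section contraction.
Context {R : realType} {d0} {T0 : measurableType d0}
  (P0 : probability T0 R) (Z : T0 -> R).
Variables (m g q : R).
Hypotheses (mZ : mfn Z) (Z0 : forall u, 0 <= Z u) (m0 : 0 < m) (g0 : 0 < g).
Hypothesis Zg : (\int[P0]_u (Z u `^ g)%:E = q%:E)%E.
Hypothesis qgm : q < g * m.
Notation unif := (@unif R).

Definition transform_solution (w : R -> R) : Prop :=
  [/\ mfn w, forall t, 0 <= w t <= 1 & forall t : R, 0 <= t ->
    w t = \int[unif]_v (w (t * `|v| `^ m) * \int[P0]_u w (t * `|v| `^ m * Z u))].

(** The equation reproduces a difference of order t^g with the factor [ro]: E V^(g m) = 1 / (1 + g
    m), and the two factors of the product contribute 1 and q. The powers of [ro] < 1 then tend to
    0. *)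
Lemma transform_unique (w1 w2 : R -> R) (D : R) :
  transform_solution w1 -> transform_solution w2 -> 0 <= D ->
  (forall t, 0 <= t -> `|w1 t - w2 t| <= D * t `^ g) ->
  forall t, 0 <= t -> w1 t = w2 t.
Proof.
move=> [mw1 w101 e1] [mw2 w201 e2] D0 hD.
have q0 : 0 <= q by rewrite -lee_fin -Zg; apply: integral_ge0 => u _; rewrite lee_fin powR_ge0.
have gm0 : 0 < g * m by pos.
pose ro := (1 + q) / (1 + g * m).
have ro0 : 0 <= ro by rewrite divr_ge0 ?addr_ge0 ?(ltW gm0).
have ro1 : ro < 1 by rewrite ltr_pdivrMr ?addr_gt0// mul1r ltrD2l.
have mpow : mfn (fun v : R => `|v| `^ m) by meas.
have mZg : mfn (fun u => Z u `^ g) by meas.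
have bw (w : R -> R) : mfn w -> (forall t, 0 <= w t <= 1) -> bmf w.
  by move=> mw w01; exact: bmf01.
have bc (w : R -> R) d' (T' : measurableType d') (k : T' -> R) :
    mfn w -> (forall t, 0 <= w t <= 1) -> mfn k -> bmf (fun x => w (k x)).
  by move=> mw w01 mk; case: (bw _ mw w01) => _ hw; exact: (bmf_comp mw hw mk).
have mtZ (s : R) : mfn (fun u => s * Z u) by meas.
have ind n : forall t, 0 <= t -> `|w1 t - w2 t| <= D * ro ^+ n * t `^ g.
  elim: n => [t t0|n IH t t0]; first by rewrite expr0 mulr1; exact: hD.
  pose Dn := D * ro ^+ n; have Dn0 : 0 <= Dn by rewrite mulr_ge0// exprn_ge0.
  pose k1 s := \int[P0]_u w1 (s * Z u); pose k2 s := \int[P0]_u w2 (s * Z u).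
  have k101 s : 0 <= k1 s <= 1 by apply: bint_01 => //; by meas.
  have k201 s : 0 <= k2 s <= 1 by apply: bint_01 => //; by meas.
  have kk s : 0 <= s -> `|k1 s - k2 s| <= Dn * q * s `^ g.
    move=> s0; have bb1 := bc w1 _ _ _ mw1 w101 (mtZ s); have bb2 := bc w2 _ _ _ mw2 w201 (mtZ s).
    rewrite /k1 /k2 -bintB//; apply: (le_trans (bint_norm _ (bmfB bb1 bb2))); rewrite -lee_fin.
    apply: (@le_trans _ _ (\int[P0]_u (Dn * s `^ g * Z u `^ g)%:E)%E).
      apply: bint_EFin_le => //; mp.
      - by apply: bmf_norm; meas.
      apply: aeW => u; rewrite -mulrA -powRM//; apply: IH; by pos.
    under eq_integral do rewrite EFinM.
    rewrite ge0_integralZl_EFin//; mp.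
    by rewrite Zg -EFinM lee_fin mulrAC.
  have mtv : mfn (fun v : R => t * `|v| `^ m) by meas.
  have mtvZ : mfn (fun p : R * T0 => t * `|p.1| `^ m * Z p.2) by meas.
  have bk1 : bmf (fun v : R => k1 (t * `|v| `^ m)).
    exact: (bmf_fubini1 (bc w1 _ _ _ mw1 w101 mtvZ) P0).
  have bk2 : bmf (fun v : R => k2 (t * `|v| `^ m)).
    exact: (bmf_fubini1 (bc w2 _ _ _ mw2 w201 mtvZ) P0).
  have bp1 := bmfM (bc w1 _ _ _ mw1 w101 mtv) bk1.
  have bp2 := bmfM (bc w2 _ _ _ mw2 w201 mtv) bk2.
  rewrite e1// e2// -bintB//; apply: (le_trans (bint_norm _ (bmfB bp1 bp2))); rewrite -lee_fin.
  apply: (@le_trans _ _ (\int[unif]_v (Dn * (1 + q) * t `^ g * `|v| `^ (g * m))%:E)%E).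
    have mv : mfn (fun v : R => `|v| `^ (g * m)) by meas.
    apply: bint_EFin_le => //.
    - by apply: bmf_norm; meas.
    - by meas.
    - move=> v; rewrite (mulr_ge0 _ (powR_ge0 _ _))// (mulr_ge0 _ (powR_ge0 _ _))//; mp.
    apply: aeW => v; set s := t * `|v| `^ m.
    have s0 : 0 <= s by rewrite mulr_ge0 ?powR_ge0.
    have -> : Dn * (1 + q) * t `^ g * `|v| `^ (g * m) = Dn * s `^ g + Dn * q * s `^ g.
      by rewrite /s powRM ?powR_ge0// -powRrM [m * g]mulrC; ring.
    rewrite -/(k1 s) -/(k2 s).
    rewrite (_ : w1 s * k1 s - w2 s * k2 s = (w1 s - w2 s) * k1 s + w2 s * (k1 s - k2 s)); last by ring.
    apply: (le_trans (ler_normD _ _)); rewrite !normrM; apply: lerD.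
      apply: le_trans (IH s s0); rewrite ler_piMr//.
      by have /andP[a1 a2] := k101 s; rewrite ger0_norm.
    apply: le_trans (kk s s0); rewrite ler_piMl//.
    by have /andP[a1 a2] := w201 s; rewrite ger0_norm.
  under eq_integral do rewrite EFinM.
  rewrite ge0_integralZl_EFin//; mp.
  rewrite integral_unif_powR; last by rewrite (lt_trans _ gm0).
  rewrite -EFinM lee_fin exprS /Dn /ro; apply: eqle; field.
  by rewrite gt_eqF// addr_gt0.
move=> t t0; apply/eqP; rewrite -subr_eq0 -normr_le0; apply: le0_eps => e e0.
have cv : D * ro ^+ n * t `^ g @[n --> \oo] --> D * 0 * t `^ g.
  apply: cvgM; last exact: cvg_cst.
  by apply: cvgM; [exact: cvg_cst|apply: cvg_expr; rewrite ger0_norm].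
rewrite mulr0 mul0r in cv.
move/cvgrPdist_lt : cv => /(_ _ e0) [N _ /(_ N (leqnn N))] /=.
rewrite sub0r normrN => /ltW h; apply: (le_trans (ind N t t0)).
exact: (le_trans (ler_norm _) h).
Qed.

End contraction.

(** * A power of a uniform variable as a mixture *)

Section exponential_mixture.
Context {R : realType}.
Variables (p q : R).
Hypotheses (p0 : 0 <= p) (q0 : 0 < q) (pq : p + q = 1).
Notation unif := (@unif R).
Notation Q := (pprod (pprod unif unif) unif).

Let lg (v : R) : R := `|ln `|v| |.

Let mlg : mfn lg.
Proof.
apply: measurableT_comp => //; apply: (measurableT_comp (@measurable_ln R)); mp.
Qed.
Let J : set R := `[0%R, p[%classic.
Let mJ : measurable J. Proof. by meas. Qed.
Let bJ : bmf (\1_J : R -> R). Proof. exact: bmf_indic. Qed.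
Let IJ : \int[unif]_c (\1_J c : R) = p.
Proof. by rewrite integral_unif_itv ?subr0// -pq lerDl ltW. Qed.
Let X2 (z : (R * R) * R) : R := lg z.1.1 + \1_J z.2 * (q^-1 * lg z.1.2).

Let mX2 : mfn X2.
Proof.
have mI : mfn (\1_J : R -> R) by case: bJ.
apply: measurable_funD.
  by meas.
by meas.
Qed.
Let mix (K : R -> R) : bmf K ->
  \int[Q]_z K (X2 z) = p * \int[unif]_v \int[unif]_v' K (lg v + q^-1 * lg v') +
                       q * \int[unif]_v K (lg v).
Proof.
move=> bK; have [mK hK] := bK.
have b1 : bmf (fun z => K (X2 z)) by meas.
have mxy : mfn (fun z : R * R => lg z.1 + q^-1 * lg z.2) by meas.
have b2 : bmf (fun z : R * R => K (lg z.1 + q^-1 * lg z.2)) by meas.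
have b3 : bmf (fun z : R * R => K (lg z.1)) by meas.
rewrite (bint_fubini1 b1).
transitivity (\int[pprod unif unif]_z (p * K (lg z.1 + q^-1 * lg z.2) + q * K (lg z.1))).
  apply: eq_Rintegral => z _.
  transitivity (\int[unif]_c (\1_J c * K (lg z.1 + q^-1 * lg z.2) + (1 - \1_J c) * K (lg z.1))).
    apply: eq_Rintegral => c _; rewrite /X2/= indicE; case: (c \in J) => /=.
      by rewrite !mul1r subrr mul0r addr0.
    by rewrite !mul0r subr0 mul1r add0r addr0.
  have b4 : bmf (fun c : R => 1 - \1_J c : R) by meas.
  rewrite bintD; [|by meas|by meas].
  rewrite !bintZr// IJ bintB//; last by meas.
  by rewrite bint_cst IJ -pq [p + q]addrC addrK.
rewrite bintD; [|by meas|by meas].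
rewrite !bintZl// (bint_fubini1 b2) (bint_fubini1 b3); congr (_ + _ * _).
by apply: eq_Rintegral => v _; rewrite /= bint_cst.
Qed.
Let expR_lg (a v : R) : 0 < v < 1 -> expR (- (a * lg v)) = `|v| `^ a.
Proof.
move=> /andP[v0 v1]; rewrite /lg (gtr0_norm v0) ltr0_norm ?ln_lt0 ?v0//.
by rewrite mulrN opprK /powR (gt_eqF v0).
Qed.
Let bexp (a : R) : 0 <= a -> bmf (fun v : R => expR (- (a * lg v))).
Proof. by meas. Qed.
Let int_lg (a : R) : 0 <= a -> \int[unif]_v expR (- (a * lg v)) = (1 + a)^-1.
Proof.
move=> a0; apply: EFin_inj; rewrite bint_EFin; last exact: bexp.
rewrite -integral_unif_powR; last by rewrite (lt_le_trans _ a0).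
apply: ae_eq_integral => //; mp.
- by apply: filterS ae_unif_01 => v v01 _; rewrite expR_lg.
Qed.

(** In the variable - ln v: an exponential variable of rate q is a standard one plus, with
    probability p, an independent copy of the whole. This converts an equation with exponent m / q
    into one with exponent m and a mass p at Z = 0. *)
Lemma exponential_mixture (h : R -> R) : bmf h ->
  \int[unif]_v h (`|v| `^ q^-1) =
  p * \int[unif]_v \int[unif]_v' h (`|v| * `|v'| `^ q^-1) + q * \int[unif]_v h `|v|.
Proof.
move=> bh; have [mh hh] := bh.
pose K (x : R) : R := h (expR (- x)).
have bK : bmf K.
  apply: (bmf_comp mh hh); apply: measurableT_comp => //; by meas.
have [mK hK] := bK.
have qV : 0 <= q^-1 by pos.
pose X1 (v : R) : R := q^-1 * lg v.
have mX1 : mfn X1 by exact: measurable_funM.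
have mpw (a : R) : mfn (fun v : R => `|v| `^ a) by meas.
have X10 v : 0 <= X1 v by exact: (mulr_ge0 qV (normr_ge0 _)).
have X20 z : 0 <= X2 z.
  apply: addr_ge0; first by pos.
  by pos.
have law : eq_law unif Q X1 X2.
  move=> A mA; apply: laplace_uniqueness => //.
  move=> n; have bn : bmf (fun x : R => expR (- (n%:R * `|x|))) by meas.
  transitivity ((1 + n%:R / q)^-1).
    rewrite -int_lg; last by pos.
    by apply: eq_Rintegral => v _; rewrite /X1 mulrA.
  transitivity (\int[Q]_z expR (- (n%:R * `|X2 z|))); last by apply: eq_Rintegral => z _; rewrite ger0_norm.
  rewrite (mix bn).
  have -> : \int[unif]_v expR (- (n%:R * `|lg v|)) = (1 + n%:R)^-1.
    by rewrite -int_lg//; apply: eq_Rintegral => v _; rewrite ger0_norm// normr_ge0.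
  have -> : \int[unif]_v \int[unif]_v' expR (- (n%:R * `|lg v + q^-1 * lg v'|)) =
     (1 + n%:R)^-1 * (1 + n%:R / q)^-1.
    have nq : 0 <= n%:R / q by pos.
    rewrite -(int_lg nq) -(int_lg (ler0n R n)) -bintZr; last exact: bexp.
    apply: eq_Rintegral => v _; rewrite -bintZl; last exact: bexp.
    apply: eq_Rintegral => v' _; rewrite -expRD; congr expR.
    rewrite ger0_norm; last by pos.
    by ring.
  have n1 : (1 + n%:R : R) != 0 by rewrite gt_eqF// ltr_pwDl.
  have n2 : q + n%:R != 0 by rewrite gt_eqF// ltr_pwDl.
  have -> : (1 + n%:R / q)^-1 = q / (q + n%:R) by field; rewrite n2 gt_eqF.
  have -> : p = 1 - q by rewrite -pq addrK.
  by field; rewrite n1 n2.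
have E := eq_law_bint mX1 mX2 law bK; rewrite (mix bK) in E.
have key (f k : R -> R) : mfn f -> mfn k ->
    (forall v, 0 < v < 1 -> f v = k v) -> \int[unif]_v h (f v) = \int[unif]_v h (k v).
  move=> mf mk fk; apply: ae_eq_Rint; mp.
  by apply: filterS ae_unif_01 => v v01; rewrite fk.
have me (f : R -> R) : mfn f -> mfn (fun v => expR (- f v)) by meas.
rewrite (key _ (fun v => expR (- X1 v)) (mpw _) (me _ mX1)); last by move=> v v01; rewrite expR_lg.
have e1 (v : R) : 0 < v < 1 -> `|v| = expR (- lg v).
  by move=> v01; rewrite -[lg v]mul1r expR_lg// powRr1.
rewrite (key _ (fun v => expR (- lg v)) _ (me _ mlg) e1); last by meas.
rewrite [LHS]E; apply: (congr1 (fun z => p * z + _)).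
have mj : mfn (fun z : R * R => `|z.1| * `|z.2| `^ q^-1) by meas.
have bj := bmf_comp mh hh mj.
have mx : mfn (fun z : R * R => lg z.1 + q^-1 * lg z.2) by meas.
have bx := bmf_comp mK hK mx.
apply: ae_eq_Rint.
- by case: (bmf_fubini1 bx unif).
- by case: (bmf_fubini1 bj unif).
apply: filterS ae_unif_01 => v v01; apply: ae_eq_Rint; mp.
apply: filterS ae_unif_01 => v' v'01; rewrite /K opprD expRD expR_lg//.
by rewrite -e1.
Qed.

End exponential_mixture.

(** * Taylor remainders of exp (- x) *)

Section taylor.
Context {R : realType}.

Definition rem (J : nat) (x : R) : R := expR (- x) - \sum_(i < J) (- x) ^+ i / i`!%:R.

Lemma remS J x : rem J.+1 x = rem J x - (- x) ^+ J / J`!%:R.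
Proof. by rewrite /rem big_ord_recr/= opprD addrA. Qed.
Let dpow J (x : R) : is_derive x 1 (fun y : R => (- y) ^+ J.+1 / J.+1`!%:R)
  (- ((- x) ^+ J / J`!%:R)).
Proof.
have D2 : is_derive x 1 (fun y : R => - y) (-1) by exact: (is_deriveN (is_derive_id x 1)).
have D3 := is_deriveX J.+1 D2.
have D4 := is_deriveZ (J.+1`!%:R^-1) D3.
have -> : (fun y : R => (- y) ^+ J.+1 / J.+1`!%:R) =
   J.+1`!%:R^-1 \*: ((fun y : R => - y) ^+ J.+1) :> (R -> R).
  by apply/funext => y; rewrite /GRing.scale/= mulrC exprfctE.
apply: is_derive_eq; rewrite /GRing.scale/= factS natrM; field.
by rewrite nat1r !pnatr_eq0 -!lt0n fact_gt0.
Qed.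
Let is_derive_rem J (x : R) : is_derive x 1 (rem J.+1) (- rem J x).
Proof.
have D2 : is_derive x 1 (fun y : R => - y) (-1) by exact: (is_deriveN (is_derive_id x 1)).
elim: J => [|J IH].
  have -> : rem 1 = (fun y => expR (- y)) - cst 1.
    by apply/funext => y; rewrite /rem big_ord_recl big_ord0 expr0 fact0 divr1 addr0.
  have DE := @is_derive1_comp R (@expR R) (fun y : R => - y) x _ _ (is_derive_expR _) D2.
  have := is_deriveB DE (is_derive_cst (1 : R) x 1) => D.
  by apply: is_derive_eq; rewrite subr0 mulrN1 /rem big_ord0 subr0.
have -> : rem J.+2 = rem J.+1 - (fun y : R => (- y) ^+ J.+1 / J.+1`!%:R).
  by apply/funext => y; rewrite remS.
have E : - rem J x - - ((- x) ^+ J / J`!%:R) = - rem J.+1 x by rewrite remS; ring.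
by have := is_deriveB IH (dpow J x); rewrite E.
Qed.
Let ge0_of_derive (f f' : R -> R) (x : R) : (forall y : R, is_derive y 1 f (f' y)) ->
  (forall y, 0 <= y -> 0 <= f' y) -> f 0 = 0 -> 0 <= x -> 0 <= f x.
Proof.
move=> D f'0 f0; rewrite le_eqVlt => /predU1P[<-|x0]; first by rewrite f0.
have [|c] := @MVT R f f' 0 x x0 (fun y _ => D y).
  by apply: derivable_within_continuous => y _; have [] := D y.
rewrite in_itv/= => /andP[c0 _]; rewrite f0 !subr0 => ->.
by rewrite mulr_ge0 ?(ltW x0)// f'0// ltW.
Qed.
Let rem0 J : rem J.+1 0 = 0.
Proof.
rewrite /rem big_ord_recl expr0 fact0 divr1 oppr0 expR0.
by rewrite big1 ?addr0 ?subrr// => i _; rewrite /bump/= exprS mul0r mul0r.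
Qed.

(** The remainder with sign (-1)^J lies between 0 and x^J / J!. The derivative of order J + 1 is the
    case J, so both inequalities pass on by monotonicity. *)
Lemma rem_bound J (x : R) : 0 <= x -> `|rem J x| <= x ^+ J / J`!%:R.
Proof.
suff H : forall x, 0 <= x -> 0 <= (-1) ^+ J * rem J x <= x ^+ J / J`!%:R.
  move=> /H /andP[h1 h2]; rewrite -[`|_|]mul1r -[X in X * _](normr1 R).
  rewrite (_ : `|1| = `|(-1) ^+ J| :> R); last by rewrite normr1 normrX normrN1 expr1n.
  by rewrite -normrM ger0_norm.
elim: J => [y y0|J IH y y0].
  by rewrite !expr0 mul1r fact0 divr1 /rem big_ord0 subr0 expR_ge0 -expR0 ler_expR oppr_le0.
have D (z : R) : is_derive z 1 (fun z => (-1) ^+ J.+1 * rem J.+1 z) ((-1) ^+ J * rem J z).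
  have := is_deriveZ ((-1) ^+ J.+1) (is_derive_rem J z).
  by rewrite /GRing.scale/= exprS mulN1r mulrNN.
have Dx (z : R) : is_derive z 1 (fun z : R => z ^+ J.+1 / J.+1`!%:R) (z ^+ J / J`!%:R).
  have D4 := is_deriveZ (J.+1`!%:R^-1) (is_deriveX J.+1 (is_derive_id z 1)).
  have -> : (fun y : R => y ^+ J.+1 / J.+1`!%:R) = J.+1`!%:R^-1 \*: (id ^+ J.+1) :> (R -> R).
    by apply/funext => y'; rewrite /GRing.scale/= mulrC exprfctE.
  apply: is_derive_eq; rewrite /GRing.scale/= factS natrM mulr1; field.
  by rewrite nat1r !pnatr_eq0 -!lt0n fact_gt0.
apply/andP; split.
  apply: (ge0_of_derive D) => //; last by rewrite rem0 mulr0.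
  by move=> z z0; case/andP: (IH z z0).
rewrite -subr_ge0.
apply: (@ge0_of_derive (fun z => z ^+ J.+1 / J.+1`!%:R - (-1) ^+ J.+1 * rem J.+1 z)
   (fun z => z ^+ J / J`!%:R - (-1) ^+ J * rem J z)) => //.
- by move=> z z0; rewrite subr_ge0; case/andP: (IH z z0).
- by rewrite rem0 mulr0 exprS !mul0r subrr.
Qed.

End taylor.

Lemma bin_le_exp2 (n k : nat) : ('C(n, k) <= 2 ^ n)%N.
Proof.
elim: n k => [|n IH] [|k]; rewrite ?bin0 ?expn_gt0// ?bin0n//.
by rewrite binS expnS mul2n -addnn leq_add.
Qed.

(** * Laws with the moments j! *)

Section factorial_moments.
Context {R : realType} {d} {T : measurableType d}
  (P : probability T R) (X : T -> R).
Hypotheses (mX : mfn X) (X0 : forall w, 0 <= X w).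
Hypothesis Xm : forall j : nat, (\int[P]_w (X w ^+ j)%:E = (j`!%:R)%:E)%E.

Let intX (j : nat) (c : R) : P.-integrable setT (EFin \o (fun w => c * X w ^+ j)).
Proof.
apply: (@integrableZl _ _ _ P setT measurableT c (EFin \o (fun w => X w ^+ j))).
apply/integrableP; split; first by meas.
under eq_integral do rewrite /= ger0_norm ?exprn_ge0//.
by rewrite Xm ltry.
Qed.
Let int_le (f : T -> R) (j : nat) (c : R) : mfn f ->
  (forall w, `|f w| <= c * X w ^+ j) -> P.-integrable setT (EFin \o f).
Proof.
move=> mf h; apply: le_integrable (intX j c) => //; first by meas.
by move=> w _; rewrite /= lee_fin (le_trans (h w))// ler_norm.
Qed.

Definition emom (j : nat) (t : R) : R := \int[P]_w (X w ^+ j * expR (- (t * X w))).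

(** The Taylor remainder in s of [emom j (t + s)]: by [erem0] it is this value itself for J = 0, and
    [eremS] removes one term at a time. *)
Definition erem (j : nat) (t s : R) (J : nat) : R :=
  \int[P]_w (X w ^+ j * expR (- (t * X w)) * rem J (s * X w)).

Let e01 (t : R) w : 0 <= t -> `|expR (- (t * X w))| <= 1.
Proof.
by move=> t0; rewrite ger0_norm ?expR_ge0// -expR0 ler_expR oppr_le0 mulr_ge0.
Qed.
Let mrem J s : mfn (fun w => rem J (s * X w)).
Proof.
elim: J => [|J IH].
  rewrite (_ : (fun w => _) = (fun w => expR (- (s * X w)))); mp.
  by apply/funext => w; rewrite /rem big_ord0 subr0.
under eq_fun do rewrite remS; apply: measurable_funB => //; apply: measurable_funM => //; mp.
Qed.
Let me j t : mfn (fun w => X w ^+ j * expR (- (t * X w))).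
Proof. by meas. Qed.
Let erem_pt j t s J w : 0 <= t -> 0 <= s ->
  `|X w ^+ j * expR (- (t * X w)) * rem J (s * X w)| <= s ^+ J / J`!%:R * X w ^+ (j + J).
Proof.
move=> t0 s0; rewrite !normrM (ger0_norm (exprn_ge0 _ (X0 w))).
apply: (@le_trans _ _ (X w ^+ j * 1 * ((s * X w) ^+ J / J`!%:R))).
  apply: ler_pM => //; first by pos.
    by rewrite ler_wpM2l ?exprn_ge0// e01.
  by apply: rem_bound; rewrite mulr_ge0.
by rewrite mulr1 exprMn exprD; apply: eqle; ring.
Qed.
Let int_erem j t s J : 0 <= t -> 0 <= s ->
  P.-integrable setT (EFin \o (fun w => X w ^+ j * expR (- (t * X w)) * rem J (s * X w))).
Proof.
move=> t0 s0; apply: (@int_le _ (j + J) (s ^+ J / J`!%:R)); first exact: measurable_funM.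
by move=> w; exact: erem_pt.
Qed.
Let int_emom j t c : 0 <= t -> P.-integrable setT (EFin \o (fun w => c * (X w ^+ j * expR (- (t * X w))))).
Proof.
move=> t0; apply: (@int_le _ j `|c|); first by meas.
move=> w; rewrite normrM ler_wpM2l// normrM (ger0_norm (exprn_ge0 _ (X0 w))).
by rewrite ler_piMr ?exprn_ge0// e01.
Qed.

Lemma erem0 j t s : erem j t s 0 = emom j (t + s).
Proof.
apply: eq_Rintegral => w _; rewrite /rem big_ord0 subr0 -mulrA -expRD.
by congr (_ * expR _); ring.
Qed.

Lemma eremS j t s J : 0 <= t -> 0 <= s ->
  erem j t s J.+1 = erem j t s J - (- s) ^+ J / J`!%:R * emom (j + J) t.
Proof.
move=> t0 s0.
have i1 := int_erem j J t0 s0.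
have i2 := int_emom (j + J) ((- s) ^+ J / J`!%:R) t0.
have i3 : P.-integrable setT (EFin \o (fun w => X w ^+ (j + J) * expR (- (t * X w)))).
  by have := int_emom (j + J) 1 t0; congr (P.-integrable _ (EFin \o _)); apply/funext => w; rewrite mul1r.
rewrite /emom -(RintegralZl _ measurableT i3) -(RintegralB measurableT i1 i2).
apply: eq_Rintegral => w _; rewrite remS -[- (s * _)]mulNr [(- s * _) ^+ J]exprMn exprD; ring.
Qed.

Lemma erem_bound j t s J : 0 <= t -> 0 <= s ->
  `|erem j t s J| <= s ^+ J / J`!%:R * (j + J)`!%:R.
Proof.
move=> t0 s0; have c0 : 0 <= s ^+ J / J`!%:R by pos.
apply: (le_trans (le_normr_Rintegral measurableT (int_erem j J t0 s0))).
have -> : s ^+ J / J`!%:R * (j + J)`!%:R = \int[P]_w (s ^+ J / J`!%:R * X w ^+ (j + J)).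
  have i1 : P.-integrable setT (EFin \o (fun w => X w ^+ (j + J))).
    by have := intX (j + J) 1; congr (P.-integrable _ (EFin \o _)); apply/funext => w; rewrite mul1r.
  rewrite (RintegralZl _ measurableT i1); congr (_ * _).
  by rewrite /Rintegral Xm.
apply: le_Rintegral => //.
- exact: (integrable_norm (int_erem j J t0 s0)).
- by move=> w _; exact: erem_pt.
Qed.

Lemma emom0 j : emom j 0 = j`!%:R.
Proof.
rewrite /emom /Rintegral -[RHS]/(fine (j`!%:R)%:E) -Xm; congr fine.
by apply: eq_integral => w _; rewrite mul0r oppr0 expR0 mulr1.
Qed.

End factorial_moments.

(** Continuation by steps of 1/4. Equality of all [emom j] at t forces it at t + 1/4, since the
    remainder is at most 4^(- J) j! times a binomial coefficient below 2^(j + J), which tends to 0.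
    Four steps lead from an integer to the next. *)
Lemma factorial_moments_laplace {R : realType} {d1 d2 : measure_display}
    {T1 : measurableType d1} {T2 : measurableType d2}
    (P1 : probability T1 R) (P2 : probability T2 R) (X1 : T1 -> R) (X2 : T2 -> R) :
  mfn X1 -> mfn X2 ->
  (forall w, 0 <= X1 w) -> (forall w, 0 <= X2 w) ->
  (forall j : nat, (\int[P1]_w (X1 w ^+ j)%:E = (j`!%:R)%:E)%E) ->
  (forall j : nat, (\int[P2]_w (X2 w ^+ j)%:E = (j`!%:R)%:E)%E) ->
  forall n : nat, \int[P1]_w expR (- (n%:R * X1 w)) = \int[P2]_w expR (- (n%:R * X2 w)).
Proof.
move=> m1 m2 p1 p2 M1 M2.
have s0 : (0 <= 4^-1 :> R) by pos.
have step (t : R) : 0 <= t -> (forall j, emom P1 X1 j t = emom P2 X2 j t) ->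
    forall j, emom P1 X1 j (t + 4^-1) = emom P2 X2 j (t + 4^-1).
  move=> t0 IH j; rewrite -!erem0.
  have cst J : erem P1 X1 j t 4^-1 0 - erem P2 X2 j t 4^-1 0 =
               erem P1 X1 j t 4^-1 J - erem P2 X2 j t 4^-1 J.
    elim: J => // J ->; rewrite !eremS// IH; ring.
  apply/eqP; rewrite -subr_eq0 -normr_le0; apply: le0_eps => e e0.
  pose K := 2 * (j`!%:R * 2 ^+ j) : R.
  have bound J : `|erem P1 X1 j t 4^-1 0 - erem P2 X2 j t 4^-1 0| <= K * 2^-1 ^+ J.
    rewrite (cst J); apply: (le_trans (ler_normB _ _)).
    apply: (le_trans (lerD (erem_bound m1 p1 M1 j J t0 s0) (erem_bound m2 p2 M2 j J t0 s0))).
    rewrite -mulr2n -[leLHS]mulr_natl /K -[leRHS]mulrA ler_wpM2l//.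
    have -> : ((j + J)`!%:R : R) = 'C(j + J, J)%:R * (J`!%:R * j`!%:R).
      by rewrite -!natrM -(@bin_fact (j + J) J) ?leq_addl// addnK.
    have fJ : (J`!%:R : R) != 0 by rewrite pnatr_eq0 -lt0n fact_gt0.
    rewrite [leLHS](_ : _ = 'C(j + J, J)%:R * (4^-1 ^+ J * j`!%:R)); last by field.
    apply: (@le_trans _ _ (2 ^+ (j + J) * (4^-1 ^+ J * j`!%:R))).
      rewrite ler_wpM2r ?mulr_ge0 ?exprn_ge0// -natrX ler_nat; exact: bin_le_exp2.
    rewrite exprD (_ : 4^-1 = 2^-1 * 2^-1 :> R); last by field.
    rewrite exprMn; apply: eqle.
    rewrite [LHS](_ : _ = j`!%:R * (2 ^+ j * 2^-1 ^+ J) * (2 ^+ J * 2^-1 ^+ J)); last by ring.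
    by rewrite -[2 ^+ J * _]exprMn divff// expr1n mulr1 mulrA.
  have cv : K * 2^-1 ^+ n @[n --> \oo] --> K * 0.
    apply: cvgM; first exact: cvg_cst.
    by apply: cvg_expr; rewrite ger0_norm ?invr_ge0// invf_lt1// ltr1n.
  rewrite mulr0 in cv.
  move/cvgrPdist_lt : cv => /(_ _ e0) [N _ /(_ N (leqnn N))] /=.
  rewrite sub0r normrN => /ltW h; apply: (le_trans (bound N)).
  exact: (le_trans (ler_norm _) h).
have all k : forall j, emom P1 X1 j (k%:R / 4) = emom P2 X2 j (k%:R / 4).
  elim: k => [j|k IH j]; first by rewrite mul0r !emom0.
  have -> : k.+1%:R / 4 = k%:R / 4 + 4^-1 :> R by rewrite -natr1; field.
  by apply: step => //; rewrite divr_ge0.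
move=> n; have := all (n * 4)%N 0%N.
have -> : (n * 4)%:R / 4 = n%:R :> R by rewrite natrM; field.
rewrite /emom.
under eq_Rintegral do rewrite expr0 mul1r.
by under [RHS]eq_Rintegral do rewrite expr0 mul1r.
Qed.

(** * Cancellation of a power of an exponential variable *)

Section exponential_tail.
Context {R : realType}.
Notation mu := (@lebesgue_measure R).

Lemma ex_tail (c : R) : 0 <= c -> \int[ex]_z (\1_(`]c, +oo[%classic) z : R) = expR (- c).
Proof.
move=> c0; have mI : measurable (`]c, +oo[%classic : set R) by meas.
have mi : mfn (\1_(`]c, +oo[%classic) : R -> R) by exact: measurable_indic.
apply: EFin_inj; rewrite bint_EFin; last exact: bmf_indic.
rewrite ge0_integral_ex//; last by meas.
rewrite (@ge0_integral_affine R 1 c _ ltr01); last 2 first.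
- apply: emeasurable_funM; apply/measurable_EFinP => //; exact: measurable_expdens.
- by move=> x; rewrite mule_ge0// lee_fin ?expdens_ge0.
rewrite mul1e.
transitivity (\int[mu]_x ((expR (- c))%:E * (expdens x)%:E))%E.
  apply: eq_integral => x _; rewrite mul1r -!EFinM; congr EFin.
  rewrite indicE mem_setE in_itv/= andbT ltrDr /expdens.
  case: (ltP 0 x) => x0; last by rewrite mul0r mulr0.
  by rewrite ltr_wpDr// mul1r opprD expRD mulrC.
rewrite ge0_integralZl_EFin//; last 2 first.
- by move=> x _; rewrite lee_fin expdens_ge0.
- by apply/measurable_EFinP; exact: measurable_expdens.
by rewrite integral_expdens mule1.
Qed.

End exponential_tail.

Section cancellation.
Context {R : realType} {d1 d2 : measure_display}
    {T1 : measurableType d1} {T2 : measurableType d2}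
    (P1 : probability T1 R) (P2 : probability T2 R) (A : T1 -> R) (B : T2 -> R).
Hypotheses (mA : mfn A) (mB : mfn B).
Hypotheses (A0 : forall w, 0 <= A w) (B0 : forall w, 0 <= B w).
Hypotheses (Apos : {ae P1, forall w, 0 < A w}) (Bpos : {ae P2, forall w, 0 < B w}).
Variable m : R.
Hypothesis m0 : 0 < m.
Hypothesis lap : forall t : R, 0 <= t ->
  \int[ex]_z \int[P1]_w expR (- (t * `|z| `^ m * A w)) =
  \int[ex]_z \int[P2]_w expR (- (t * `|z| `^ m * B w)).

Let mW d (T : measurableType d) (X : T -> R) : mfn X ->
  mfn (fun p : R * T => `|p.1| `^ m * X p.2).
Proof. by meas. Qed.
Let lawW : eq_law (pprod ex P1) (pprod ex P2)
  (fun p : R * T1 => `|p.1| `^ m * A p.2) (fun p : R * T2 => `|p.1| `^ m * B p.2).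
Proof.
move=> X mX_; apply: laplace_uniqueness => //; mp.
move=> n; have := lap (ler0n R n).
have E d (T : measurableType d) (P : probability T R) (C : T -> R) :
    mfn C -> (forall w, 0 <= C w) ->
    \int[pprod ex P]_p expR (- (n%:R * (`|p.1| `^ m * C p.2))) =
    \int[ex]_z \int[P]_w expR (- (n%:R * `|z| `^ m * C w)).
  move=> mx x0; rewrite bint_fubini1; mp.
  by apply: eq_Rintegral => z _; apply: eq_Rintegral => w _; rewrite /= !mulrA.
by rewrite -!E.
Qed.
Let tail d (T : measurableType d) (P : probability T R) (X : T -> R) (s : R) :
  mfn X -> (forall w, 0 <= X w) -> {ae P, forall w, 0 < X w} -> 0 <= s ->
  \int[pprod ex P]_p (\1_(`](s `^ m), +oo[%classic) (`|p.1| `^ m * X p.2) : R) =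
  \int[P]_w expR (- (s * X w `^ (- m^-1))).
Proof.
move=> mx x0 xpos s0.
have mI : measurable (`](s `^ m), +oo[%classic : set R) by meas.
have bj := bmf_indic_comp (mW mx) mI.
rewrite (bint_fubini2 bj); apply: ae_eq_Rint.
- by case: (bmf_fubini2 bj ex).
- by meas.
apply: filterS xpos => w w0 /=.
have c0 : 0 <= s * X w `^ (- m^-1) by pos.
rewrite -(ex_tail c0); apply: ae_eq_Rint; mp.
- by apply: measurable_indic; meas.
apply: filterS ae_ex_gt0 => z z0; rewrite !indicE !mem_setE !in_itv/= !andbT.
congr (_%:R); congr nat_of_bool.
rewrite (gtr0_norm z0).
have xE : X w = (X w `^ m^-1) `^ m by rewrite -powRrM mulVf ?gt_eqF// powRr1 ?ltW.
have xp : 0 < X w `^ m^-1 by pos.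
rewrite [X in _ * X]xE -powRM ?(ltW z0) ?(ltW xp)//.
have -> : (s `^ m < (z * X w `^ m^-1) `^ m) = (s < z * X w `^ m^-1).
  have pn : 0 <= z * X w `^ m^-1 by pos.
  apply/idP/idP => h.
    rewrite ltNge; apply/negP => le1; move: h; apply/negP; rewrite -leNgt.
    by apply: ge0_ler_powR; rewrite ?nnegrE ?(ltW m0).
  by apply: gt0_ltr_powR; rewrite ?nnegrE.
by rewrite powRN ltr_pdivrMr.
Qed.

(** P (E^m A > s^m) = E exp (- s A^(- 1/m)): the tail of the product is the Laplace transform of
    A^(- 1/m), which determines the law of A as A > 0. *)
Lemma cancel_exponential : eq_law P1 P2 A B.
Proof.
pose f (x : R) : R := x `^ (- m^-1).
have mf : mfn f by exact: measurable_powR.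
have mfA : mfn (fun w => f (A w)) by meas.
have mfB : mfn (fun w => f (B w)) by meas.
have law : eq_law P1 P2 (fun w => f (A w)) (fun w => f (B w)).
  move=> X mX_; apply: laplace_uniqueness => //; mp.
  move=> n.
  have mI : measurable (`](n%:R `^ m), +oo[%classic : set R) by meas.
  rewrite -(tail mA A0 Apos (ler0n R n)) -(tail mB B0 Bpos (ler0n R n)).
  apply: (eq_law_bint (mW mA) (mW mB) lawW); exact: bmf_indic.
move=> X mX_.
pose h (y : R) : R := y `^ (- m).
have mh : mfn h by exact: measurable_powR.
have hf (x : R) : 0 < x -> h (f x) = x.
  by move=> x0; rewrite /h /f -powRrM mulrNN mulVf ?gt_eqF// powRr1// ltW.
have mhX : measurable (h @^-1` X) by meas.
have E d (T : measurableType d) (P : probability T R) (C : T -> R) :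
    mfn C -> {ae P, forall w, 0 < C w} ->
    P (C @^-1` X) = P ((fun w => f (C w)) @^-1` (h @^-1` X)).
  move=> mC Cpos; rewrite (prob_bint P mC mX_).
  have mfC : mfn (fun w => f (C w)) by meas.
  rewrite (prob_bint P mfC mhX); congr EFin; apply: ae_eq_Rint; mp.
  apply: filterS Cpos => w w0; rewrite !indicE; congr (_%:R); congr nat_of_bool.
  by apply/idP/idP; rewrite !inE/= hf.
by rewrite (E _ _ _ _ mA Apos) (E _ _ _ _ mB Bpos) law.
Qed.

End cancellation.

(** * Mittag-Leffler and exponential variables *)

Section mittag_leffler_product.
Context {R : realType} {d} {T : measurableType d}
  (P : probability T R) (M : T -> R).
Variable q : R.
Hypotheses (q0 : 0 < q) (mM : mfn M) (M0 : forall w, 0 <= M w).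
Hypothesis Mm : forall j : nat,
  (\int[P]_w (M w ^+ j)%:E = (gam j%:R / gam (q * j%:R))%:E)%E.

Let Xq (p : R * T) : R := `|p.1| `^ q * M p.2.

Let mXq : mfn Xq.
Proof.
apply: measurable_funM; last by meas.
by meas.
Qed.
Let Xq0 p : 0 <= Xq p. Proof. by rewrite mulr_ge0 ?powR_ge0. Qed.
Let moments (j : nat) : (\int[pprod ex P]_p (Xq p ^+ j)%:E = (j`!%:R)%:E)%E.
Proof.
have mX : mfn (fun p => (Xq p ^+ j)%:E) by meas.
have X0 p : (0 <= (Xq p ^+ j)%:E)%E by rewrite lee_fin exprn_ge0.
rewrite (@fubini_tonelli1 _ _ _ _ R ex P (fun p => (Xq p ^+ j)%:E))//.
have c0 : 0 <= gam (q * j%:R) :> R by pos.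
have cj : 0 <= gam j%:R :> R by pos.
transitivity (\int[ex]_z ((gam j%:R / gam (q * j%:R))%:E * (`|z| `^ (q * j%:R))%:E))%E.
  apply: eq_integral => z _; rewrite /fubini_F -Mm.
  transitivity (\int[P]_w ((`|z| `^ (q * j%:R))%:E * (M w ^+ j)%:E))%E.
    apply: eq_integral => w _; rewrite -EFinM; congr EFin; rewrite /Xq/= exprMn.
    by rewrite -[(`|z| `^ q) ^+ j]powR_mulrn ?powR_ge0// -powRrM.
  rewrite ge0_integralZl_EFin//; last 2 first.
  - by move=> w _; rewrite lee_fin exprn_ge0.
  - by meas.
  by rewrite muleC.
rewrite ge0_integralZl_EFin//; mp.
rewrite gamE; last by pos.
rewrite -EFinM divfK ?gam_nat// gt_eqF// gam_gt0// mulr_ge0// ltW//.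
Qed.

(** E^q M has j-th moment Gamma (1 + q j) j! / Gamma (1 + q j) = j!, so it is a standard exponential
    variable. *)
Lemma mittag_leffler_exponential (h : R -> R) : bmf h ->
  \int[ex]_z \int[P]_w h (`|z| `^ q * M w) = \int[ex]_z h `|z|.
Proof.
move=> bh.
have mn : mfn (fun z : R => `|z|) by meas.
have law : eq_law (pprod ex P) ex Xq (fun z : R => `|z|).
  move=> A mA; apply: laplace_uniqueness => //.
  apply: factorial_moments_laplace => // j.
  rewrite -gam_nat -gamE//; apply: eq_integral => z _; by rewrite powR_mulrn.
rewrite -(eq_law_bint mXq mn law bh) bint_fubini1//; mp.
Qed.

End mittag_leffler_product.

(** * Removal of the zero factors *)

Section thinning.
Context {R : realType} {d0 d1 d d2 : measure_display}
  {T0 : measurableType d0} (P0 : probability T0 R) (Z : T0 -> R)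
  {T : measurableType d} (P : probability T R) (Y : T -> R)
  {T1 : measurableType d1} (P1 : probability T1 R) (Z1 : T1 -> R)
  {T2 : measurableType d2} (P2 : probability T2 R) (Y1 M : T2 -> R).
Variables (m m1 g s s1 p q : R).
Hypotheses (el : echo_law m g s P0 Z P Y) (el1 : echo_law m1 g s1 P1 Z1 P2 Y1).
Hypotheses (p0 : 0 <= p) (q0 : 0 < q) (pq : p + q = 1) (m1E : m1 = m / q).
Hypothesis condZ : forall h : R -> R, bmf h ->
  \int[P0]_u h (Z u) = p * h 0 + q * \int[P1]_u h (Z1 u).
Hypotheses (mM : mfn M) (M0 : forall w, 0 <= M w)
  (Mpos : {ae P2, forall w, 0 < M w}).
Hypothesis Mm : forall j : nat,
  (\int[P2]_w (M w ^+ j)%:E = (gam j%:R / gam (q * j%:R))%:E)%E.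
Hypothesis indep : forall h : R * R -> R, bmf h ->
  \int[P2]_w h (Y1 w, M w) = \int[P2]_w \int[P2]_w' h (Y1 w, M w').
Notation unif := (@unif R).
Notation ex := (@ex R).

Let m0 := el_m el.
Let mY1 := el_mY el1.
Let Y10 := el_Y0 el1.
Let w1 := expT P2 Y1 m1.
Let K1 := expK P1 Z1 P2 Y1 m1.

Let w10 : w1 0 = 1.
Proof.
rewrite /w1 /expT -[RHS](bint_cst ex); apply: eq_Rintegral => z _.
rewrite mul0r /lapT -[RHS](bint_cst P2); apply: eq_Rintegral => w _.
by rewrite normr0 mul0r oppr0 expR0.
Qed.
Let sol : transform_solution P0 Z m (expT P Y m).
Proof.
split; first by case: (bmf_expT el).
- exact: (expT01 el).
- by move=> t t0; exact: (expT_eq el t0).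
Qed.
Let powM (a b : R) : `| `|a| * `|b| `^ q^-1| `^ m = `|a| `^ m * `|b| `^ m1.
Proof.
rewrite normrM normr_id (ger0_norm (powR_ge0 _ _)) (powRM _ (normr_ge0 _) (powR_ge0 _ _)).
by rewrite -powRrM m1E mulrC [q^-1 * m]mulrC mulrC.
Qed.
(** The equation of the thinned echo has the exponent m1 = m / q, which [exponential_mixture] brings
    back to m. Its term of weight p is [w1] itself, the contribution of Z = 0, and [condZ]
    recombines the two terms. *)
Let sol1 : transform_solution P0 Z m w1.
Proof.
have bw := bmf_expT el1; have bK := bmf_expK el1.
split; first by case: bw.
- exact: (expT01 el1).
move=> t t0.
pose A (x : R) : R := w1 x * K1 x.
have bA : bmf A by exact: bmfM.
have [mA hA] := bA; have [mw hw] := bw.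
pose h (y : R) : R := A (t * `|y| `^ m).
have mty : mfn (fun y : R => t * `|y| `^ m) by meas.
have bh : bmf h by exact: (bmf_comp mA hA mty).
have wA (x : R) : 0 <= x -> w1 x = \int[unif]_v A (x * `|v| `^ m1).
  by move=> x0; exact: (expT_eq el1 x0).
have qV (v : R) : (`|v| `^ q^-1) `^ m = `|v| `^ m1 by rewrite -powRrM m1E mulrC.
have nn (x y : R) : `| `|x| `^ y| = `|x| `^ y by rewrite ger0_norm ?powR_ge0.
have L : w1 t = \int[unif]_v h (`|v| `^ q^-1).
  by rewrite (wA _ t0); apply: eq_Rintegral => v _; rewrite /h nn qV.
rewrite L (exponential_mixture p0 q0 pq bh).
have bwt : bmf (fun v : R => w1 (t * `|v| `^ m)) by exact: (bmf_comp mw hw mty).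
transitivity (\int[unif]_v (p * w1 (t * `|v| `^ m) + q * A (t * `|v| `^ m))).
  have bAt : bmf (fun v : R => A (t * `|v| `^ m)) := bh.
  rewrite (bintD _ (bmfM (bmf_cst p) bwt) (bmfM (bmf_cst q) bAt)).
  rewrite (bintZl _ _ bwt) (bintZl _ _ bAt).
  have -> : \int[unif]_v \int[unif]_v' h (`|v| * `|v'| `^ q^-1) = \int[unif]_v w1 (t * `|v| `^ m).
    apply: eq_Rintegral => v _; rewrite wA; last by pos.
    apply: eq_Rintegral => v' _; rewrite /h powM.
    by rewrite mulrA.
  have Eh : \int[unif]_v h `|v| = \int[unif]_v A (t * `|v| `^ m).
    by apply: eq_Rintegral => v _; rewrite /h normr_id.
  exact: (congr1 (fun z : R => p * \int[unif]_v w1 (t * `|v| `^ m) + q * z) Eh).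
apply: eq_Rintegral => v _; set x := t * `|v| `^ m.
have bx : bmf (fun z : R => w1 (x * z)) by apply: (bmf_comp mw hw); exact: measurable_funM.
have -> : \int[P0]_u w1 (x * Z u) = p * w1 (x * 0) + q * K1 x by exact: (condZ bx).
rewrite mulr0 w10 mulr1 /A; ring.
Qed.
Let w_eq (t : R) : 0 <= t -> expT P Y m t = w1 t.
Proof.
have [C hC] := expT_taylor el; have [C1 hC1] := expT_taylor el1.
have /andP[g1 _] := el_g el; have g0 : 0 < g by exact: lt_trans g1.
apply: (@transform_unique _ _ _ P0 Z m g s (el_mZ el) (el_Z0 el) m0 g0 (el_Zg el) (el_q el)
  _ _ (`|C| + `|C1|) sol sol1); first by pos.
move=> x x0; rewrite (_ : _ - _ = (expT P Y m x - 1 + x) - (w1 x - 1 + x)); last by ring.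
apply: (le_trans (ler_normB _ _)); rewrite mulrDl; apply: lerD.
  by apply: (le_trans (hC x x0)); rewrite ler_wpM2r ?powR_ge0// ler_norm.
by apply: (le_trans (hC1 x x0)); rewrite ler_wpM2r ?powR_ge0// ler_norm.
Qed.
Let B (w : T2) : R := Y1 w * M w `^ m1.

Let mB : mfn B.
Proof. by apply: measurable_funM => //; meas. Qed.
Let B0 w : 0 <= B w. Proof. by rewrite mulr_ge0 ?powR_ge0. Qed.
(** As q m1 = m, the product E^m M^m1 = (E^q M)^m1 has the law of E^m1. *)
Let transform_B (t : R) : 0 <= t ->
  \int[ex]_z \int[P2]_w expR (- (t * `|z| `^ m * B w)) = w1 t.
Proof.
move=> t0.
have qm : q * m1 = m by rewrite m1E mulrC divfK// gt_eqF.
have mneg (x : R) : mfn (fun y : R * R => x * (`|y.1| * `|y.2| `^ m1)) by meas.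
have step1 (z : R) : \int[P2]_w expR (- (t * `|z| `^ m * B w)) =
    \int[P2]_w \int[P2]_w' expR (- (t * `|z| `^ m * (Y1 w * M w' `^ m1))).
  pose h (y : R * R) : R := expR (- (t * `|z| `^ m * (`|y.1| * `|y.2| `^ m1))).
  have bh : bmf h by apply: bmf_expN => // y; rewrite !mulr_ge0 ?powR_ge0.
  have := indep bh; rewrite /h/=.
  under eq_Rintegral do rewrite (ger0_norm (Y10 _)) (ger0_norm (M0 _)).
  move=> ->; apply: eq_Rintegral => w _; apply: eq_Rintegral => w' _.
  by rewrite (ger0_norm (Y10 _)) (ger0_norm (M0 _)).
under eq_Rintegral do rewrite step1.
have bj : bmf (fun y : (R * T2) * T2 => expR (- (t * `|y.1.1| `^ m * (Y1 y.1.2 * M y.2 `^ m1)))) by meas.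
have bj1 := bmf_fubini1 bj P2.
rewrite -(bint_fubini1 bj1) (bint_fubini2 bj1).
have bl : bmf (fun y : R * T2 => expR (- (t * `|y.1| `^ m1 * Y1 y.2))) by meas.
transitivity (\int[P2]_w \int[ex]_z expR (- (t * `|z| `^ m1 * Y1 w))).
  apply: eq_Rintegral => w _ /=.
  pose k (y : R) : R := expR (- (t * `|y| `^ m1 * Y1 w)).
  have bk : bmf k by exact: (bmf_pair2 bl w).
  transitivity (\int[ex]_z k `|z|); last by apply: eq_Rintegral => z _; rewrite /k normr_id.
  rewrite -(mittag_leffler_exponential q0 mM M0 Mm bk).
  apply: eq_Rintegral => z _; apply: eq_Rintegral => w' _; rewrite /k.
  rewrite normrM (ger0_norm (powR_ge0 _ _)) (ger0_norm (M0 _)) powRM ?powR_ge0//.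
  by rewrite -powRrM qm; congr (expR (- _)); ring.
rewrite -(bint_fubini2 bl) (bint_fubini1 bl) /w1 /expT; apply: eq_Rintegral => z _.
by rewrite /lapT ger0_norm// mulr_ge0 ?powR_ge0.
Qed.

(** Both variables have the same transform once multiplied by an independent E^m, which
    [cancel_exponential] removes. *)
Lemma thinning_law : eq_law P P2 Y (fun w => Y1 w * M w `^ (m / q)).
Proof.
rewrite -m1E.
apply: (@cancel_exponential R _ _ _ _ P P2 Y B (el_mY el) mB (el_Y0 el) B0
  (ae_Y_gt0 el) _ m m0) => [|t t0].
- apply: filterS2 Mpos (ae_Y_gt0 el1) => w w1' w2'.
  by rewrite mulr_gt0// powR_gt0.
rewrite (transform_B t0) -(w_eq t0) /expT; apply: eq_Rintegral => z _.
by rewrite /lapT (ger0_norm (mulr_ge0 t0 (powR_ge0 _ _))).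
Qed.

End thinning.

(** * Almost sure modifications and joint laws *)

Section almost_sure_transfer.
Context {R : realType} {d} {T : measurableType d}
  (P : probability T R).

Lemma ae_prob0 (A : set T) : measurable A -> {ae P, forall w, ~ A w} -> P A = 0%E.
Proof.
move=> mA [N [mN N0 sN]]; apply/eqP; rewrite eq_le measure_ge0 andbT -N0.
by apply: le_measure; rewrite ?inE// => w Aw; apply: sN => /= /(_ Aw).
Qed.

Lemma prob0_ae (A : set T) : measurable A -> P A = 0%E -> {ae P, forall w, ~ A w}.
Proof. by move=> mA A0; exists A; split => // w /= /contrapT. Qed.

Lemma ae_eq_prob {d' : measure_display} {S : measurableType d'} (X Y : T -> S) (A : set S) :
  mfn X -> mfn Y -> measurable A ->
  {ae P, forall w, X w = Y w} -> P (X @^-1` A) = P (Y @^-1` A).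
Proof.
move=> mX mY mA XY.
have mXA : measurable (X @^-1` A) by meas.
have mYA : measurable (Y @^-1` A) by meas.
transitivity (\int[P]_w (\1_(X @^-1` A) w)%:E)%E.
  by rewrite integral_indic// setIT.
transitivity (\int[P]_w (\1_(Y @^-1` A) w)%:E)%E; last by rewrite integral_indic// setIT.
apply: ae_eq_integral => //; [exact/measurable_EFinP|exact/measurable_EFinP|].
by apply: filterS XY => w e _; rewrite /= !indicE -[w \in X @^-1` A]/(X w \in A) e.
Qed.

Lemma ae_eq_int (f h : T -> R) : mfn f -> mfn h ->
  {ae P, forall w, f w = h w} -> (\int[P]_w (f w)%:E = \int[P]_w (h w)%:E)%E.
Proof.
move=> mf mh fh; apply: ae_eq_integral => //; [by meas|by meas|].
by apply: filterS fh => w e _; rewrite e.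
Qed.

Lemma prob_lt1_ae (X : T -> R) (c : R) : mfn X ->
  ~ {ae P, forall w, X w = c} -> (P (X @^-1` [set c]) < 1)%E.
Proof.
move=> mX H; rewrite lt_neqAle probability_le1 ?andbT; last by meas.
apply/eqP => E; apply: H.
have mc : measurable (X @^-1` [set c]) by meas.
have := prob0_ae (measurableC mc); rewrite probability_setC// E subee// => /(_ erefl).
by apply: filterS => w /= /contrapT.
Qed.

Lemma prob_lt1_not_ae (X : T -> R) (c : R) : mfn X ->
  (P (X @^-1` [set c]) < 1)%E -> ~ {ae P, forall w, X w = c}.
Proof.
move=> mX lt1 H; move: lt1.
rewrite (@ae_eq_prob _ _ X (cst c))// preimage_cst mem_set// probability_setT.
by rewrite ltxx.
Qed.

End almost_sure_transfer.

Lemma eq_law_ae {R : realType} {d1 d2 d' : measure_display} {T1 : measurableType d1}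
    {T2 : measurableType d2} {S : measurableType d'}
    (P1 : probability T1 R) (P2 : probability T2 R) (X1 : T1 -> S) (X2 : T2 -> S) (A : set S) :
  mfn X1 -> mfn X2 -> eq_law P1 P2 X1 X2 -> measurable A ->
  {ae P2, forall w, A (X2 w)} -> {ae P1, forall w, A (X1 w)}.
Proof.
move=> m1 m2 XX mA H.
have mC1 := preimage_measurable m1 (measurableC mA).
have mC2 := preimage_measurable m2 (measurableC mA).
have A0 : P2 (X2 @^-1` (~` A)) = 0%E.
  by apply: (ae_prob0 mC2); apply: filterS H => w Aw /(_ Aw).
rewrite -XX in A0; last exact: measurableC.
by apply: filterS (prob0_ae mC1 A0) => w /= /contrapT.
Qed.

Lemma ae_nng_transfer {R : realType} {d1 d2 : measure_display} {T1 : measurableType d1}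
    {T2 : measurableType d2} (P1 : probability T1 R) (P2 : probability T2 R)
    (X1 : T1 -> R) (X2 : T2 -> R) :
  mfn X1 -> mfn X2 -> eq_law P1 P2 X1 X2 ->
  {ae P2, forall w, 0 <= X2 w} -> {ae P1, forall w, 0 <= X1 w}.
Proof.
move=> m1 m2 XX H.
have mA : measurable (`[0%R, +oo[%classic : set R) by meas.
have K : {ae P2, forall w, (`[0%R, +oo[%classic : set R) (X2 w)}.
  by apply: filterS H => w w0; rewrite /= in_itv/= andbT.
by apply: filterS (eq_law_ae m1 m2 XX mA K) => w; rewrite /= in_itv/= andbT.
Qed.

Section joint_laws.
Context {R : realType} {d} {T : measurableType d} (P : probability T R).
Context {d1 d2 da db : measure_display} {S1 : measurableType d1} {S2 : measurableType d2}
  {Ta : measurableType da} {Tb : measurableType db}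
  (Pa : probability Ta R) (Pb : probability Tb R).
Variables (X : T -> S1) (Y : T -> S2) (X' : Ta -> S1) (Y' : Tb -> S2).
Hypotheses (mX : mfn X) (mY : mfn Y)
  (mX' : mfn X') (mY' : mfn Y').
Hypotheses (eX : eq_law P Pa X X') (eY : eq_law P Pb Y Y').
Hypothesis ind : forall A B, measurable A -> measurable B ->
  P (X @^-1` A `&` Y @^-1` B) = (P (X @^-1` A) * P (Y @^-1` B))%E.

Let mXY : mfn (fun w => (X w, Y w)).
Proof. by meas. Qed.
Let mXY' : mfn (fun z : Ta * Tb => (X' z.1, Y' z.2)).
Proof. by meas. Qed.

Lemma indep_joint_law :
  eq_law P (pprod Pa Pb) (fun w => (X w, Y w)) (fun z => (X' z.1, Y' z.2)).
Proof.
move=> D mD.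
pose fX := mkmfun mX; pose fY := mkmfun mY.
transitivity ((distribution P fX \x distribution P fY)%E D); last first.
  rewrite -[RHS]/(pushm (pprod Pa Pb) mXY' D).
  apply: product_measure_unique => // A B mA mB.
  have -> : pushm (pprod Pa Pb) mXY' (A `*` B) = pprod Pa Pb ((X' @^-1` A) `*` (Y' @^-1` B)) by [].
  rewrite pprodX; [|exact: preimage_measurable..].
  by rewrite -(eX mA) -(eY mB).
rewrite -[LHS]/(pushm P mXY D); apply/esym.
by apply: product_measure_unique => // A B mA mB; rewrite -[RHS]ind.
Qed.

End joint_laws.

Section pair_independence.
Context {R : realType} {d} {T : measurableType d} (P : probability T R).
Variables (X1 X2 Y1 Y2 : T -> R).
Hypotheses (mX1 : mfn X1) (mX2 : mfn X2)
  (mY1 : mfn Y1) (mY2 : mfn Y2).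
Hypothesis ind : forall A1 A2 B1 B2 : set R,
  measurable A1 -> measurable A2 -> measurable B1 -> measurable B2 ->
  P ((X1 @^-1` A1 `&` X2 @^-1` A2) `&` (Y1 @^-1` B1 `&` Y2 @^-1` B2)) =
  (P (X1 @^-1` A1 `&` X2 @^-1` A2) * P (Y1 @^-1` B1 `&` Y2 @^-1` B2))%E.

Let X w := (X1 w, X2 w).
Let Y w := (Y1 w, Y2 w).
Let mX : mfn X. Proof. exact: measurable_fun_pair. Qed.
Let mY : mfn Y. Proof. exact: measurable_fun_pair. Qed.
Let G : set (set (R * R)) := [set A `*` B | A in measurable & B in measurable].

Let GI : setI_closed G.
Proof.
move=> _ _ [A mA [B mB <-]] [A' mA' [B' mB' <-]].
exists (A `&` A'); first exact: measurableI.
by exists (B `&` B'); [exact: measurableI|rewrite setXI].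
Qed.
Let GT : G setT.
Proof. by exists setT => //; exists setT => //; rewrite setXTT. Qed.

Lemma pair_indep (A B : set (R * R)) : measurable A -> measurable B ->
  P (X @^-1` A `&` Y @^-1` B) = (P (X @^-1` A) * P (Y @^-1` B))%E.
Proof.
move=> mA mB; rewrite setIC muleC.
apply: (@indep_event_pi _ _ _ P _ _ X G) => //; mp.
- exact: measurable_prod_measurableType.
move=> _ [A1 mA1 [A2 mA2 <-]]; rewrite setIC muleC.
apply: (@indep_event_pi _ _ _ P _ _ Y G) => //.
- by apply: preimage_measurable => //; exact: measurableX.
- exact: measurable_prod_measurableType.
by move=> _ [B1 mB1 [B2 mB2 <-]]; exact: ind.
Qed.

End pair_independence.

Section mutual_independence.
Context {R : realType} {d} {T : measurableType d} (P : probability T R).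

Lemma mutual_indep2 (X Y : {RV P >-> R}) : mutual_indep [:: X; Y] ->
  forall A B : set R, measurable A -> measurable B ->
  P (X @^-1` A `&` Y @^-1` B) = (P (X @^-1` A) * P (Y @^-1` B))%E.
Proof.
move=> H A B mA mB.
pose E (i : 'I_2) : set T := tnth (in_tuple [:: X; Y]) i @^-1` (tnth [tuple A; B] i).
have /(_ (index_enum 'I_2) E (index_enum_uniq _)) := H.
rewrite !big_ord_recl !big_ord0 setIT mulr1 /E !(tnth_nth X) !(tnth_nth A)/= => ->.
  by rewrite EFinM !fineK// fin_num_measure//; meas.
move=> i _; exists (tnth [tuple A; B] i); last by rewrite setTI.
by rewrite (tnth_nth A); case: i => [[|[|//]] ?].
Qed.

Lemma mutual_indep4 (X Y Z V : {RV P >-> R}) : mutual_indep [:: X; Y; Z; V] ->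
  forall A B C D : set R, measurable A -> measurable B -> measurable C -> measurable D ->
  P (X @^-1` A `&` (Y @^-1` B `&` (Z @^-1` C `&` V @^-1` D))) =
  (P (X @^-1` A) * (P (Y @^-1` B) * (P (Z @^-1` C) * P (V @^-1` D))))%E.
Proof.
move=> H A B C D mA mB mC mD.
pose E (i : 'I_4) : set T := tnth (in_tuple [:: X; Y; Z; V]) i @^-1` (tnth [tuple A; B; C; D] i).
have /(_ (index_enum 'I_4) E (index_enum_uniq _)) := H.
rewrite !big_ord_recl !big_ord0 setIT mulr1 /E !(tnth_nth X) !(tnth_nth A)/= => ->.
  by rewrite !EFinM !fineK// fin_num_measure//; meas.
move=> i _; exists (tnth [tuple A; B; C; D] i); last by rewrite setTI.
by rewrite (tnth_nth A); case: i => [[|[|[|[|//]]]] ?].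
Qed.

End mutual_independence.

Lemma echo_limit_echo_law {R : realType} {d0} {T0 : measurableType d0}
    (P0 : probability T0 R) (xi : {RV P0 >-> R})
    {d} {T : measurableType d} (P : probability T R) (L : {RV P >-> R})
    (m g q : R) :
  {ae P0, forall w, 0 <= xi w} -> m = fine 'E_P0[xi] -> 0 < m ->
  (\int[P0]_w `|xi w|%:E = m%:E)%E -> (\int[P0]_w (`|xi w| `^ g)%:E = q%:E)%E ->
  1 < g <= 2 -> q < g * m -> echo_limit xi L ->
  {ae P, forall w, 0 <= L w} /\
  echo_law m g q P0 (fun w => `|xi w|) P (fun w => `|L w|).
Proof.
move=> xi0 mE m0 xim xiq g12 qgm [xi_ [U_ [X [inputs recX cL]]]].
have H := echo_limit_cvg xi0 inputs recX cL; rewrite -mE in H.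
split; first by apply: filterS H => w [].
apply: (echo_law_of_cvg inputs recX (Y := fun w => `|L w|)) => //; mp.
- by apply: filterS H => w [c L0]; rewrite ger0_norm.
Qed.

(** * Conditioning on xi > 0 *)

Section conditioning.
Context {R : realType} {d0 d1 : measure_display} {T0 : measurableType d0}
  {T1 : measurableType d1} (P0 : probability T0 R) (P1 : probability T1 R)
  (X : {RV P0 >-> R}) (X1 : {RV P1 >-> R}).
Hypothesis X0 : {ae P0, forall w, 0 <= X w}.
Hypothesis Xnz : (P0 (X @^-1` [set 0%R]) < 1)%E.
Hypothesis condX : forall A : set R, measurable A ->
  P1 (X1 @^-1` A) = (fine (P0 (X @^-1` (A `&` `]0, +oo[))) / fine (P0 (X @^-1` `]0, +oo[)))%:E.

Let p := fine (P0 (X @^-1` [set 0%R])).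

Let pE : P0 (X @^-1` [set 0%R]) = p%:E.
Proof. by rewrite /p fineK// fin_num_measure//; meas. Qed.
Let p1 : 0 < 1 - p.
Proof. by rewrite subr_gt0 -lte_fin -pE. Qed.
Let p0 : 0 <= p. Proof. exact: fine_ge0. Qed.
(** Almost sure nonnegativity leaves only 0 and ]0, +oo[; passing to |X| makes this decomposition
    hold at every point. *)
Let split_law (A : set R) : measurable A ->
  P0 (X @^-1` A) = (p%:E * \d_(0%R : R) A + P0 (X @^-1` (A `&` `]0%R, +oo[)))%E.
Proof.
move=> mA.
have -> : P0 (X @^-1` A) = P0 ((fun w => `|X w|) @^-1` A).
  apply: ae_eq_prob => //; first by meas.
  by apply: filterS X0 => w w0; rewrite ger0_norm.
have -> : P0 (X @^-1` (A `&` `]0%R, +oo[)) =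
    P0 ((fun w => `|X w|) @^-1` (A `&` `]0%R, +oo[)).
  apply: ae_eq_prob => //; [by meas|exact: measurableI|].
  by apply: filterS X0 => w w0; rewrite ger0_norm.
have mN : mfn (fun w => `|X w|) by meas.
have -> : (fun w => `|X w|) @^-1` A =
    ((fun w => `|X w|) @^-1` (A `&` [set 0])) `|` ((fun w => `|X w|) @^-1` (A `&` `]0%R, +oo[)).
  apply/seteqP; split => w /=; last by case => -[].
  move=> Aw; have [e0|n0] := eqVneq `|X w| 0; first by left.
  by right; split => //; rewrite in_itv/= andbT lt_def normr_ge0 n0.
rewrite measureU; [|by apply: preimage_measurable => //; exact: measurableI..|]; last by apply/seteqP; split => // w /= [[_ ->] [_]]; rewrite in_itv/= ltxx.
congr (_ + _)%E; rewrite diracE; have [A0|A0] := boolP (0 \in A).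
  rewrite mule1 -pE; congr (P0 _); apply/seteqP; split => w /=.
    by move=> [_ /eqP]; rewrite normr_eq0 => /eqP.
  by move=> ->; rewrite normr0; split => //; exact: set_mem.
rewrite mule0 (_ : _ @^-1` _ = set0) ?measure0//.
by apply/seteqP; split => // w /= [Aw e0]; move: A0; rewrite notin_setE -e0.
Qed.
Let posE : fine (P0 (X @^-1` `]0%R, +oo[)) = 1 - p.
Proof.
have := split_law (@measurableT _ R); rewrite preimage_setT probability_setT setTI diracT mule1.
have : P0 (X @^-1` `]0%R, +oo[) \is a fin_num.
  by rewrite fin_num_measure//; meas.
move=> /fineK <-; rewrite -EFinD => -[->]; ring.
Qed.

Lemma cond_ge0 : {ae P1, forall w, 0 <= X1 w}.
Proof.
have mneg : measurable (`]-oo, 0%R[%classic : set R) by meas.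
have := prob0_ae (P := P1) (preimage_measurable (measurable_funPT X1) mneg).
rewrite condX// (_ : _ `&` _ = set0).
  rewrite preimage_set0 measure0 mul0r => /(_ erefl); apply: filterS => w.
  by rewrite /= in_itv/= => /negP; rewrite -leNgt.
apply/seteqP; split => // x /=; rewrite !in_itv/= andbT => -[x0 x1].
by have := lt_trans x0 x1; rewrite ltxx.
Qed.

Lemma cond_integral (h : R -> \bar R) : mfn h -> (forall x, 0 <= h x)%E ->
  (\int[P0]_w h `|X w|%R = p%:E * h 0%R + (1 - p)%:E * \int[P1]_w h `|X1 w|%R)%E.
Proof.
move=> mh h0.
have mhn : mfn (fun x : R => h `|x|) by meas.
pose m1 := mscale (NngNum p0) (\d_(0%R : R)).
pose m2 := mscale (NngNum (ltW p1)) (pushm P1 (measurable_funPT X1)).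
have -> : (\int[P0]_w h `|X w|%R = \int[pushm P0 (measurable_funPT X)]_x h `|x|%R)%E.
  by rewrite ge0_integral_pushforward.
transitivity (\int[measure_add m1 m2]_x h `|x|%R)%E.
  apply: eq_measure_integral => A mA _.
  have addE : measure_add m1 m2 A = (p%:E * \d_(0%R : R) A + (1 - p)%:E * P1 (X1 @^-1` A))%E.
    by rewrite measure_addE /m1 /m2 /mscale/=.
  apply: etrans (esym addE); rewrite -[LHS]/(P0 (X @^-1` A)) split_law//; congr (_ + _)%E.
  rewrite condX// posE -EFinM mulrC divfK ?gt_eqF//.
  by rewrite fineK// fin_num_measure//; apply: preimage_measurable => //; exact: measurableI.
rewrite ge0_integral_measure_add// !ge0_integral_mscale//= integral_dirac// diracT mul1e normr0.
by rewrite ge0_integral_pushforward.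
Qed.

Lemma cond_bint (h : R -> R) : bmf h ->
  \int[P0]_w h `|X w| = p * h 0 + (1 - p) * \int[P1]_w h `|X1 w|.
Proof.
move=> [mh [M hM]].
have nX : mfn (fun w => `|X w|) by meas.
have nX1 : mfn (fun w => `|X1 w|) by meas.
have bX : bmf (fun w => h `|X w|) by apply: (bmf_comp mh _ nX); exists M.
have bX1 : bmf (fun w => h `|X1 w|) by apply: (bmf_comp mh _ nX1); exists M.
have mk : mfn (fun x => (h x + M)%:E) by meas.
have k0 x : (0 <= (h x + M)%:E)%E.
  by rewrite lee_fin; have := hM x; rewrite ler_norml => /andP[+ _]; lra.
have := cond_integral mk k0.
rewrite -bint_EFin; last by meas.
rewrite -bint_EFin; last by meas.
rewrite (bintD _ bX (bmf_cst M)) (bintD _ bX1 (bmf_cst M)) !bint_cst => -[]; lra.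
Qed.

End conditioning.

Lemma Lfun_natP {R : realType} {d} {T : measurableType d}
    (P : probability T R) (X : {RV P >-> R}) (k : nat) : (1 <= k)%N ->
  (X : T -> R) \in Lfun P k%:R%:E <-> (\int[P]_w (`|X w| ^+ k)%:E < +oo)%E.
Proof.
move=> k1.
have kR : 1 <= k%:R :> R by rewrite ler1n.
split=> [H|H].
  have /integrableP[_] := Lfun_integrable kR H; congr (_ < _)%E.
  by apply: eq_integral => w _; rewrite gee0_abs ?lee_fin ?powR_ge0// powR_mulrn.
rewrite inE; apply/andP; split; first by rewrite inE; by meas.
rewrite inE/= /finite_norm unlock poweR_lty//; move: H; congr (_ < _)%E.
by apply: eq_integral => w _; rewrite /= powR_mulrn.
Qed.

Lemma Lfun1_ge0P {R : realType} {d} {T : measurableType d}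
    (P : probability T R) (f : T -> R) : mfn f -> (forall w, 0 <= f w) ->
  f \in Lfun P 1%E <-> (\int[P]_w (f w)%:E < +oo)%E.
Proof.
move=> mf f0.
have E : (\int[P]_w `|(EFin \o f) w| = \int[P]_w (f w)%:E)%E.
  by apply: eq_integral => w _; rewrite /= ger0_norm.
split => [/Lfun1_integrable/integrableP[_]|H]; first by rewrite E.
by apply/Lfun1_integrable/integrableP; split; [by meas|rewrite E].
Qed.

(** * The properties in terms of [xi] and [L] *)

Section limit_properties.
Context {R : realType} {d0} {T0 : measurableType d0}
  (P0 : probability T0 R) (xi : {RV P0 >-> R})
  {d} {T : measurableType d} (P : probability T R) (L : {RV P >-> R}).
Hypotheses (xi0 : {ae P0, forall w, 0 <= xi w}) (L0 : {ae P, forall w, 0 <= L w}).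
Notation Z := (fun w => `|xi w|).
Notation Y := (fun w => `|L w|).
Variables (m g q : R).
Hypothesis el : echo_law m g q P0 Z P Y.
Notation unif := (@unif R).

Let mZ := el_mZ el.
Let mY := el_mY el.
Let m0 := el_m el.

Let aeZ : {ae P0, forall w, xi w = Z w}.
Proof. by apply: filterS xi0 => w w0; rewrite ger0_norm. Qed.
Let aeY : {ae P, forall w, L w = Y w}.
Proof. by apply: filterS L0 => w w0; rewrite ger0_norm. Qed.

Lemma lawLE (A : set R) : measurable A -> P (L @^-1` A) = P (Y @^-1` A).
Proof. by move=> mA; exact: ae_eq_prob. Qed.

Lemma lawXE (A : set R) : measurable A -> P0 (xi @^-1` A) = P0 (Z @^-1` A).
Proof. by move=> mA; exact: ae_eq_prob. Qed.

Lemma moment_MZ k : moment P0 xi k = MZ P0 Z k.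
Proof.
rewrite /moment unlock /MZ; apply: ae_eq_int => //; [by meas|by meas|].
by apply: filterS xi0 => w w0; rewrite (ger0_norm w0).
Qed.

Lemma moment_MY k : moment P L k = MY P Y k.
Proof.
rewrite /moment unlock /MY; apply: ae_eq_int => //; [by meas|by meas|].
by apply: filterS L0 => w w0; rewrite (ger0_norm w0).
Qed.

Lemma limit_mean : ('E_P[L] = ((Gamma (1 + m))^-1)%:E)%E.
Proof. by rewrite Gamma_gam unlock -(el_Ym el); exact: ae_eq_int. Qed.

Lemma limit_moment k : (2 <= k)%N ->
  ((moment P0 xi k < (k%:R * m)%:E)%E <-> (L : T -> R) \in Lfun P k%:R%:E) /\
  ((moment P0 xi k < (k%:R * m)%:E)%E ->
    (moment P L k =
      ((Gamma (k%:R * m + 1))^-1 / (k%:R * m - fine (moment P0 xi k)) *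
       \sum_(1 <= i < k)
         'C(k, i)%:R * fine (moment P0 xi i) * Gamma (1 + i%:R * m) *
         Gamma (1 + (k - i)%:R * m) * fine (moment P L i) * fine (moment P L (k - i)%N))%:E)%E).
Proof.
move=> k2; rewrite !moment_MZ !moment_MY; split.
  rewrite Lfun_natP; last by lia.
  split => [Zk|Yk]; first exact: (MY_lty el Zk k2).
  exact: (MZ_lt_of_MY el k2 Yk).
move=> Zk; rewrite (MY_formula el k2 Zk) [k%:R * m + 1]addrC Gamma_gam.
congr (_ * _)%:E; apply: eq_bigr => i _.
by rewrite !Gamma_gam !moment_MZ !moment_MY.
Qed.

Lemma limit_nonatomic (x : R) : (P0 (xi @^-1` [set 1%R]) < 1)%E -> P (L @^-1` [set x]) = 0%E.
Proof. by rewrite lawXE// lawLE// => ne1; exact: (law_atom el ne1). Qed.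

Lemma limit_support : (P0 (xi @^-1` [set 1%R]) < 1)%E -> law_support L = [set x : R | 0 <= x].
Proof.
rewrite lawXE// => ne1; apply/seteqP; split => x /=.
  move=> /(_ `]-oo, 0[%classic (interval_open _ _)) H; rewrite leNgt; apply/negP => x0.
  have mneg : measurable (`]-oo, 0%R[%classic : set R) by meas.
  have : (0 < P (L @^-1` `]-oo, 0%R[))%E by apply: H => //=; rewrite in_itv.
  rewrite (ae_prob0 (preimage_measurable (measurable_funPT L) mneg)) ?ltxx//.
  by apply: filterS L0 => w w0; rewrite /= in_itv/= => /lt_geF; rewrite w0.
move=> x0 O oO Ox.
have mO : measurable O by exact: open_measurable.
have nO : nbhs x O by exact: open_nbhs_nbhs.
have [A mA [sA PA]] := psupp_nbhs nO (psupp_all el ne1 x0).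
rewrite lawLE//; apply: (lt_le_trans PA); apply: le_measure; rewrite ?inE; mp.
- by move=> w /= /sA.
Qed.

Lemma variance0 : ('V_P[L] = 0)%E -> {ae P, forall w, L w = fine 'E_P[L]}.
Proof.
rewrite /variance unlock unlock /= => H.
set c := fine _.
have : (\int[P]_w `|((L w - c) ^+ 2)%:E| = 0)%E.
  rewrite -[RHS]H; apply: eq_integral => w _.
  by rewrite gee0_abs ?lee_fin ?sqr_ge0// expr2 /c unlock.
have mE : mfn (fun w => ((L w - c) ^+ 2)%:E) by meas.
move/(ae_eq_integral_abs P measurableT mE); apply: filterS => w /(_ Logic.I) [] /eqP.
by rewrite expf_eq0/= subr_eq0 => /eqP.
Qed.

Lemma variance_cst (c : R) : {ae P, forall w, L w = c} -> ('V_P[L] = 0)%E.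
Proof.
move=> Lc.
have EL : ('E_P[L] = c%:E)%E.
  by rewrite unlock (@ae_eq_int _ _ _ P L (cst c))// prob_intc.
rewrite /variance covariance.unlock EL /= unlock.
rewrite (@ae_eq_int _ _ _ P _ (cst 0)) ?prob_intc//.
by apply: filterS Lc => w e /=; rewrite /GRing.mul/= e subrr mulr0.
Qed.

(** If xi is not almost surely 1 then L has no atoms, whereas zero variance makes it constant. *)
Lemma limit_variance : ('V_P[L] = 0)%E -> {ae P0, forall w, xi w = 1}.
Proof.
move=> V0; apply: contrapT => /(prob_lt1_ae (measurable_funPT xi)) ne1.
apply: (prob_lt1_not_ae (measurable_funPT L) _ (variance0 V0)).
by rewrite (limit_nonatomic _ ne1).
Qed.

Section decomposition.
Context {d1} {T1 : measurableType d1} (P1 : probability T1 R)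
  (Lh Lc V xi' : {RV P1 >-> R}).
Hypotheses (V01 : uniform01 V) (Xlaw : eq_law P1 P0 xi' xi).

Let Vlaw : eq_law P1 unif V id. Proof. by move=> A mA; rewrite V01. Qed.
Let aeV : {ae P1, forall w, 0 < V w < 1}.
Proof.
have m01 : measurable (`]0%R, 1%R[%classic : set R) by meas.
have H : {ae unif, forall v, `]0%R, 1%R[%classic v}.
  by apply: filterS ae_unif_01 => v h; rewrite /= in_itv.
apply: filterS (eq_law_ae (measurable_funPT V) (@measurable_id _ R setT) Vlaw m01 H) => w.
by rewrite /= in_itv.
Qed.
Let aeX : {ae P1, forall w, 0 <= xi' w}.
Proof. exact: (ae_nng_transfer (measurable_funPT xi') (measurable_funPT xi) Xlaw xi0). Qed.

(** Independence of the pairs (V, xi') and (Lh, Lc), and inside each pair, gives the quadruple the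
    law it has under [fpQ]; then [fp_law] applies. *)
Lemma limit_decomposition : eq_law P1 P Lh L -> eq_law P1 P Lc L ->
  mutual_indep [:: Lh; Lc; V; xi'] ->
  eq_law P P1 L (fun w => V w `^ m * Lh w + xi' w * (1 - V w) `^ m * Lc w).
Proof.
move=> hlaw claw ind A mA.
have ind4 := mutual_indep4 ind.
have mH := measurable_funPT Lh; have mC := measurable_funPT Lc.
have mV := measurable_funPT V; have mX := measurable_funPT xi'.
have PT1 : P1 setT = 1%E by exact: probability_setT.
have indVX B D : measurable B -> measurable D ->
    P1 (V @^-1` B `&` xi' @^-1` D) = (P1 (V @^-1` B) * P1 (xi' @^-1` D))%E.
  move=> mB mD; have := ind4 setT setT B D measurableT measurableT mB mD.
  by rewrite !preimage_setT !setTI PT1 !mul1e.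
have indHC B D : measurable B -> measurable D ->
    P1 (Lh @^-1` B `&` Lc @^-1` D) = (P1 (Lh @^-1` B) * P1 (Lc @^-1` D))%E.
  move=> mB mD; have := ind4 B D setT setT mB mD measurableT measurableT.
  by rewrite !preimage_setT !setIT PT1 !mule1.
have lVX := indep_joint_law mV mX (@measurable_id _ R setT) (measurable_funPT xi) Vlaw Xlaw indVX.
have lHC := indep_joint_law mH mC (measurable_funPT L) (measurable_funPT L) hlaw claw indHC.
have indQ (A1 A2 B1 B2 : set R) :
    measurable A1 -> measurable A2 -> measurable B1 -> measurable B2 ->
    P1 ((V @^-1` A1 `&` xi' @^-1` A2) `&` (Lh @^-1` B1 `&` Lc @^-1` B2)) =
    (P1 (V @^-1` A1 `&` xi' @^-1` A2) * P1 (Lh @^-1` B1 `&` Lc @^-1` B2))%E.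
  move=> mA1 mA2 mB1 mB2; rewrite (indVX _ _ mA1 mA2) (indHC _ _ mB1 mB2).
  by rewrite setIC -setIA (ind4 _ _ _ _ mB1 mB2 mA1 mA2) muleA muleC.
have mVX : mfn (fun z : R * T0 => (z.1, xi z.2)) by meas.
have mLL : mfn (fun z : T * T => (L z.1, L z.2)) by meas.
have lQ := indep_joint_law (measurable_fun_pair mV mX) (measurable_fun_pair mH mC)
  mVX mLL lVX lHC (pair_indep mV mX mH mC indQ).
pose F (z : (R * R) * (R * R)) : R :=
  `|z.1.1| `^ m * `|z.2.1| + `|1 - z.1.1| `^ m * `|z.1.2| * `|z.2.2|.
have mF : mfn F.
  apply: measurable_funD; apply: measurable_funM; mp.
rewrite lawLE// (fp_law el mA).
have mG : mfn (fun w => V w `^ m * Lh w + xi' w * (1 - V w) `^ m * Lc w) by meas.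
have -> : P1 ((fun w => V w `^ m * Lh w + xi' w * (1 - V w) `^ m * Lc w) @^-1` A) =
    P1 ((fun w => F ((V w, xi' w), (Lh w, Lc w))) @^-1` A).
  apply: ae_eq_prob => //; first by meas.
  have aeH := ae_nng_transfer mH (measurable_funPT L) hlaw L0.
  have aeC := ae_nng_transfer mC (measurable_funPT L) claw L0.
  apply: filterS2 (filterI aeV aeX) (filterI aeH aeC) => w [/andP[v0 v1] x0] [h0 c0].
  rewrite /F/= (ger0_norm x0) (ger0_norm h0) (ger0_norm c0) (gtr0_norm v0).
  by rewrite ger0_norm ?subr_ge0 ?ltW//; ring.
rewrite -[RHS]/(P1 ((fun w => ((V w, xi' w), (Lh w, Lc w))) @^-1` (F @^-1` A))).
by rewrite [RHS]lQ//; meas.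
Qed.

Lemma charfunE (t : R) : charfun L t = Complex (cosT P Y t) (sinT P Y t).
Proof.
have mtL : mfn (fun w => t * L w) by meas.
have mtY : mfn (fun w => t * `|L w|) by meas.
have [mc1 _] := bmf_cos mtL; have [ms1 _] := bmf_sin mtL.
have [mc2 _] := bmf_cos mtY; have [ms2 _] := bmf_sin mtY.
rewrite /charfun /cexpectation /= unlock; congr Complex.
- by apply: ae_eq_Rint => //; apply: filterS L0 => w w0; rewrite (ger0_norm w0).
- by apply: ae_eq_Rint => //; apply: filterS L0 => w w0; rewrite (ger0_norm w0).
Qed.

Lemma limit_charfun (t : R) : mutual_indep [:: V; xi'] ->
  charfun L t = cexpectation P1 (fun w =>
    charfun L (t * V w `^ m) * charfun L (t * xi' w * (1 - V w) `^ m)).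
Proof.
move=> ind; have indVX := mutual_indep2 ind.
have mV := measurable_funPT V; have mX := measurable_funPT xi'.
have lVX := indep_joint_law mV mX (@measurable_id _ R setT) (measurable_funPT xi) Vlaw Xlaw indVX.
have mJ : mfn (fun w => (V w, xi' w)) by meas.
have mK : mfn (fun z : R * T0 => (z.1, xi z.2)) by meas.
have bC := bmf_cosT P mY; have bS := bmf_sinT P mY.
pose a1 (z : R * R) : R := t * `|z.1| `^ m.
pose a2 (z : R * R) : R := t * `|1 - z.1| `^ m * `|z.2|.
have ma1 : mfn a1.
  apply: measurable_funM => //; apply: (measurableT_comp (measurable_powR m)); mp.
have ma2 : mfn a2.
  apply: measurable_funM; last by meas.
  by meas.
have bc1 : bmf (fun z => cosT P Y (a1 z)) by meas.
have bc2 : bmf (fun z => cosT P Y (a2 z)) by meas.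
have bs1 : bmf (fun z => sinT P Y (a1 z)) by meas.
have bs2 : bmf (fun z => sinT P Y (a2 z)) by meas.
have key (h : R * R -> R) (k : T1 -> R) : bmf h ->
    mfn k -> {ae P1, forall w, k w = h (V w, xi' w)} ->
    fine ('E_P1[k])%E = \int[unif]_v \int[P0]_u h (v, xi u).
  move=> bh mk kh; rewrite unlock.
  have [mh hh] := bh.
  transitivity (\int[P1]_w h (V w, xi' w)).
    by apply: ae_eq_Rint => //; meas.
  rewrite (eq_law_bint mJ mK lVX bh).
  rewrite (bint_fubini1 (f := fun z : R * T0 => h (z.1, xi z.2)))//; mp.
have ae12 : {ae P1, forall w, t * V w `^ m = a1 (V w, xi' w) /\
    t * xi' w * (1 - V w) `^ m = a2 (V w, xi' w)}.
  apply: filterS2 aeV aeX => w /andP[v0 v1] x0.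
  rewrite /a1 /a2/= (ger0_norm x0) (gtr0_norm v0) ger0_norm ?subr_ge0 ?ltW//.
  by split => //; ring.
have [mc _] := bC; have [ms _] := bS.
rewrite charfunE /cexpectation; congr Complex.
- rewrite (cosT_eq el); apply/esym.
  pose h z := cosT P Y (a1 z) * cosT P Y (a2 z) - sinT P Y (a1 z) * sinT P Y (a2 z).
  rewrite (key h); first by [].
  + by apply: bmfB; apply: bmfM.
  + under eq_fun do rewrite !charfunE/=.
    by apply: measurable_funB; apply: measurable_funM; meas.
  + by apply: filterS ae12 => w [e1 e2]; rewrite !charfunE/= /h -e1 -e2.
- rewrite (sinT_eq el); apply/esym.
  pose h z := sinT P Y (a1 z) * cosT P Y (a2 z) + cosT P Y (a1 z) * sinT P Y (a2 z).
  rewrite (key h); first by [].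
  + by apply: bmfD; apply: bmfM.
  + under eq_fun do rewrite !charfunE/=.
    by apply: measurable_funD; apply: measurable_funM; meas.
  + by apply: filterS ae12 => w [e1 e2]; rewrite !charfunE/= /h -e1 -e2 addrC.
Qed.

End decomposition.

Lemma charfun_decay (a : R) : decays (modT P Y) a -> decay_order (charfun L) a.
Proof.
move=> [C C0 HC]; exists C; split.
- near=> t; have t0 : 0 < t by [].
  by rewrite charfunE /= (gtr0_norm t0) HC.
- near=> t; have t0 : t < 0 by [].
  rewrite charfunE /= (ltr0_norm t0) -/(modT P Y t) -(modTN P mY t) HC//.
  by rewrite oppr_gt0.
Unshelve. all: by end_near. Qed.

Lemma is_densityP (f : R -> R) : law_density P Y f -> is_density L f.
Proof. by case=> mf f0 fA; split => // A mA; rewrite lawLE// fA. Qed.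

Section decay_part.
Hypotheses (ne1 : (P0 (xi @^-1` [set 1%R]) < 1)%E) (xipos : {ae P0, forall w, 0 < xi w}).

Let Zne1 : (P0 (Z @^-1` [set 1%R]) < 1)%E. Proof. by rewrite -lawXE. Qed.

Lemma limit_decay (a : R) : 0 < a < m^-1 -> (fun w => xi w `^ (- a)) \in Lfun P0 1%E ->
  decays (modT P Y) a.
Proof.
move=> /andP[a0 am].
have mx : mfn (fun w => xi w `^ (- a)) by meas.
move/(Lfun1_ge0P P0 mx (fun w => powR_ge0 _ _)) => fin.
apply: (modT_decays el Zne1 (A0 := fine (\int[P0]_w (xi w `^ (- a))%:E)%E) a0).
- by rewrite -ltr_pdivlMr// div1r.
- by apply: filterS xipos => w w0; rewrite gtr0_norm.
- rewrite fineK; last by rewrite ge0_fin_numE//; apply: integral_ge0 => w _; rewrite lee_fin powR_ge0.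
  apply: ae_eq_int => //; first by meas.
  by apply: filterS xi0 => w w0; rewrite (ger0_norm w0).
Qed.

Lemma echo_lower_bound : (fun w => (xi w)^-1) \in Lfun P0 +oo%E ->
  exists2 e : R, 0 < e & {ae P0, forall w, e <= Z w}.
Proof.
rewrite inE => /andP[_]; rewrite inE/= /finite_norm Lnorm.unlock.
have -> : (0 < P0 setT)%E by rewrite probability_setT.
move=> /ess_sup_inf.ess_supr_bounded [B HB].
(* [|B| + 1] is positive whatever the essential bound B. *)
exists (`|B| + 1)^-1; first by rewrite invr_gt0 ltr_wpDl.
apply: filterS2 HB xipos => w /= wB w0.
have iB : (xi w)^-1 <= `|B| + 1.
  apply: (le_trans (ler_norm _)); apply: (le_trans wB).
  by rewrite (le_trans (ler_norm B))// lerDl.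
rewrite (gtr0_norm w0) -[xi w]invrK lef_pV2// posrE ?invr_gt0// ltr_wpDl//.
Qed.

Lemma limit_negative_moment (e s : R) : 0 < e -> {ae P0, forall w, e <= Z w} -> 0 < s ->
  (fun w => L w `^ (- s)) \in Lfun P 1%E.
Proof.
move=> e0 Ze s0.
have ml : mfn (fun w => L w `^ (- s)) by meas.
apply/(Lfun1_ge0P P ml (fun w => powR_ge0 _ _)).
rewrite (@ae_eq_int _ _ _ P _ (fun w => `|L w| `^ (- s)))//; mp.
- exact: (negative_moment el e0 Ze s0).
- by apply: filterS L0 => w w0; rewrite (ger0_norm w0).
Qed.

End decay_part.

End limit_properties.

(** * The thinned echo and its limit *)

Section thinned_limit.
Context {R : realType} {d0} {T0 : measurableType d0}
  (P0 : probability T0 R) (xi : {RV P0 >-> R})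
  {d} {T : measurableType d} (P : probability T R) (L : {RV P >-> R}).
Hypotheses (xi0 : {ae P0, forall w, 0 <= xi w}) (L0 : {ae P, forall w, 0 <= L w}).
Hypothesis xi_nz : (P0 (xi @^-1` [set 0%R]) < 1)%E.
Variables (m g q : R).
Hypothesis el : echo_law m g q P0 (fun w => `|xi w|) P (fun w => `|L w|).
Context {d1} {T1 : measurableType d1} (P1 : probability T1 R)
  (xip : {RV P1 >-> R}) {d2} {T2 : measurableType d2}
  (P2 : probability T2 R) (Lp M : {RV P2 >-> R}).
Let p := fine (P0 (xi @^-1` [set 0%R])).
Hypothesis cond : forall A : set R, measurable A ->
  P1 (xip @^-1` A) =
    (fine (P0 (xi @^-1` (A `&` `]0, +oo[))) / fine (P0 (xi @^-1` `]0, +oo[)))%:E.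
Hypotheses (HLp : echo_limit xip Lp) (HM : mittag_leffler2 (1 - p) M)
  (ind : mutual_indep [:: Lp; M]).

Let p1 : 0 < 1 - p.
Proof.
rewrite subr_gt0 -lte_fin /p fineK// fin_num_measure//; by meas.
Qed.
Let xip0 : {ae P1, forall w, 0 <= xip w}. Proof. exact: (cond_ge0 cond). Qed.
Let divide (a : R) (I : \bar R) : (a%:E = (1 - p)%:E * I)%E -> I = (a / (1 - p))%:E.
Proof.
by move=> E; rewrite mulrC EFinM E muleA -EFinM mulVf ?gt_eqF// mul1e.
Qed.
Let xip_mean : (\int[P1]_w `|xip w|%:E = (m / (1 - p))%:E)%E.
Proof.
apply: divide.
have mh : mfn (fun x : R => `|x|%:E) by meas.
have h0 (x : R) : (0 <= `|x|%:E)%E by pos.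
have := cond_integral xi0 xi_nz cond mh h0.
rewrite normr0 mule0 add0e; under eq_integral do rewrite normr_id.
by rewrite (el_Zm el) => ->; under eq_integral do rewrite normr_id.
Qed.
Let xip_g : (\int[P1]_w (`|xip w| `^ g)%:E = (q / (1 - p))%:E)%E.
Proof.
apply: divide.
have mh : mfn (fun x : R => (`|x| `^ g)%:E) by meas.
have h0 (x : R) : (0 <= (`|x| `^ g)%:E)%E by pos.
have := cond_integral xi0 xi_nz cond mh h0.
have /andP[g1 _] := el_g el.
rewrite normr0 powR0 ?gt_eqF//; last exact: lt_trans g1.
rewrite mule0 add0e; under eq_integral do rewrite normr_id.
by rewrite (el_Zg el) => ->; under eq_integral do rewrite normr_id.
Qed.
Let xip_E : m / (1 - p) = fine ('E_P1[xip])%E.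
Proof.
rewrite unlock (@ae_eq_int _ _ _ P1 xip (fun w => `|xip w|)) ?xip_mean//; mp.
by apply: filterS xip0 => w w0; rewrite ger0_norm.
Qed.
(** Mean and g-th moment of [xip] are those of [xi] divided by 1 - p, so the inequality q < g m is
    inherited with the same g. *)
Let elp : {ae P2, forall w, 0 <= Lp w} /\
  echo_law (m / (1 - p)) g (q / (1 - p)) P1 (fun w => `|xip w|) P2 (fun w => `|Lp w|).
Proof.
apply: echo_limit_echo_law => //.
- by rewrite divr_gt0 ?(el_m el).
- exact: (el_g el).
- by rewrite mulrA ltr_pM2r ?invr_gt0// (el_q el).
Qed.
Let nM : {ae P2, forall w, M w = `|M w|}.
Proof. by case: HM => + _; apply: filterS => w w0; rewrite gtr0_norm. Qed.
Let M_moment (j : nat) :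
  (\int[P2]_w (`|M w| ^+ j)%:E = (gam j%:R / gam ((1 - p) * j%:R))%:E)%E.
Proof.
case: HM => _ /(_ j%:R); rewrite !Gamma_gam unlock => <-; last by rewrite (lt_le_trans _ (ler0n _ j))// ltrN10.
apply: ae_eq_int; mp.
- by apply: filterS nM => w e; rewrite [in RHS]e powR_mulrn.
Qed.
Let indep (h : R * R -> R) : bmf h ->
  \int[P2]_w h (`|Lp w|, `|M w|) = \int[P2]_w \int[P2]_w' h (`|Lp w|, `|M w'|).
Proof.
move=> [mh hh].
have mn : mfn (fun z : R * R => (`|z.1|, `|z.2|)) by meas.
have bk : bmf (fun z : R * R => h (`|z.1|, `|z.2|)) by exact: (bmf_comp mh hh mn).
have mL := measurable_funPT Lp; have mM := measurable_funPT M.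
have law := indep_joint_law mL mM mL mM (fun _ _ => erefl) (fun _ _ => erefl) (mutual_indep2 ind).
have m2 : mfn (fun z : T2 * T2 => (Lp z.1, M z.2)) by meas.
have m1 : mfn (fun w => (Lp w, M w)) by meas.
rewrite (eq_law_bint m1 m2 law bk).
rewrite (bint_fubini1 (f := fun z : T2 * T2 => h (`|Lp z.1|, `|M z.2|)))//.
by have [mk hk] := bk; exact: (bmf_comp mk hk m2).
Qed.

Lemma limit_thinning : eq_law P P2 L (fun w => Lp w * M w `^ (m / (1 - p))).
Proof.
have [Lp0 elp'] := elp.
have nnM : {ae P2, forall w, 0 < `|M w|}.
  by case: HM => + _; apply: filterS => w w0; rewrite normr_gt0 gt_eqF.
have mM : mfn (fun w => `|M w|) by meas.
have p0 : 0 <= p by exact: fine_ge0.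
have law := thinning_law el elp' p0 p1 (subrKC _ _) erefl
  (cond_bint xi0 xi_nz cond) mM (fun w => normr_ge0 _) nnM M_moment indep.
move=> A mA; rewrite (lawLE L0 el mA) law//; apply/esym; apply: ae_eq_prob => //; mp.
- by apply: filterS2 Lp0 nM => w w0 e; rewrite (ger0_norm w0) -e.
Qed.

End thinned_limit.

Lemma limit_one {R : realType} {d0} {T0 : measurableType d0}
    (P0 : probability T0 R) (xi : {RV P0 >-> R})
    {d} {T : measurableType d} (P : probability T R) (L : {RV P >-> R}) :
  echo_limit xi L -> {ae P0, forall w, xi w = 1} -> {ae P, forall w, L w = 1}.
Proof.
move=> [xi_ [U_ [X [inputs [X1 XS] cL]]]] xi1.
have Exi : fine ('E_P0[xi])%E = 1.
  by rewrite unlock (@ae_eq_int _ _ _ P0 xi (cst 1)) ?prob_intc.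
have xin n : {ae P, forall w, (2 <= n)%N -> xi_ n w = 1}.
  have [n2|n2] := leqP 2 n; last by apply: aeW => w.
  apply: filterS (eq_law_ae (measurable_funPT (xi_ n)) (measurable_funPT xi)
    (echo_copies inputs n2) (measurable_set1 (1 : R)) xi1) => w + _.
  by [].
have xiN : {ae P, forall w, forall n, (2 <= n)%N -> xi_ n w = 1} by apply/ae_foralln.
apply: filterS2 xiN cL => w xw; rewrite Exi => cw.
have Xone k : (1 <= k)%N -> X k w = 1.
  elim/ltn_ind : k => k IH k1.
  have [->|kn1] := eqVneq k 1%N; first by rewrite X1.
  have k2 : (2 <= k)%N by lia.
  have /andP[U1 Uk] := echo_range inputs w k2.
  by rewrite XS// xw// IH// mulr1.
have cst1 : (n%:R `^ (- 1) * \sum_(1 <= k < n.+1) X k w) @[n --> \oo] --> (1 : R).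
  apply: cvg_near_cst; near=> n.
  have n0 : (0 < n)%N by near: n; exact: nbhs_infty_gt.
  rewrite (eq_big_nat _ _ (F2 := fun=> 1)) => [|k /andP[k1 _]]; last exact: Xone.
  by rewrite big_const_nat iter_addr_0 subn1/= powR_inv1// mulVf// pnatr_eq0 -lt0n.
exact: (cvg_unique _ cw cst1).
Unshelve. all: by end_near. Qed.

(** * Assembly of the properties (i) to (vi) *)

Theorem proposition6p1 (R : realType)
    (d0 : measure_display) (T0 : measurableType d0) (P0 : probability T0 R)
    (xi : {RV P0 >-> R})
    (xi_ge0 : {ae P0, forall w, 0 <= xi w})
    (xi_nz : (P0 (xi @^-1` [set 0%R]) < 1)%E)
    (xi_La : exists2 a : R, 1 < a & (xi : T0 -> R) \in Lfun P0 a%:E)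
    (xi_log : ('E_P0[(fun w => xi w * ln (xi w))%R] < 'E_P0[xi])%E)
    (d : measure_display) (T : measurableType d) (P : probability T R)
    (L : {RV P >-> R}) (HL : echo_limit xi L) :
  let m1 : R := fine 'E_P0[xi] in
  let m (k : nat) : R := fine (moment P0 xi k) in
  let EL (k : nat) : R := fine (moment P L k) in
  let p0 : R := fine (P0 (xi @^-1` [set 0%R])) in
  let phi : R -> R[i] := charfun L in
  (* (i) *)
  (0 < p0 ->
    forall (d1 : measure_display) (T1 : measurableType d1)
      (P1 : probability T1 R) (xip : {RV P1 >-> R})
      (d2 : measure_display) (T2 : measurableType d2)
      (P2 : probability T2 R) (Lp M : {RV P2 >-> R}),
    (forall A : set R, measurable A ->
      P1 (xip @^-1` A) =
        (fine (P0 (xi @^-1` (A `&` `]0, +oo[)))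
          / fine (P0 (xi @^-1` `]0, +oo[)))%:E) ->
    echo_limit xip Lp ->
    mittag_leffler2 (1 - p0) M ->
    mutual_indep [:: Lp; M] ->
    eq_law P P2 L (fun w => Lp w * M w `^ (m1 / (1 - p0)))) /\
  (* (ii) *)
  (forall (d1 : measure_display) (T1 : measurableType d1)
      (P1 : probability T1 R) (Lh Lc V xi' : {RV P1 >-> R}),
    eq_law P1 P Lh L -> eq_law P1 P Lc L ->
    uniform01 V -> eq_law P1 P0 xi' xi ->
    mutual_indep [:: Lh; Lc; V; xi'] ->
    eq_law P P1 L
      (fun w => V w `^ m1 * Lh w + xi' w * (1 - V w) `^ m1 * Lc w)) /\
  (* (iii) *)
  (('E_P[L] = ((Gamma (1 + m1))^-1)%:E)%E /\
   forall k : nat, (2 <= k)%N ->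
    ((moment P0 xi k < (k%:R * m1)%:E)%E <->
       (L : T -> R) \in Lfun P k%:R%:E) /\
    ((moment P0 xi k < (k%:R * m1)%:E)%E ->
      (moment P L k =
        ((Gamma (k%:R * m1 + 1))^-1 / (k%:R * m1 - m k) *
         \sum_(1 <= i < k)
           'C(k, i)%:R * m i * Gamma (1 + i%:R * m1) *
           Gamma (1 + (k - i)%:R * m1) * EL i * EL (k - i)%N)%:E)%E)) /\
  (* (iv) *)
  [/\ ('V_P[L] = 0)%E <-> {ae P0, forall w, xi w = 1},
      (P0 (xi @^-1` [set 1%R]) < 1)%E -> law_support L = [set x : R | 0 <= x] &
      {ae P0, forall w, xi w = 1} -> {ae P, forall w, L w = 1}] /\
  (* (v) *)
  ((forall (d1 : measure_display) (T1 : measurableType d1)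
      (P1 : probability T1 R) (V xi' : {RV P1 >-> R}),
     uniform01 V -> eq_law P1 P0 xi' xi -> mutual_indep [:: V; xi'] ->
     forall t : R,
       phi t = cexpectation P1 (fun w =>
         phi (t * V w `^ m1) * phi (t * xi' w * (1 - V w) `^ m1))) /\
   ((P0 (xi @^-1` [set 1%R]) < 1)%E ->
     forall x : R, P (L @^-1` [set x]) = 0%E)) /\
  (* (vi) *)
  ((P0 (xi @^-1` [set 1%R]) < 1)%E -> {ae P0, forall w, 0 < xi w} ->
    (forall a : R, 0 < a < m1^-1 ->
      (fun w => xi w `^ (- a)) \in Lfun P0 1%E ->
      decay_order phi a /\
      (m1 < 1 -> 1 < a ->
        exists f : R -> R,
          [/\ is_density L f, continuous f & exists B : R, forall x, f x <= B])) /\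
    ((fun w => (xi w)^-1) \in Lfun P0 +oo%E ->
      (forall k : nat, (1 <= k)%N -> decay_order phi k%:R) /\
      (exists f : R -> R,
        [/\ is_density L f, smooth f, exists B : R, forall x, f x <= B &
            {ae lebesgue_measure, forall x : R, 0 <= x -> 0 < f x}]) /\
      (* moments of all negative orders *)
      (forall s : R, 0 < s -> (fun w => L w `^ (- s)) \in Lfun P 1%E))).
Proof.
have xm := echo_mean xi_ge0 xi_La.
have m0 := echo_mean_gt0 xi_ge0 xi_nz xi_La.
(* One exponent g serves all parts: it fixes the [echo_law] from which they are derived. *)
have [g [q [g12 xq qg]]] := echo_subcritical xi_ge0 xi_La xi_log.
have [L0 el] := echo_limit_echo_law xi_ge0 erefl m0 xm xq g12 qg HL.
move=> m1 m EL p0 phi; split.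
  by move=> _ d1 T1 P1 xip d2 T2 P2 Lp M; exact: (limit_thinning xi_ge0 L0 xi_nz el).
split.
  by move=> d1 T1 P1 Lh Lc V xi' eh ec V01 ex ind; exact: (limit_decomposition xi_ge0 L0 el).
split.
  split; first exact: (limit_mean L0 el).
  by move=> k k2; exact: (limit_moment xi_ge0 L0 el).
split.
  split.
  - split; first exact: (limit_variance xi_ge0 L0 el).
    by move=> /(limit_one HL); exact: variance_cst.
  - exact: (limit_support xi_ge0 L0 el).
  - exact: limit_one.
split.
  split; last by move=> ne1 x; exact: (limit_nonatomic xi_ge0 L0 el).
  by move=> d1 T1 P1 V xi' V01 ex ind t; exact: (limit_charfun xi_ge0 L0 el).
move=> ne1 xipos.
have Zne1 : (P0 ((fun w => `|xi w|%R) @^-1` [set 1%R]) < 1)%E by rewrite -(lawXE xi_ge0 el).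
split.
  move=> a am La; have da := limit_decay xi_ge0 el ne1 xipos am La.
  split; first exact: (charfun_decay L0 el).
  move=> _ a1; have [f [fd fc fb]] := continuous_density el Zne1 a1 da.
  by exists f; split => //; exact: (is_densityP L0 el).
move=> /(echo_lower_bound xipos) [e e0 Ze].
have dec s : 0 < s -> decays (modT P (fun w => `|L w|)) s.
  exact: (modT_decays_all el Zne1 e0 Ze).
split.
  by move=> k k1; apply: (charfun_decay L0 el); apply: dec; rewrite ltr0n.
split; last by move=> s s0; exact: (limit_negative_moment L0 el e0 Ze).
have [f [fd fs fb f0]] := smooth_density el Zne1 dec.
exists f; split => //; first exact: (is_densityP L0 el).
(* The density is positive at every x > 0; only the origin is left out. *)
exists [set 0]; split => //; first exact: lebesgue_measure_set1.
move=> x /= H; apply: contrapT => x0; apply: H => x_ge0; apply: f0.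
by rewrite lt_def x_ge0 andbT; apply/eqP.
Qed.
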